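(* Suppose $m,n,Q\in\mathbb N$, $0<\alpha\le 1$, $1\le p\le n$, $U$ is an open subset of $\mathbb R^{n+m}$, and $\mu$ is an integral $n$ varifold in $U$ satisfying the following condition: either $p>1$ and there is $\vec H_\mu\in L^p_{\mathrm{loc}}(\mu,\mathbb R^{n+m})$ with $$(\delta\mu)(\eta)=-\int \vec H_\mu\bullet\eta\,d\mu\quad\text{for all }\eta\in C^1_c(U,\mathbb R^{n+m}),$$ or $p=1$ and $\mu$ is of locally bounded first variation. Then the following two statements hold: (i) If $p<n$, $1\le q_1<n$, $1\le q_2\le\min\left\{\frac{nq_1}{n-q_1},\frac1\alpha\cdot\frac{np}{n-p}\right\}$, then for $\mu$ almost all $a\in U$ with $\theta^n(\mu,a)=Q$ there holds $$\limsup_{r\downarrow0} r^{-\alpha-1-n/q_2}\,\|\operatorname{dist}(\cdot-a,T_a\mu)\|_{L^{q_2}(\mu\llcorner B(a,r))}\le\Gamma_{(i)}\limsup_{r\downarrow0}r^{-\alpha-n/q_1}\,\|T_\mu-T_a\mu\|_{L^{q_1}(\mu\llcorner B(a,r))}$$ where $\Gamma_{(i)}$ is a positive, finite number depending only on $m$, $n$, $Q$, $q_1$, and $q_2$. (ii) If $p=n$, $n<q\le\infty$, then for $\mu$ almost all $a\in U$ with $\theta^n(\mu,a)=Q$ there holds $$\limsup_{r\downarrow0} r^{-\alpha-1}\,\|\operatorname{dist}(\cdot-a,T_a\mu)\|_{L^{\infty}(\mu\llcorner B(a,r))}\le\Gamma_{(ii)}\limsup_{r\downarrow0}r^{-\alpha-n/q}\,\|T_\mu-T_a\mu\|_{L^{q}(\mu\llcorner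 B(a,r))}$$ where $\Gamma_{(ii)}$ is a positive, finite number depending only on $m$, $n$, $Q$, and $q$.
   Context: $\mathbb N=\{1,2,3,\dots\}$; $B(a,r)$ is the open ball in $\mathbb R^{n+m}$ and $\bar B(a,r)$ the closed ball; $\omega_n$ is the Lebesgue measure of the unit ball in $\mathbb R^n$; $1/\infty=0$; $\bullet$ is the usual inner product. $G(n+m,n)$ is the set of $n$ dimensional linear subspaces of $\mathbb R^{n+m}$; each $T\in G(n+m,n)$ is identified with the orthogonal projection of $\mathbb R^{n+m}$ onto $T$, and $|\cdot|$ on $\operatorname{Hom}(\mathbb R^{n+m},\mathbb R^{n+m})$ is the norm induced by the usual inner product (Hilbert–Schmidt norm). So $\|T_\mu-T_a\mu\|_{L^q(\mu\llcorner B(a,r))}$ is the $L^q$ norm of $\xi\mapsto|T_\xi\mu-T_a\mu|$, where $T_\mu$ denotes the function mapping $x$ to $T_x\mu$ whenever the latter exists. For a measure $\mu$, $\theta^n(\mu,x)=\lim_{r\downarrow0}\mu(\bar B(x,r))/(\omega_nr^n)$ if the limit exists. An integral $n$ varifold in an open set $U\subset\mathbb R^{n+m}$ is a Radon measure $\mu$ on $U$ such that for $\mu$ almost all $x\in U$ there is an approximate tangent plane $T_x\mu\in G(n+m,n)$ with multiplicity $\theta^n(\mu,x)\in\mathbb N$, i.e. $\lim_{r\downarrow0}r^{-n}\int\varphi((y-x)/r)\,d\mu(y)=\theta^n(\mu,x)\int_{T_x\mu}\varphi\,d\mathcal H^n$ for all $\varphi\in C_c^0(\mathbb R^{n+m})$.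 The first variation is $(\delta\mu)(\eta)=\int\operatorname{div}_\mu\eta\,d\mu$ for $\eta\in C_c^1(U,\mathbb R^{n+m})$, where $\operatorname{div}_\mu\eta(x)$ is the trace of $D\eta(x)$ with respect to $T_x\mu$. $\|\delta\mu\|$ is the total variation measure associated to $\delta\mu$; $\mu$ is of locally bounded first variation if $\|\delta\mu\|$ is a Radon measure. *)

(* Defs.v *)
From HB Require Import structures.
From mathcomp Require Import all_boot all_order all_algebra.
From mathcomp Require Import all_classical all_reals all_analysis.

Set Implicit Arguments.
Unset Strict Implicit.
Unset Printing Implicit Defensive.

Import Order.TTheory GRing.Theory Num.Theory.
Import numFieldNormedType.Exports.

Local Open Scope classical_set_scope.
Local Open Scope ring_scope.

(** * Euclidean structure on ['rV[R]_k]

The norm of ['rV[R]_k] in the library is the sup norm: it induces the usual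
topology, but balls, distances and diameters have to be Euclidean. *)

Section Euclidean.
Context {R : realType}.
Implicit Types (k : nat) (r : R).

Definition edot k (x y : 'rV[R]_k) : R := \sum_i x 0 i * y 0 i.

Definition enorm k (x : 'rV[R]_k) : R := Num.sqrt (edot x x).

Definition eball k (a : 'rV[R]_k) r : set 'rV[R]_k :=
  [set x | enorm (x - a) < r].

Definition ecball k (a : 'rV[R]_k) r : set 'rV[R]_k :=
  [set x | enorm (x - a) <= r].

Definition eucl_dist k (x : 'rV[R]_k) (A : set 'rV[R]_k) : R :=
  inf [set enorm (x - y) | y in A].

(* [maxe 0] only serves to give the empty set diameter [0] *)
Definition ediam k (A : set 'rV[R]_k) : \bar R :=
  maxe 0%E (ereal_sup [set (enorm (x - y))%:E | x in A & y in A]).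

Definition hsnorm k (A : 'M[R]_k) : R :=
  Num.sqrt (\sum_i \sum_j A i j ^+ 2).

End Euclidean.

(* R^k with its Borel sigma-algebra *)
Definition eucl (R : realType) (k : nat) :=
  g_sigma_algebraType (@open 'rV[R]_k).

HB.instance Definition _ R k := Measurable.on (eucl R k).

Section Borel.
Context {R : realType} {k : nat}.

Lemma continuous_enorm (a : 'rV[R]_k) :
  continuous (fun x : 'rV[R]_k => enorm (x - a)).
Proof.
have cd : continuous (fun x : 'rV[R]_k => edot (x - a) (x - a)).
  apply: continuous_big => [|i _ x]; first exact: add_continuous.
  have ci : {for x, continuous (fun y : 'rV[R]_k => (y - a) 0 i)}.
    have -> : (fun y : 'rV[R]_k => (y - a) 0 i) = fun y => y 0 i - a 0 i.
      by apply/funext => y; rewrite !mxE.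
    by apply: continuousB; [exact: coord_continuous | exact: cst_continuous].
  exact: continuousM.
move=> x; exact: (continuous_comp (cd x) (@sqrt_continuous R _)).
Qed.

Lemma measurable_eball (a : 'rV[R]_k) (r : R) :
  measurable (eball a r : set (eucl R k)).
Proof.
apply: sub_sigma_algebra.
have -> : eball a r =
    (fun x : 'rV[R]_k => enorm (x - a)) @^-1` [set y | y < r] by [].
apply: open_comp; last exact: open_lt.
by move=> x _; exact: continuous_enorm.
Qed.

End Borel.

(** * Lebesgue and Hausdorff measure *)

Section GeometricMeasures.
Context {R : realType}.
Implicit Types (k n : nat).

(* outer measure obtained from countable coverings by closed boxes *)
Definition lebesgue_outer n (A : set 'rV[R]_n) : \bar R :=
  ereal_inf [set s | exists a b : nat -> 'rV[R]_n,
    [/\ forall j i, a j 0 i <= b j 0 i,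
        A `<=` \bigcup_j [set x | forall i, a j 0 i <= x 0 i <= b j 0 i] &
        s = (\sum_(0 <= j <oo) (\prod_i (b j 0 i - a j 0 i))%:E)%E]].

Definition omega n : R := fine (lebesgue_outer [set x : 'rV[R]_n | enorm x <= 1]).

Definition hausdorff_size n (d : R) k (A : set 'rV[R]_k) : \bar R :=
  ereal_inf [set s | exists S : nat -> set 'rV[R]_k,
    [/\ forall j, (ediam (S j) <= d%:E)%E,
        A `<=` \bigcup_j S j &
        s = (\sum_(0 <= j <oo) (omega n / 2 ^+ n)%:E * ediam (S j) ^+ n)%E]].

(* the [n]-dimensional Hausdorff (outer) measure, meant for [0 < n] *)
Definition hausdorff n k (A : set (eucl R k)) : \bar R :=
  ereal_sup [set hausdorff_size n d A | d in [set d : R | 0 < d]].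

End GeometricMeasures.

(** * Planes

[G(k, n)] is the set of orthogonal projections of rank [n]; the projection
with matrix [P] is [x |-> x *m P], so that its image is the row space of [P]. *)

Section Planes.
Context {R : realType} {k : nat}.

Definition grassmannian (n : nat) : set 'M[R]_k :=
  [set P | [/\ P^T = P, P *m P = P & \rank P = n]].

Definition plane (P : 'M[R]_k) : set 'rV[R]_k := [set x | (x <= P)%MS].

End Planes.

(** * Varifolds

A measure on an open set [U] is represented by its extension by zero to all
Borel subsets of R^k.

Tangent planes are only measurable with respect to the completion of the
measure.  The library integral is total and, for a nonnegative function, is
the supremum over Borel simple functions below it; hence it has the expected
value for functions that are measurable with respect to the completion. *)

Section Varifolds.
Context {R : realType} {k : nat}.
Implicit Types (n : nat) (mu : {measure set (eucl R k) -> \bar R}).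
Implicit Types (U V K : set 'rV[R]_k) (x a : 'rV[R]_k) (r theta : R).

Definition radon_on U mu : Prop :=
  mu (~` U) = 0%E /\
  forall K, compact K -> K `<=` U -> (mu K < +oo)%E.

Definition has_density n mu x theta : Prop :=
  (mu (ecball x r) * ((omega n * r ^+ n)^-1)%:E)%E @[r --> 0^'+] --> theta%:E.

Definition approx_tangent n mu x theta (T : 'M[R]_k) : Prop :=
  grassmannian n T /\
  forall phi : 'rV[R]_k -> R, continuous phi ->
    compact (closure [set y | phi y != 0]) ->
    r ^- n * (\int[mu]_y phi (r^-1 *: (y - x))) @[r --> 0^'+]
      --> theta * fine (\int[@hausdorff R n k]_(y in plane T) (phi y)%:E)%E.

(* [T] is the approximate tangent plane of [mu] at [x], with multiplicity the
   density of [mu] at [x]; positivity of the density makes [T] unique *)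
Definition is_tangent_plane n mu x (T : 'M[R]_k) : Prop :=
  exists theta, [/\ 0 < theta, has_density n mu x theta &
    approx_tangent n mu x theta T].

(* the zero matrix if there is no tangent plane *)
Definition tangent_plane n mu x : 'M[R]_k :=
  xget 0 [set T | is_tangent_plane n mu x T].

Definition integral_varifold n U mu : Prop :=
  radon_on U mu /\
  {ae mu, forall x, U x -> exists (T : 'M[R]_k) (N : nat),
    [/\ (0 < N)%N, has_density n mu x N%:R & approx_tangent n mu x N%:R T]}.

(** First variation; a vector field on [U] with compact support in [U] is
extended by zero. *)

Definition C1c U (eta : 'rV[R]_k -> 'rV[R]_k) : Prop :=
  [/\ forall x, differentiable eta x,
      continuous (fun x => 'J eta x),
      compact (closure [set x | eta x != 0]) &
      closure [set x | eta x != 0] `<=` U].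

Definition tangential_div n mu (eta : 'rV[R]_k -> 'rV[R]_k) x : R :=
  \tr (tangent_plane n mu x *m 'J eta x).

Definition first_variation n mu (eta : 'rV[R]_k -> 'rV[R]_k) : R :=
  \int[mu]_x tangential_div n mu eta x.

Definition total_first_variation_open n mu V : \bar R :=
  ereal_sup [set (first_variation n mu eta)%:E |
    eta in [set eta | C1c V eta /\ forall x, enorm (eta x) <= 1]].

(* total variation measure of an arbitrary subset of [U], by outer regularity *)
Definition total_first_variation n U mu (A : set 'rV[R]_k) : \bar R :=
  ereal_inf [set total_first_variation_open n mu V |
    V in [set V | [/\ open V, V `<=` U & A `<=` V]]].

(* [total_first_variation n U mu] is always a Borel regular outer measure on the
   open set [U], so that being Radon amounts to being finite on compact sets *)
Definition locally_bounded_first_variation n U mu : Prop :=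
  forall K, compact K -> K `<=` U -> (total_first_variation n U mu K < +oo)%E.

(* classes in L^p_loc have Borel representatives *)
Definition Lploc U mu (p : R) (H : 'rV[R]_k -> 'rV[R]_k) : Prop :=
  (forall i, measurable_fun (U : set (eucl R k)) (fun x => H x 0 i)) /\
  forall K, compact K -> K `<=` U ->
    (\int[mu]_(x in K) (enorm (H x) `^ p)%:E < +oo)%E.

Definition mean_curvature_condition n U mu (p : R) : Prop :=
  (1 < p /\ exists2 H : 'rV[R]_k -> 'rV[R]_k, Lploc U mu p H &
     forall eta, C1c U eta ->
       first_variation n mu eta = - \int[mu]_(x in U) edot (H x) (eta x))
  \/ (p = 1 /\ locally_bounded_first_variation n U mu).

(* norm of L^q of [mu] restricted to [B(a, r)], for [q] in [1, +oo] *)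
Definition Lnorm_ball mu (q : \bar R) a r (f : 'rV[R]_k -> R) : \bar R :=
  Lnorm (mrestr mu (measurable_eball a r)) q (EFin \o f).

End Varifolds.

(* Main.v *)
Require Import Defs.
From HB Require Import structures.
From mathcomp Require Import all_boot all_order all_algebra.
From mathcomp Require Import all_classical all_reals all_analysis.
From mathcomp Require Import measurable_realfun ring lra.

Set Implicit Arguments.
Unset Strict Implicit.
Unset Printing Implicit Defensive.

Import Order.TTheory GRing.Theory Num.Theory.
Import numFieldNormedType.Exports.

Local Open Scope classical_set_scope.
Local Open Scope ring_scope.

(** The theorem is proved without Lipschitz approximation by multiple-valued
functions.  Write P for the tangent plane at a, |y - a|_perp for the length of
(y - a)(1 - P) and D(y) = |T_y mu - P|.

Testing the first variation with truncated radial fields gives a weak form of the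
Michael-Simon inequality, in which a set where a cut-off function equals 1 is
estimated by means of the tangential gradient of the function.  Applied to
functions of |y - a|_perp, whose tangential gradient is at most D, it bounds the
mass above a level t by the mass above a lower level s, the integral of D between
the two levels, and the first variation; iterating over levels is De Giorgi's
method.

Almost every point is flat: the part of B(a, r) with |y - a|_perp > eps r has mass
o(r^n), and by a density argument its variation (or the integral of |H|^p over it)
is o(r^n) as well; one iteration improves the mass bound to o(r^(n+1)).  A radial
field multiplied by a smoothed height, integrated over dyadic scales, yields the
decay of the L^1 norm of |y - a|_perp in terms of the L^1 norm of D.  A second
iteration started from this bound gives the supremum estimate if p = n, and, with
Hoelder's and Young's inequalities on the dyadic levels, the L^(q2) estimate if p < n.
The multiplicity Q enters only through the upper bound for mu(B(a, r)) / r^n.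

Tangent planes are recovered as Borel functions of the point from second moments:
for w in R^k the limit of r^(-n) int phi(|y - x|^2 / r^2) <(y - x)/r, w>^2 is a constant
times |w T|^2, since reflections leave the Hausdorff measure on T invariant. *)

(** * Euclidean geometry and projections *)

(** The constants may depend on the dimensions, [Q] and the exponents only, whereas bounds for the
    variation belong to the individual varifold. Every term coming from the variation must therefore
    carry a factor that becomes small with [r]. This is why a density argument for the variation is
    needed, and why heights are measured in units of [tau * r^(1 + alpha)], with [tau] any number
    above the limit superior of the tilt: the iterations then see [alpha] only through bounds such
    as [2^alpha <= 2].

    The two forms of the hypothesis on [p] are merged into set functions [v] and [lam] with
    [v O <= lam O ^ (1/p) * mu O ^ (1 - 1/p)]: both are the total variation if [p = 1]; they are the
    integrals of [|H|] and [|H|^p] if [p > 1]. The condition [alpha <= 1] makes errors of order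
    [r^2] harmless against [r^(1 + alpha)], and [alpha q2 <= n p / (n - p)] does the same for the
    contribution of [lam] in the [L^(q2)] estimate.

    All estimates take place in open sets of finite mass, with an everywhere defined Borel field of
    projections in place of the tangent planes, so that nearly all integrands are bounded Borel
    functions. *)

Section EuclideanFacts.
Context {R : realType}.

Lemma edotE k (x y : 'rV[R]_k) : edot x y = (x *m y^T) 0 0.
Proof. by rewrite mxE; apply: eq_bigr => i _; rewrite mxE. Qed.

Lemma edotC k (x y : 'rV[R]_k) : edot x y = edot y x.
Proof. by apply: eq_bigr => i _; rewrite mulrC. Qed.

Lemma edotDl k (x y z : 'rV[R]_k) : edot (x + y) z = edot x z + edot y z.
Proof. by rewrite !edotE mulmxDl mxE. Qed.

Lemma edotZl k c (x z : 'rV[R]_k) : edot (c *: x) z = c * edot x z.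
Proof. by rewrite !edotE -scalemxAl mxE. Qed.

Lemma edotNl k (x z : 'rV[R]_k) : edot (- x) z = - edot x z.
Proof. by rewrite -scaleN1r edotZl mulN1r. Qed.

Lemma edotBl k (x y z : 'rV[R]_k) : edot (x - y) z = edot x z - edot y z.
Proof. by rewrite edotDl edotNl. Qed.

Lemma edotDr k (x y z : 'rV[R]_k) : edot z (x + y) = edot z x + edot z y.
Proof. by rewrite edotC edotDl !(edotC z). Qed.

Lemma edotZr k c (x z : 'rV[R]_k) : edot z (c *: x) = c * edot z x.
Proof. by rewrite edotC edotZl (edotC z). Qed.

Lemma edotNr k (x z : 'rV[R]_k) : edot z (- x) = - edot z x.
Proof. by rewrite edotC edotNl (edotC z). Qed.

Lemma edotBr k (x y z : 'rV[R]_k) : edot z (x - y) = edot z x - edot z y.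
Proof. by rewrite edotDr edotNr. Qed.

Lemma edot0l k (z : 'rV[R]_k) : edot 0 z = 0.
Proof. by rewrite -(scale0r 0) edotZl mul0r. Qed.

Lemma edot_mulmx k l (x : 'rV[R]_k) (y : 'rV[R]_l) (A : 'M[R]_(k, l)) :
  edot (x *m A) y = edot x (y *m A^T).
Proof. by rewrite !edotE trmx_mul trmxK mulmxA. Qed.

Lemma edotxx_ge0 k (x : 'rV[R]_k) : 0 <= edot x x.
Proof. by apply: sumr_ge0 => i _; rewrite -expr2 sqr_ge0. Qed.

Lemma edotxx_eq0 k (x : 'rV[R]_k) : edot x x = 0 -> x = 0.
Proof.
move=> /eqP; rewrite psumr_eq0; last by move=> i _; rewrite -expr2 sqr_ge0.
move=> /allP x0; apply/rowP => i; rewrite mxE.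
by have /implyP/(_ isT) := x0 i (mem_index_enum i); rewrite mulf_eq0 orbb => /eqP.
Qed.

Lemma enorm_ge0 k (x : 'rV[R]_k) : 0 <= enorm x.
Proof. exact: sqrtr_ge0. Qed.

Lemma sqr_enorm k (x : 'rV[R]_k) : enorm x ^+ 2 = edot x x.
Proof. by rewrite sqr_sqrtr// edotxx_ge0. Qed.

Lemma enorm0 k : enorm (0 : 'rV[R]_k) = 0.
Proof. by rewrite /enorm edot0l sqrtr0. Qed.

Lemma enorm_eq0 k (x : 'rV[R]_k) : enorm x = 0 -> x = 0.
Proof. by move=> x0; apply: edotxx_eq0; rewrite -sqr_enorm x0 expr0n. Qed.

Lemma enormZ k c (x : 'rV[R]_k) : enorm (c *: x) = `|c| * enorm x.
Proof.
rewrite /enorm edotZl edotZr mulrA -expr2 sqrtrM ?sqr_ge0//.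
by rewrite sqrtr_sqr.
Qed.

Lemma enormN k (x : 'rV[R]_k) : enorm (- x) = enorm x.
Proof. by rewrite -scaleN1r enormZ normrN1 mul1r. Qed.

Lemma enormB k (x y : 'rV[R]_k) : enorm (x - y) = enorm (y - x).
Proof. by rewrite -enormN opprB. Qed.

Lemma edot_le k (x y : 'rV[R]_k) : `|edot x y| <= enorm x * enorm y.
Proof.
have [x0|x0] := eqVneq (edot x x) 0.
  by rewrite (edotxx_eq0 x0) edot0l normr0 mulr_ge0// enorm_ge0.
have xx : 0 < edot x x by rewrite lt_neqAle eq_sym x0 edotxx_ge0.
have := edotxx_ge0 (edot x x *: y - edot x y *: x).
rewrite edotBl !edotBr !edotZl !edotZr (edotC y x) => h.
rewrite -ler_sqr ?nnegrE ?mulr_ge0 ?enorm_ge0// exprMn !sqr_enorm.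
rewrite real_normK ?num_real// -(ler_pM2l xx); nra.
Qed.

Lemma ler_enormD k (x y : 'rV[R]_k) : enorm (x + y) <= enorm x + enorm y.
Proof.
rewrite -ler_sqr ?nnegrE ?addr_ge0 ?enorm_ge0// sqrrD !sqr_enorm.
rewrite edotDl !edotDr (edotC y x).
have := le_trans (ler_norm _) (edot_le x y); lra.
Qed.

Lemma enorm_dist k (x y z : 'rV[R]_k) : enorm (x - z) <= enorm (x - y) + enorm (y - z).
Proof.
have -> : x - z = (x - y) + (y - z) by rewrite addrA subrK.
exact: ler_enormD.
Qed.

Lemma ler_coord_enorm k (x : 'rV[R]_k) i : `|x 0 i| <= enorm x.
Proof.
rewrite -ler_sqr ?nnegrE ?enorm_ge0// sqr_enorm real_normK ?num_real// /edot.
by rewrite (bigD1 i)//= -expr2 lerDl sumr_ge0// => j _; rewrite -expr2 sqr_ge0.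
Qed.

Lemma ler_norm_enorm k (x : 'rV[R]_k) : `|x| <= enorm x.
Proof.
have [->|x0] := eqVneq x 0; first by rewrite normr0 enorm_ge0.
have [i ->] : exists i, `|x| = `|x i.1 i.2|.
  by apply: mx_norm_neq0; move: x0; apply: contra => /eqP/mx_norm_eq0/eqP.
by case: i => i j /=; rewrite (ord1 i); exact: ler_coord_enorm.
Qed.

Lemma ler_coord_norm k (x : 'rV[R]_k) i : `|x 0 i| <= `|x|.
Proof.
rewrite [leRHS]/Num.Def.normr /= mx_normrE.
by apply/bigmax_geP; right => /=; exists (0, i).
Qed.

Lemma ler_enorm_norm k (x : 'rV[R]_k) : enorm x <= k%:R * `|x|.
Proof.
rewrite -ler_sqr ?nnegrE ?mulr_ge0 ?enorm_ge0// sqr_enorm.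
have : edot x x <= k%:R * `|x| ^+ 2.
  rewrite /edot (le_trans (y := \sum_(i < k) `|x| ^+ 2))//; last first.
    by rewrite sumr_const card_ord mulr_natl.
  apply: ler_sum => i _; rewrite -expr2 -[leLHS]real_normK ?num_real//.
  by rewrite ler_sqr ?nnegrE// ler_coord_norm.
move=> /le_trans; apply; rewrite exprMn ler_wpM2r ?sqr_ge0//.
by case: k x => [|k] x; rewrite ?expr0n// expr2 ler_peMr// ler1n.
Qed.

Lemma sqr_hsnorm k (A : 'M[R]_k) : hsnorm A ^+ 2 = \sum_i \sum_j A i j ^+ 2.
Proof.
by rewrite sqr_sqrtr// sumr_ge0// => i _; rewrite sumr_ge0// => j _; exact: sqr_ge0.
Qed.

Lemma hsnorm_ge0 k (A : 'M[R]_k) : 0 <= hsnorm A.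
Proof. exact: sqrtr_ge0. Qed.

Lemma hsnorm_mxvec k (A : 'M[R]_k) : hsnorm A = enorm (mxvec A).
Proof.
congr Num.sqrt; rewrite pair_bigA /= /edot.
rewrite (reindex _ (curry_mxvec_bij k k)) /=.
by apply: eq_bigr => -[i j] _ /=; rewrite mxvecE expr2.
Qed.

Lemma sqr_hsnorm_tr k (A : 'M[R]_k) : hsnorm A ^+ 2 = \tr (A *m A^T).
Proof.
rewrite sqr_hsnorm; apply: eq_bigr => i _; rewrite mxE.
by apply: eq_bigr => j _; rewrite mxE expr2.
Qed.

Lemma ler_mxtrace_hsnorm k (A B : 'M[R]_k) : `|\tr (A *m B)| <= hsnorm A * hsnorm B.
Proof.
suff -> : \tr (A *m B) = edot (mxvec A) (mxvec B^T).
  have -> : hsnorm B = hsnorm B^T.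
    by congr Num.sqrt; rewrite exchange_big /=; do 2!apply: eq_bigr => ? _; rewrite mxE.
  by rewrite !hsnorm_mxvec; exact: edot_le.
rewrite /edot (reindex _ (curry_mxvec_bij k k)) /=.
transitivity (\sum_i \sum_j A i j * B j i).
  by apply: eq_bigr => i _; rewrite mxE.
by rewrite pair_bigA; apply: eq_bigr => -[i j] _ /=; rewrite !mxvecE mxE.
Qed.

Lemma ler_enorm_mulmx k (x : 'rV[R]_k) (A : 'M[R]_k) :
  enorm (x *m A) <= enorm x * hsnorm A.
Proof.
rewrite -ler_sqr ?nnegrE ?mulr_ge0 ?enorm_ge0 ?hsnorm_ge0// exprMn.
rewrite sqr_enorm sqr_hsnorm exchange_big /= mulr_sumr; apply: ler_sum => j _.
have -> : (x *m A) 0 j = edot x (col j A)^T.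
  by rewrite mxE; apply: eq_bigr => i _; rewrite !mxE.
rewrite -expr2 -[leLHS]real_normK ?num_real//.
have -> : \sum_i A i j ^+ 2 = enorm (col j A)^T ^+ 2.
  by rewrite sqr_enorm; apply: eq_bigr => i _; rewrite !mxE expr2.
by rewrite -exprMn ler_sqr ?nnegrE ?mulr_ge0 ?enorm_ge0// edot_le.
Qed.

End EuclideanFacts.

(** * Orthogonal projections and the tilt between planes *)

Section Projections.
Context {R : realType} {k n : nat}.
Implicit Types (P T : 'M[R]_k).

(** In a rank factorization [P = C B], idempotence cancels to [B C = 1], and the trace is cyclic. *)
Lemma mxtrace_proj P : P *m P = P -> \tr P = (\rank P)%:R.
Proof.
move=> PP.
have [C [B [PE Cf Bf]]] : exists (C : 'M[R]_(k, \rank P)), exists (B : 'M[R]_(\rank P, k)),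
    [/\ C *m B = P, row_full C & row_free B].
  exists (col_base P), (row_base P).
  by rewrite mulmx_base col_base_full row_base_free.
have /row_fullP [D DC] := Cf.
have : C *m (B *m C) *m B = C *m 1%:M *m B.
  by rewrite mulmx1 mulmxA -mulmxA PE PP.
move=> /(row_free_inj Bf) /(congr1 (mulmx D)); rewrite !mulmxA DC !mul1mx => BC.
by rewrite -{1}PE mxtrace_mulC BC mxtrace1.
Qed.

Hypothesis n_gt0 : (0 < n)%N.

Lemma grass_tr P : grassmannian n P -> P^T = P. Proof. by case. Qed.
Lemma grass_idem P : grassmannian n P -> P *m P = P. Proof. by case. Qed.
Lemma grass_trace P : grassmannian n P -> \tr P = n%:R.
Proof. by case=> _ PP <-; rewrite mxtrace_proj. Qed.

Lemma grass_edot P x y : grassmannian n P -> edot (x *m P) y = edot x (y *m P).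
Proof. by move=> gP; rewrite edot_mulmx grass_tr. Qed.

Lemma grass_edot2 P x y : grassmannian n P -> edot (x *m P) (y *m P) = edot x (y *m P).
Proof. by move=> gP; rewrite grass_edot// -mulmxA grass_idem. Qed.

Lemma grass_enorm P x : grassmannian n P -> enorm (x *m P) <= enorm x.
Proof.
move=> gP; have [x0|x0] := eqVneq (enorm (x *m P)) 0; first by rewrite x0 enorm_ge0.
have xP : 0 < enorm (x *m P) by rewrite lt_neqAle eq_sym x0 enorm_ge0.
rewrite -(ler_pM2r xP) -expr2 sqr_enorm grass_edot2//.
exact: le_trans (ler_norm _) (edot_le _ _).
Qed.

Lemma grass_pythagoras P x : grassmannian n P ->
  enorm x ^+ 2 = enorm (x *m P) ^+ 2 + enorm (x *m (1%:M - P)) ^+ 2.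
Proof.
move=> gP; rewrite !sqr_enorm mulmxBr mulmx1 edotBl !edotBr.
rewrite grass_edot2// (edotC (x *m P) x); lra.
Qed.

Lemma grass_perp_enorm P x : grassmannian n P -> enorm (x *m (1%:M - P)) <= enorm x.
Proof.
move=> gP; rewrite -ler_sqr ?nnegrE ?enorm_ge0// (grass_pythagoras x gP).
by rewrite lerDr sqr_ge0.
Qed.

Lemma grass_hsnorm P : grassmannian n P -> hsnorm P <= n%:R.
Proof.
move=> gP; rewrite -ler_sqr ?nnegrE ?hsnorm_ge0// sqr_hsnorm_tr.
rewrite grass_tr// grass_idem// grass_trace//.
by rewrite expr2 ler_peMr// ler1n.
Qed.

(** Expand [|T - P|^2 = 2 n - 2 tr(T P)] and use [tr(T P) = |T P|^2 >= 0]. The crude bound serves to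
    reduce squares of the tilt to linear terms and to run the iteration in [steep_decay]. *)
Lemma grass_tilt_le P T : grassmannian n P -> grassmannian n T ->
  hsnorm (T - P) <= 2 * n%:R.
Proof.
move=> gP gT; rewrite -ler_sqr ?nnegrE ?hsnorm_ge0 ?mulr_ge0//.
rewrite sqr_hsnorm_tr linearB /= !(grass_tr gP, grass_tr gT).
rewrite mulmxBl !mulmxBr !(grass_idem gP, grass_idem gT) !raddfB /=.
rewrite (grass_trace gP) (grass_trace gT) (mxtrace_mulC P T).
have := sqr_ge0 (hsnorm (T *m P)).
have -> : hsnorm (T *m P) ^+ 2 = \tr (T *m P).
  rewrite sqr_hsnorm_tr trmx_mul (grass_tr gP) (grass_tr gT).
  by rewrite -mulmxA (mulmxA P) (grass_idem gP) mxtrace_mulC -mulmxA (grass_idem gT) mxtrace_mulC.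
move=> ?.
have : (1 : R) <= n%:R by rewrite ler1n.
nra.
Qed.

(** The vector [x (1 - P)] is annihilated by [P], so [T] may be replaced by [T - P]. This is the
    reason why the tangential gradient of the height is at most the tilt. *)
Lemma grass_tilt_perp P T x : grassmannian n P ->
  enorm (x *m (1%:M - P) *m T) <= hsnorm (T - P) * enorm (x *m (1%:M - P)).
Proof.
move=> gP; have -> : x *m (1%:M - P) *m T = x *m (1%:M - P) *m (T - P).
  rewrite (mulmxBr (x *m (1%:M - P))) -(mulmxA x (1%:M - P) P) (mulmxBl 1%:M P P).
  by rewrite mul1mx (grass_idem gP) subrr mulmx0 subr0.
by rewrite mulrC; exact: ler_enorm_mulmx.
Qed.

Lemma eucl_dist_plane P x : grassmannian n P ->
  eucl_dist x (plane P) = enorm (x *m (1%:M - P)).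
Proof.
move=> gP; set d := enorm _.
have xP : plane P (x *m P) by rewrite /plane /= submxMl.
have dE : enorm (x - x *m P) = d by rewrite /d mulmxBr mulmx1.
have lb : lbound [set enorm (x - y) | y in plane P] d.
  move=> _ [y /submxP[z yE] <-].
  have yP : y *m P = y by rewrite yE -mulmxA grass_idem.
  have -> : d = enorm ((x - y) *m (1%:M - P)).
    congr enorm; rewrite mulmxBl [y *m _]mulmxBr mulmx1 yP subrr subr0//.
  exact: grass_perp_enorm.
apply/le_anti/andP; split.
  by apply: ge_inf; [exists d|exists (x *m P)].
by apply: lb_le_inf => //; exists d, (x *m P).
Qed.

End Projections.

Section FunContinuity.
Context {R : realType} {T : topologicalType} {V : normedModType R}.
Implicit Types (f g : T -> V) (s : T -> R).

Lemma fun_continuousD f g : continuous f -> continuous g -> continuous (fun t => f t + g t).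
Proof. by move=> cf cg t; apply: cvgD; [exact: cf|exact: cg]. Qed.

Lemma fun_continuousB f g : continuous f -> continuous g -> continuous (fun t => f t - g t).
Proof. by move=> cf cg t; apply: cvgB; [exact: cf|exact: cg]. Qed.

Lemma fun_continuousZ s f : continuous s -> continuous f -> continuous (fun t => s t *: f t).
Proof. by move=> cs cf t; apply: cvgZ; [exact: cs|exact: cf]. Qed.

Lemma fun_continuousM s s' : continuous s -> continuous s' -> continuous (fun t => s t * s' t).
Proof. by move=> cs cf t; apply: cvgM; [exact: cs|exact: cf]. Qed.

Lemma fun_continuous_cst (U : topologicalType) (c : U) : continuous (fun _ : T => c).
Proof. by move=> t; exact: cvg_cst. Qed.

Lemma fun_continuous_comp (U W : topologicalType) (h : U -> W) (g : T -> U) :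
  continuous h -> continuous g -> continuous (fun t => h (g t)).
Proof. by move=> ch cg t; exact: (continuous_comp (cg t) (ch _)). Qed.

End FunContinuity.

Section EuclideanTopology.
Context {R : realType} {k : nat}.
Implicit Types (A : set 'rV[R]_k) (x y : 'rV[R]_k).

Lemma eball_norm_ball x r : 0 < r -> ball x (r / k.+1%:R) `<=` eball x r.
Proof.
move=> r0 y; rewrite -ball_normE /= distrC => h; rewrite /eball /=.
apply: le_lt_trans (ler_enorm_norm _) _.
rewrite ltr_pdivlMr// in h; apply: le_lt_trans h.
by rewrite mulrC ler_wpM2l// ler_nat.
Qed.

Lemma eball_sub_ball x r : eball x r `<=` ball x r.
Proof.
move=> y; rewrite -ball_normE /= distrC => h.
exact: le_lt_trans (ler_norm_enorm _) h.
Qed.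

Lemma nbhs_eball x r : 0 < r -> nbhs x (eball x r).
Proof.
move=> r0; apply/nbhs_ballP; exists (r / k.+1%:R) => /=; first by rewrite divr_gt0.
exact: eball_norm_ball.
Qed.

Lemma nbhs_eballP x A : nbhs x A <-> exists2 r, 0 < r & eball x r `<=` A.
Proof.
split=> [/nbhs_ballP[r /= r0 rA]|[r r0 rA]].
  by exists r => //; apply: subset_trans rA; exact: eball_sub_ball.
by apply: filterS rA _; exact: nbhs_eball.
Qed.

Lemma open_eballP A : open A <-> forall x, A x -> exists2 r, 0 < r & eball x r `<=` A.
Proof.
rewrite openE; split=> h x /h; first by move/nbhs_eballP.
by move=> ?; exact/nbhs_eballP.
Qed.

Lemma open_eball x r : open (eball x r).
Proof.
apply/open_eballP => y /= yr; exists (r - enorm (y - x)); first by rewrite subr_gt0.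
move=> z /= zy; have := enorm_dist z y x; rewrite /eball /= in yr zy *; lra.
Qed.

Lemma closed_ecball x r : closed (ecball x r).
Proof.
rewrite -openC; apply/open_eballP => y /= /negP; rewrite -ltNge => yr.
exists (enorm (y - x) - r); first by rewrite subr_gt0.
move=> z /= zy; apply/negP; rewrite -ltNge.
have := enorm_dist y z x; rewrite (enormB y z); rewrite /eball /= in zy *; lra.
Qed.

Lemma bounded_ecball x r : bounded_set (ecball x r).
Proof.
exists (`|x| + r); split=> [|M xM y /= yx]; first by rewrite num_real.
have := ler_normD (y - x) x; rewrite subrK => /le_trans; apply.
have := le_trans (ler_norm_enorm (y - x)) yx; move: xM; lra.
Qed.

Lemma compact_ecball x r : compact (ecball x r).
Proof. by apply: bounded_closed_compact; [exact: bounded_ecball|exact: closed_ecball]. Qed.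

Lemma compact_sub_ecball A x r : closed A -> A `<=` ecball x r -> compact A.
Proof. by move=> cA; apply: subclosed_compact cA (@compact_ecball x r). Qed.

Lemma closure_sub A B : closed B -> A `<=` B -> closure A `<=` B.
Proof. by move=> cB AB; rewrite ((closure_id B).1 cB); exact: closure_subset. Qed.

Lemma continuous_edotl g : continuous (edot g : 'rV[R]_k -> R).
Proof.
apply: continuous_big => [|i _ x]; first exact: add_continuous.
apply: continuousM; first exact: cst_continuous.
exact: coord_continuous.
Qed.

Lemma continuous_edot (T : topologicalType) (f g : T -> 'rV[R]_k) :
  continuous f -> continuous g -> continuous (fun t => edot (f t) (g t)).
Proof.
move=> cf cg; apply: continuous_big => [|i _ x]; first exact: add_continuous.
apply: continuousM.
  exact: (continuous_comp (cf x) (@coord_continuous _ _ _ 0 i _)).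
exact: (continuous_comp (cg x) (@coord_continuous _ _ _ 0 i _)).
Qed.

Lemma continuous_rowP (T : topologicalType) l (f : T -> 'rV[R]_l) :
  (forall i, continuous (fun t => f t 0 i)) -> continuous f.
Proof.
move=> h t; apply/cvgrPdist_le => e e0; near=> s.
have [E|E] := eqVneq (f t - f s) 0; first by rewrite E normr0 ltW.
have [[i0 i] ->] : exists i, `|f t - f s| = `|(f t - f s) i.1 i.2|.
  by apply: mx_norm_neq0; move: E; apply: contra => /eqP/mx_norm_eq0/eqP.
rewrite /= (ord1 i0); move: i; near: s; apply: filter_forall => i.
have /cvgrPdist_le/(_ _ e0) := h i t.
by apply: filterS => s /=; rewrite !mxE.
Unshelve. all: by end_near. Qed.

Lemma continuous_mulmxr l (A : 'M[R]_(k, l)) : continuous (fun x : 'rV[R]_k => x *m A).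
Proof.
apply: continuous_rowP => i x.
have -> : (fun t : 'rV[R]_k => (t *m A) 0 i) = edot (col i A)^T.
  by apply/funext => t; rewrite mxE; apply: eq_bigr => j _; rewrite !mxE mulrC.
exact: continuous_edotl.
Qed.

Lemma continuous_mulmx_sub l (a : 'rV[R]_k) (A : 'M[R]_(k, l)) :
  continuous (fun x : 'rV[R]_k => (x - a) *m A).
Proof.
apply: (fun_continuous_comp (h := fun x => x *m A) (g := fun x => x - a)).
  exact: continuous_mulmxr.
by apply: fun_continuousB; [move=> x; exact: cvg_id|exact: fun_continuous_cst].
Qed.

Lemma continuous_mxP (T : topologicalType) l l' (f : T -> 'M[R]_(l, l')) :
  (forall i j, continuous (fun t => f t i j)) -> continuous f.
Proof.
move=> h t; apply/cvgrPdist_le => e e0; near=> s.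
have [E|E] := eqVneq (f t - f s) 0; first by rewrite E normr0 ltW.
have [[i j] ->] : exists i, `|f t - f s| = `|(f t - f s) i.1 i.2|.
  by apply: mx_norm_neq0; move: E; apply: contra => /eqP/mx_norm_eq0/eqP.
move: i j; near: s; apply: filter_forall => i; apply: filter_forall => j.
have /cvgrPdist_le/(_ _ e0) := h i j t.
by apply: filterS => s /=; rewrite !mxE.
Unshelve. all: by end_near. Qed.

End EuclideanTopology.

Lemma is_diff_epsP (R : realType) (V W : normedModType R) (f : V -> W)
    (df : {linear V -> W}) x : continuous df ->
  (forall e, 0 < e -> \forall v \near (0 : V),
     `|f (v + x) - f x - df v| <= e * `|v|) ->
  is_diff x f df.
Proof.
move=> cdf h; have E : f \o shift x = cst (f x) + df +o_ 0 id.
  apply/eqaddoP => e e0; have := h e e0; apply: filterS => v /=.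
  by rewrite /cst !fctE /= opprD addrA.
have dE := diff_unique cdf E.
apply: DiffDef; last exact: dE.
by apply/diff_locallyP; rewrite dE.
Qed.

Lemma nbhs0_norm_le (R : realType) (V : normedModType R) (e : R) :
  0 < e -> \forall v \near (0 : V), `|v| <= e.
Proof. by move=> e0; exact: nbhs0_le. Qed.

(** * C^1 functions with explicit gradients, and radial test fields *)

Section C1functions.
Context {R : realType} {k : nat}.
Implicit Types (x y v : 'rV[R]_k) (L : 'M[R]_k).

Fact edot_is_linear (g : 'rV[R]_k) : linear (edot g : 'rV[R]_k -> R).
Proof. by move=> c x y; rewrite edotDr edotZr. Qed.

HB.instance Definition _ (g : 'rV[R]_k) :=
  GRing.isLinear.Build R 'rV[R]_k R _ (edot g) (edot_is_linear g).

Lemma is_diff_comp_derive (f : R -> R) d (g : 'rV[R]_k -> R) (G : 'rV[R]_k) x :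
  is_derive (g x) (1 : R) f d -> is_diff x g (edot G) ->
  is_diff x (fun y => f (g y)) (edot (d *: G)).
Proof.
move=> fd gd.
have df : is_diff (g x) f (fun h => h *: d).
  have dif : derivable f (g x) 1 by case: fd.
  apply: DiffDef; first exact/derivable1_diffP.
  by rewrite diff1E; [rewrite derive1E derive_val|exact/derivable1_diffP].
apply: is_diff_eq (is_diff_comp gd df) _.
by apply/funext => v /=; rewrite edotZl mulrC.
Qed.

Definition isC1 (f : 'rV[R]_k -> R) (G : 'rV[R]_k -> 'rV[R]_k) :=
  (forall x, is_diff x f (edot (G x))) /\ continuous G.

Lemma isC1_continuous f G : isC1 f G -> continuous f.
Proof. by move=> [fG _] x; apply: differentiable_continuous; case: (fG x). Qed.

Lemma isC1_mul f F g G : isC1 f F -> isC1 g G ->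
  isC1 (fun y => f y * g y) (fun y => f y *: G y + g y *: F y).
Proof.
move=> fF gG; have cf := isC1_continuous fF; have cg := isC1_continuous gG.
move: fF gG => [fF cF] [gG cG]; split=> [x|].
  apply: is_diff_eq (is_diffM (fF x) (gG x)) _.
  by apply/funext => v; rewrite !fctE /= edotDl !edotZl.
by apply: fun_continuousD; exact: fun_continuousZ.
Qed.

Lemma isC1_comp (f f' : R -> R) g G : (forall t : R, is_derive t (1 : R) f (f' t)) ->
  continuous f' -> isC1 g G -> isC1 (fun y => f (g y)) (fun y => f' (g y) *: G y).
Proof.
move=> ff' cf' gG; have cg := isC1_continuous gG.
move: gG => [gG cG]; split=> [x|]; first exact: is_diff_comp_derive.
by apply: fun_continuousZ => //; exact: fun_continuous_comp.
Qed.

Lemma isC1_quad a L :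
  isC1 (fun y => edot ((y - a) *m L) ((y - a) *m L))
       (fun y => 2 *: ((y - a) *m L *m L^T)).
Proof.
split=> [x|]; last first.
  apply: fun_continuousZ; first exact: fun_continuous_cst.
  apply: (fun_continuous_comp (h := fun x => x *m L^T)); first exact: continuous_mulmxr.
  exact: continuous_mulmx_sub.
apply: is_diff_epsP; first exact: continuous_edotl.
move=> e e0; set C := (k%:R * hsnorm L) ^+ 2.
have C0 : 0 <= C by exact: sqr_ge0.
have eC : 0 < e / (C + 1) by rewrite divr_gt0// ltr_wpDl.
near=> v.
have -> : edot ((v + x - a) *m L) ((v + x - a) *m L) -
    edot ((x - a) *m L) ((x - a) *m L) - edot (2 *: ((x - a) *m L *m L^T)) v =
    enorm (v *m L) ^+ 2.
  have -> : v + x - a = v + (x - a) by rewrite addrA.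
  rewrite edotZl (edot_mulmx ((x - a) *m L) v L^T) trmxK mulmxDl sqr_enorm edotDl !edotDr.
  by rewrite (edotC ((x - a) *m L)); ring.
rewrite ger0_norm ?sqr_ge0//.
have -> : e * `|v| = (e / (C + 1)) * ((C + 1) * `|v|).
  by rewrite mulrA divfK// gt_eqF// ltr_wpDl.
have h : enorm (v *m L) ^+ 2 <= C * `|v| ^+ 2.
  rewrite -exprMn ler_sqr ?nnegrE ?mulr_ge0 ?enorm_ge0 ?hsnorm_ge0//.
  apply: le_trans (ler_enorm_mulmx _ _) _.
  by rewrite mulrAC ler_wpM2r ?hsnorm_ge0// ler_enorm_norm.
apply: le_trans h _.
have : `|v| <= e / (C + 1).
  near: v.
  exact: (@nbhs0_norm_le R (matrix_matrix__canonical__normed_module_NormedModule R 1 k)).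
move=> hv; have v0 := normr_ge0 v.
have := mulr_ge0 v0 v0; have : 0 <= (C + 1) * (`|v| * (e / (C + 1) - `|v|)).
  by rewrite !mulr_ge0 ?subr_ge0// addr_ge0.
nra.
Unshelve. all: by end_near. Qed.

(** [L] is the identity in the monotonicity argument and the projection onto the tangent plane at
    [a] in the height estimate. *)
Definition radial_field (psi : 'rV[R]_k -> R) a L : 'rV[R]_k -> 'rV[R]_k :=
  fun y => psi y *: ((y - a) *m L).

Lemma jacobian_radial psi G a L x : isC1 psi G ->
  differentiable (radial_field psi a L) x /\
  jacobian (radial_field psi a L) x = (G x)^T *m ((x - a) *m L) + psi x *: L.
Proof.
move=> [dpsi _]; set eta := radial_field psi a L.
pose D v := edot (G x) v *: ((x - a) *m L) + psi x *: (v *m L).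
have linD : linear D.
  move=> c u v; rewrite /D edotDr edotZr (mulmxDl (c *: u)) -scalemxAl !scalerDr scalerDl.
  by rewrite !scalerA (mulrC _ c) addrACA.
pose DL := HB.pack_for {linear 'rV[R]_k -> 'rV[R]_k} D (GRing.isLinear.Build _ _ _ _ _ linD).
have cD : continuous DL.
  apply: fun_continuousD.
    by apply: fun_continuousZ; [exact: continuous_edotl|exact: fun_continuous_cst].
  by apply: fun_continuousZ; [exact: fun_continuous_cst|exact: continuous_mulmxr].
have dE : is_diff x eta DL.
  apply: is_diff_epsP => // e e0.
  have := dpsi x; set df := edot (G x) => dx.
  pose C := enorm ((x - a) *m L) + 1; pose C' := k%:R * hsnorm L + 1.
  have C0 : 0 < C by rewrite ltr_wpDl// enorm_ge0.
  have C'0 : 0 < C' by rewrite ltr_wpDl// mulr_ge0// hsnorm_ge0.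
  have e1 : 0 < e / C / 2 by rewrite !divr_gt0.
  have e2 : 0 < e / C' / 2 by rewrite !divr_gt0.
  have cpsi : {for x, continuous psi} by apply: differentiable_continuous; case: dx.
  have dpx : \forall v \near (0 : 'rV[R]_k), `|psi (v + x) - psi x - df v| <= e / C / 2 * `|v|.
    have /diff_locally/eqaddoP/(_ _ e1) : differentiable psi x by case: dx.
    have -> : 'd psi x = df :> (_ -> _) by case: dx.
    by apply: filterS => v; rewrite !fctE /= /cst opprD addrA.
  have cpx : \forall v \near (0 : 'rV[R]_k), `|psi (v + x) - psi x| <= e / C' / 2.
    have /nbhs_eballP[r r0 rA] : nbhs x [set y | `|psi x - psi y| <= e / C' / 2].
      by move/cvgrPdist_le : cpsi => /(_ _ e2).
    apply/nbhs_eballP; exists r => // v; rewrite /eball /= subr0 => vr.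
    by rewrite distrC; apply: rA; rewrite /eball /= addrK.
  near=> v.
  have -> : eta (v + x) - eta x - DL v = (psi (v + x) - psi x - df v) *: ((x - a) *m L)
      + (psi (v + x) - psi x) *: (v *m L).
    rewrite /= /D /eta /radial_field.
    have -> : v + x - a = v + (x - a) by rewrite addrA.
    rewrite (mulmxDl v) -/df; move: (v *m L) ((x - a) *m L) => p q.
    by apply/rowP => j; rewrite !mxE; ring.
  apply: le_trans (ler_normD _ _) _; rewrite !normrZ.
  have h1 : `|psi (v + x) - psi x - df v| * `|(x - a) *m L| <= e / 2 * `|v|.
    apply: (@le_trans _ _ (e / C / 2 * `|v| * C)).
      apply: ler_pM => //; first by near: v.
      by apply: le_trans (ler_norm_enorm _) _; rewrite lerDl.
    by rewrite le_eqVlt; apply/orP; left; apply/eqP; field; rewrite gt_eqF.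
  have h2 : `|psi (v + x) - psi x| * `|v *m L| <= e / 2 * `|v|.
    apply: (@le_trans _ _ (e / C' / 2 * (`|v| * C'))).
      apply: ler_pM => //; first by near: v.
      apply: le_trans (ler_norm_enorm _) _; apply: le_trans (ler_enorm_mulmx _ _) _.
      have := ler_enorm_norm v; have := hsnorm_ge0 L; have := normr_ge0 v; rewrite /C'.
      by nra.
    by rewrite le_eqVlt; apply/orP; left; apply/eqP; field; rewrite gt_eqF.
  by rewrite [e]splitr mulrDl lerD.
split; first by case: dE.
apply/matrixP => i j; rewrite /jacobian; case: dE => _ ->.
have -> : lin1_mx DL i j = DL (delta_mx 0 i) 0 j by rewrite mxE.
rewrite /= /D -rowE; move: ((x - a) *m L) => p.
rewrite [edot _ _]edotC edotE -rowE !mxE big_ord1 !mxE.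
by rewrite mulrC.
Unshelve. all: by end_near. Qed.

Lemma trace_radial psi G a L (T : 'M[R]_k) x : isC1 psi G ->
  \tr (T *m jacobian (radial_field psi a L) x) =
    psi x * \tr (T *m L) + edot ((x - a) *m L *m T) (G x).
Proof.
move=> h; have [_ ->] := jacobian_radial a L x h.
rewrite mulmxDr mxtraceD -scalemxAr mxtraceZ addrC; congr (_ + _).
rewrite mulmxA mxtrace_mulC mulmxA edotE.
by rewrite /mxtrace big_ord1.
Qed.

Lemma continuous_jacobian_radial psi G a L : isC1 psi G ->
  continuous (fun x => jacobian (radial_field psi a L) x).
Proof.
move=> h.
have -> : (fun x => jacobian (radial_field psi a L) x) =
    fun x => (G x)^T *m ((x - a) *m L) + psi x *: L.
  by apply/funext => x; have [_ ->] := jacobian_radial a L x h.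
have cpsi := isC1_continuous h; have [_ cG] := h.
apply: continuous_mxP => i j.
have -> : (fun x => ((G x)^T *m ((x - a) *m L) + psi x *: L) i j) =
    fun x => G x 0 i * ((x - a) *m L) 0 j + psi x * L i j.
  by apply/funext => x; rewrite [LHS]mxE [X in X + _]mxE big_ord1 !mxE.
apply: fun_continuousD; apply: fun_continuousM => //.
- exact: (fun_continuous_comp (h := fun M : 'rV[R]_k => M 0 i) (@coord_continuous _ _ _ 0 i)).
- apply: (fun_continuous_comp (h := fun M : 'rV[R]_k => M 0 j) (@coord_continuous _ _ _ 0 j)).
  exact: continuous_mulmx_sub.
- exact: fun_continuous_cst.
Qed.

Lemma C1c_radial psi G a L (U K : set 'rV[R]_k) : isC1 psi G ->
  compact K -> K `<=` U -> (forall y, ~ K y -> psi y = 0) ->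
  C1c U (radial_field psi a L).
Proof.
move=> h cK KU psi0.
have clK : closed K by apply: compact_closed cK; exact: norm_hausdorff.
have sK : closure [set x | radial_field psi a L x != 0] `<=` K.
  apply: closure_sub => // x /= /eqP nx; apply: contrapT => /psi0 px.
  by apply: nx; rewrite /radial_field px scale0r.
split.
- by move=> x; have [] := jacobian_radial a L x h.
- exact: continuous_jacobian_radial h.
- by apply: (subclosed_compact _ cK sK); exact: closed_closure.
- exact: subset_trans KU.
Qed.

End C1functions.

(** * Cut-off functions *)
Section Cutoffs.
Context {R : realType}.
Implicit Types t : R.

Definition pos t : R := Num.max t 0.

Lemma pos_ge0 t : 0 <= pos t.
Proof. by rewrite /pos le_max lexx orbT. Qed.

Lemma pos_id t : 0 <= t -> pos t = t.
Proof. by move=> t0; rewrite /pos; case: ltgtP t0. Qed.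

Lemma pos_eq0 t : t <= 0 -> pos t = 0.
Proof. by move=> t0; rewrite /pos; case: ltgtP t0. Qed.

Lemma continuous_pos : continuous pos.
Proof.
move=> t; apply: (@continuous_max R R id (fun=> 0)); [exact: cvg_id|exact: cvg_cst].
Qed.

Lemma is_derive_quadratic (f : R -> R) d C t :
  (forall h, `|f (h + t) - f t - d * h| <= C * h ^+ 2) -> is_derive t (1 : R) f d.
Proof.
move=> key; have C1 : 0 < `|C| + 1 by rewrite ltr_wpDl.
have lim : h^-1 *: (f (h *: (1 : R) + t) - f t) @[h --> (0 : R)^'] --> d.
  apply/cvgrPdist_le => e e0; near=> h.
  have h0 : h != 0 by near: h; exact: nbhs_dnbhs_neq.
  have -> : d - h^-1 *: (f (h *: (1 : R) + t) - f t) =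
     - (h^-1 * (f (h + t) - f t - d * h)).
    by rewrite /GRing.scale /= mulr1; field.
  rewrite normrN normrM normfV ler_pdivrMl ?normr_gt0//.
  apply: le_trans (key h) _; rewrite -[h ^+ 2]real_normK ?num_real// expr2.
  have he : `|h| <= e / (`|C| + 1) by near: h; apply: dnbhs0_le; rewrite divr_gt0.
  rewrite ler_pdivlMr// in he; have := normr_ge0 h; have := ler_norm C; nra.
apply: DeriveDef; last exact: cvg_lim lim.
by apply/cvg_ex; exists d.
Unshelve. all: by end_near. Qed.

Variant pos_spec t : R -> Type :=
  | PosGe0 of 0 <= t : pos_spec t t
  | PosLe0 of t <= 0 : pos_spec t 0.

Lemma posP t : pos_spec t (pos t).
Proof.
by have [t0|/ltW t0] := leP 0 t; [rewrite pos_id//|rewrite pos_eq0//]; constructor.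
Qed.

Lemma sqr_pos_remainder t h :
  `|pos (h + t) ^+ 2 - pos t ^+ 2 - 2 * pos t * h| <= h ^+ 2.
Proof.
by rewrite ler_norml; case: (posP t) => t0; case: (posP (h + t)) => h0;
  apply/andP; split; nra.
Qed.

(** Applied to [|y - x|^2 / r^2] it is a C^1 cut-off of the ball of radius [r]. The sign of its
    derivative is what makes the monotonicity inequality one-sided. *)
Definition bump t : R := pos (1 - t) ^+ 2.
Definition dbump t : R := - (2 * pos (1 - t)).

Lemma is_derive_bump t : is_derive t (1 : R) bump (dbump t).
Proof.
apply: (@is_derive_quadratic _ _ 1) => h; have := sqr_pos_remainder (1 - t) (- h).
rewrite /bump /dbump sqrrN mul1r mulrN mulNr.
by have -> : 1 - (h + t) = - h + (1 - t) by ring.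
Qed.

Lemma continuous_dbump : continuous dbump.
Proof.
move=> t; apply: cvgN; apply: cvgM; first exact: cvg_cst.
apply: (@continuous_comp _ _ _ (fun s : R => 1 - s) pos); last exact: continuous_pos.
by apply: cvgB; [exact: cvg_cst|exact: cvg_id].
Qed.

Lemma bump_ge0 t : 0 <= bump t. Proof. exact: sqr_ge0. Qed.

Lemma bump_le1 t : 0 <= t -> bump t <= 1.
Proof.
move=> t0; rewrite /bump expr_le1 ?pos_ge0//.
by rewrite /pos ge_max ler01 andbT; lra.
Qed.

Lemma bump_ge_half t : 0 <= t -> t <= 4^-1 -> 2^-1 <= bump t.
Proof. by move=> t0 t1; rewrite /bump pos_id; nra. Qed.

Lemma bump_eq0 t : 1 <= t -> bump t = 0.
Proof. by move=> t1; rewrite /bump pos_eq0 ?expr0n//; lra. Qed.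

Lemma dbump_le0 t : dbump t <= 0.
Proof. by rewrite /dbump oppr_le0 mulr_ge0// pos_ge0. Qed.

Lemma dbump_ge t : 0 <= t -> -2 <= dbump t.
Proof.
move=> t0; rewrite /dbump lerN2 -[leRHS]mulr1 ler_pM2l//.
by rewrite /pos ge_max ler01 andbT; lra.
Qed.

Lemma dbump_eq0 t : 1 <= t -> dbump t = 0.
Proof. by move=> t1; rewrite /dbump pos_eq0 ?mulr0 ?oppr0//; lra. Qed.

(** The primitive of the tent function on [[0, 1]] with peak 2 at [1/2]: a C^1 step from 0 to 1 with
    slope at most 2. *)
Definition ramp t : R := 2 * pos t ^+ 2 - 4 * pos (t - 2^-1) ^+ 2 + 2 * pos (t - 1) ^+ 2.
Definition dramp t : R := 4 * pos t - 8 * pos (t - 2^-1) + 4 * pos (t - 1).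

Lemma is_derive_ramp t : is_derive t (1 : R) ramp (dramp t).
Proof.
apply: (@is_derive_quadratic _ _ 8) => h.
have := sqr_pos_remainder t h; have := sqr_pos_remainder (t - 2^-1) h.
have := sqr_pos_remainder (t - 1) h; rewrite /ramp /dramp !addrA !ler_norml.
by move=> /andP[? ?] /andP[? ?] /andP[? ?]; apply/andP; split; lra.
Qed.

Lemma continuous_dramp : continuous dramp.
Proof.
have c d : continuous (fun t : R => pos (t - d)).
  move=> t; apply: (@continuous_comp _ _ _ (fun s : R => s - d) pos); last exact: continuous_pos.
  by apply: cvgB; [exact: cvg_id|exact: cvg_cst].
move=> t; apply: cvgD; first apply: cvgB; (apply: cvgM; first exact: cvg_cst).
- exact: continuous_pos.
- exact: c.
- exact: c.
Qed.

Lemma ramp_ge0 t : 0 <= ramp t.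
Proof.
rewrite /ramp; case: (posP t) => ?; case: (posP (t - 2^-1)) => ?;
  case: (posP (t - 1)) => ?; nra.
Qed.

Lemma ramp_le1 t : ramp t <= 1.
Proof.
rewrite /ramp; case: (posP t) => ?; case: (posP (t - 2^-1)) => ?;
  case: (posP (t - 1)) => ?; nra.
Qed.

Lemma ramp_eq0 t : t <= 0 -> ramp t = 0.
Proof. by move=> t0; rewrite /ramp !pos_eq0 ?expr0n /=; lra. Qed.

Lemma ramp_eq1 t : 1 <= t -> ramp t = 1.
Proof. by move=> t0; rewrite /ramp !pos_id; lra. Qed.

Lemma dramp_ge0 t : 0 <= dramp t.
Proof.
rewrite /dramp; case: (posP t) => ?; case: (posP (t - 2^-1)) => ?;
  case: (posP (t - 1)) => ?; lra.
Qed.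

Lemma dramp_le2 t : dramp t <= 2.
Proof.
rewrite /dramp; case: (posP t) => ?; case: (posP (t - 2^-1)) => ?;
  case: (posP (t - 1)) => ?; lra.
Qed.

Lemma dramp_eq0 t : t <= 0 -> dramp t = 0.
Proof. by move=> t0; rewrite /dramp !pos_eq0; lra. Qed.

Lemma dramp_eq0_ge1 t : 1 <= t -> dramp t = 0.
Proof. by move=> t0; rewrite /dramp !pos_id; lra. Qed.

End Cutoffs.

Lemma ler_norm_mul3 (R : realType) (a b c a' b' c' : R) :
  `|a| <= a' -> `|b| <= b' -> `|c| <= c' -> `|a * b * c| <= a' * b' * c'.
Proof.
by move=> ha hb hc; rewrite !normrM ler_pM// ?mulr_ge0// ler_pM.
Qed.

(** * Integrals of bounded Borel functions *)

Section BoundedBorel.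
Context d (X : measurableType d) (R : realType).
Implicit Types (f g : X -> R) (A : set X).

(** For a finite measure these functions are integrable and closed under sums and products, so
    linearity of the integral needs no further side conditions. *)
Definition bborel f := measurable_fun setT f /\ exists M, forall x, `|f x| <= M.

Lemma bborel_cst c : bborel (fun=> c).
Proof. by split; [exact: measurable_cst|exists `|c|]. Qed.

Lemma bborelD f g : bborel f -> bborel g -> bborel (fun x => f x + g x).
Proof.
move=> [mf [M fM]] [mg [N gN]]; split; first exact: measurable_funD.
by exists (M + N) => x; apply: le_trans (ler_normD _ _) _; exact: lerD.
Qed.

Lemma bborelM f g : bborel f -> bborel g -> bborel (fun x => f x * g x).
Proof.
move=> [mf [M fM]] [mg [N gN]]; split; first exact: measurable_funM.
by exists (M * N) => x; rewrite normrM; exact: ler_pM.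
Qed.

Lemma bborelN f : bborel f -> bborel (fun x => - f x).
Proof.
move=> [mf [M fM]]; split; first exact: measurableT_comp.
by exists M => x; rewrite normrN.
Qed.

Lemma bborelB f g : bborel f -> bborel g -> bborel (fun x => f x - g x).
Proof. by move=> bf bg; apply: bborelD => //; exact: bborelN. Qed.

Lemma bborel_indic A : measurable A -> bborel (\1_A).
Proof.
move=> mA; split; first exact: measurable_indic.
by exists 1 => x; rewrite indicE; case: (_ \in _); rewrite ?normr1 ?normr0.
Qed.

Lemma bborel_normr f : bborel f -> bborel (fun x => `|f x|).
Proof.
move=> [mf [M fM]]; split; first exact: measurableT_comp.
by exists M => x; rewrite normr_id.
Qed.

Variable nu : {finite_measure set X -> \bar R}.

Lemma bborel_integrable f : bborel f -> nu.-integrable setT (EFin \o f).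
Proof.
move=> [mf [M fM]]; apply: measurable_bounded_integrable => //.
  by rewrite -ge0_fin_numE// fin_num_measure.
exists M; split; first by rewrite num_real.
by move=> N MN x _ /=; apply: le_trans (fM x) (ltW MN).
Qed.

Definition expect f : R := \int[nu]_x f x.
Definition mass A : R := fine (nu A).

Lemma massE A : measurable A -> (mass A)%:E = nu A.
Proof. by move=> mA; rewrite /mass fineK// fin_num_measure. Qed.

Lemma mass_ge0 A : 0 <= mass A. Proof. by rewrite /mass fine_ge0. Qed.

Lemma mass_le A B : measurable A -> measurable B -> A `<=` B -> mass A <= mass B.
Proof.
move=> mA mB AB; rewrite -lee_fin !massE//.
by apply: le_measure => //; rewrite inE.
Qed.

Lemma massU A B : measurable A -> measurable B -> mass (A `|` B) <= mass A + mass B.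
Proof.
move=> mA mB; rewrite -lee_fin EFinD !massE//; last exact: measurableU.
exact: measureU2.
Qed.

Lemma expectD f g : bborel f -> bborel g ->
  expect (fun x => f x + g x) = expect f + expect g.
Proof. by move=> bf bg; apply: RintegralD => //; exact: bborel_integrable. Qed.

Lemma expectB f g : bborel f -> bborel g ->
  expect (fun x => f x - g x) = expect f - expect g.
Proof. by move=> bf bg; apply: RintegralB => //; exact: bborel_integrable. Qed.

Lemma expectZ c f : bborel f -> expect (fun x => c * f x) = c * expect f.
Proof. by move=> bf; apply: RintegralZl => //; exact: bborel_integrable. Qed.

Lemma expect_le f g : bborel f -> bborel g -> (forall x, f x <= g x) ->
  expect f <= expect g.
Proof.
by move=> bf bg fg; apply: le_Rintegral => //; exact: bborel_integrable.
Qed.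

Lemma expect_ge0 f : (forall x, 0 <= f x) -> 0 <= expect f.
Proof. by move=> f0; apply: Rintegral_ge0. Qed.

Lemma expect_norm f : bborel f -> `|expect f| <= expect (fun x => `|f x|).
Proof. by move=> bf; apply: le_normr_Rintegral => //; exact: bborel_integrable. Qed.

Lemma expect_indic A : measurable A -> expect (\1_A) = mass A.
Proof.
by move=> mA; rewrite /expect /Rintegral integral_indic// setIT.
Qed.

Lemma eq_expect f g : f =1 g -> expect f = expect g.
Proof. by move=> fg; apply: eq_Rintegral => x _. Qed.

Lemma expect_indic_le f A c : bborel f -> measurable A ->
  (forall x, f x <= c * \1_A x) -> expect f <= c * mass A.
Proof.
move=> bf mA fA; rewrite -expect_indic// -expectZ; last exact: bborel_indic.
apply: expect_le => //; apply: bborelM; first exact: bborel_cst.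
exact: bborel_indic.
Qed.

Lemma expectE f : bborel f -> (\int[nu]_x (f x)%:E)%E = (expect f)%:E.
Proof.
move=> bf; rewrite /expect /Rintegral fineK//.
by apply: integrable_fin_num => //; exact: bborel_integrable.
Qed.

Lemma ge_mass_indic f A c : bborel f -> measurable A ->
  (forall x, c * \1_A x <= f x) -> c * mass A <= expect f.
Proof.
move=> bf mA fA; rewrite -expect_indic// -expectZ; last exact: bborel_indic.
apply: expect_le => //; apply: bborelM; first exact: bborel_cst.
exact: bborel_indic.
Qed.

End BoundedBorel.

Section BorelEucl.
Context {R : realType} {k : nat}.

Lemma open_measurable_eucl (A : set 'rV[R]_k) : open A -> measurable (A : set (eucl R k)).
Proof. by move=> oA; apply: sub_sigma_algebra. Qed.

Lemma closed_measurable_eucl (A : set 'rV[R]_k) : closed A -> measurable (A : set (eucl R k)).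
Proof.
move=> cA; rewrite -[A]setCK; apply: measurableC.
by apply: open_measurable_eucl; rewrite openC.
Qed.

Lemma measurable_ecball (x : 'rV[R]_k) r : measurable (ecball x r : set (eucl R k)).
Proof. by apply: closed_measurable_eucl; exact: closed_ecball. Qed.

Lemma continuous_measurable_eucl (f : 'rV[R]_k -> R) : continuous f ->
  measurable_fun setT (f : eucl R k -> R).
Proof.
move=> /continuousP cf; apply: (measurability _ (RGenOInfty.measurableE R)) => //.
move=> _ [_ [x ->] <-]; rewrite setTI; apply: open_measurable_eucl.
by apply: cf; exact: interval_open.
Qed.

Lemma continuous_bborel (f : 'rV[R]_k -> R) M : continuous f ->
  (forall x, `|f x| <= M) -> bborel (f : eucl R k -> R).
Proof. by move=> cf fM; split; [exact: continuous_measurable_eucl|exists M]. Qed.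

Lemma measurable_enorm_sub (x : 'rV[R]_k) (L : 'M[R]_k) :
  measurable_fun setT ((fun y => enorm ((y - x) *m L)) : eucl R k -> R).
Proof.
apply: continuous_measurable_eucl => y.
apply: (@continuous_comp _ _ _ (fun y : 'rV[R]_k => edot ((y - x) *m L) ((y - x) *m L)) Num.sqrt).
  by apply: continuous_edot; exact: continuous_mulmx_sub.
exact: sqrt_continuous.
Qed.

Variable nu : {finite_measure set (eucl R k) -> \bar R}.

Lemma is_derive_expect_bump (x : 'rV[R]_k) (L : 'M[R]_k) (W : eucl R k -> R) (s : R) :
  bborel W -> 0 < s ->
  is_derive s (1 : R)
    (fun r => expect nu (fun y => bump (enorm ((y - x) *m L) ^+ 2 / r ^+ 2) * W y))
    (expect nu (fun y => dbump (enorm ((y - x) *m L) ^+ 2 / s ^+ 2) *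
      (- 2 * (enorm ((y - x) *m L) ^+ 2 / s ^+ 3)) * W y)).
Proof.
move=> bW s0; pose u (y : eucl R k) := enorm ((y - x) *m L) ^+ 2.
have u0 y : 0 <= u y by exact: sqr_ge0.
have mu_ : measurable_fun setT u.
  by apply: measurable_funX; exact: measurable_enorm_sub.
have [mW [M WM]] := bW.
pose f (r : R) (y : eucl R k) := bump (u y / r ^+ 2) * W y.
have dinv (r : R) c : r != 0 -> is_derive r (1 : R) (fun r => c / r ^+ 2) (- 2 * (c / r ^+ 3)).
  move=> r0; have h : r ^+ 2 != 0 by rewrite expf_neq0.
  have := @is_deriveV R (fun r : R => r ^+ 2) r _ 1 h (is_deriveX 2 (is_derive_id r (1 : R))).
  move=> h1; have := is_deriveZ c h1.
  move=> h2; apply: is_derive_eq h2 _.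
  by rewrite /GRing.scale /=; field.
have df r y : r != 0 -> is_derive r (1 : R) (f ^~ y) (dbump (u y / r ^+ 2) * (- 2 * (u y / r ^+ 3)) * W y).
  move=> r0; have h1 := dinv r (u y) r0.
  have h2 := @is_derive1_comp R bump (fun r => u y / r ^+ 2) r _ _ (is_derive_bump (u y / r ^+ 2)) h1.
  have h3 := is_deriveZ (W y) h2.
  have -> : f ^~ y = W y \*: (bump \o (fun r : R => u y / r ^+ 2)).
    by apply/funext => t; rewrite /f /= /GRing.scale /= mulrC.
  by apply: is_derive_eq h3 _; rewrite /GRing.scale /=; ring.
have bf r : bborel (f r).
  apply: bborelM => //; split.
    apply: (@measurableT_comp _ _ _ _ _ _ bump).
      by apply: continuous_measurable_fun => t; apply: differentiable_continuous;
        apply/derivable1_diffP; case: (is_derive_bump t).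
    by apply: measurable_funM => //; exact: measurable_cst.
  by exists 1 => y; rewrite ger0_norm ?bump_ge0// bump_le1// divr_ge0// sqr_ge0.
have Is : `](s / 2), (2 * s)[%classic s by rewrite /= in_itv /=; apply/andP; split; lra.
have Ipos r : `](s / 2), (2 * s)[%classic r -> s / 2 < r.
  by rewrite /= in_itv /= => /andP[].
(* A bound for the derivative in [r], uniform for [s/2 < r < 2 s]: where [dbump] does not vanish one
   has [u < r^2], hence [2 u / r^3 <= 2 / r <= 4 / s], and [|dbump| <= 2]. *)
pose C := 4 * (2 / s) * M.
have key r y : `](s / 2), (2 * s)[%classic r -> `|partial1of2 f r y| <= C.
  move=> /Ipos sr; have r0 : 0 < r by apply: lt_trans sr; rewrite divr_gt0.
  have r1 : r != 0 by rewrite gt_eqF.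
  rewrite partial1of2E; have [_ ->] := df r y r1.
  have M0 : 0 <= M := le_trans (normr_ge0 _) (WM y).
  have [u1|u1] := leP 1 (u y / r ^+ 2).
    by rewrite dbump_eq0// !mul0r normr0 !mulr_ge0// invr_ge0 ltW.
  have h1 : r^-1 <= 2 / s.
    rewrite -[2 / s]invrK lef_pV2 ?posrE ?invr_gt0 ?divr_gt0//.
    by rewrite invf_div ltW.
  have r0' : 0 < r^-1 by rewrite invr_gt0.
  have ur0 : 0 <= u y / r ^+ 2 by rewrite divr_ge0// sqr_ge0.
  set A := dbump _; set B := -2 * _.
  have hA : `|A| <= 2 by rewrite ler0_norm ?dbump_le0// lerNl dbump_ge.
  have hB : `|B| <= 2 * (2 / s).
    have -> : B = - (2 * (u y / r ^+ 2 * r^-1)) by rewrite /B; field.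
    rewrite normrN ger0_norm; last by rewrite mulr_ge0// (mulr_ge0 ur0 (ltW r0')).
    rewrite ler_pM2l//.
    by move: ur0 u1 h1 r0'; nra.
  have -> : C = 2 * (2 * (2 / s)) * M by rewrite /C; ring.
  exact: ler_norm_mul3 hA hB (WM y).
have H1 : forall r, `](s / 2), (2 * s)[%classic r -> nu.-integrable setT (EFin \o f r).
  by move=> r _; exact: bborel_integrable.
have H2 : forall r y, `](s / 2), (2 * s)[%classic r -> setT y -> derivable (f ^~ y) r 1.
  move=> r y /Ipos sr _; have r1 : r != 0.
    by rewrite gt_eqF//; apply: lt_trans sr; rewrite divr_gt0.
  by case: (df r y r1).
pose G : eucl R k -> R := fun=> `|C|.
have H3 : forall y, 0 <= G y by move=> y; exact: normr_ge0.
have H4 : nu.-integrable setT (EFin \o G) by apply: bborel_integrable; exact: bborel_cst.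
have H5 : forall r y, `](s / 2), (2 * s)[%classic r -> setT y -> `|partial1of2 f r y| <= G y.
  by move=> r y Ir _; apply: le_trans (key r y Ir) (ler_norm _).
have cv := cvg_differentiation_under_integral measurableT Is H1 H2 H3 H4 H5.
have dE := differentiation_under_integral measurableT Is H1 H2 H3 H4 H5.
have dd := derivable_under_integral measurableT Is H1 H2 H3 H4 H5.
have E : (\int[nu]_y partial1of2 f s y) = (expect nu (fun y => dbump (u y / s ^+ 2) *
      (- 2 * (u y / s ^+ 3)) * W y)).
  apply: eq_Rintegral => y _; rewrite partial1of2E.
  by have [_ ->] := df s y (lt0r_neq0 s0).
apply: DeriveDef; first exact: dd.
by rewrite -E -dE derive1E.
Qed.

End BorelEucl.

Section VectorMeasurability.
Context {R : realType} {k : nat} d (X : measurableType d).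

Definition measurable_row (f : X -> 'rV[R]_k) := forall i, measurable_fun setT (fun x => f x 0 i).
Definition measurable_matrix (T : X -> 'M[R]_k) := forall i j, measurable_fun setT (fun x => T x i j).

Lemma measurable_edot f g : measurable_row f -> measurable_row g ->
  measurable_fun setT (fun x => edot (f x) (g x)).
Proof. by move=> mf mg; apply: measurable_sum => i; exact: measurable_funM. Qed.

Lemma measurable_enorm f : measurable_row f -> measurable_fun setT (fun x => enorm (f x)).
Proof.
move=> mf; apply: (@measurableT_comp _ _ _ _ _ _ (@Num.sqrt R)).
  by apply: continuous_measurable_fun; exact: sqrt_continuous.
exact: measurable_edot.
Qed.

Lemma measurable_row_mulmx f T : measurable_row f -> measurable_matrix T ->
  measurable_row (fun x => f x *m T x).
Proof.
move=> mf mT j; under eq_fun do rewrite mxE.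
by apply: measurable_sum => i; exact: measurable_funM.
Qed.

Lemma measurable_hsnorm T : measurable_matrix T -> measurable_fun setT (fun x => hsnorm (T x)).
Proof.
move=> mT; apply: (@measurableT_comp _ _ _ _ _ _ (@Num.sqrt R)).
  by apply: continuous_measurable_fun; exact: sqrt_continuous.
by apply: measurable_sum => i; apply: measurable_sum => j; exact: measurable_funX.
Qed.

Lemma measurable_mxtrace_mulmx T L : measurable_matrix T ->
  measurable_fun setT (fun x => \tr (T x *m L)).
Proof.
move=> mT; apply: measurable_sum => i; under eq_fun do rewrite mxE.
by apply: measurable_sum => j; apply: measurable_funM => //; exact: measurable_cst.
Qed.

End VectorMeasurability.

Section CompactSupport.
Context {R : realType} {k : nat}.
Implicit Types (K : set 'rV[R]_k).

Definition C1_supp (psi : 'rV[R]_k -> R) (G : 'rV[R]_k -> 'rV[R]_k) K :=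
  [/\ isC1 psi G, compact K & forall y, ~ K y -> psi y = 0 /\ G y = 0].

Lemma compact_supp_bounded (f : 'rV[R]_k -> R) K : continuous f -> compact K ->
  (forall y, ~ K y -> f y = 0) -> exists M, forall y, `|f y| <= M.
Proof.
move=> cf cK f0; have : compact (f @` K).
  by apply: continuous_compact => //; exact: continuous_subspaceT.
move=> /compact_bounded[M [_ hM]]; exists (`|M| + 1) => y.
have M0 : 0 <= `|M| + 1 by rewrite addr_ge0.
have [Ky|/f0 ->] := pselect (K y); last by rewrite normr0.
apply: hM; last by exists y.
by apply: le_lt_trans (ler_norm M) _; rewrite ltrDl.
Qed.

Lemma continuous_measurable_row (f : 'rV[R]_k -> 'rV[R]_k) : continuous f ->
  measurable_row (f : eucl R k -> 'rV[R]_k).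
Proof.
move=> cf i; apply: continuous_measurable_eucl.
exact: (fun_continuous_comp (h := fun M : 'rV[R]_k => M 0 i) (@coord_continuous _ _ _ 0 i)).
Qed.

Lemma continuous_enorm_comp (T : topologicalType) (f : T -> 'rV[R]_k) :
  continuous f -> continuous (fun t => enorm (f t)).
Proof.
move=> cf t; apply: (@continuous_comp _ _ _ (fun t => edot (f t) (f t)) Num.sqrt).
  exact: continuous_edot.
exact: sqrt_continuous.
Qed.

Lemma C1_supp_bounded psi G K : C1_supp psi G K ->
  exists M, forall y, `|psi y| <= M /\ enorm (G y) <= M.
Proof.
move=> [h cK z]; have cpsi := isC1_continuous h; have [_ cG] := h.
have [M hM] : exists M, forall y, `|psi y| <= M.
  by apply: compact_supp_bounded cpsi cK _ => y /z[].
have [N hN] : exists M, forall y, `|enorm (G y)| <= M.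
  apply: compact_supp_bounded cK _; first exact: continuous_enorm_comp.
  by move=> y /z[_ ->]; rewrite enorm0.
exists (Num.max M N) => y; rewrite !le_max hM; split=> //.
by rewrite (le_trans (ler_norm _) (hN y)) orbT.
Qed.

End CompactSupport.

(** * Monotonicity and the weak Sobolev inequality *)

(* [ld_var O] dominates the first variation on fields of norm at most [1] supported
   in the open set [O]; it need not be the total variation itself. *)
Record local_data (R : realType) (k : nat) := LocalData {
  ld_mu : {finite_measure set (eucl R k) -> \bar R} ;
  ld_plane : eucl R k -> 'M[R]_k ;
  ld_dom : set 'rV[R]_k ;
  ld_var : set 'rV[R]_k -> R }.

(** By [trace_radial] this is the tangential divergence of [radial_field psi a L]. *)
Definition div_radial (R : realType) (k : nat) (T : eucl R k -> 'M[R]_k)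
    (psi : 'rV[R]_k -> R) (G : 'rV[R]_k -> 'rV[R]_k) (a : 'rV[R]_k) (L : 'M[R]_k) (y : eucl R k) : R :=
  psi y * \tr (T y *m L) + edot ((y - a) *m L *m T y) (G y).

Definition regular_point (R : realType) (k n : nat) (w : R)
    (mu : {finite_measure set (eucl R k) -> \bar R}) (x : 'rV[R]_k) :=
  exists C r0, 0 < r0 /\ forall r, 0 < r -> r < r0 ->
    w * r ^+ n <= mass mu (ecball x r) <= C * r ^+ n.

(** The lower mass ratio [w] holds at almost every point because multiplicities are at least 1. It
    is later taken to be [omega n / 2], so the Sobolev constant does not depend on the varifold. The
    first variation is needed on radial fields only. *)
Record local_spec (R : realType) (k n : nat) (w : R) (V : local_data R k) : Prop := LocalSpec {
  ls_w : 0 < w ;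
  ls_n : (0 < n)%N ;
  ls_measurable : measurable_matrix (ld_plane V) ;
  ls_grass : forall x, grassmannian n (ld_plane V x) ;
  ls_open : open (ld_dom V) ;
  ls_null : ld_mu V (~` ld_dom V) = 0%E ;
  ls_regular : (ld_mu V).-negligible (~` [set x | regular_point n w (ld_mu V) x]) ;
  ls_var_ge0 : forall O, 0 <= ld_var V O ;
  ls_var_mono : forall O O', open O -> open O' -> O `<=` O' -> O' `<=` ld_dom V ->
    ld_var V O <= ld_var V O' ;
  ls_var_super : forall O O', open O -> open O' -> O `&` O' = set0 ->
    O `<=` ld_dom V -> O' `<=` ld_dom V -> ld_var V O + ld_var V O' <= ld_var V (O `|` O') ;
  ls_first_variation : forall psi G a L K O M, C1_supp psi G K -> K `<=` O -> open O ->
    O `<=` ld_dom V -> (forall y, enorm (psi y *: ((y - a) *m L)) <= M) ->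
    `|expect (ld_mu V) (div_radial (ld_plane V) psi G a L)| <= M * ld_var V O }.

Section Monotonicity.
Context {R : realType} {k n : nat} {w : R} {V : local_data R k}.
Hypothesis VS : local_spec n w V.
Local Notation nu := (ld_mu V).
Local Notation T := (ld_plane V).
Local Notation v := (ld_var V).
Local Notation E := (expect nu).

Implicit Types (x a : 'rV[R]_k) (L : 'M[R]_k) (s : R) (W : eucl R k -> R).

Definition sqd x L s (y : 'rV[R]_k) : R := enorm ((y - x) *m L) ^+ 2 / s ^+ 2.

Lemma sqd_ge0 x L s y : 0 <= sqd x L s y.
Proof. by rewrite divr_ge0// sqr_ge0. Qed.

Lemma continuous_sqd x L s : continuous (sqd x L s).
Proof.
apply: fun_continuousM; last exact: fun_continuous_cst.
under eq_fun do rewrite sqr_enorm.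
by apply: continuous_edot; exact: continuous_mulmx_sub.
Qed.

Lemma bborel_div_radial psi G a L K : C1_supp psi G K -> bborel (div_radial T psi G a L).
Proof.
move=> h; have [M hM] := C1_supp_bounded h; have [hC cK z] := h.
have cpsi := isC1_continuous hC; have [_ cG] := hC.
have mT := ls_measurable VS.
split.
  apply: measurable_funD.
    apply: measurable_funM; first exact: continuous_measurable_eucl.
    exact: measurable_mxtrace_mulmx.
  apply: measurable_edot; last exact: continuous_measurable_row.
  apply: measurable_row_mulmx => //; apply: continuous_measurable_row.
  exact: continuous_mulmx_sub.
have [N N0 hN] : exists2 N, 0 <= N & forall y, K y -> enorm (y - a) <= N.
  have [N [_ hN]] := compact_bounded cK.
  exists (k%:R * (`|N| + 1 + `|a|)); first by rewrite mulr_ge0// !addr_ge0.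
  move=> y Ky; apply: le_trans (ler_enorm_norm _) _.
  rewrite ler_wpM2l//; apply: le_trans (ler_normB _ _) _; rewrite lerD2r.
  by apply: hN Ky; apply: le_lt_trans (ler_norm N) _; rewrite ltrDl.
have n0 := ls_n VS.
exists (M * (n%:R * hsnorm L) + N * hsnorm L * n%:R * M) => y.
have [My Gy] := hM y; have M0 : 0 <= M := le_trans (normr_ge0 _) My.
have gT := ls_grass VS y; have hT := grass_hsnorm n0 gT.
have [Ky|/z[py Gy0]] := pselect (K y); last first.
  rewrite /div_radial py Gy0 mul0r edotC edot0l addr0 normr0.
  by rewrite addr_ge0 ?mulr_ge0// hsnorm_ge0.
apply: le_trans (ler_normD _ _) _; apply: lerD.
  rewrite normrM; apply: ler_pM => //.
  apply: le_trans (ler_mxtrace_hsnorm _ _) _.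
  by rewrite ler_wpM2r ?hsnorm_ge0.
apply: le_trans (edot_le _ _) _; apply: ler_pM; rewrite ?enorm_ge0//.
apply: le_trans (ler_enorm_mulmx _ _) _; apply: ler_pM; rewrite ?enorm_ge0 ?hsnorm_ge0//.
apply: le_trans (ler_enorm_mulmx _ _) _.
by rewrite ler_wpM2r ?hsnorm_ge0// hN.
Qed.

Lemma isC1_comp_sqd (f f' : R -> R) x L s : (forall t : R, is_derive t (1 : R) f (f' t)) ->
  continuous f' ->
  isC1 (fun y => f (sqd x L s y)) (fun y => (f' (sqd x L s y) * (2 / s ^+ 2)) *: ((y - x) *m L *m L^T)).
Proof.
move=> df cf; have hq := isC1_quad x L; have := @isC1_comp R k (fun t => f (t / s ^+ 2))
  (fun t => f' (t / s ^+ 2) / s ^+ 2) _ _ _ _ hq.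
have -> : (fun y : 'rV[R]_k => f (edot ((y - x) *m L) ((y - x) *m L) / s ^+ 2)) =
    fun y => f (sqd x L s y).
  by apply/funext => y; rewrite /sqd sqr_enorm.
have -> : (fun y : 'rV[R]_k => (f' (edot ((y - x) *m L) ((y - x) *m L) / s ^+ 2) / s ^+ 2) *:
     (2 *: ((y - x) *m L *m L^T))) =
    fun y => (f' (sqd x L s y) * (2 / s ^+ 2)) *: ((y - x) *m L *m L^T).
  by apply/funext => y; rewrite /sqd sqr_enorm scalerA; congr (_ *: _); ring.
apply.
  move=> t; have d : is_derive t (1 : R) (fun t => t / s ^+ 2) (s ^+ 2)^-1.
    apply: (@is_derive_quadratic _ _ _ 0) => h'; rewrite mul0r.
    by rewrite (_ : _ - _ - _ = 0) ?normr0//; ring.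
  exact: (@is_derive1_comp R f (fun t => t / s ^+ 2) t _ _ (df _) d).
apply: fun_continuousM; last exact: fun_continuous_cst.
apply: (fun_continuous_comp (h := f')) => //.
by apply: fun_continuousM; [move=> t; exact: cvg_id|exact: fun_continuous_cst].
Qed.

Lemma continuous_bump : continuous (@bump R).
Proof.
by move=> t; apply: differentiable_continuous; apply/derivable1_diffP; case: (is_derive_bump t).
Qed.

Lemma bborel_bump_sqd x L s : bborel ((fun y => bump (sqd x L s y)) : eucl R k -> R).
Proof.
apply: (@continuous_bborel _ _ _ 1); last first.
  by move=> y; rewrite ger0_norm ?bump_ge0// bump_le1// sqd_ge0.
by apply: (fun_continuous_comp (h := bump)); [exact: continuous_bump|exact: continuous_sqd].
Qed.

Lemma bborel_dbump_sqd x L s :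
  bborel ((fun y => dbump (sqd x L s y) * sqd x L s y) : eucl R k -> R).
Proof.
apply: (@continuous_bborel _ _ _ 2).
  apply: fun_continuousM; last exact: continuous_sqd.
  apply: (fun_continuous_comp (h := dbump)); last exact: continuous_sqd.
  exact: continuous_dbump.
move=> y; have u0 := sqd_ge0 x L s y; move: (sqd _ _ _ _) u0 => u u0.
have [u1|u1] := leP 1 u; first by rewrite dbump_eq0// mul0r normr0.
rewrite normrM ler0_norm ?dbump_le0// ger0_norm//.
have := dbump_ge u0; have := dbump_le0 u; nra.
Qed.

(** With [L] the identity or a projection of rank [n], the factor of [W] on the right is the
    divergence of [bump * (y - x) L] along a plane through [x] contained in the image of [L]. The
    first variation therefore controls this derivative up to tangential defects. *)
Lemma is_derive_ratio x L W s : bborel W -> 0 < s ->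
  is_derive s (1 : R)
    (fun r => (r ^+ n)^-1 * E (fun y => bump (sqd x L r y) * W y))
    (- (s ^+ n.+1)^-1 * E (fun y => (n%:R * bump (sqd x L s y) +
       2 * (dbump (sqd x L s y) * sqd x L s y)) * W y)).
Proof.
move=> bW s0; have sn0 : s != 0 by rewrite gt_eqF.
have h1 := is_derive_expect_bump nu x L bW s0.
have h0 : is_derive s (1 : R) (fun r : R => r ^+ n) ((n%:R * s ^+ n.-1) *: 1).
  have := is_deriveX n (is_derive_id s (1 : R)).
  by have -> : (id ^+ n : R -> R) = (fun r => r ^+ n) by apply/funext => r; rewrite exprfctE.
have h2 := @is_deriveV R (fun r : R => r ^+ n) s _ 1 (expf_neq0 n sn0) h0.
refine (is_derive_eq (is_deriveM h2 h1) _).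
have bb := bborel_bump_sqd x L s; have bdb := bborel_dbump_sqd x L s.
have bbW := bborelM bb bW; have bdbW := bborelM bdb bW.
have -> : E (fun y => dbump (enorm ((y - x) *m L) ^+ 2 / s ^+ 2) *
    (-2 * (enorm ((y - x) *m L) ^+ 2 / s ^+ 3)) * W y) =
    (-2 / s) * E (fun y => dbump (sqd x L s y) * sqd x L s y * W y).
  by rewrite -expectZ//; apply: eq_expect => y; rewrite /sqd; field.
have -> : E (fun y => (n%:R * bump (sqd x L s y) +
       2 * (dbump (sqd x L s y) * sqd x L s y)) * W y)
  = n%:R * E (fun y => bump (sqd x L s y) * W y) +
    2 * E (fun y => dbump (sqd x L s y) * sqd x L s y * W y).
  rewrite -!expectZ// -expectD//; try by apply: bborelM => //; exact: bborel_cst.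
  by apply: eq_expect => y; ring.
rewrite -/(sqd x L s); rewrite /GRing.scale /= !mulr1.
move: (E _) (E _) => A B.
have n0 := ls_n VS; rewrite -(prednK n0); move: (n.-1) => q.
rewrite /= !exprS; field.
by rewrite sn0 expf_neq0.
Qed.

End Monotonicity.

(** * Vitali coverings by Euclidean balls *)

Section Covering.
Context {R : realType} {k : nat}.
Implicit Types (x y : 'rV[R]_k) (A D : set 'rV[R]_k) (r : 'rV[R]_k -> R).

Definition disjoint_eballs D r :=
  forall x y, D x -> D y -> x != y -> eball x (r x) `&` eball y (r y) = set0.

Lemma rational_point x (e : R) : 0 < e -> exists q : 'rV[rat]_k, eball x e (map_mx ratr q).
Proof.
move=> e0; have d0 : 0 < e / k.+1%:R by rewrite divr_gt0.
have /choice[q hq] i : exists q : rat, `|ratr q - x 0 i| < e / k.+1%:R.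
  have [|q] := @rat_in_itvoo R (x 0 i - e / k.+1%:R) (x 0 i + e / k.+1%:R).
    by rewrite ltrD2l gtrN.
  by rewrite in_itv /= => hq; exists q; rewrite ltr_distl.
exists (\row_i q i); apply: eball_norm_ball => //; rewrite -ball_normE /=.
have [E|E] := eqVneq (x - map_mx ratr (\row_i q i)) 0; first by rewrite E normr0.
have [[i0 i] ->] : exists i, `|x - map_mx ratr (\row_i q i)| = `|(x - map_mx ratr (\row_i q i)) i.1 i.2|.
  by apply: mx_norm_neq0; move: E; apply: contra => /eqP/mx_norm_eq0/eqP.
by rewrite /= (ord1 i0) !mxE distrC.
Qed.

Lemma disjoint_eballs_countable D r : (forall x, D x -> 0 < r x) ->
  disjoint_eballs D r -> countable D.
Proof.
move=> r0 dD; have /choice[q hq] x :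
    exists q : 'rV[rat]_k, D x -> eball x (r x) (map_mx ratr q).
  have [Dx|nDx] := pselect (D x); last by exists 0.
  by have [q hq] := rational_point x (r0 _ Dx); exists q.
apply/countable_injP; exists (pickle \o q) => x y /set_mem Dx /set_mem Dy /=.
move=> /(pcan_inj pickleK) qE; apply/eqP; apply: contrapT => /negP xy.
have := dD x y Dx Dy xy; rewrite -subset0 => /(_ (map_mx ratr (q x))); apply.
by split; [exact: hq|rewrite qE; exact: hq].
Qed.

Lemma vitali_eball A r R0 : (forall x, A x -> 0 < r x <= R0) ->
  exists D, [/\ D `<=` A, disjoint_eballs D r &
    forall x, A x -> exists2 y, D y & eball x (r x) `<=` eball y (5 * r y)].
Proof.
move=> hr; pose meets x y := eball x (r x) `&` eball y (r y) !=set0.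
have meetC x y : meets x y -> meets y x by rewrite /meets setIC.
(* Zorn's lemma needs a property stable under unions of chains: a ball of the family [A] that meets
   a selected ball must meet a selected one of at least half its radius. *)
pose P D := [/\ D `<=` A, disjoint_eballs D r &
  forall x, A x -> (exists2 y, D y & meets x y) -> exists y, [/\ D y, meets x y & r x <= 2 * r y]].
have [D [[DA dD PD] maxD]] : exists D, P D /\ forall B, D `<` B -> ~ P B.
  apply: Zorn_bigcup => F FP totF; split.
  - by move=> x [B FB Bx]; have [BA _ _] := FP _ FB; exact: BA.
  - move=> x y [B FB Bx] [C FC Cy]; have [BC|CB] := totF _ _ FB FC.
      by have [_ dC _] := FP _ FC; apply: dC => //; exact: BC.
    by have [_ dB _] := FP _ FB; apply: dB => //; exact: CB.
  - move=> x Ax [y [B FB By] xy]; have [_ _ PB] := FP _ FB.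
    by have [|z [Bz xz rz]] := PB x Ax; [exists y|exists z; split => //; exists B].
have meetD x : A x -> exists2 y, D y & meets x y.
  move=> Ax; apply: contrapT => nD.
  pose A0 := [set x | A x /\ ~ exists2 y, D y & meets x y].
  pose rA0 := [set r x | x in A0].
  have supA0 : has_sup rA0.
    split; first by exists (r x), x.
    by exists R0 => _ [z [Az _] <-]; have /andP[] := hr z Az.
  have rx0 : 0 < r x by have /andP[] := hr x Ax.
  have s0 : 0 < sup rA0.
    by apply: lt_le_trans rx0 _; apply: ub_le_sup; [exact: supA0.2|exists x].
  (* Among the balls that miss the maximal family, [z] has more than half the supremum of the radii,
     so adding it preserves the property and contradicts maximality. *)
  have [_ [z [Az nz] <-] rz] := sup_adherent (divr_gt0 s0 (ltr0n _ 2)) supA0.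
  have rz0 : 0 < r z by have /andP[] := hr z Az.
  have zz : meets z z by exists z; split; rewrite /eball /= subrr enorm0.
  apply: (maxD (D `|` [set z])).
    split; first exact: subsetUl.
    by move=> /(_ z) h; apply: nz; exists z => //; apply: h; right.
  split.
  - by move=> y [/DA//|->].
  - move=> y y' [Dy|->] [Dy'|->] //; first exact: dD.
    + move=> _; rewrite -subset0 => u h; apply: nz; exists y => //.
      by apply: meetC; exists u.
    + by move=> _; rewrite -subset0 => u h; apply: nz; exists y' => //; exists u.
    + by rewrite eqxx.
  - move=> y Ay [y' [Dy'|->] yy'].
      by have [|u [Du yu ru]] := PD y Ay; [exists y'|exists u; split => //; left].
    have [yD|nyD] := pselect (exists2 u, D u & meets y u).
      by have [u [Du yu ru]] := PD y Ay yD; exists u; split => //; left.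
    exists z; split => //; first by right.
    have : r y <= sup rA0 by apply: ub_le_sup; [exact: supA0.2|exists y].
    move: rz; lra.
exists D; split => // x Ax; have [y [Dy [z [xz yz]] ry]] := PD x Ax (meetD x Ax).
exists y => // u; rewrite /eball /= in xz yz * => ux.
have := enorm_dist u x y; have := enorm_dist x z y; rewrite (enormB x z); lra.
Qed.

(** Used for the Sobolev inequality and for the density theorems. The hypothesis concerns finite
    disjoint families only, because the measure of the countable cover is bounded through partial
    sums. *)
Lemma covering_bound (nu : {measure set (eucl R k) -> \bar R}) A r (c : 'rV[R]_k -> R) R0 S :
  (forall x, A x -> 0 < r x <= R0) ->
  (forall x, A x -> (nu (eball x (5 * r x)) <= (c x)%:E)%E) ->
  (forall s : seq 'rV[R]_k, uniq s -> (forall x, x \in s -> A x) ->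
    disjoint_eballs [set` s] r -> \sum_(x <- s) c x <= S) ->
  exists W : set (eucl R k), [/\ measurable W, A `<=` W & (nu W <= S%:E)%E].
Proof.
move=> hr hc hS; have [D [DA dD DE]] := vitali_eball hr.
have /countable_injP[f fI] : countable D.
  by apply: (disjoint_eballs_countable _ dD) => x /DA/hr/andP[].
(* A partial inverse of the enumeration [f] of the disjoint family; indices that enumerate nothing
   receive the empty set. *)
pose h i := if pselect (exists x, D x /\ f x = i) is left e then Some (projT1 (cid e)) else None.
have hP i x : h i = Some x -> D x /\ f x = i.
  by rewrite /h; case: pselect => // e [<-]; exact: (projT2 (cid e)).
have hf x : D x -> h (f x) = Some x.
  move=> Dx; rewrite /h; case: pselect => [e|]; last by case; exists x.
  have [Dy fy] := projT2 (cid e); congr Some.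
  by apply: fI; rewrite ?inE.
pose F i : set (eucl R k) := if h i is Some x then eball x (5 * r x) else set0.
have mF i : measurable (F i).
  by rewrite /F; case: (h i) => // x; exact: measurable_eball.
exists (\bigcup_i F i); split.
- exact: bigcupT_measurable.
- move=> x Ax; have [y Dy xy] := DE x Ax; exists (f y) => //.
  rewrite /F hf//; apply: xy; rewrite /eball /= subrr enorm0.
  by have /andP[] := hr x Ax.
- have sub : (nu (\bigcup_i F i) <= \sum_(0 <= i <oo) nu (F i))%E.
    by apply: measure_sigma_subadditive => //; exact: bigcupT_measurable.
  apply: le_trans sub _; apply: lime_le; first by apply: is_cvg_nneseries.
  apply: nearW => N; pose s := pmap h (iota 0 N).
  have sP x : x \in s -> D x.
    by rewrite mem_pmap => /mapP[i _ /esym/hP[]].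
  have us : uniq s.
    apply: (@pmap_uniq _ _ h f) (iota_uniq 0 N) => i /=.
    by case hi : (h i) => [x|//] /=; have [] := hP _ _ hi.
  apply: (@le_trans _ _ (\sum_(x <- s) c x)%:E).
    rewrite /s big_mkord -(big_mkord xpredT (fun i => nu (F i))) /index_iota subn0.
    elim: (iota 0 N) => [|i l IH]; first by rewrite !big_nil.
    rewrite big_cons /=; case hi : (h i) => [x|] /=.
      rewrite big_cons EFinD; apply: leeD => //; rewrite /F hi.
      by apply: hc; apply: DA; have [] := hP _ _ hi.
    by rewrite /F hi measure0 add0e.
  rewrite lee_fin; apply: hS => // [x /sP/DA//|x y /sP Dx /sP Dy].
  exact: dD.
Qed.

Lemma small_cover_negligible (nu : {measure set (eucl R k) -> \bar R}) A :
  (forall e : R, 0 < e -> exists W : set (eucl R k), [/\ measurable W, A `<=` W & (nu W <= e%:E)%E]) ->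
  nu.-negligible A.
Proof.
move=> h; have /choice[W hW] (i : nat) : exists W : set (eucl R k),
    [/\ measurable W, A `<=` W & (nu W <= (i.+1%:R^-1)%:E)%E].
  by apply: h; rewrite invr_gt0.
exists (\bigcap_i W i); split.
- by apply: bigcapT_measurable => i; have [] := hW i.
- apply/eqP; rewrite eq_le measure_ge0 andbT; apply/lee_addgt0Pr => e e0.
  rewrite add0e; have [N hN] : exists N : nat, N.+1%:R^-1 <= e.
    by exists (Num.truncn e^-1); rewrite invf_ple ?posrE// ltW// truncnS_gt.
  apply: (@le_trans _ _ (nu (W N))).
    apply: le_measure; rewrite ?inE; last exact: bigcap_inf.
      by apply: bigcapT_measurable => i; have [] := hW i.
    by have [] := hW N.
  by have [_ _ /le_trans] := hW N; apply; rewrite lee_fin.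
- by move=> x Ax i _; have [_ AW _] := hW i; exact: AW.
Qed.

End Covering.

Lemma MVT_ge (R : realType) (f df : R -> R) a b M : a <= b -> 0 <= M ->
  (forall x : R, a <= x <= b -> is_derive x (1 : R) f (df x)) ->
  (forall x, a < x < b -> - M <= df x) -> f a <= f b + M * (b - a).
Proof.
move=> ab M0 hf hM; have [E|ab'] := eqVneq a b.
  by rewrite E subrr mulr0 addr0.
have {}ab : a < b by rewrite lt_neqAle ab' ab.
have [|||c] := @MVT R f df a b => //.
- by move=> x; rewrite in_itv /= => /andP[h1 h2]; apply: hf; rewrite !ltW.
- apply: derivable_within_continuous => x; rewrite in_itv /= => h.
  by case: (hf x h).
rewrite in_itv /= => /hM; have : 0 < b - a by rewrite subr_gt0.
move=> h1 h2 E; have : f b = f a + df c * (b - a) by rewrite -E; ring.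
nra.
Qed.

Section Superadditive.
Context {R : realType} {k : nat}.
Variables (v : set 'rV[R]_k -> R) (U : set 'rV[R]_k).
Hypothesis v_ge0 : forall O, 0 <= v O.
Hypothesis v_mono : forall O O', open O -> open O' -> O `<=` O' -> O' `<=` U -> v O <= v O'.
Hypothesis v_super : forall O O', open O -> open O' -> O `&` O' = set0 ->
    O `<=` U -> O' `<=` U -> v O + v O' <= v (O `|` O').

Lemma superadditive_sum (F : 'rV[R]_k -> set 'rV[R]_k) (s : seq 'rV[R]_k) O :
  open O -> O `<=` U -> uniq s -> (forall x, x \in s -> open (F x)) ->
  (forall x, x \in s -> F x `<=` O) ->
  (forall x y, x \in s -> y \in s -> x != y -> F x `&` F y = set0) ->
  \sum_(x <- s) v (F x) <= v O.
Proof.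
move=> oO OU us oF FO dF.
suff: \sum_(x <- s) v (F x) <= v (\bigcup_(x in [set` s]) F x).
  move=> /le_trans; apply; apply: v_mono => //.
    by apply: bigcup_open => x; exact: oF.
  by move=> y [x] /FO; apply.
elim: s us oF FO dF => [|x s IH] /=; first by rewrite big_nil.
move=> /andP[xs us] oF FO dF; rewrite big_cons.
have xin y : y \in s -> y \in x :: s by rewrite inE => ->; rewrite orbT.
have {}IH : \sum_(y <- s) v (F y) <= v (\bigcup_(y in [set` s]) F y).
  apply: IH => // [y /xin/oF//|y /xin/FO//|y z /xin ys /xin zs].
  exact: dF.
have oU : open (\bigcup_(y in [set` s]) F y).
  by apply: bigcup_open => y /= /xin/oF.
apply: le_trans (lerD (lexx _) IH) _.
have sub : (\bigcup_(y in [set` s]) F y) `<=` O by move=> z [y /= /xin/FO]; apply.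
have dis : F x `&` (\bigcup_(y in [set` s]) F y) = set0.
  rewrite -subset0 => z [Fz [y /= ys Fy]].
  have xy : x != y by apply: contraNneq xs => ->.
  by have := dF x y (mem_head _ _) (xin _ ys) xy; rewrite -subset0 => /(_ z); apply.
apply: le_trans (v_super _ oU dis _ _) _.
- by apply: oF; rewrite mem_head.
- by apply: subset_trans OU; apply: FO; rewrite mem_head.
- exact: subset_trans OU.
apply: v_mono.
- by apply: openU => //; apply: oF; rewrite mem_head.
- by apply: bigcup_open => y /=; exact: oF.
- move=> z [Fz|[y ys Fy]]; first by exists x => //=; rewrite mem_head.
  by exists y => //=; exact: xin.
- by move=> z [y /= /FO Fy] /Fy /OU.
Qed.

End Superadditive.

(** * The weak Sobolev inequality *)

Section WeakSobolev.
Context {R : realType} {k n : nat} {w : R} {V : local_data R k}.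
Hypothesis VS : local_spec n w V.
Local Notation nu := (ld_mu V).
Local Notation T := (ld_plane V).
Local Notation v := (ld_var V).
Local Notation E := (expect nu).
Local Notation m := (mass nu).
Implicit Types (x y : 'rV[R]_k).

Variables (h : 'rV[R]_k -> R) (Gh : 'rV[R]_k -> 'rV[R]_k) (K O : set 'rV[R]_k) (G0 : eucl R k -> R).
Hypothesis hh : C1_supp h Gh K.
Hypothesis h01 : forall y, 0 <= h y <= 1.
Hypothesis KO : K `<=` O.
Hypothesis oO : open O.
Hypothesis OU : O `<=` ld_dom V.
Hypothesis bG : bborel G0.
Hypothesis G0_ge0 : forall y, 0 <= G0 y.
Hypothesis GhG0 : forall y, enorm (Gh y *m T y) <= G0 y.

Let Grad x rho := E (fun y => G0 y * \1_(eball x rho) y) + v (O `&` eball x rho).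
Let J x rho := E (fun y => h y * \1_(eball x rho) y).

Let bh : bborel (h : eucl R k -> R).
Proof.
have [hC _ _] := hh; apply: (@continuous_bborel _ _ _ 1); first exact: isC1_continuous hC.
by move=> y; have /andP[? ?] := h01 y; rewrite ger0_norm.
Qed.

Let Grad_ge0 x rho : 0 <= Grad x rho.
Proof.
rewrite addr_ge0 ?(ls_var_ge0 VS)// expect_ge0// => y.
by rewrite mulr_ge0// indicE.
Qed.

Lemma sqd1 x s y : sqd x 1%:M s y = enorm (y - x) ^+ 2 / s ^+ 2.
Proof. by rewrite /sqd mulmx1. Qed.

Lemma sqd1_lt1 x s y : 0 < s -> sqd x 1%:M s y < 1 -> enorm (y - x) < s.
Proof.
move=> s0; rewrite sqd1 ltr_pdivrMr ?exprn_gt0// mul1r.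
by rewrite ltr_sqr ?nnegrE ?enorm_ge0// ltW.
Qed.

(** The test field is [bump * h * (y - x)], of norm at most [s]. As [dbump <= 0] and
    [|(y - x) T| <= |y - x|], replacing the tangential part of the radius by the whole radius only
    decreases the divergence. What remains is the tangential gradient of [h] times [s]. The radius
    [2 s] gives an open ball around the closed support. *)
Lemma first_variation_ball x s : 0 < s ->
  E (fun y => (n%:R * bump (sqd x 1%:M s y) +
       2 * (dbump (sqd x 1%:M s y) * sqd x 1%:M s y)) * h y) <= s * Grad x (2 * s).
Proof.
move=> s0; have [hC cK hz] := hh.
pose psi y := bump (sqd x 1%:M s y) * h y.
pose Gp y := bump (sqd x 1%:M s y) *: Gh y +
  h y *: ((dbump (sqd x 1%:M s y) * (2 / s ^+ 2)) *: ((y - x) *m 1%:M *m (1%:M)^T)).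
have hpsi : isC1 psi Gp.
  apply: isC1_mul hC; apply: isC1_comp_sqd; first exact: is_derive_bump.
  exact: continuous_dbump.
pose K' := K `&` ecball x s.
have cK' : compact K'.
  by rewrite /K' setIC; apply: compact_closedI; [exact: compact_ecball|apply: compact_closed cK; exact: norm_hausdorff].
have out y : ~ ecball x s y -> bump (sqd x 1%:M s y) = 0 /\ dbump (sqd x 1%:M s y) = 0.
  move=> ny; have u1 : 1 <= sqd x 1%:M s y.
    rewrite leNgt; apply/negP => /(sqd1_lt1 s0) h1; apply: ny; exact: ltW.
  by rewrite bump_eq0 ?dbump_eq0.
have supp : C1_supp psi Gp K'.
  split=> // y nK'; have [Ky|nKy] := pselect (K y).
    have [b0 d0] : bump (sqd x 1%:M s y) = 0 /\ dbump (sqd x 1%:M s y) = 0.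
      by apply: out => ?; apply: nK'.
    by rewrite /psi /Gp b0 d0 !mul0r !scale0r scaler0 addr0.
  have [h0 g0] := hz y nKy.
  by rewrite /psi /Gp h0 g0 mulr0 scale0r scaler0 addr0.
have sup : forall y, enorm (psi y *: ((y - x) *m 1%:M)) <= s.
  move=> y; rewrite enormZ mulmx1; have /andP[h0 h1] := h01 y.
  rewrite ger0_norm; last by rewrite mulr_ge0// bump_ge0.
  have [Ky|nKy] := pselect (ecball x s y); last first.
    by have [b0 _] := out y nKy; rewrite /psi b0 !mul0r ltW.
  have b1 : psi y <= 1.
    have := bump_ge0 (sqd x 1%:M s y); have := bump_le1 (sqd_ge0 x 1%:M s y).
    rewrite /psi; nra.
  by apply: le_trans (ler_wpM2r (enorm_ge0 _) b1) _; rewrite mul1r.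
have sub : K' `<=` O `&` eball x (2 * s).
  move=> y [/KO Oy ys]; split => //; rewrite /eball /ecball /= in ys *; lra.
have oO' : open (O `&` eball x (2 * s)) by apply: openI => //; exact: open_eball.
have OU' : O `&` eball x (2 * s) `<=` ld_dom V by move=> y [/OU].
have := ls_first_variation VS supp sub oO' OU' sup.
set F := div_radial _ _ _ _ _ => /ler_normlP[] _ hF.
have bF : bborel F by apply: (bborel_div_radial VS) supp.
have bI : bborel (\1_(eball x (2 * s)) : eucl R k -> R).
  by apply: bborel_indic; exact: measurable_eball.
have bGI := bborelM bG bI.
have le1 : E (fun y => (n%:R * bump (sqd x 1%:M s y) +
       2 * (dbump (sqd x 1%:M s y) * sqd x 1%:M s y)) * h y) <=
   E (fun y => F y + s * (G0 y * \1_(eball x (2 * s)) y)).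
  apply: expect_le.
  - apply: bborelM => //; apply: bborelD; apply: bborelM; try exact: bborel_cst.
      exact: bborel_bump_sqd.
    exact: bborel_dbump_sqd.
  - by apply: bborelD => //; apply: bborelM => //; exact: bborel_cst.
  move=> y; have gT := ls_grass VS y; have /andP[h0 h1] := h01 y.
  rewrite /F /div_radial mulmx1 (grass_trace gT) /psi /Gp !mulmx1 trmx1 mulmx1.
  rewrite edotDr !edotZr.
  set b := bump _; set d := dbump _; set u := sqd _ _ _ _.
  have Tp : edot ((y - x) *m T y) (y - x) <= enorm (y - x) ^+ 2.
    rewrite edotC -(grass_edot2 _ _ gT) -sqr_enorm.
    by rewrite ler_sqr ?nnegrE ?enorm_ge0// (grass_enorm _ gT).
  have Tp0 : 0 <= edot ((y - x) *m T y) (y - x).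
    by rewrite edotC -(grass_edot2 _ _ gT) -sqr_enorm sqr_ge0.
  have uE : u = enorm (y - x) ^+ 2 / s ^+ 2 by rewrite /u sqd1.
  have d0 : d <= 0 by exact: dbump_le0.
  have key1 : 2 * (d * u) * h y <= h y * (d * (2 / s ^+ 2) * edot ((y - x) *m T y) (y - x)).
    rewrite uE; have -> : 2 * (d * (enorm (y - x) ^+ 2 / s ^+ 2)) * h y =
      h y * (d * (2 / s ^+ 2) * enorm (y - x) ^+ 2) by ring.
    rewrite ler_wpM2l//; apply: ler_wnM2l => //.
    by rewrite mulr_le0_ge0// divr_ge0// sqr_ge0.
  have key2 : - (s * (G0 y * \1_(eball x (2 * s)) y)) <= b * edot ((y - x) *m T y) (Gh y).
    have [Ky|nKy] := pselect (ecball x s y); last first.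
      have [b0 _] := out y nKy; rewrite /b b0 mul0r oppr_le0 mulr_ge0 ?(ltW s0)//.
      by rewrite mulr_ge0// indicE.
    have iy : \1_(eball x (2 * s)) y = 1 :> R.
      rewrite indicE mem_set//; rewrite /eball /ecball /= in Ky *; lra.
    rewrite iy mulr1 (grass_edot _ _ gT).
    have := edot_le (y - x) (Gh y *m T y); rewrite ler_norml => /andP[h2 _].
    have b0 : 0 <= b by exact: bump_ge0.
    have b1 : b <= 1 by apply: bump_le1; exact: sqd_ge0.
    have h3 : enorm (y - x) * enorm (Gh y *m T y) <= s * G0 y.
      by apply: ler_pM; rewrite ?enorm_ge0.
    have h4 : 0 <= s * G0 y by rewrite mulr_ge0// ltW.
    nra.
  by rewrite mulrDl; move: key1 key2; nra.
apply: le_trans le1 _; rewrite expectD//; last by apply: bborelM => //; exact: bborel_cst.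
by rewrite expectZ// /Grad mulrDr addrC lerD2l.
Qed.

Lemma eball_setS x r r' : r <= r' -> eball x r `<=` eball x r'.
Proof. by move=> rr y /lt_le_trans; apply. Qed.

Let bhI x r : bborel ((fun y => h y * \1_(eball x r) y) : eucl R k -> R).
Proof. by apply: bborelM => //; apply: bborel_indic; exact: measurable_eball. Qed.

Let J_le x r r' : r <= r' -> J x r <= J x r'.
Proof.
move=> rr; apply: expect_le => // y; have /andP[h0 _] := h01 y.
rewrite ler_wpM2l// !indicE; have [/set_mem yr|] := boolP (y \in eball x r); last by rewrite ler0n.
by rewrite mem_set//; exact: eball_setS yr.
Qed.

Let J_ge0 x r : 0 <= J x r.
Proof. by apply: expect_ge0 => y; have /andP[h0 _] := h01 y; rewrite mulr_ge0// indicE. Qed.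

Let J_leE x r : J x r <= E h.
Proof.
apply: expect_le => // y; have /andP[h0 _] := h01 y.
by rewrite -[leRHS]mulr1 ler_wpM2l// indicE lern1 leq_b1.
Qed.

Let J_leM x r : J x r <= m (ecball x r).
Proof.
rewrite -expect_indic; last exact: measurable_ecball.
apply: expect_le => //; first by apply: (@bborel_indic _ (eucl R k)); exact: measurable_ecball.
move=> y; have /andP[h0 h1] := h01 y; rewrite !indicE.
have [/set_mem yr|] := boolP (y \in eball x r); last by rewrite mulr0 ler0n.
by rewrite mem_set ?mulr1//; exact: ltW.
Qed.

(** Near a point with [h = 1] one has [h > 1/2], and the mass ratio at radius [r/2] is at least [w]:
    this makes [J x r >= c0 r^n] for small [r]. The factor between [c0] and [c1] is the margin used
    at the end of [sobolev_scale]. *)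
Let c0 : R := w / 2 ^+ n.+1.
Let c1 : R := c0 / 2 ^+ n.+4.

Let c0_gt0 : 0 < c0. Proof. by rewrite divr_gt0 ?exprn_gt0// (ls_w VS). Qed.

(* Simon's form of the Michael-Simon argument: at a maximal mass ratio of [h] the
   monotonicity inequality can only fail at some scale below [rho0]. *)
Lemma sobolev_scale x (kap rho0 : R) : regular_point n w nu x -> h x = 1 ->
  0 < kap -> 0 < rho0 -> E h <= c1 * rho0 ^+ n ->
  exists rho, 0 < rho < rho0 /\
    J x (kap * rho) <= (2 ^+ n.+3 * kap ^+ n * 2 ^+ n) * rho0 * Grad x (2 * rho).
Proof.
move=> [C [r0 [r00 hreg]]] hx kap0 rho00 Eh.
have [hC cK hz] := hh.
have low : exists2 r1, 0 < r1 & forall r, 0 < r -> r < r1 -> c0 * r ^+ n <= J x r.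
  have ch := isC1_continuous hC.
  have : nbhs x [set y | 2^-1 < h y].
    have : open [set y | 2^-1 < h y].
      have -> : [set y | 2^-1 < h y] = h @^-1` [set t | 2^-1 < t] by [].
      by apply: open_comp; [move=> y _; exact: ch|exact: open_gt].
    rewrite openE; by apply; rewrite /= hx invf_lt1// ltr1n.
  move=> /nbhs_eballP[r1 r10 hr1]; exists (Num.min r1 r0); first by rewrite lt_min r10.
  move=> r rr0; rewrite lt_min => /andP[rr1 rr2].
  have r2 : 0 < r / 2 by rewrite divr_gt0.
  have r3 : r / 2 < r0 by lra.
  have /andP[hl _] := hreg _ r2 r3.
  have : 2^-1 * m (ecball x (r / 2)) <= J x r.
    apply: ge_mass_indic => //; first exact: measurable_ecball.
    move=> y; have /andP[h0 _] := h01 y; rewrite !indicE.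
    have [/set_mem yr|] := boolP (y \in ecball x (r / 2)); last first.
      by rewrite mulr0 mulr_ge0.
    have yr' : eball x r y by rewrite /eball /ecball /= in yr *; lra.
    rewrite (mem_set yr') !mulr1 ltW//; apply: hr1.
    exact: eball_setS (ltW rr1) _ yr'.
  apply: le_trans; apply: le_trans (ler_wpM2l _ hl) => //.
  rewrite le_eqVlt /c0; apply/orP; left; apply/eqP.
  rewrite exprSr expr_div_n; field.
  by rewrite expf_neq0 ?pnatr_eq0.
have [r1 r10 hlow] := low.
(* The ratios are bounded by the upper mass ratio [C] at small radii and by the total integral of
   [h] at large ones, so the supremum [S] is finite. *)
pose Q := [set J x r / r ^+ n | r in [set r | 0 < r]].
have supQ : has_sup Q.
  split; first by exists (J x 1 / 1 ^+ n), 1 => //=; exact: ltr01.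
  exists (Num.max C (E h / r0 ^+ n)) => _ [r /= rr0 <-]; rewrite le_max.
  have [rlt|rge] := ltP r r0.
    apply/orP; left; rewrite ler_pdivrMr ?exprn_gt0//.
    by have /andP[_] := hreg _ rr0 rlt; apply: le_trans; exact: J_leM.
  apply/orP; right; apply: ler_pM => //; rewrite ?invr_ge0 ?exprn_ge0 ?(ltW rr0)//.
  by rewrite lef_pV2 ?posrE ?exprn_gt0// lerXn2r ?nnegrE ?(ltW rr0) ?(ltW r00).
set S := sup Q.
have S0 : c0 <= S.
  have r2 : 0 < r1 / 2 by rewrite divr_gt0.
  have r3 : r1 / 2 < r1 by lra.
  apply: (@le_trans _ _ (J x (r1 / 2) / (r1 / 2) ^+ n)).
    by rewrite ler_pdivlMr ?exprn_gt0// hlow.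
  by apply: ub_le_sup; [exact: supQ.2|exists (r1 / 2)].
have S00 : 0 < S := lt_le_trans c0_gt0 S0.
have JS r : 0 < r -> J x r <= S * r ^+ n.
  move=> rr0; rewrite -ler_pdivrMr ?exprn_gt0//.
  by apply: ub_le_sup; [exact: supQ.2|exists r].
have [_ [rs /= rs0 <-] hrs] := sup_adherent (divr_gt0 S00 (ltr0n _ 2)) supQ.
have {}hrs : S / 2 * rs ^+ n < J x rs.
  by rewrite -ltr_pdivlMr ?exprn_gt0//; move: hrs; rewrite -/S; lra.
apply: contrapT => neg.
have {}neg rho : 0 < rho -> rho < rho0 ->
    2 ^+ n.+3 * kap ^+ n * 2 ^+ n * rho0 * Grad x (2 * rho) <= J x (kap * rho).
  move=> rp rl; rewrite leNgt; apply/negP => /ltW hle; apply: neg; exists rho.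
  by rewrite rp rl.
have e2 q : (0 : R) < 2 ^+ q by rewrite exprn_gt0.
have c1E : c1 * (2 ^+ n * 16) = c0.
  by rewrite /c1 !exprS; field; rewrite gt_eqF.
(* A nearly maximal ratio cannot occur at a scale comparable to [rho0] or larger, since there the
   total integral of [h] is too small. *)
have [big|small] := leP rho0 (2 * rs).
  have : J x rs <= c1 * (2 ^+ n * rs ^+ n).
    apply: le_trans (J_leE _ _) _; apply: le_trans Eh _.
    rewrite ler_wpM2l//; first by rewrite /c1 divr_ge0 ?(ltW c0_gt0) ?(ltW (e2 _)).
    by rewrite -exprMn lerXn2r ?nnegrE ?mulr_ge0 ?(ltW rs0) ?(ltW rho00).
  have rsn : 0 < rs ^+ n by rewrite exprn_gt0.
  have : c1 * 2 ^+ n < S / 2 by move: c1E; lra.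
  rewrite mulrA; nra.
(* The smoothed mass ratio. If the claim failed at all scales below [rho0], the gradient term would
   be at most a multiple of [J], hence of [S r^n], and [f] could drop by at most [S / 8 / 2^n]
   between [2 rs] and [rho0]. *)
pose f r := (r ^+ n)^-1 * E (fun y => bump (sqd x 1%:M r y) * h y).
pose df s := - (s ^+ n.+1)^-1 * E (fun y => (n%:R * bump (sqd x 1%:M s y) +
       2 * (dbump (sqd x 1%:M s y) * sqd x 1%:M s y)) * h y).
have P0 : 0 < 2 ^+ n.+3 * 2 ^+ n * rho0 := mulr_gt0 (mulr_gt0 (e2 _) (e2 _)) rho00.
have M0 : 0 <= S / (2 ^+ n.+3 * 2 ^+ n * rho0) := divr_ge0 (ltW S00) (ltW P0).
have := @MVT_ge R f df (2 * rs) rho0 (S / (2 ^+ n.+3 * 2 ^+ n * rho0)) (ltW small) M0.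
move=> main.
have h1 : f (2 * rs) <= f rho0 + S / (2 ^+ n.+3 * 2 ^+ n * rho0) * (rho0 - 2 * rs).
  apply: main => [r /andP[r1' _]|r /andP[r1' r2']].
    apply: (is_derive_ratio VS) => //; apply: lt_le_trans r1'; by rewrite mulr_gt0.
  have rp : 0 < r by apply: lt_trans r1'; rewrite mulr_gt0.
  have g1 := first_variation_ball x rp.
  have g2 := neg r rp r2'.
  have g3 := JS (kap * r) (mulr_gt0 kap0 rp).
  rewrite /df mulNr lerN2.
  have rn : 0 < r ^+ n by rewrite exprn_gt0.
  rewrite (ler_pdivlMr _ _ P0).
  apply: (@le_trans _ _ ((r ^+ n.+1)^-1 * (r * Grad x (2 * r)) * (2 ^+ n.+3 * 2 ^+ n * rho0))).
    apply: ler_wpM2r; first exact: ltW.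
    by apply: ler_wpM2l => //; rewrite invr_ge0 exprn_ge0// ltW.
  have -> : (r ^+ n.+1)^-1 * (r * Grad x (2 * r)) * (2 ^+ n.+3 * 2 ^+ n * rho0) =
    (2 ^+ n.+3 * kap ^+ n * 2 ^+ n * rho0 * Grad x (2 * r)) / (kap * r) ^+ n.
    by rewrite exprMn exprS; field; rewrite !gt_eqF ?exprn_gt0.
  rewrite ler_pdivrMr ?exprn_gt0 ?mulr_gt0//.
  exact: le_trans g2 g3.
have h2 : f rho0 <= c1.
  rewrite /f mulrC ler_pdivrMr ?exprn_gt0//; apply: le_trans Eh.
  apply: expect_le => //; first by apply: bborelM => //; exact: bborel_bump_sqd.
  move=> y; have /andP[h0 _] := h01 y.
  by rewrite -[leRHS]mul1r ler_wpM2r// bump_le1// sqd_ge0.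
have h3 : S / 2 / 2 ^+ n / 2 <= f (2 * rs).
  have : 2^-1 * J x rs <= E (fun y => bump (sqd x 1%:M (2 * rs) y) * h y).
    rewrite -expectZ//; apply: expect_le.
    - by apply: bborelM => //; exact: bborel_cst.
    - by apply: bborelM => //; exact: bborel_bump_sqd.
    move=> y; have /andP[h0 _] := h01 y; rewrite indicE.
    have [/set_mem yr|] := boolP (y \in eball x rs); last first.
      by rewrite !mulr0 mulr_ge0// bump_ge0.
    rewrite mulr1 ler_wpM2r// bump_ge_half ?sqd_ge0//.
    rewrite sqd1 ler_pdivrMr ?exprn_gt0 ?mulr_gt0//.
    have -> : 4^-1 * (2 * rs) ^+ 2 = rs ^+ 2 by rewrite exprMn; field.
    by rewrite ler_sqr ?nnegrE ?enorm_ge0 ?(ltW rs0)// ltW.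
  move=> h4; rewrite /f [leRHS]mulrC ler_pdivlMr ?exprn_gt0 ?mulr_gt0//; apply: le_trans h4.
  have -> : S / 2 / 2 ^+ n / 2 * (2 * rs) ^+ n = 2^-1 * (S / 2 * rs ^+ n).
    by rewrite exprMn; field; rewrite gt_eqF.
  by rewrite ler_pM2l// ltW.
have h5 : S / (2 ^+ n.+3 * 2 ^+ n * rho0) * (rho0 - 2 * rs) <= S / 8 / 2 ^+ n / 2 ^+ n.
  rewrite -[leRHS]mulr1; have -> : S / (2 ^+ n.+3 * 2 ^+ n * rho0) * (rho0 - 2 * rs) =
     S / 8 / 2 ^+ n / 2 ^+ n * ((rho0 - 2 * rs) / rho0).
    by rewrite !exprS; field; rewrite !gt_eqF.
  rewrite ler_wpM2l//; first by rewrite !divr_ge0 ?(ltW (e2 _)) ?(ltW S00).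
  by rewrite ler_pdivrMr// mul1r; lra.
have e3 : 1 <= (2 : R) ^+ n by rewrite exprn_ege1// ler1n.
have h6 : S / 8 / 2 ^+ n / 2 ^+ n <= S / 8 / 2 ^+ n.
  by rewrite ler_pdivrMr// ler_peMr// !divr_ge0 ?(ltW (e2 _)) ?(ltW S00).
have h7 : c1 <= S / 16 / 2 ^+ n.
  by rewrite ler_pdivlMr// ler_pdivlMr//; move: c1E; lra.
have h8 : 0 < S / 2 ^+ n by rewrite divr_gt0.
(* In units of [S / 2^n] this says that [1/4] is at most [1/16 + 1/8]. *)
have := le_trans h3 (le_trans h1 (lerD h2 (le_trans h5 h6))).
move: h7 h8; rewrite -![_ / _ / 2 ^+ n]mulrAC; move: (S / 2 ^+ n) => z; lra.
Qed.

(** Cover by balls of radius [2 rho], with [rho] from [sobolev_scale]. The choice [kap = 10] makes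
    its left side refer to the fivefold balls, while on the disjoint balls the integrals of [G0] and
    the variations add up by superadditivity. *)
Lemma weak_sobolev_scale (rho0 : R) : 0 < rho0 -> E h <= c1 * rho0 ^+ n ->
  m [set y | h y = 1] <= (2 ^+ n.+3 * 10 ^+ n * 2 ^+ n) * rho0 * (E G0 + v O).
Proof.
move=> rho00 Eh; set C := 2 ^+ n.+3 * 10 ^+ n * 2 ^+ n.
have C0 : 0 < C by apply: mulr_gt0; [apply: mulr_gt0|]; exact: exprn_gt0.
have [hC _ _] := hh; have ch := isC1_continuous hC.
have m1 : measurable ([set y | h y = 1] : set (eucl R k)).
  apply: closed_measurable_eucl.
  have -> : [set y | h y = 1] = h @^-1` [set 1] by [].
  by apply: closed_comp; [move=> y _; exact: ch|exact: closed_eq].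
pose A := [set x | h x = 1 /\ regular_point n w nu x].
have /choice[rho hrho] x : exists rho, A x -> 0 < rho < rho0 /\
    J x (10 * rho) <= C * rho0 * Grad x (2 * rho).
  have [[hx rx]|nA] := pselect (A x); last by exists 0.
  by have [//|rho hr] := @sobolev_scale x 10 rho0 rx hx _ rho00 Eh; exists rho.
pose r x := 2 * rho x.
have [W [mW AW nuW]] : exists W : set (eucl R k), [/\ measurable W, A `<=` W &
    (* The measure is restricted to the set where [h = 1], because there it is dominated by the
       integral of [h] over the ball. *)
    (mrestr nu m1 W <= (C * rho0 * (E G0 + v O))%:E)%E].
  apply: (@covering_bound _ _ (mrestr nu m1) A r (fun x => C * rho0 * Grad x (r x)) (2 * rho0)).
  - by move=> x /hrho[/andP[h1 h2] _]; rewrite /r; apply/andP; split; lra.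
  - move=> x Ax; have [/andP[h1 h2] h3] := hrho x Ax.
    apply: (@le_trans _ _ (J x (10 * rho x))%:E); last by rewrite lee_fin.
    have -> : 5 * r x = 10 * rho x by rewrite /r; ring.
    change (nu (eball x (10 * rho x) `&` [set y | h y = 1%R]) <= (J x (10 * rho x))%:E)%E.
    have mB : measurable (eball x (10 * rho x) `&` [set y | h y = 1] : set (eucl R k)).
      by apply: measurableI => //; exact: measurable_eball.
    rewrite -(massE nu mB) lee_fin -expect_indic//.
    apply: expect_le => //; first exact: (@bborel_indic _ (eucl R k)).
    move=> y; have /andP[h0 _] := h01 y; rewrite !indicE.
    have [/set_mem[yr hy]|] := boolP (y \in _ `&` _); last by rewrite mulr_ge0.
    by rewrite (mem_set yr) hy mulr1.
  - move=> s us sA ds; rewrite -mulr_sumr; apply: ler_wpM2l; first exact: (mulr_ge0 (ltW C0) (ltW rho00)).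
    rewrite big_split /=; apply: lerD.
      pose v' (B : set 'rV[R]_k) := E (fun y => G0 y * \1_B y).
      have bGB (B : set 'rV[R]_k) : open B -> bborel ((fun y => G0 y * \1_B y) : eucl R k -> R).
        move=> oB; apply: bborelM => //; apply: (@bborel_indic _ (eucl R k)).
        exact: open_measurable_eucl.
      apply: (@le_trans _ _ (v' setT)); last first.
        by rewrite /v'; apply: expect_le => //; [exact/bGB/openT|move=> y; rewrite indicT mulr1].
      apply: (@superadditive_sum _ _ v' setT _ _ _ (fun x => eball x (r x))) => //.
      + by move=> B; apply: expect_ge0 => y; rewrite mulr_ge0// indicE.
      + move=> B B' oB oB' BB' _; apply: expect_le; try exact: bGB.
        move=> y; rewrite ler_wpM2l// !indicE.
        have [/set_mem yB|] := boolP (y \in B); last by rewrite ler0n.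
        by rewrite (mem_set (BB' _ yB)).
      + move=> B B' oB oB' BB' _ _; rewrite /v' -expectD; try exact: bGB.
        apply: expect_le; [by apply: bborelD; exact: bGB|by apply: bGB; exact: openU|].
        move=> y; rewrite -mulrDr ler_wpM2l// !indicE -natrD ler_nat in_setU.
        have [/set_mem yB|] := boolP (y \in B) => //=.
        have [/set_mem yB'|//] := boolP (y \in B').
        by have : (B `&` B') y by []; rewrite BB'.
      + exact: openT.
      + by move=> x _; exact: open_eball.
    apply: (@superadditive_sum _ _ v (ld_dom V) _ _ _ (fun x => O `&` eball x (r x))) => //.
    + exact: (ls_var_ge0 VS).
    + exact: (ls_var_mono VS).
    + exact: (ls_var_super VS).
    + by move=> x _; apply: openI => //; exact: open_eball.
    + move=> x y xs ys xy; rewrite setIACA (ds x y)//.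
      by rewrite setI0.
have [N [mN N0 subN]] := ls_regular VS.
have mW1 : measurable (W `&` [set y | h y = 1]) by exact: measurableI.
rewrite -lee_fin; apply: le_trans nuW; rewrite massE//.
apply: (@le_trans _ _ (nu ((W `&` [set y | h y = 1]) `|` N))).
  apply: le_measure; rewrite ?inE//; first exact: measurableU.
  move=> y hy; have [ry|nry] := pselect (regular_point n w nu y).
    by left; split => //; apply: AW.
  by right; apply: subN.
have -> : mrestr nu m1 W = (nu (W `&` [set y | h y = 1%R]) + nu N)%E by rewrite N0 adde0.
exact: measureU2.
Qed.

End WeakSobolev.

(** The first three factors come from [sobolev_scale] with [kap = 10], the last one from the choice
    of [rho0] in [weak_sobolev]. *)
Definition sobolev_const (R : realType) (n : nat) (w : R) : R :=
  2 ^+ n.+3 * 10 ^+ n * 2 ^+ n * (w / 2 ^+ n.+1 / 2 ^+ n.+4) `^ (- n%:R^-1).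

Lemma sobolev_const_gt0 (R : realType) n (w : R) : 0 < w -> 0 < sobolev_const n w.
Proof.
move=> w0; by rewrite /sobolev_const mulr_gt0 ?powR_gt0 ?divr_gt0 ?exprn_gt0//.
Qed.

(** The scale [rho0] is chosen with equality in the smallness condition, [c1 rho0^n = X]. If [X = 0]
    no such scale exists, but then the set where [h = 1] has measure 0. *)
Lemma weak_sobolev (R : realType) (k n : nat) (w : R) (V : local_data R k)
    (h : 'rV[R]_k -> R) Gh (K O : set 'rV[R]_k) (G0 : eucl R k -> R) :
  local_spec n w V -> C1_supp h Gh K -> (forall y, 0 <= h y <= 1) ->
  K `<=` O -> open O -> O `<=` ld_dom V -> bborel G0 -> (forall y, 0 <= G0 y) ->
  (forall y, enorm (Gh y *m ld_plane V y) <= G0 y) ->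
  mass (ld_mu V) [set y | h y = 1] <=
    sobolev_const n w * (expect (ld_mu V) (h : eucl R k -> R)) `^ n%:R^-1 * (expect (ld_mu V) G0 + ld_var V O).
Proof.
move=> VS hh h01 KO oO OU bG G0_ge0 GhG0.
have w0 := ls_w VS; have n0 := ls_n VS.
have n0' : n%:R != 0 :> R by rewrite pnatr_eq0 -lt0n.
set X := expect _ _; set Y := _ + ld_var V O; set c1 := w / 2 ^+ n.+1 / 2 ^+ n.+4.
have c10 : 0 < c1 by rewrite !divr_gt0 ?exprn_gt0.
have X0 : 0 <= X by apply: expect_ge0 => y; have /andP[] := h01 y.
have Y0 : 0 <= Y by rewrite addr_ge0 ?(ls_var_ge0 VS)// expect_ge0.
have [XE|XN] := eqVneq X 0.
  have : mass (ld_mu V) [set y | h y = 1] <= X.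
    have [hC _ _] := hh; have ch := isC1_continuous hC.
    have m1 : measurable ([set y | h y = 1] : set (eucl R k)).
      apply: closed_measurable_eucl.
      have -> : [set y | h y = 1] = h @^-1` [set 1] by [].
      by apply: closed_comp; [move=> y _; exact: ch|exact: closed_eq].
    rewrite -expect_indic//; apply: expect_le; first exact: (@bborel_indic _ (eucl R k)).
      apply: (@continuous_bborel _ _ _ 1) => // y.
      by have /andP[? ?] := h01 y; rewrite ger0_norm.
    move=> y; have /andP[h0 _] := h01 y; rewrite indicE.
    by have [/set_mem ->|] := boolP (y \in _).
  by rewrite XE => /le_trans; apply; rewrite powR0 ?invr_eq0// mulr0 mul0r//.
have XP : 0 < X by rewrite lt_neqAle eq_sym XN.
have r0 : 0 < (X / c1) `^ n%:R^-1 by rewrite powR_gt0// divr_gt0.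
have Xc : 0 <= X / c1 := ltW (divr_gt0 XP c10).
have rn : c1 * ((X / c1) `^ n%:R^-1) ^+ n = X.
  rewrite -powR_mulrn ?powR_ge0// -powRrM mulVf// (powRr1 Xc).
  by rewrite mulrC divfK// gt_eqF.
have hX : X <= c1 * ((X / c1) `^ n%:R^-1) ^+ n by rewrite rn.
have := weak_sobolev_scale VS hh h01 KO oO OU bG G0_ge0 GhG0 r0 hX.
move=> /le_trans; apply; rewrite le_eqVlt; apply/orP; left; apply/eqP.
rewrite /sobolev_const -/c1 powRM ?invr_ge0 ?(ltW XP) ?(ltW c10)//.
have -> : c1^-1 `^ n%:R^-1 = c1 `^ (- n%:R^-1).
  by rewrite -powR_inv1 ?(ltW c10)// -powRrM mulN1r.
by rewrite -/Y; ring.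
Qed.

(** * Decay of the height at a point of flatness *)

Section Levels.
Context {R : realType} {k n : nat} {w : R} {V : local_data R k}.
Hypothesis VS : local_spec n w V.
Local Notation nu := (ld_mu V).
Local Notation T := (ld_plane V).
Local Notation v := (ld_var V).
Local Notation E := (expect nu).
Local Notation m := (mass nu).
Implicit Types (a y : 'rV[R]_k) (P : 'M[R]_k) (r s t : R).

Definition height a P (y : 'rV[R]_k) : R := enorm ((y - a) *m (1%:M - P)).

Definition steep a P r s : set 'rV[R]_k := eball a r `&` [set y | s < height a P y].

Definition tilt P (y : eucl R k) : R := hsnorm (T y - P).

Lemma height_ge0 a P y : 0 <= height a P y. Proof. exact: enorm_ge0. Qed.

Lemma continuous_height a P : continuous (height a P).
Proof. by apply: continuous_enorm_comp; exact: continuous_mulmx_sub. Qed.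

Lemma open_steep a P r s : open (steep a P r s).
Proof.
apply: openI; first exact: open_eball.
have -> : [set y | s < height a P y] = height a P @^-1` [set u | s < u] by [].
by apply: open_comp; [move=> y _; exact: continuous_height|exact: open_gt].
Qed.

Lemma measurable_steep a P r s : measurable (steep a P r s : set (eucl R k)).
Proof. by apply: open_measurable_eucl; exact: open_steep. Qed.

Lemma steep_sub a P r s r' s' : r <= r' -> s' <= s -> steep a P r s `<=` steep a P r' s'.
Proof.
move=> rr ss y [yr ys]; split; first exact: lt_le_trans rr.
exact: le_lt_trans ys.
Qed.

Lemma bborel_tilt P : grassmannian n P -> bborel (tilt P).
Proof.
move=> gP; split.
  apply: measurable_hsnorm => i j; have -> : (fun x => (T x - P) i j) = fun x => T x i j - P i j.
    by apply/funext => x; rewrite !mxE.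
  by apply: measurable_funB; [exact: (ls_measurable VS)|exact: measurable_cst].
exists (2 * n%:R) => y; rewrite ger0_norm ?hsnorm_ge0//.
exact: (grass_tilt_le (ls_n VS) gP (ls_grass VS y)).
Qed.

Lemma tilt_ge0 P y : 0 <= tilt P y. Proof. exact: hsnorm_ge0. Qed.

Lemma bborel_indic_eucl (A : set 'rV[R]_k) : measurable (A : set (eucl R k)) ->
  bborel (\1_A : eucl R k -> R).
Proof. by move=> mA; exact: (@bborel_indic _ (eucl R k)). Qed.

Lemma measurable_low a P r s t :
  measurable (steep a P r s `&` [set y | height a P y <= t] : set (eucl R k)).
Proof.
apply: measurableI; first exact: measurable_steep.
apply: closed_measurable_eucl.
have -> : [set y | height a P y <= t] = height a P @^-1` [set u | u <= t] by [].
by apply: closed_comp; [move=> y _; exact: continuous_height|exact: closed_le].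
Qed.

Lemma is_derive_affine (f f' : R -> R) (c d : R) : (forall t : R, is_derive t (1 : R) f (f' t)) ->
  forall t : R, is_derive t (1 : R) (fun u => f (c * u + d)) (f' (c * t + d) * c).
Proof.
move=> df t; have h : is_derive t (1 : R) (fun u => c * u + d) c.
  apply: (@is_derive_quadratic _ _ _ 0) => u; rewrite mul0r.
  by rewrite (_ : _ - _ - _ = 0) ?normr0//; ring.
exact: (@is_derive1_comp R f (fun u => c * u + d) t _ _ (df _) h).
Qed.

Lemma continuous_affine (f' : R -> R) (c d : R) : continuous f' ->
  continuous (fun u : R => f' (c * u + d) * c).
Proof.
move=> cf; apply: fun_continuousM; last exact: fun_continuous_cst.
apply: (fun_continuous_comp (h := f') (g := fun u => c * u + d)) => //.
apply: fun_continuousD; last exact: fun_continuous_cst.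
by apply: fun_continuousM; [exact: fun_continuous_cst|move=> u; exact: cvg_id].
Qed.

Lemma sqd1E a (L : 'M[R]_k) y : sqd a L 1 y = enorm ((y - a) *m L) ^+ 2.
Proof. by rewrite /sqd expr1n divr1. Qed.

(** The weak Sobolev inequality for a product of cut-offs in height and in distance. The tilt is
    integrated only over the layer between the two levels, where the height cut-off varies; for
    successive levels these layers are disjoint, which is essential for the [L^(q2)] estimate. *)
Lemma level_estimate a P r r' s t : grassmannian n P ->
  0 < r -> r < r' -> 0 <= s -> s < t -> eball a r' `<=` ld_dom V ->
  m (steep a P r t) <= sobolev_const n w * m (steep a P r' s) `^ n%:R^-1 *
    (8 / (t - s) * E (fun y => tilt P y * \1_(steep a P r' s `&` [set y | height a P y <= t]) y) +
     8 / (r' - r) * m (steep a P r' s) + v (steep a P r' s)).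
Proof.
move=> gP r0 rr s0 st BU.
set A := steep a P r' s.
(* Midpoints leave room between the compact support of the cut-off and the open set
   [steep a P r' s]. The cut-offs are functions of squared lengths and hence C^1 also where the
   lengths vanish. *)
pose s1 := (s + t) / 2; pose r1 := (r + r') / 2.
have s1s : s < s1 by rewrite /s1; lra.
have s1t : s1 < t by rewrite /s1; lra.
have r1r : r < r1 by rewrite /r1; lra.
have r1r' : r1 < r' by rewrite /r1; lra.
pose d1 := (t ^+ 2 - s1 ^+ 2)^-1; pose d2 := (r1 ^+ 2 - r ^+ 2)^-1.
have D1 : 0 < t ^+ 2 - s1 ^+ 2 by nra.
have D2 : 0 < r1 ^+ 2 - r ^+ 2 by nra.
have d1p : 0 < d1 by rewrite invr_gt0.
have d2p : 0 < d2 by rewrite invr_gt0.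
pose f1 u := ramp (d1 * u + (- (d1 * s1 ^+ 2))).
pose f1' u := dramp (d1 * u + (- (d1 * s1 ^+ 2))) * d1.
pose f2 u := ramp (- d2 * u + d2 * r1 ^+ 2).
pose f2' u := dramp (- d2 * u + d2 * r1 ^+ 2) * (- d2).
pose Q := 1%:M - P.
have h1 : isC1 (fun y => f1 (sqd a Q 1 y)) (fun y => (f1' (sqd a Q 1 y) * (2 / 1 ^+ 2)) *: ((y - a) *m Q *m Q^T)).
  apply: isC1_comp_sqd; first exact/is_derive_affine/is_derive_ramp.
  exact/continuous_affine/continuous_dramp.
have h2 : isC1 (fun y => f2 (sqd a 1%:M 1 y)) (fun y => (f2' (sqd a 1%:M 1 y) * (2 / 1 ^+ 2)) *: ((y - a) *m 1%:M *m 1%:M^T)).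
  apply: isC1_comp_sqd; first exact/is_derive_affine/is_derive_ramp.
  exact/continuous_affine/continuous_dramp.
pose h y := f1 (sqd a Q 1 y) * f2 (sqd a 1%:M 1 y).
pose Gh y := f1 (sqd a Q 1 y) *: ((f2' (sqd a 1%:M 1 y) * (2 / 1 ^+ 2)) *: ((y - a) *m 1%:M *m 1%:M^T)) +
  f2 (sqd a 1%:M 1 y) *: ((f1' (sqd a Q 1 y) * (2 / 1 ^+ 2)) *: ((y - a) *m Q *m Q^T)).
have hC : isC1 h Gh by exact: isC1_mul h1 h2.
have QE : Q *m Q^T = Q.
  rewrite /Q linearB /= trmx1 (grass_tr gP) mulmxBr mulmx1 mulmxBl mul1mx (grass_idem gP).
  by rewrite subrr subr0.
have hE y : sqd a Q 1 y = height a P y ^+ 2 by rewrite sqd1E.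
have yE y : sqd a 1%:M 1 y = enorm (y - a) ^+ 2 by rewrite sqd1E mulmx1.
have low y : height a P y <= s1 -> f1 (sqd a Q 1 y) = 0 /\ f1' (sqd a Q 1 y) = 0.
  move=> ys; have le0 : d1 * sqd a Q 1 y + - (d1 * s1 ^+ 2) <= 0.
    rewrite hE subr_le0 ler_pM2l// lerXn2r ?nnegrE ?height_ge0//; lra.
  by rewrite /f1 /f1' ramp_eq0// dramp_eq0// mul0r.
have high y : t <= height a P y -> f1 (sqd a Q 1 y) = 1 /\ f1' (sqd a Q 1 y) = 0.
  move=> ys; have ge1 : 1 <= d1 * sqd a Q 1 y + - (d1 * s1 ^+ 2).
    rewrite hE -mulrBr /d1 mulrC ler_pdivlMr// mul1r lerD2r.
    by rewrite lerXn2r ?nnegrE ?height_ge0//; lra.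
  by rewrite /f1 /f1' ramp_eq1// dramp_eq0_ge1// mul0r.
have far y : r1 <= enorm (y - a) -> f2 (sqd a 1%:M 1 y) = 0 /\ f2' (sqd a 1%:M 1 y) = 0.
  move=> ys; have le0 : - d2 * sqd a 1%:M 1 y + d2 * r1 ^+ 2 <= 0.
    rewrite yE mulNr addrC subr_le0 ler_pM2l// lerXn2r ?nnegrE ?enorm_ge0//; lra.
  by rewrite /f2 /f2' ramp_eq0// dramp_eq0// mul0r.
have near_ y : enorm (y - a) <= r -> f2 (sqd a 1%:M 1 y) = 1 /\ f2' (sqd a 1%:M 1 y) = 0.
  move=> ys; have ge1 : 1 <= - d2 * sqd a 1%:M 1 y + d2 * r1 ^+ 2.
    rewrite yE mulNr addrC -mulrBr /d2 mulrC ler_pdivlMr// mul1r lerD2l lerN2.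
    by rewrite lerXn2r ?nnegrE ?enorm_ge0//; lra.
  by rewrite /f2 /f2' ramp_eq1// dramp_eq0_ge1// mul0r.
pose K := ecball a r1 `&` [set y | s1 <= height a P y].
have cK : compact K.
  apply: compact_closedI; first exact: compact_ecball.
  have -> : [set y | s1 <= height a P y] = height a P @^-1` [set u | s1 <= u] by [].
  by apply: closed_comp; [move=> y _; exact: continuous_height|exact: closed_ge].
have supp : C1_supp h Gh K.
  split=> // y nK; have [hs|hs] := leP s1 (height a P y).
    have [e1 e2] : f2 (sqd a 1%:M 1 y) = 0 /\ f2' (sqd a 1%:M 1 y) = 0.
      apply: far; rewrite leNgt; apply/negP => /ltW yr; exact: nK.
    by rewrite /h /Gh e1 e2 mul0r !scale0r mulr0 scaler0 addr0.
  have [e1 e2] := low y (ltW hs).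
  by rewrite /h /Gh e1 e2 !mul0r !scale0r scaler0 addr0.
have h01 y : 0 <= h y <= 1.
  rewrite /h; have := ramp_ge0 (d1 * sqd a Q 1 y + - (d1 * s1 ^+ 2)).
  have := ramp_le1 (d1 * sqd a Q 1 y + - (d1 * s1 ^+ 2)).
  have := ramp_ge0 (- d2 * sqd a 1%:M 1 y + d2 * r1 ^+ 2).
  have := ramp_le1 (- d2 * sqd a 1%:M 1 y + d2 * r1 ^+ 2).
  by rewrite -/(f1 _) -/(f2 _) => *; apply/andP; split; nra.
have KA : K `<=` A.
  move=> y [ya ys]; split; rewrite /ecball /eball /= in ya ys *; lra.
have AU : A `<=` ld_dom V by move=> y [/BU].
pose At := A `&` [set y | height a P y <= t].
have mA : measurable (A : set (eucl R k)) by exact: measurable_steep.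
have mAt : measurable (At : set (eucl R k)) by exact: measurable_low.
have bt := bborel_tilt gP.
have bI1 := bborel_indic_eucl mA; have bI2 := bborel_indic_eucl mAt.
(* For the height: [ramp] has slope at most 2, the squared height has gradient at most twice the
   height times the tilt, and [height / (t^2 - s1^2) <= 2 / (t - s)] up to level [t]. The product is
   [8 / (t - s)]. The distance cut-off is treated in the same way. *)
pose G0 (y : eucl R k) := 8 / (t - s) * (tilt P y * \1_At y) + 8 / (r' - r) * \1_A y.
have c1 : 0 < 8 / (t - s) by rewrite divr_gt0// subr_gt0.
have c2 : 0 < 8 / (r' - r) by rewrite divr_gt0// subr_gt0.
have i01 (B : set 'rV[R]_k) y : 0 <= (\1_B y : R) by rewrite indicE.
have bG1 : bborel (fun y : eucl R k => 8 / (t - s) * (tilt P y * \1_At y)).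
  by apply: bborelM; [exact: bborel_cst|exact: bborelM].
have bG2 : bborel (fun y : eucl R k => 8 / (r' - r) * \1_A y).
  by apply: bborelM; [exact: bborel_cst|].
have bG0 : bborel G0 by exact: bborelD.
have G00 y : 0 <= G0 y.
  have := tilt_ge0 P y; have := i01 At y; have := i01 A y; rewrite /G0.
  by move=> u1 u2 u3; exact: (addr_ge0 (mulr_ge0 (ltW c1) (mulr_ge0 u3 u2)) (mulr_ge0 (ltW c2) u1)).
have key y : enorm (Gh y *m T y) <= G0 y.
  have [Ky|nK] := pselect (K y); last first.
    have [_ _ hz] := supp; have [_ ->] := hz y nK.
    by rewrite mul0mx enorm0.
  have Ay := KA y Ky; have [ya ys] := Ky.
  rewrite /Gh -(mulmxA (y - a) Q Q^T) QE trmx1 !mulmx1 expr1n divr1 mulmxDl; apply: le_trans (ler_enormD _ _) _.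
  rewrite /G0 [leRHS]addrC; apply: lerD.
    have -> : \1_A y = 1 :> R by rewrite indicE mem_set.
    rewrite mulr1; apply: le_trans (grass_enorm _ (ls_grass VS y)) _.
    rewrite !enormZ.
    have a1 : `|f1 (sqd a Q 1 y)| <= 1.
      by rewrite ger0_norm ?ramp_le1 ?ramp_ge0.
    have a2 : `|f2' (sqd a 1%:M 1 y) * 2| <= 4 * d2.
      rewrite /f2' mulrAC normrM normrN (ger0_norm (ltW d2p)) ler_wpM2r ?(ltW d2p)//.
      rewrite ger0_norm ?mulr_ge0 ?dramp_ge0//.
      have := dramp_le2 (- d2 * sqd a 1%:M 1 y + d2 * r1 ^+ 2); lra.
    have a3 : d2 * enorm (y - a) <= 2 / (r' - r).
      have -> : d2 * enorm (y - a) = enorm (y - a) / (r1 ^+ 2 - r ^+ 2) by rewrite mulrC.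
      have e : 0 < r1 ^+ 2 - r ^+ 2 by nra.
      rewrite ler_pdivrMr// mulrAC ler_pdivlMr ?subr_gt0//.
      have : enorm (y - a) <= r1 := ya.
      have -> : r' = 2 * r1 - r by rewrite /r1; lra.
      have := enorm_ge0 (y - a); nra.
    have := enorm_ge0 (y - a); have := normr_ge0 (f1 (sqd a Q 1 y)).
    have := normr_ge0 (f2' (sqd a 1%:M 1 y) * 2).
    move: a1 a2 a3; move: (`|f1 _|) (`|f2' _ * 2|) (enorm (y - a)) => A1 A2 A3 a1 a2 a3 p1 p2 p3.
    have : A1 * (A2 * A3) <= 4 * d2 * A3.
      have : A2 * A3 <= 4 * d2 * A3 by rewrite ler_wpM2r.
      have : 0 <= A2 * A3 by rewrite mulr_ge0.
      nra.
    rewrite (_ : 8 / (r' - r) = 4 * (2 / (r' - r))); last by ring.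
    nra.
  have [hle|hgt] := leP (height a P y) t; last first.
    have [_ ->] := high y (ltW hgt).
    rewrite mul0r scale0r scaler0 mul0mx enorm0.
    exact: (mulr_ge0 (ltW c1) (mulr_ge0 (tilt_ge0 _ _) (i01 _ _))).
  have -> : \1_At y = 1 :> R by rewrite indicE mem_set.
  rewrite mulr1 -!scalemxAl !enormZ.
  have a1 : `|f2 (sqd a 1%:M 1 y)| <= 1.
    by rewrite ger0_norm ?ramp_le1 ?ramp_ge0.
  have a2 : `|f1' (sqd a Q 1 y) * 2| <= 4 * d1.
    rewrite /f1' mulrAC normrM (ger0_norm (ltW d1p)) ler_wpM2r ?(ltW d1p)//.
    rewrite ger0_norm ?mulr_ge0 ?dramp_ge0//.
    have := dramp_le2 (d1 * sqd a Q 1 y + - (d1 * s1 ^+ 2)); lra.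
  have a3 : d1 * height a P y <= 2 / (t - s).
    have -> : d1 * height a P y = height a P y / (t ^+ 2 - s1 ^+ 2) by rewrite mulrC.
    have e : 0 < t ^+ 2 - s1 ^+ 2 by nra.
    rewrite ler_pdivrMr// mulrAC ler_pdivlMr ?subr_gt0//.
    have -> : s = 2 * s1 - t by rewrite /s1; lra.
    have := height_ge0 a P y; nra.
  have a4 : enorm ((y - a) *m Q *m T y) <= tilt P y * height a P y.
    exact: grass_tilt_perp gP.
  have := normr_ge0 (f2 (sqd a 1%:M 1 y)).
  have := normr_ge0 (f1' (sqd a Q 1 y) * 2); have := enorm_ge0 ((y - a) *m Q *m T y).
  have := tilt_ge0 P y; have := height_ge0 a P y.
  move: a1 a2 a3 a4; move: (`|f2 _|) (`|f1' _ * 2|) (enorm _) (tilt P y) (height a P y).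
  move=> A1 A2 A3 A4 A5 a1 a2 a3 a4 p5 p4 p3 p2 p1.
  have : A1 * (A2 * A3) <= 4 * d1 * (A4 * A5).
    have : A2 * A3 <= 4 * d1 * (A4 * A5) by apply: ler_pM.
    have : 0 <= A2 * A3 by rewrite mulr_ge0.
    nra.
  have : 4 * d1 * (A4 * A5) <= 4 * (2 / (t - s)) * A4.
    have -> : 4 * d1 * (A4 * A5) = 4 * A4 * (d1 * A5) by ring.
    have -> : 4 * (2 / (t - s)) * A4 = 4 * A4 * (2 / (t - s)) by ring.
    by rewrite ler_wpM2l// mulr_ge0.
  rewrite (_ : 8 / (t - s) = 4 * (2 / (t - s))); last by ring.
  by move=> l1 l2; exact: le_trans l2 l1.
have oA : open A by exact: open_steep.
have := weak_sobolev VS supp h01 KA oA AU bG0 G00 key.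
rewrite /G0 expectD// !expectZ ?expect_indic//; last exact: bborelM.
have m1 : measurable ([set y | h y = 1] : set (eucl R k)).
  have ch := isC1_continuous hC; apply: closed_measurable_eucl.
  have -> : [set y | h y = 1] = h @^-1` [set 1] by [].
  by apply: closed_comp; [move=> y _; exact: ch|exact: closed_eq].
have le1 : m (steep a P r t) <= m [set y | h y = 1].
  apply: mass_le => //; first exact: measurable_steep.
  move=> y [ya yt]; have [e1 _] := high y (ltW yt); have [e2 _] := near_ y (ltW ya).
  by rewrite /= /h e1 e2 mulr1.
move=> /(le_trans le1)/le_trans; apply.
have EhA : E (h : eucl R k -> R) <= m A.
  rewrite -expect_indic//; apply: expect_le => //.
    apply: (@continuous_bborel _ _ _ 1); first exact: isC1_continuous hC.
    by move=> y; have /andP[? ?] := h01 y; rewrite ger0_norm.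
  move=> y; have /andP[_ hy1] := h01 y.
  have [Ky|nK] := pselect (K y); first by rewrite indicE mem_set//; exact: KA.
  by have [_ _ hz] := supp; have [-> _] := hz y nK.
apply: ler_wpM2r.
  apply: addr_ge0; last exact: (ls_var_ge0 VS).
  apply: addr_ge0; last exact: (mulr_ge0 (ltW c2) (mass_ge0 _ _)).
  apply: (mulr_ge0 (ltW c1)); apply: expect_ge0 => y.
  exact: (mulr_ge0 (tilt_ge0 _ _) (i01 _ _)).
rewrite ler_wpM2l ?(ltW (sobolev_const_gt0 _ (ls_w VS)))//.
apply: ge0_ler_powR; rewrite ?nnegrE ?mass_ge0 ?invr_ge0//.
by apply: expect_ge0 => y; have /andP[] := h01 y.
Qed.

End Levels.

(** * Small radii and De Giorgi's iteration *)

Section NearZero.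
Context {R : realType}.

Lemma near0P (Q : R -> Prop) :
  (\forall r \near 0^'+, Q r) <-> exists2 r0, 0 < r0 & forall r, 0 < r -> r < r0 -> Q r.
Proof.
split=> [[r0 /= r00 h]|[r0 r00 h]].
  exists r0 => // r rp rr; apply: h => //=.
  by rewrite sub0r normrN ger0_norm// ltW.
near=> r; apply: h; [by near: r; exact: nbhs_right_gt|by near: r; exact: nbhs_right_lt].
Unshelve. all: by end_near. Qed.

Lemma near0_scale (Q : R -> Prop) c : 0 < c ->
  (\forall r \near 0^'+, Q r) -> \forall r \near 0^'+, Q (c * r).
Proof.
move=> c0 /near0P[r0 r00 h]; apply/near0P; exists (r0 / c); first by rewrite divr_gt0.
move=> r rp; rewrite ltr_pdivlMr// => rl; apply: h; first by rewrite mulr_gt0.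
by rewrite mulrC.
Qed.

(** For [rho = B^(-1/b)] one has [rho^b = 1/B], so along a sequence decaying like [rho^k] the growth
    [B^k] is cancelled exactly. The nonlinear and the linear coefficient may each take half of
    [rho]; the linear one accommodates the variation if [p = n]. *)
Lemma de_giorgi (C B b kap : R) (d : nat -> R) : 1 < B -> 0 < b -> 0 <= C -> 0 <= kap ->
  (forall k, 0 <= d k) ->
  (forall k, d k.+1 <= (C * B ^+ k * d k `^ b + kap) * d k) ->
  C * d 0%N `^ b <= B `^ (- b^-1) / 2 -> kap <= B `^ (- b^-1) / 2 ->
  forall e, 0 < e -> exists k, d k < e.
Proof.
move=> B1 b0 C0 kap0 d0 hd small1 small2 e e0.
set rho := B `^ (- b^-1) in small1 small2.
have B0 : 0 < B := lt_trans ltr01 B1.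
have r0 : 0 < rho by exact: powR_gt0.
have r1 : rho < 1.
  rewrite /rho powRN invf_lt1 ?powR_gt0//.
  have := @gt0_ltr_powR R b^-1; rewrite invr_gt0 => /(_ b0 1 B).
  by rewrite !nnegrE powR1 ler01 (ltW B0) B1; apply.
have rb : rho `^ b = B^-1 by rewrite -powRrM mulNr mulVf ?gt_eqF// powR_inv1 ?ltW.
have hk k : d k <= d 0%N * rho ^+ k.
  elim: k => [|k IH]; first by rewrite expr0 mulr1.
  apply: le_trans (hd k) _.
  have h1 : d k `^ b <= d 0%N `^ b * (B ^+ k)^-1.
    apply: (@le_trans _ _ ((d 0%N * rho ^+ k) `^ b)).
      by apply: ge0_ler_powR; rewrite ?nnegrE ?(ltW b0)// mulr_ge0// exprn_ge0// ltW.
    have -> : (B ^+ k)^-1 = (rho ^+ k) `^ b.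
      rewrite -(powR_mulrn k (ltW r0)) -powRrM (mulrC k%:R) powRrM rb.
      by rewrite powR_mulrn ?invr_ge0 ?(ltW B0)// exprVn.
    by rewrite powRM// exprn_ge0// ltW.
  have h2 : C * B ^+ k * d k `^ b <= C * d 0%N `^ b.
    apply: (@le_trans _ _ (C * B ^+ k * (d 0%N `^ b * (B ^+ k)^-1))).
      by rewrite ler_wpM2l// mulr_ge0// exprn_ge0// ltW.
    by rewrite le_eqVlt; apply/orP; left; apply/eqP; field; rewrite gt_eqF// exprn_gt0.
  have h3 : C * B ^+ k * d k `^ b + kap <= rho by lra.
  apply: (@le_trans _ _ (rho * d k)); first by rewrite ler_wpM2r.
  by rewrite exprS mulrCA ler_wpM2l// ltW.
have [d00|d0p] := leP (d 0%N) 0; first by exists 0%N; exact: le_lt_trans e0.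
have /cvgrPdist_lt/(_ (e / d 0%N)) : rho ^+ k @[k --> \oo] --> (0 : R).
  by apply: cvg_expr; rewrite ger0_norm// ltW.
have ed : 0 < e / d 0%N by rewrite divr_gt0.
move=> /(_ ed) [N _ hN]; exists N; apply: le_lt_trans (hk N) _.
have := hN N (leqnn N); rewrite /= sub0r normrN ger0_norm ?exprn_ge0 ?(ltW r0)//.
by rewrite ltr_pdivlMr// mulrC.
Qed.

End NearZero.

(** [lam] is the total variation if [p = 1] and the integral of [|H|^p] if [p > 1], and [ps_var] is
    Hoelder's inequality. The bound [L] in [ps_lam] is specific to the varifold, unlike [M], which
    will be a multiple of [Q]. *)
Record point_spec (R : realType) (k n : nat) (V : local_data R k) (p M : R)
    (lam : set 'rV[R]_k -> R) (a : 'rV[R]_k) (P : 'M[R]_k) : Prop := PointSpec {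
  ps_grass : grassmannian n P ;
  ps_p : 1 <= p ;
  ps_M : 0 <= M ;
  ps_dom : \forall r \near 0^'+, eball a r `<=` ld_dom V ;
  ps_mass : \forall r \near 0^'+, mass (ld_mu V) (eball a r) <= M * r ^+ n ;
  ps_lam_ge0 : forall O, 0 <= lam O ;
  ps_lam_mono : forall O O', open O -> open O' -> O `<=` O' -> O' `<=` ld_dom V -> lam O <= lam O' ;
  ps_var : forall O, open O -> O `<=` ld_dom V ->
    ld_var V O <= lam O `^ p^-1 * mass (ld_mu V) O `^ (1 - p^-1) ;
  ps_lam : exists2 L, 0 <= L & \forall r \near 0^'+, lam (eball a r) <= L * r ^+ n ;
  ps_flat : forall eps eta : R, 0 < eps -> 0 < eta ->
    \forall r \near 0^'+, mass (ld_mu V) (steep a P r (eps * r)) <= eta * r ^+ n ;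
  ps_lam_flat : forall eps eta : R, 0 < eps -> 0 < eta ->
    \forall r \near 0^'+, lam (steep a P r (eps * r)) <= eta * r ^+ n }.

(** * Mass far from the tangent plane at a flat point *)

Section FlatPoint.
Context {R : realType} {k n : nat} {w : R} {V : local_data R k}.
Hypothesis VS : local_spec n w V.
Context {p M : R} {lam : set 'rV[R]_k -> R} {a : 'rV[R]_k} {P : 'M[R]_k}.
Hypothesis PS : point_spec n V p M lam a P.
Local Notation nu := (ld_mu V).
Local Notation T := (ld_plane V).
Local Notation v := (ld_var V).
Local Notation E := (expect nu).
Local Notation m := (mass nu).

Let n0 : (0 < n)%N := ls_n VS.
Let cs := sobolev_const n w.
Let cs0 : 0 < cs := sobolev_const_gt0 n (ls_w VS).

Lemma invp_bounds : 0 < p^-1 <= 1.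
Proof.
have p1 := ps_p PS; have p0 : 0 < p := lt_le_trans ltr01 p1.
by rewrite invr_gt0 p0 invf_le1.
Qed.

Lemma var_le (O : set 'rV[R]_k) x y : open O -> O `<=` ld_dom V ->
  lam O <= x -> m O <= y -> v O <= x `^ p^-1 * y `^ (1 - p^-1).
Proof.
move=> oO OU hx hy; have /andP[p0 p1] := invp_bounds.
apply: le_trans (ps_var PS oO OU) _; apply: ler_pM; rewrite ?powR_ge0//.
  by apply: ge0_ler_powR; rewrite ?nnegrE ?(ps_lam_ge0 PS) ?(ltW p0)//;
    exact: le_trans (ps_lam_ge0 PS O) hx.
by apply: ge0_ler_powR; rewrite ?nnegrE ?mass_ge0 ?subr_ge0//;
    exact: le_trans (mass_ge0 nu O) hy.
Qed.

Lemma powR_conj (x : R) : 0 <= x -> x `^ p^-1 * x `^ (1 - p^-1) = x.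
Proof.
move=> x0; have [->|xN] := eqVneq x 0.
  have /andP[p0 p1] := invp_bounds; rewrite powR0 ?gt_eqF// mul0r//.
by rewrite -powRD ?xN ?implybT// subrKC powRr1.
Qed.

Lemma steep_eball r s : steep a P r s `<=` eball a r.
Proof. by move=> y []. Qed.

Lemma near_var_ball : exists2 L, 0 <= L & \forall r \near 0^'+, v (eball a r) <= L * r ^+ n.
Proof.
have [L L0 hL] := ps_lam PS; pose L' := L + M; have M0 := ps_M PS.
exists L'; first exact: addr_ge0; near=> r.
have r0 : 0 < r by near: r; exact: nbhs_right_gt.
have rn : 0 <= r ^+ n by rewrite exprn_ge0// ltW.
have dom : eball a r `<=` ld_dom V by near: r; exact: ps_dom PS.
have h1 : lam (eball a r) <= L' * r ^+ n.
  apply: (@le_trans _ _ (L * r ^+ n)); first by near: r.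
  by rewrite ler_wpM2r// /L' lerDl.
have h2 : m (eball a r) <= L' * r ^+ n.
  apply: (@le_trans _ _ (M * r ^+ n)); first by near: r; exact: ps_mass PS.
  by rewrite ler_wpM2r// /L' lerDr.
rewrite -[leRHS]powR_conj; last by rewrite mulr_ge0// addr_ge0.
exact: (var_le (@open_eball R k a r) dom h1 h2).
Unshelve. all: by end_near. Qed.

Lemma near_var_flat (eps eta : R) : 0 < eps -> 0 < eta ->
  \forall r \near 0^'+, v (steep a P r (eps * r)) <= eta * r ^+ n.
Proof.
move=> eps0 eta0.
have h1 := ps_lam_flat PS eps0 eta0; have h2 := ps_flat PS eps0 eta0.
near=> r.
have r0 : 0 < r by near: r; exact: nbhs_right_gt.
have dom : eball a r `<=` ld_dom V by near: r; exact: ps_dom PS.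
rewrite -[leRHS]powR_conj; last by rewrite mulr_ge0 ?exprn_ge0// ltW.
apply: var_le; first exact: open_steep.
- by move=> y /steep_eball/dom.
- by near: r; exact: h1.
- by near: r; exact: h2.
Unshelve. all: by end_near. Qed.

(** As long as a level set has mass above [eta r^(n+1)], its variation, which is at most [eta r^n]
    by flatness, is below [1/r] times its mass and thus scales like the other terms. De Giorgi's
    iteration with the trivial bound of the tilt then drives the masses to 0. Either way the final
    set, contained in all level sets, satisfies the bound. *)
Lemma steep_decay (eps eta : R) : 0 < eps -> 0 < eta ->
  \forall r \near 0^'+, m (steep a P r (eps * r)) <= eta * r ^+ n.+1.
Proof.
move=> eps0 eta0; have gP := ps_grass PS.
have nV : 0 < (n%:R^-1 : R) by rewrite invr_gt0 ltr0n.
(* With the level differences [eps r / (4 * 2^i)] and radius differences [r / (2 * 2^i)] below,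
   [8 * 4 * 2 n / eps] comes from the tilt, 16 from the radial cut-off and 1 from the variation. *)
pose C := cs * (64 * n%:R / eps + 17).
have C0 : 0 < C by rewrite mulr_gt0// ltr_wpDl// divr_ge0 ?mulr_ge0// ltW.
have rho0 : 0 < (2 : R) `^ (- n%:R^-1^-1) by exact: powR_gt0.
(* The solution of [C q^(1/n) = 2^(-n) / 2], the smallness condition of [de_giorgi] for [B = 2] and
   [b = 1/n]. *)
pose q := ((2 : R) `^ (- n%:R^-1^-1) / 2 / C) `^ n%:R.
have q0 : 0 < q by rewrite powR_gt0 ?divr_gt0.
have p2 : 0 < (2 : R) ^+ n by rewrite exprn_gt0.
have e4 : 0 < eps / 4 by rewrite divr_gt0.
have q1 : 0 < q / 2 ^+ n by rewrite divr_gt0.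
have eta1 : 0 < eta / 2 ^+ n by rewrite divr_gt0.
have h0 : 0 <= (2^-1 : R) by rewrite invr_ge0.
have h1 : (2^-1 : R) <= 1 by rewrite invf_le1// ler1n.
have two0 : 0 < (2 : R) by [].
have near_dom := near0_scale two0 (ps_dom PS).
have near_flat := near0_scale two0 (ps_flat PS e4 q1).
have near_var := near0_scale two0 (near_var_flat e4 eta1).
near=> r.
have r0 : 0 < r by near: r; exact: nbhs_right_gt.
have rn : 0 < r ^+ n by rewrite exprn_gt0.
(* Radii decrease from [2 r] to [r] and levels increase from [eps r / 2] to [eps r]. In terms of the
   radius [2 r] the first level is [eps / 4] times the radius, which is where flatness is
   applied. *)
pose rk i := r * (1 + 2^-1 ^+ i); pose tk i := eps * r * (1 - 2^-1 ^+ i.+1).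
pose A i := steep a P (rk i) (tk i).
have hp i : 0 < (2^-1 : R) ^+ i by rewrite exprn_gt0// invr_gt0.
have hp1 i : (2^-1 : R) ^+ i <= 1 by exact: exprn_ile1.
have hpS i : (2^-1 : R) ^+ i.+1 = 2^-1 * 2^-1 ^+ i by rewrite exprS.
have hpK i : (2 : R) ^+ i * 2^-1 ^+ i = 1 by rewrite -exprMn divff// expr1n.
have er : 0 < eps * r by rewrite mulr_gt0.
have A0 i : A i `<=` steep a P (2 * r) (eps / 4 * (2 * r)).
  apply: steep_sub; first by rewrite /rk (mulrC 2) ler_pM2l//; have := hp1 i; lra.
  by rewrite /tk hpS; have := hp1 i; nra.
have Alast i : steep a P r (eps * r) `<=` A i.
  apply: steep_sub; first by rewrite /rk ler_peMr ?(ltW r0)// lerDl ltW.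
  by rewrite /tk ler_piMr ?(ltW er)// gerBl ltW.
have dom2 : eball a (2 * r) `<=` ld_dom V.
  by near: r.
have flat2 : m (steep a P (2 * r) (eps / 4 * (2 * r))) <= q / 2 ^+ n * (2 * r) ^+ n.
  by near: r.
have var2 : v (steep a P (2 * r) (eps / 4 * (2 * r))) <= eta / 2 ^+ n * (2 * r) ^+ n.
  by near: r.
have varA i : v (A i) <= eta * r ^+ n.
  have -> : eta * r ^+ n = eta / 2 ^+ n * (2 * r) ^+ n.
    by rewrite exprMn; field; rewrite gt_eqF.
  apply: le_trans var2; apply: (ls_var_mono VS); [exact: open_steep|exact: open_steep|exact: A0|].
  by move=> y /steep_eball/dom2.
have massA i j : (i <= j)%N -> m (A j) <= m (A i).
  move=> ij; apply: mass_le; try exact: measurable_steep.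
  apply: steep_sub.
    by rewrite /rk ler_pM2l// lerD2l; exact: ler_wiXn2l.
  by rewrite /tk ler_pM2l// lerD2l lerN2; apply: ler_wiXn2l.
rewrite exprS mulrCA.
have [[i hi]|hbig] := pselect (exists i, m (A i) <= r * (eta * r ^+ n)).
  apply: le_trans hi; apply: mass_le; try exact: measurable_steep.
  exact: Alast.
have big i : r * (eta * r ^+ n) < m (A i).
  by rewrite ltNge; apply/negP => h; apply: hbig; exists i.
pose d i := m (A i) / r ^+ n.
have d_ge0 i : 0 <= d i by rewrite divr_ge0 ?mass_ge0 ?ltW.
have mE i : m (A i) = d i * r ^+ n by rewrite /d divfK// gt_eqF.
have dn i : m (A i) `^ n%:R^-1 = d i `^ n%:R^-1 * r.
  rewrite mE powRM ?(ltW rn)// -powR_mulrn ?(ltW r0)// -powRrM divff ?powRr1 ?(ltW r0)//.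
  by rewrite pnatr_eq0 -lt0n.
have step i : d i.+1 <= (C * 2 ^+ i * d i `^ n%:R^-1 + 0) * d i.
  rewrite addr0.
  have rr : rk i.+1 < rk i by rewrite /rk ltr_pM2l// ltrD2l hpS; have := hp i; lra.
  have tt : tk i < tk i.+1 by rewrite /tk ltr_pM2l// ltrD2l ltrN2 !hpS; have := hp i; lra.
  have rk0 : 0 < rk i.+1 by rewrite mulr_gt0// addr_gt0.
  have tk0 : 0 <= tk i by rewrite mulr_ge0 ?subr_ge0// ltW.
  have domA : eball a (rk i) `<=` ld_dom V.
    apply: subset_trans dom2; move=> y; rewrite /eball /= => /lt_le_trans; apply.
    by rewrite /rk (mulrC 2) ler_pM2l//; have := hp1 i; lra.
  have := level_estimate VS gP rk0 rr tk0 tt domA.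
  rewrite -/(A i) -/(A i.+1) => hlev.
  have tiltE : E (fun y => tilt (V := V) P y * \1_(A i `&` [set y | height a P y <= tk i.+1]) y) <=
      2 * n%:R * m (A i).
    apply: expect_indic_le; last 1 first.
    - move=> y; have := grass_tilt_le n0 gP (ls_grass VS y); rewrite -/(tilt P y) => ht.
      have t0 := tilt_ge0 (V := V) P y; rewrite !indicE.
      have [/set_mem[yA _]|_] := boolP (y \in _ `&` _); first by rewrite (mem_set yA) !mulr1.
      by rewrite mulr0 mulr_ge0 ?mulr_ge0.
    - apply: bborelM; first exact: (bborel_tilt VS gP).
      by apply: bborel_indic_eucl; exact: measurable_low.
    - exact: measurable_steep.
  have tE : tk i.+1 - tk i = eps * r * 2^-1 ^+ i / 4 by rewrite /tk !hpS; field.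
  have rE : rk i - rk i.+1 = r * 2^-1 ^+ i / 2 by rewrite /rk !hpS; field.
  have key : 8 / (tk i.+1 - tk i) * E (fun y => tilt (V := V) P y * \1_(A i `&` [set y | height a P y <= tk i.+1]) y) +
     8 / (rk i - rk i.+1) * m (A i) + v (A i) <= (64 * n%:R / eps + 17) * 2 ^+ i / r * m (A i).
    have k1 : 8 / (tk i.+1 - tk i) * E (fun y => tilt (V := V) P y * \1_(A i `&` [set y | height a P y <= tk i.+1]) y)
        <= 64 * n%:R / eps * 2 ^+ i / r * m (A i).
      apply: (@le_trans _ _ (8 / (tk i.+1 - tk i) * (2 * n%:R * m (A i)))).
        by rewrite ler_wpM2l// divr_ge0// subr_ge0 ltW.
      rewrite le_eqVlt tE; apply/orP; left; apply/eqP.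
      have -> : (2 : R) ^+ i = (2^-1 ^+ i)^-1 by rewrite exprVn invrK.
      by field; rewrite !gt_eqF ?exprn_gt0.
    have k2 : 8 / (rk i - rk i.+1) * m (A i) = 16 * 2 ^+ i / r * m (A i).
      rewrite rE; have -> : (2 : R) ^+ i = (2^-1 ^+ i)^-1 by rewrite exprVn invrK.
      by field; rewrite !gt_eqF ?exprn_gt0.
    have k3 : v (A i) <= 2 ^+ i / r * m (A i).
      have hv : v (A i) <= m (A i) / r.
        by rewrite ler_pdivlMr//; have := big i; have := varA i; nra.
      apply: le_trans hv _; rewrite [leLHS]mulrC; apply: ler_wpM2r; rewrite ?mass_ge0//.
      by rewrite ler_peMl ?invr_ge0 ?(ltW r0)// exprn_ege1// ler1n.
    by rewrite k2; lra.
  rewrite /d ler_pdivrMr//; apply: le_trans hlev _.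
  apply: (@le_trans _ _ (cs * m (A i) `^ n%:R^-1 * ((64 * n%:R / eps + 17) * 2 ^+ i / r * m (A i)))).
    by rewrite ler_wpM2l// mulr_ge0 ?powR_ge0// ltW.
  rewrite le_eqVlt dn; apply/orP; left; apply/eqP.
  by rewrite -/(d i) [m (A i)]mE /C; field; rewrite !gt_eqF.
have d0small : C * d 0%N `^ n%:R^-1 <= 2 `^ (- n%:R^-1^-1) / 2.
  have hq : d 0%N <= q.
    rewrite /d ler_pdivrMr//.
    have hle : m (A 0%N) <= m (steep a P (2 * r) (eps / 4 * (2 * r))).
      by apply: mass_le; [exact: measurable_steep|exact: measurable_steep|exact: A0].
    apply: le_trans hle _; by apply: le_trans flat2 _; rewrite exprMn mulrA divfK// gt_eqF.
  have hq2 : d 0%N `^ n%:R^-1 <= 2 `^ (- n%:R^-1^-1) / 2 / C.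
    apply: (@le_trans _ _ (q `^ n%:R^-1)).
      by apply: ge0_ler_powR; rewrite ?nnegrE ?(ltW nV) ?(ltW q0).
    rewrite /q -powRrM divff ?pnatr_eq0 -?lt0n// powRr1//.
    by rewrite !divr_ge0 ?(ltW C0) ?(ltW rho0).
  by rewrite mulrC -ler_pdivlMr.
have B1 : 1 < (2 : R) by rewrite ltr1n.
have k0 : 0 <= (2 : R) `^ (- n%:R^-1^-1) / 2 by rewrite divr_ge0 ?(ltW rho0).
have [h|h] := leP (m (steep a P r (eps * r))) 0.
  by apply: le_trans h _; rewrite !mulr_ge0 ?(ltW r0) ?(ltW eta0) ?(ltW rn).
have [i hi] := de_giorgi B1 nV (ltW C0) (lexx 0) d_ge0 step d0small k0 (divr_gt0 h rn).
exfalso; move: hi; rewrite /d ltNge => /negP; apply.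
rewrite ler_pM2r ?invr_gt0//; apply: mass_le; try exact: measurable_steep.
exact: Alast.
Unshelve. all: by end_near. Qed.

End FlatPoint.

(* [rootnorm kap (h ^+ 2)] is a C^1 substitute for [h], with error at most [kap]. *)
Section SmoothHeight.
Context {R : realType}.
Implicit Types (kap b u h : R).

Definition quart kap u : R := Num.sqrt (Num.sqrt (u ^+ 2 + kap ^+ 4)).
Definition rootnorm kap u : R := quart kap u - kap.
Definition drootnorm kap u : R := u * (2 * quart kap u ^+ 3)^-1.

Lemma quart_gt0 kap u : 0 < kap -> 0 < quart kap u.
Proof.
move=> k0; have k4 : 0 < kap ^+ 4 by exact: exprn_gt0.
by rewrite !sqrtr_gt0 ltr_wpDl// sqr_ge0.
Qed.

Lemma quart_exp4 kap u : 0 < kap -> quart kap u ^+ 4 = u ^+ 2 + kap ^+ 4.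
Proof.
move=> k0; have k4 : 0 < kap ^+ 4 by exact: exprn_gt0.
rewrite (_ : 4 = 2 * 2)%N// exprM sqr_sqrtr ?sqrtr_ge0// sqr_sqrtr//.
by rewrite addr_ge0 ?sqr_ge0 ?(ltW k4).
Qed.

Lemma is_derive_rootnorm kap u : 0 < kap -> is_derive u (1 : R) (rootnorm kap) (drootnorm kap u).
Proof.
move=> k0; have k4 : 0 < kap ^+ 4 by exact: exprn_gt0.
have w0 : 0 < u ^+ 2 + kap ^+ 4 by rewrite ltr_wpDl// sqr_ge0.
have d1 : is_derive u (1 : R) (fun u => u ^+ 2 + kap ^+ 4) (2 * u).
  apply: (@is_derive_quadratic _ _ _ 1) => t.
  by rewrite (_ : _ - _ - _ = t ^+ 2) ?mul1r ?ger0_norm ?sqr_ge0//; ring.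
have d2 := @is_derive1_comp R Num.sqrt (fun u => u ^+ 2 + kap ^+ 4) u _ _ (is_derive1_sqrt w0) d1.
have v0 : 0 < Num.sqrt (u ^+ 2 + kap ^+ 4) by rewrite sqrtr_gt0.
have d3 := @is_derive1_comp R Num.sqrt (fun u => Num.sqrt (u ^+ 2 + kap ^+ 4)) u _ _ (is_derive1_sqrt v0) d2.
have d4 := is_deriveB d3 (is_derive_cst kap u (1 : R)).
refine (is_derive_eq d4 _); rewrite subr0 /drootnorm -/(quart kap u).
have q0 := quart_gt0 u k0.
have -> : Num.sqrt (u ^+ 2 + kap ^+ 4) = quart kap u ^+ 2.
  by rewrite sqr_sqrtr// sqrtr_ge0.
by field; rewrite gt_eqF.
Qed.

Lemma continuous_drootnorm kap : 0 < kap -> continuous (drootnorm kap).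
Proof.
move=> k0 u; apply: cvgM; first exact: cvg_id.
apply: cvgV; first by rewrite gt_eqF// mulr_gt0// exprn_gt0// quart_gt0.
apply: cvgM; first exact: cvg_cst.
apply: (@continuous_comp _ _ _ (quart kap) (fun t : R => t ^+ 3)); last exact: exprn_continuous.
apply: (@continuous_comp _ _ _ (fun u : R => Num.sqrt (u ^+ 2 + kap ^+ 4)) Num.sqrt); last exact: sqrt_continuous.
apply: (@continuous_comp _ _ _ (fun u : R => u ^+ 2 + kap ^+ 4) Num.sqrt); last exact: sqrt_continuous.
by apply: cvgD; [exact: exprn_continuous|exact: cvg_cst].
Qed.

Lemma quart_bounds kap h : 0 < kap -> 0 <= h ->
  [/\ h <= quart kap (h ^+ 2), kap <= quart kap (h ^+ 2) & quart kap (h ^+ 2) <= h + kap].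
Proof.
move=> k0 h0; have q0 := quart_gt0 (h ^+ 2) k0; have qE := quart_exp4 (h ^+ 2) k0.
have le4 (x y : R) : 0 <= x -> 0 <= y -> x ^+ 4 <= y ^+ 4 -> x <= y.
  by move=> x0 y0; rewrite ler_pXn2r// nnegrE.
have hE : (h ^+ 2) ^+ 2 = h ^+ 4 by rewrite -exprM.
split; apply: le4; rewrite ?(ltW q0) ?(ltW k0)// ?qE ?hE.
- by rewrite lerDl exprn_ge0// ltW.
- by rewrite lerDr exprn_ge0.
- by rewrite addr_ge0// ltW.
have e : (h + kap) ^+ 4 = h ^+ 4 + kap ^+ 4 + (4 * h ^+ 3 * kap + 6 * h ^+ 2 * kap ^+ 2 + 4 * h * kap ^+ 3).
  by ring.
by rewrite e lerDl !addr_ge0// !mulr_ge0// ?exprn_ge0// ltW.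
Qed.

Lemma drootnorm_le kap h : 0 < kap -> 0 <= h -> `|drootnorm kap (h ^+ 2)| * (2 * h) <= 1.
Proof.
move=> k0 h0; have [hq _ _] := quart_bounds k0 h0; have q0 := quart_gt0 (h ^+ 2) k0.
rewrite /drootnorm ger0_norm; last by rewrite mulr_ge0 ?sqr_ge0// invr_ge0 mulr_ge0// exprn_ge0// ltW.
have -> : h ^+ 2 / (2 * quart kap (h ^+ 2) ^+ 3) * (2 * h) = (h / quart kap (h ^+ 2)) ^+ 3.
  by field; rewrite gt_eqF.
have r0 : 0 <= h / quart kap (h ^+ 2) by rewrite divr_ge0// ltW.
have r1 : h / quart kap (h ^+ 2) <= 1 by rewrite ler_pdivrMr// mul1r.
exact: exprn_ile1.
Qed.

(** The truncation gives the cylindrical test function compact support and keeps the smoothed height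
    below [b = eps r], so that the variation enters with the small factor [eps]. *)
Definition low_cut b u : R := ramp (- (2 / b ^+ 2) * u + 2).
Definition dlow_cut b u : R := dramp (- (2 / b ^+ 2) * u + 2) * (- (2 / b ^+ 2)).
Definition smooth_height kap b u : R := low_cut b u * rootnorm kap u.
Definition dsmooth_height kap b u : R := low_cut b u * drootnorm kap u + rootnorm kap u * dlow_cut b u.

Lemma is_derive_smooth_height kap b u : 0 < kap ->
  is_derive u (1 : R) (smooth_height kap b) (dsmooth_height kap b u).
Proof.
move=> k0; have d1 := is_derive_rootnorm u k0.
have d2 := is_derive_affine (- (2 / b ^+ 2)) 2 (@is_derive_ramp R) u.
by refine (is_derive_eq (is_deriveM d2 d1) _).
Qed.

Lemma continuous_dsmooth_height kap b : 0 < kap -> continuous (dsmooth_height kap b).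
Proof.
move=> k0; apply: fun_continuousD; apply: fun_continuousM.
- move=> u; apply: differentiable_continuous; apply/derivable1_diffP.
  by case: (is_derive_affine (- (2 / b ^+ 2)) 2 (@is_derive_ramp R) u).
- exact: continuous_drootnorm.
- move=> u; apply: differentiable_continuous; apply/derivable1_diffP.
  by case: (is_derive_rootnorm u k0).
- exact/continuous_affine/continuous_dramp.
Qed.

Lemma low_cut_bounds b u : 0 <= low_cut b u <= 1.
Proof. by rewrite /low_cut ramp_ge0 ramp_le1. Qed.

Lemma low_cut0 b h : 0 < b -> b <= h -> low_cut b (h ^+ 2) = 0 /\ dlow_cut b (h ^+ 2) = 0.
Proof.
move=> b0 bh; have b2 : 0 < b ^+ 2 by exact: exprn_gt0.
have le0 : - (2 / b ^+ 2) * h ^+ 2 + 2 <= 0.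
  have e : 1 <= h ^+ 2 / b ^+ 2 by rewrite ler_pdivlMr// mul1r; nra.
  have -> : - (2 / b ^+ 2) * h ^+ 2 + 2 = 2 - 2 * (h ^+ 2 / b ^+ 2) by ring.
  lra.
by rewrite /low_cut /dlow_cut ramp_eq0// dramp_eq0// mul0r.
Qed.

Lemma low_cut1 b h : 0 < b -> 0 <= h -> 2 * h <= b -> low_cut b (h ^+ 2) = 1.
Proof.
move=> b0 h0 hb; have b2 : 0 < b ^+ 2 by exact: exprn_gt0.
apply: ramp_eq1; have e : h ^+ 2 / b ^+ 2 <= 2^-1 by rewrite ler_pdivrMr//; nra.
have -> : - (2 / b ^+ 2) * h ^+ 2 + 2 = 2 - 2 * (h ^+ 2 / b ^+ 2) by ring.
lra.
Qed.

Lemma rootnorm_bounds kap h : 0 < kap -> 0 <= h ->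
  h - kap <= rootnorm kap (h ^+ 2) /\ 0 <= rootnorm kap (h ^+ 2) <= h.
Proof.
by move=> k0 h0; have [? ? ?] := quart_bounds k0 h0; rewrite /rootnorm; split; [lra|apply/andP; split; lra].
Qed.

Lemma smooth_height_bounds kap b h : 0 < kap -> 0 < b -> 0 <= h ->
  0 <= smooth_height kap b (h ^+ 2) <= h.
Proof.
move=> k0 b0 h0; have [_ /andP[r0 r1]] := rootnorm_bounds k0 h0.
have /andP[c0 c1] := low_cut_bounds b (h ^+ 2).
by rewrite /smooth_height mulr_ge0//=; nra.
Qed.

Lemma smooth_height0 kap b h : 0 < b -> b <= h ->
  smooth_height kap b (h ^+ 2) = 0 /\ dsmooth_height kap b (h ^+ 2) = 0.
Proof.
by move=> b0 bh; rewrite /smooth_height /dsmooth_height; have [-> ->] := low_cut0 b0 bh;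
  rewrite !mul0r mulr0 addr0.
Qed.

Lemma smooth_height_le kap b h : 0 < kap -> 0 < b -> 0 <= h -> smooth_height kap b (h ^+ 2) <= b.
Proof.
move=> k0 b0 h0; have [bh|hb] := leP b h; first by have [-> _] := smooth_height0 kap b0 bh; exact: ltW.
by have /andP[_ /le_trans] := smooth_height_bounds k0 b0 h0; apply; exact: ltW.
Qed.

Lemma smooth_height_ge kap b h : 0 < kap -> 0 < b -> 0 <= h -> 2 * h <= b ->
  h - kap <= smooth_height kap b (h ^+ 2).
Proof.
by move=> k0 b0 h0 hb; rewrite /smooth_height low_cut1// mul1r; have [] := rootnorm_bounds k0 h0.
Qed.

(** As a function of the height [h] the derivative is at most 1 from [rootnorm] plus
    [h * (4 / b^2) * 2 h <= 8] from the truncation, which acts only for [h < b]. *)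
Lemma dsmooth_height_le kap b h : 0 < kap -> 0 < b -> 0 <= h ->
  `|dsmooth_height kap b (h ^+ 2)| * (2 * h) <= 9.
Proof.
move=> k0 b0 h0; have [bh|hb] := leP b h.
  by have [_ ->] := smooth_height0 kap b0 bh; rewrite normr0 mul0r.
have [_ /andP[r0 r1]] := rootnorm_bounds k0 h0.
have /andP[c0 c1] := low_cut_bounds b (h ^+ 2).
have d1 := drootnorm_le k0 h0; have b2 : 0 < b ^+ 2 by exact: exprn_gt0.
have d2 : `|dlow_cut b (h ^+ 2)| <= 4 / b ^+ 2.
  rewrite /dlow_cut normrM normrN (ger0_norm (dramp_ge0 _)) ger0_norm; last by rewrite divr_ge0// ltW.
  rewrite (_ : 4 / b ^+ 2 = 2 * (2 / b ^+ 2)); last by ring.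
  by rewrite ler_wpM2r ?dramp_le2// divr_ge0// ltW.
have h2 : 0 <= 2 * h by rewrite mulr_ge0.
apply: (@le_trans _ _ ((`|drootnorm kap (h ^+ 2)| + h * (4 / b ^+ 2)) * (2 * h))).
  rewrite ler_wpM2r//; apply: le_trans (ler_normD _ _) _.
  rewrite (normrM (low_cut _ _)) (normrM (rootnorm _ _)) (ger0_norm c0) (ger0_norm r0); apply: lerD; first by rewrite ler_piMl.
  by apply: ler_pM.
rewrite mulrDl; have : h * (4 / b ^+ 2) * (2 * h) <= 8.
  have -> : h * (4 / b ^+ 2) * (2 * h) = 8 * (h ^+ 2 / b ^+ 2) by ring.
  have : h ^+ 2 / b ^+ 2 <= 1 by rewrite ler_pdivrMr// mul1r; nra.
  lra.
lra.
Qed.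

End SmoothHeight.

Lemma pow2_gt (R : realType) (x : R) : exists j, x < 2 ^+ j.
Proof.
exists (Num.truncn x).+1; apply: lt_le_trans (truncnS_gt x) _.
by rewrite -natrX ler_nat; exact/ltnW/ltn_expl.
Qed.

Section TiltAlgebra.
Context {R : realType} {k n : nat}.
Implicit Types (P T : 'M[R]_k) (z : 'rV[R]_k).

Lemma tilt_trace P T : grassmannian n P -> grassmannian n T ->
  \tr (T *m P) = n%:R - hsnorm (T - P) ^+ 2 / 2.
Proof.
move=> gP gT; rewrite sqr_hsnorm_tr linearB /= !(grass_tr gP, grass_tr gT).
rewrite mulmxBl !mulmxBr !(grass_idem gP, grass_idem gT) !raddfB /=.
rewrite (grass_trace gP) (grass_trace gT) (mxtrace_mulC P T); lra.
Qed.

(** The normal part of [z P] with respect to [T] is [z P (1 - T) = - z P (T - P)], so Pythagoras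
    loses only a term quadratic in the tilt. *)
Lemma tilt_para P T z : grassmannian n P -> grassmannian n T ->
  enorm (z *m P) ^+ 2 - (hsnorm (T - P) * enorm (z *m P)) ^+ 2 <= enorm (z *m P *m T) ^+ 2.
Proof.
move=> gP gT; rewrite (grass_pythagoras (z *m P) gT) lerBlDr lerD2l.
rewrite lerXn2r ?nnegrE ?enorm_ge0 ?mulr_ge0 ?enorm_ge0 ?hsnorm_ge0//.
have -> : z *m P *m (1%:M - T) = - (z *m P *m (T - P)).
  rewrite (mulmxBr (z *m P) 1%:M T) (mulmxBr (z *m P) T P) -(mulmxA z P P) (grass_idem gP) mulmx1.
  by rewrite opprB.
by rewrite enormN mulrC; exact: ler_enorm_mulmx.
Qed.

Lemma tilt_cross P T z : grassmannian n P -> grassmannian n T ->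
  `|edot (z *m P *m T) (z *m (1%:M - P))| <=
    hsnorm (T - P) * enorm (z *m P) * enorm (z *m (1%:M - P)).
Proof.
move=> gP gT; rewrite (grass_edot _ _ gT); set q := z *m (1%:M - P).
have -> : q *m T = q *m (T - P).
  rewrite (mulmxBr q T P) /q -(mulmxA z (1%:M - P) P) (mulmxBl 1%:M P P).
  by rewrite mul1mx (grass_idem gP) subrr mulmx0 subr0.
apply: le_trans (edot_le _ _) _; rewrite mulrAC mulrC.
by rewrite ler_wpM2r ?enorm_ge0// mulrC; exact: ler_enorm_mulmx.
Qed.

End TiltAlgebra.

(** * Change of the averaged height between two scales *)

Section HeightStep.
Context {R : realType} {k n : nat} {w : R} {V : local_data R k}.
Hypothesis VS : local_spec n w V.
Local Notation nu := (ld_mu V).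
Local Notation T := (ld_plane V).
Local Notation v := (ld_var V).
Local Notation E := (expect nu).
Local Notation m := (mass nu).
Local Notation tilt := (@tilt R k V).
Context {a : 'rV[R]_k} {P : 'M[R]_k}.
Hypothesis gP : grassmannian n P.

Let n0 : (0 < n)%N := ls_n VS.
Local Notation Q := (1%:M - P).

Definition smoothed kap b (y : eucl R k) : R := smooth_height kap b (sqd a Q 1 y).

(** The cut-off depends on [(y - a) P] alone. On a plane parallel to [P] this average is then
    independent of [r], apart from the truncation, so its change with [r] is governed by the tilt
    and the variation. *)
Definition height_avg kap eps r : R :=
  (r ^+ n)^-1 * E (fun y => bump (sqd a P r y) * smoothed kap (eps * r) y).

Lemma grass_compl_sq : Q *m Q^T = Q.
Proof.
rewrite linearB /= trmx1 (grass_tr gP) mulmxBr mulmx1 mulmxBl mul1mx (grass_idem gP).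
by rewrite subrr subr0.
Qed.

Lemma smoothed_bounds kap b y : 0 < kap -> 0 < b ->
  [/\ 0 <= smoothed kap b y, smoothed kap b y <= height a P y & smoothed kap b y <= b].
Proof.
move=> k0 b0; rewrite /smoothed sqd1E; have h0 := height_ge0 a P y.
have /andP[s0 s1] := smooth_height_bounds k0 b0 h0.
by split=> //; exact: smooth_height_le.
Qed.

Lemma bborel_smoothed kap b : 0 < kap -> 0 < b -> bborel (smoothed kap b).
Proof.
move=> k0 b0; apply: (@continuous_bborel _ _ _ b); last first.
  by move=> y; have [s0 _ s1] := smoothed_bounds y k0 b0; rewrite ger0_norm.
apply: (fun_continuous_comp (h := smooth_height kap b) (g := sqd a Q 1)); last exact: continuous_sqd.
move=> u; apply: differentiable_continuous; apply/derivable1_diffP.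
by case: (is_derive_smooth_height b u k0).
Qed.

Definition cyl_psi kap b s (y : 'rV[R]_k) : R := bump (sqd a P s y) * smoothed kap b y.
Definition cyl_grad kap b s (y : 'rV[R]_k) : 'rV[R]_k :=
  bump (sqd a P s y) *: ((dsmooth_height kap b (sqd a Q 1 y) * (2 / 1 ^+ 2)) *: ((y - a) *m Q *m Q^T)) +
  smoothed kap b y *: ((dbump (sqd a P s y) * (2 / s ^+ 2)) *: ((y - a) *m P *m P^T)).

Lemma sqd_ge1 s (z : 'rV[R]_k) : 0 < s -> s <= enorm ((z - a) *m P) -> 1 <= sqd a P s z.
Proof.
move=> s0 h; rewrite /sqd ler_pdivlMr ?exprn_gt0// mul1r.
by rewrite lerXn2r ?nnegrE ?enorm_ge0// ltW.
Qed.

Lemma C1_supp_cyl kap b s : 0 < kap -> 0 < b -> 0 < s ->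
  C1_supp (cyl_psi kap b s) (cyl_grad kap b s) (ecball a (s + b)).
Proof.
move=> k0 b0 s0; split; last 2 first.
- exact: compact_ecball.
- move=> y nK; have [h|h] := leP b (height a P y).
    have [e1 e2] := smooth_height0 kap b0 h.
    by rewrite /cyl_psi /cyl_grad /smoothed sqd1E -/(height a P y) e1 e2 mulr0 mul0r !scale0r scaler0 addr0.
  have [hp|hp] := leP s (enorm ((y - a) *m P)).
    have u1 := sqd_ge1 s0 hp.
    by rewrite /cyl_psi /cyl_grad bump_eq0// dbump_eq0// !mul0r !scale0r scaler0 addr0.
  exfalso; apply: nK; rewrite /ecball /=.
  have -> : y - a = (y - a) *m P + (y - a) *m Q by rewrite mulmxBr mulmx1 [RHS]addrC subrK.
  by apply: le_trans (ler_enormD _ _) _; apply: lerD; exact: ltW.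
- apply: (isC1_mul (f := fun y => bump (sqd a P s y))).
    by apply: isC1_comp_sqd; [exact: is_derive_bump|exact: continuous_dbump].
  apply: isC1_comp_sqd; first by move=> t; exact: is_derive_smooth_height.
  exact: continuous_dsmooth_height.
Qed.

(** Compared with a plane parallel to [P] there are three defects: [tr(T P)] is less than [n] by
    half the squared tilt, the radius [(y - a) P] is not quite tangential, and the smoothed height
    varies along it. With [D <= 2 n] in the quadratic terms they cost at most [n], [4 n] and 9 times
    [r D]. *)
Lemma cyl_div_error kap b s r (y : 'rV[R]_k) : 0 < kap -> 0 < b -> 2 * b <= r -> 0 < s -> s <= r ->
  `|(n%:R * bump (sqd a P s y) + 2 * (dbump (sqd a P s y) * sqd a P s y)) * smoothed kap b y -
    div_radial T (cyl_psi kap b s) (cyl_grad kap b s) a P y| <=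
  (5 * n%:R + 9) * r * (tilt P y * \1_(eball a (2 * r)) y).
Proof.
move=> k0 b0 br s0 sr; have gT := ls_grass VS y.
have r0 : 0 < r := lt_le_trans s0 sr.
have [nK|yK] := leP (2 * r) (enorm (y - a)).
  have z : ~ ecball a (s + b) y by rewrite /ecball /= => /(le_trans nK); apply/negP; rewrite -ltNge; lra.
  have [_ _ /(_ y z)[e1 e2]] := C1_supp_cyl k0 b0 s0.
  rewrite /div_radial e1 e2 mul0r edotC edot0l addr0 subr0.
  have -> : (n%:R * bump (sqd a P s y) + 2 * (dbump (sqd a P s y) * sqd a P s y)) * smoothed kap b y =
    n%:R * cyl_psi kap b s y + 2 * sqd a P s y * (dbump (sqd a P s y) * smoothed kap b y).
    by rewrite /cyl_psi; ring.
  rewrite e1 mulr0 add0r; have -> : dbump (sqd a P s y) * smoothed kap b y = 0.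
    move: e1; rewrite /cyl_psi => /eqP; rewrite mulf_eq0 => /orP[|/eqP ->]; last by rewrite mulr0.
    by rewrite /bump /dbump sqrf_eq0 => /eqP ->; rewrite mulr0 oppr0 mul0r.
  rewrite mulr0 normr0; have c0 : 0 <= (5 * n%:R + 9) * r by rewrite mulr_ge0 ?(ltW r0)// addr_ge0// mulr_ge0.
  by apply: mulr_ge0 => //; rewrite mulr_ge0 ?tilt_ge0// indicE.
have -> : \1_(eball a (2 * r)) y = 1 :> R by rewrite indicE mem_set.
rewrite mulr1; set D := tilt P y.
have D0 : 0 <= D := tilt_ge0 P y.
have D2 : D <= 2 * n%:R := grass_tilt_le n0 gP gT.
have [s00 sh sb] := smoothed_bounds y k0 b0.
have dW := dsmooth_height_le k0 b0 (height_ge0 a P y).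
rewrite /div_radial /cyl_psi /cyl_grad -(mulmxA (y - a) Q Q^T) grass_compl_sq (grass_tr gP) -(mulmxA (y - a) P P) (grass_idem gP).
rewrite (tilt_trace gP gT) -/(tilt P y) -/D.
rewrite edotDr !edotZr sqd1E -/(height a P y).
move: s00 sb dW sh; set W := smoothed kap b y; set dw := dsmooth_height _ _ _; set h := height a P y => s00 sb dW sh.
set p := (y - a) *m P; set q := (y - a) *m Q.
have pT : edot (p *m T y) p = enorm (p *m T y) ^+ 2 by rewrite sqr_enorm (grass_edot2 _ _ gT) edotC.
have x1 := tilt_para (y - a) gP gT; have x2 := grass_enorm p gT.
have x3 := tilt_cross (y - a) gP gT.
rewrite -/(tilt P y) -/D -/p -/q -/h in x1 x3; rewrite pT.
have h0 : 0 <= h := height_ge0 a P y.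
have [hp|hp] := leP s (enorm p).
  have u1 := sqd_ge1 s0 hp; rewrite bump_eq0// dbump_eq0// !(mul0r, mulr0, addr0, subr0) normr0.
  by rewrite mulr_ge0// mulr_ge0 ?(ltW r0)// addr_ge0// mulr_ge0.
have u0 := sqd_ge0 a P s y; have b1 := bump_le1 u0; have bb0 := bump_ge0 (sqd a P s y).
have db1 := dbump_ge u0; have db0 := dbump_le0 (sqd a P s y).
set B := bump _ in b1 bb0 *; set dB := dbump _ in db1 db0 *.
have uE : sqd a P s y = enorm p ^+ 2 / s ^+ 2 by [].
have p0 := enorm_ge0 p; have pT0 := enorm_ge0 (p *m T y).
set X := enorm (p *m T y) in x1 x2 pT0 *.
set Y := edot (p *m T y) q in x3 *.
have -> : (n%:R * B + 2 * (dB * sqd a P s y)) * W -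
   (B * W * (n%:R - D ^+ 2 / 2) + (B * (dw * (2 / 1 ^+ 2) * Y) + W * (dB * (2 / s ^+ 2) * X ^+ 2))) =
  B * W * D ^+ 2 / 2 + W * dB * 2 * ((enorm p ^+ 2 - X ^+ 2) / s ^+ 2) - B * (dw * 2 * Y).
  by rewrite uE expr1n; field; rewrite gt_eqF.
have Wr : W <= r / 2 by lra.
have t1 : `|B * W * D ^+ 2 / 2| <= n%:R * r * D.
  rewrite ger0_norm; last by rewrite divr_ge0// (mulr_ge0 (mulr_ge0 bb0 s00))// sqr_ge0.
  have h1 : B * W <= r / 2 by have := mulr_ge0 bb0 s00; nra.
  have h2 : D ^+ 2 <= 2 * n%:R * D by nra.
  have : B * W * D ^+ 2 <= r / 2 * (2 * n%:R * D).
    by apply: ler_pM => //; rewrite ?sqr_ge0// mulr_ge0.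
  have : 0 <= n%:R * r * D by rewrite mulr_ge0// mulr_ge0// ltW.
  lra.
have t2 : `|W * dB * 2 * ((enorm p ^+ 2 - X ^+ 2) / s ^+ 2)| <= 4 * n%:R * r * D.
  have z0 : 0 <= (enorm p ^+ 2 - X ^+ 2) / s ^+ 2.
    by rewrite divr_ge0 ?sqr_ge0// subr_ge0; nra.
  have z1 : (enorm p ^+ 2 - X ^+ 2) / s ^+ 2 <= 2 * n%:R * D.
    apply: (@le_trans _ _ (D ^+ 2)); last by nra.
    rewrite ler_pdivrMr ?exprn_gt0//; have : (D * enorm p) ^+ 2 <= D ^+ 2 * s ^+ 2.
      by rewrite exprMn ler_wpM2l ?sqr_ge0//; nra.
    lra.
  rewrite normrM (ger0_norm z0) (_ : 4 * n%:R * r * D = 2 * r * (2 * n%:R * D)); last by ring.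
  apply: ler_pM => //; rewrite normrM normrM (ger0_norm s00) (ler0_norm db0) ger0_norm//.
  nra.
have t3 : `|B * (dw * 2 * Y)| <= 9 * r * D.
  rewrite (normrM B) (normrM _ Y) (normrM dw) (ger0_norm bb0) (ger0_norm (ler0n R 2)).
  have h1 : `|dw| * 2 * `|Y| <= `|dw| * 2 * (D * enorm p * h) by rewrite ler_wpM2l// mulr_ge0.
  have h2 : `|dw| * 2 * (D * enorm p * h) <= 9 * (D * enorm p).
    rewrite (_ : `|dw| * 2 * (D * enorm p * h) = `|dw| * (2 * h) * (D * enorm p)); last by ring.
    by rewrite ler_wpM2r// mulr_ge0.
  have h3 : D * enorm p <= D * r by rewrite ler_wpM2l//; lra.
  have h4 : 0 <= `|dw| * 2 * `|Y| by rewrite !mulr_ge0.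
  have h5 : B * (`|dw| * 2 * `|Y|) <= `|dw| * 2 * `|Y| by rewrite ler_piMl.
  lra.
apply: le_trans (ler_normB _ _) _; have := ler_normD (B * W * D ^+ 2 / 2) (W * dB * 2 * ((enorm p ^+ 2 - X ^+ 2) / s ^+ 2)).
lra.
Qed.

(** Between [r/2] and [r] the truncation is frozen at [eps r], so that [is_derive_ratio] applies,
    and the derivative is estimated by [cyl_div_error] and the first variation. Passing to the
    truncation [eps r / 2] afterwards matters only for heights above [eps r / 4] and costs [r] times
    the mass of a steep set. *)
Lemma height_avg_step kap eps r : 0 < kap -> 0 < eps -> eps <= 1 / 2 -> 0 < r ->
  eball a (2 * r) `<=` ld_dom V ->
  height_avg kap eps r <= height_avg kap eps (r / 2) +
    2 ^+ n / r ^+ n * ((5 * n%:R + 9) * r * E (fun y => tilt P y * \1_(eball a (2 * r)) y) +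
       eps * r ^+ 2 * v (eball a (2 * r)) + r * m (steep a P (2 * r) (eps / 8 * (2 * r)))).
Proof.
move=> k0 e0 e1 r0 dom; set b := eps * r.
have b0 : 0 < b by rewrite mulr_gt0.
have br : 2 * b <= r by rewrite /b; nra.
have rn : 0 < r ^+ n by exact: exprn_gt0.
set ET := E _; pose O := eball a (2 * r).
have ET0 : 0 <= ET by apply: expect_ge0 => y; rewrite mulr_ge0 ?tilt_ge0// indicE.
have v0 : 0 <= v O := ls_var_ge0 VS O.
pose bW := bborel_smoothed k0 b0.
have oO : open O by exact: open_eball.
have mO : measurable (O : set (eucl R k)) by exact: open_measurable_eucl.
pose M := (5 * n%:R + 9) * r * ET + b * r * v O.
have c0 : 0 <= (5 * n%:R + 9) * r by rewrite mulr_ge0 ?(ltW r0)// addr_ge0// mulr_ge0.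
have M0 : 0 <= M by rewrite addr_ge0// mulr_ge0// mulr_ge0// ltW.
pose e s (y : eucl R k) := (n%:R * bump (sqd a P s y) + 2 * (dbump (sqd a P s y) * sqd a P s y)) * smoothed kap b y.
have be s : bborel (e s).
  apply: bborelM => //; apply: bborelD; apply: bborelM; try exact: bborel_cst.
  - exact: bborel_bump_sqd.
  - exact: bborel_dbump_sqd.
have eM s : 0 < s -> s <= r -> `|E (e s)| <= M.
  move=> s0 sr; pose d := div_radial T (cyl_psi kap b s) (cyl_grad kap b s) a P.
  have supp := C1_supp_cyl k0 b0 s0.
  have bd : bborel d by exact: (bborel_div_radial VS _ _ supp).
  have h1 : `|E (fun y => e s y - d y)| <= (5 * n%:R + 9) * r * ET.
    apply: le_trans (expect_norm _ (bborelB (be s) bd)) _.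
    rewrite -expectZ; last by apply: bborelM; [exact: (bborel_tilt VS gP)|exact: bborel_indic_eucl].
    apply: expect_le.
    - exact/bborel_normr/bborelB.
    - by apply: bborelM; [exact: bborel_cst|apply: bborelM; [exact: (bborel_tilt VS gP)|exact: bborel_indic_eucl]].
    - by move=> y; exact: cyl_div_error.
  have KO : ecball a (s + b) `<=` O.
    by move=> y; rewrite /ecball /O /eball /= => /le_lt_trans; apply; lra.
  have h2 : `|E d| <= b * r * v O.
    apply: (ls_first_variation VS supp KO oO dom) => y.
    rewrite enormZ /cyl_psi normrM; have [s00 _ sb] := smoothed_bounds y k0 b0.
    rewrite (ger0_norm s00) (ger0_norm (bump_ge0 _)).
    have [hp|hp] := leP s (enorm ((y - a) *m P)).
      by rewrite bump_eq0 ?mul0r; [exact: mulr_ge0 (ltW b0) (ltW r0)|exact: sqd_ge1].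
    have h3 := bump_le1 (sqd_ge0 a P s y); have h4 := bump_ge0 (sqd a P s y).
    apply: ler_pM => //; [exact: mulr_ge0|exact: enorm_ge0| |by lra].
    by apply: le_trans sb; rewrite ler_piMl.
  rewrite (expectB _ (be s) bd) in h1.
  have -> : E (e s) = (E (e s) - E d) + E d by rewrite subrK.
  by apply: le_trans (ler_normD _ _) _; exact: lerD.
pose f s := (s ^+ n)^-1 * E (fun y => bump (sqd a P s y) * smoothed kap b y).
have rh : r / 2 <= r by lra.
have hf (x : R) : r / 2 <= x <= r -> is_derive x (1 : R) (fun s => - f s) (- (- (x ^+ n.+1)^-1 * E (e x))).
  move=> /andP[x1 _]; have x0 : 0 < x by apply: lt_le_trans x1; rewrite divr_gt0.
  exact: (is_deriveN (is_derive_ratio VS a P bW x0)).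
pose N := 2 ^+ n.+1 / r ^+ n.+1 * M.
have N0 : 0 <= N by rewrite mulr_ge0// divr_ge0// exprn_ge0// ltW.
have hN (x : R) : r / 2 < x < r -> - N <= - (- (x ^+ n.+1)^-1 * E (e x)).
  move=> /andP[x1 x2]; have x0 : 0 < x by apply: lt_trans x1; rewrite divr_gt0.
  rewrite mulNr opprK lerNl -mulrN; apply: (@le_trans _ _ ((x ^+ n.+1)^-1 * M)).
    rewrite ler_wpM2l ?invr_ge0 ?exprn_ge0 ?(ltW x0)//.
    by apply: le_trans (eM x x0 (ltW x2)); rewrite -normrN ler_norm.
  rewrite ler_wpM2r// -[2 ^+ n.+1 / _]invf_div -expr_div_n lef_pV2 ?posrE ?exprn_gt0 ?divr_gt0//.
  by rewrite lerXn2r ?nnegrE ?(ltW x1)// ltW// divr_gt0.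
have := MVT_ge rh N0 hf hN; rewrite lerNl opprD opprK lerBlDr => hm.
have hstep : f r <= f (r / 2) + 2 ^+ n / r ^+ n * M.
  apply: le_trans hm _; rewrite lerD2l le_eqVlt; apply/orP; left; apply/eqP.
  by rewrite /N !exprS; field; rewrite !gt_eqF.
have cmp : f (r / 2) <= height_avg kap eps (r / 2) + 2 ^+ n / r ^+ n * (r * m (steep a P (2 * r) (eps / 8 * (2 * r)))).
  have -> : 2 ^+ n / r ^+ n = ((r / 2) ^+ n)^-1 by rewrite expr_div_n invf_div.
  rewrite /f /height_avg -mulrDr ler_wpM2l ?invr_ge0 ?exprn_ge0 ?divr_ge0 ?(ltW r0)//.
  set S := steep _ _ _ _; have mS : measurable (S : set (eucl R k)) by exact: measurable_steep.
  have b2 : 0 < eps * (r / 2) by rewrite mulr_gt0// divr_gt0.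
  have bI : bborel (fun y : eucl R k => r * \1_S y) by apply: bborelM; [exact: bborel_cst|exact: bborel_indic_eucl].
  have bb1 := bborelM (bborel_bump_sqd a P (r / 2)) bW.
  have bb2 := bborelM (bborel_bump_sqd a P (r / 2)) (bborel_smoothed k0 b2).
  rewrite -expect_indic// -expectZ; last exact: bborel_indic_eucl.
  rewrite -expectD//; apply: expect_le => //; first exact: bborelD.
  move=> y; have h0 := height_ge0 a P y.
  have [s00 _ sb] := smoothed_bounds y k0 b0; have [t00 _ _] := smoothed_bounds y k0 b2.
  have B0 := bump_ge0 (sqd a P (r / 2) y); have B1 := bump_le1 (sqd_ge0 a P (r / 2) y).
  have I0 : 0 <= r * (\1_S y : R) by rewrite mulr_ge0 ?(ltW r0)// indicE.
  have Bt := mulr_ge0 B0 t00.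
  have [hb|hb] := leP b (height a P y).
    have -> : smoothed kap b y = 0.
      by rewrite /smoothed sqd1E -/(height a P y); have [] := smooth_height0 kap b0 hb.
    by rewrite mulr0 addr_ge0.
  have [hp|hp] := leP (r / 2) (enorm ((y - a) *m P)).
    have r2 : 0 < r / 2 by rewrite divr_gt0.
    rewrite bump_eq0; last exact: sqd_ge1.
    by rewrite !mul0r add0r.
  have [hl|hl] := leP (height a P y) (eps / 8 * (2 * r)).
    rewrite -[leLHS]addr0 lerD//.
    have l1 : smoothed kap b y = rootnorm kap (height a P y ^+ 2).
      by rewrite /smoothed /smooth_height sqd1E -/(height a P y) low_cut1 ?mul1r// /b; lra.
    have l2 : smoothed kap (eps * (r / 2)) y = rootnorm kap (height a P y ^+ 2).
      by rewrite /smoothed /smooth_height sqd1E -/(height a P y) low_cut1 ?mul1r//; lra.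
    by rewrite l1 l2.
  have yS : S y.
    split=> //; rewrite /eball /=.
    have -> : y - a = (y - a) *m P + (y - a) *m Q by rewrite mulmxBr mulmx1 [RHS]addrC subrK.
    by apply: le_lt_trans (ler_enormD _ _) _; rewrite -/(height a P y); lra.
  rewrite (_ : \1_S y = 1); last by rewrite indicE mem_set.
  rewrite mulr1; have : bump (sqd a P (r / 2) y) * smoothed kap b y <= smoothed kap b y by rewrite ler_piMl.
  lra.
have fE : f r = height_avg kap eps r by [].
have ME : M = (5 * n%:R + 9) * r * ET + eps * r ^+ 2 * v O by rewrite /M /b; ring.
rewrite -fE; apply: le_trans hstep _.
by rewrite -ME (mulrDr _ M) addrA addrAC lerD2r.
Qed.

End HeightStep.

(** * Decay of the mean height *)

Section HeightDecay.
Context {R : realType} {k n : nat} {w : R} {V : local_data R k}.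
Hypothesis VS : local_spec n w V.
Context {p M : R} {lam : set 'rV[R]_k -> R} {a : 'rV[R]_k} {P : 'M[R]_k}.
Hypothesis PS : point_spec n V p M lam a P.
Local Notation nu := (ld_mu V).
Local Notation T := (ld_plane V).
Local Notation v := (ld_var V).
Local Notation E := (expect nu).
Local Notation m := (mass nu).
Local Notation tilt := (@tilt R k V).
Local Notation havg := (@height_avg R k n V a P).

Let n0 : (0 < n)%N := ls_n VS.
Let gP := ps_grass PS.

(** The origin of the factors: [2 * 2^n] from [height_split], 2 from the geometric series, 4 from
    doubling the radius in [r^(1 + al)], and [4^n * 2 (5 n + 9)] from a single step. *)
Definition height_const : R := 2 ^+ (n + 2) * 4 ^+ n.+1 * (2 * (5 * n%:R + 9)).

Lemma bborel_height_ball r : bborel ((fun y => height a P y * \1_(eball a r) y) : eucl R k -> R).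
Proof.
split.
  apply: measurable_funM; first by apply: continuous_measurable_eucl; exact: continuous_height.
  by apply: measurable_indic; exact: open_measurable_eucl (@open_eball R k a r).
exists `|r| => y; rewrite indicE; have [/set_mem ya|] := boolP (y \in eball a r).
  rewrite mulr1 ger0_norm ?height_ge0//.
  apply: le_trans (grass_perp_enorm _ gP) _; apply: le_trans (ltW ya) (ler_norm _).
by rewrite mulr0 normr0.
Qed.

Lemma height_avg_small kap eps r : 0 < kap -> 0 < eps -> eps <= 1 / 2 -> 0 < r ->
  m (eball a (2 * r)) <= M * (2 * r) ^+ n -> havg kap eps r <= eps * 2 ^+ n * M * r.
Proof.
move=> k0 e0 e1 r0 hm; have rn : 0 < r ^+ n by exact: exprn_gt0.
have b0 : 0 < eps * r by rewrite mulr_gt0.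
rewrite /height_avg mulrC ler_pdivrMr//.
apply: (@le_trans _ _ (eps * r * m (eball a (2 * r)))); last first.
  apply: (@le_trans _ _ (eps * r * (M * (2 * r) ^+ n))); first by rewrite ler_wpM2l// ltW.
  by rewrite exprMn le_eqVlt; apply/orP; left; apply/eqP; ring.
apply: expect_indic_le.
- by apply: bborelM; [exact: bborel_bump_sqd|exact: bborel_smoothed].
- exact: open_measurable_eucl (@open_eball R k a _).
move=> y; have [s0 _ sb] := smoothed_bounds (a := a) (P := P) y k0 b0.
have B1 := bump_le1 (sqd_ge0 a P r y); have B0 := bump_ge0 (sqd a P r y).
have [ya|ya] := leP (2 * r) (enorm (y - a)); last first.
  rewrite (_ : \1_(eball a (2 * r)) y = 1) ?mulr1; last by rewrite indicE mem_set.
  by apply: le_trans sb; rewrite ler_piMl.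
have z : ~ ecball a (r + eps * r) y by rewrite /ecball /= => /(le_trans ya); apply/negP; rewrite -ltNge; nra.
have [_ _ /(_ y z)[e2 _]] := C1_supp_cyl (a := a) (P := P) k0 b0 r0.
by rewrite -/(cyl_psi (a := a) (P := P) kap (eps * r) r y) e2 mulr_ge0 ?(ltW b0)// indicE.
Qed.

(** In [B(a, r)], at heights up to [eps r] the truncation at [2 eps r] is inactive and the bump of
    scale [2 r] is at least [1/2]; greater heights are at most [r] and lie in the steep set. The
    last term is the error of [rootnorm]. *)
Lemma height_split kap eps r : 0 < kap -> 0 < eps -> 0 < r ->
  E (fun y => height a P y * \1_(eball a r) y) <=
    2 * (2 * r) ^+ n * havg kap eps (2 * r) + r * m (steep a P r (eps * r)) + kap * m (eball a r).
Proof.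
move=> k0 e0 r0; have r2 : 0 < 2 * r by rewrite mulr_gt0.
have rn : 0 < (2 * r) ^+ n by exact: exprn_gt0.
have b0 : 0 < eps * (2 * r) by rewrite mulr_gt0.
rewrite /height_avg mulrA mulfK ?gt_eqF//.
have mB : measurable (eball a r : set (eucl R k)) by exact: open_measurable_eucl (@open_eball R k a r).
have mS := measurable_steep a P r (eps * r).
have bb := bborelM (bborel_bump_sqd a P (2 * r)) (bborel_smoothed (a := a) (P := P) k0 b0).
have b1 : bborel (fun y : eucl R k => r * \1_(steep a P r (eps * r)) y).
  by apply: bborelM; [exact: bborel_cst|exact: bborel_indic_eucl].
have b2 : bborel (fun y : eucl R k => kap * \1_(eball a r) y).
  by apply: bborelM; [exact: bborel_cst|exact: bborel_indic_eucl].
have b3 : bborel (fun y : eucl R k => 2 * (bump (sqd a P (2 * r) y) * smoothed (a := a) (P := P) kap (eps * (2 * r)) y)).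
  by apply: bborelM; [exact: bborel_cst|].
rewrite -!expect_indic// -!expectZ//; try exact: bborel_indic_eucl.
rewrite -expectD// -expectD//; last exact: bborelD.
apply: expect_le; [exact: bborel_height_ball|by apply: bborelD => //; exact: bborelD|].
move=> y; have [s0 _ sb] := smoothed_bounds (a := a) (P := P) y k0 b0.
have B0 := bump_ge0 (sqd a P (2 * r) y).
have Bs := mulr_ge0 B0 s0; have h0 := height_ge0 a P y.
have I1 : 0 <= (\1_(steep a P r (eps * r)) y : R) by rewrite indicE.
have I1r := mulr_ge0 (ltW r0) I1.
rewrite [\1_(eball a r) y]indicE; have [/set_mem ya|] := boolP (y \in eball a r); last first.
  by rewrite !mulr0 addr0 addr_ge0// mulr_ge0.
rewrite !mulr1; have [hl|hl] := leP (height a P y) (eps * r); last first.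
  have -> : \1_(steep a P r (eps * r)) y = 1 :> R by rewrite indicE mem_set.
  have : height a P y <= r by apply: le_trans (grass_perp_enorm _ gP) (ltW ya).
  by rewrite mulr1 => hr; lra.
have ge_ : height a P y - kap <= smoothed (a := a) (P := P) kap (eps * (2 * r)) y.
  by rewrite /smoothed sqd1E; apply: smooth_height_ge => //; rewrite -/(height a P y); lra.
have Bh : 2^-1 <= bump (sqd a P (2 * r) y).
  apply: bump_ge_half; first exact: sqd_ge0.
  rewrite /sqd ler_pdivrMr ?exprn_gt0//.
  have hp : enorm ((y - a) *m P) <= r by apply: le_trans (grass_enorm _ gP) (ltW ya).
  by have := enorm_ge0 ((y - a) *m P); nra.
have : 2^-1 * smoothed (a := a) (P := P) kap (eps * (2 * r)) y <=
    bump (sqd a P (2 * r) y) * smoothed (a := a) (P := P) kap (eps * (2 * r)) y by rewrite ler_wpM2r.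
lra.
Qed.

(** Sum [height_avg_step] over the radii [r / 2^j]. The tilt contributes terms of order
    [tau r^(1 + al)], which at least halve from scale to scale. Variation and steep mass contribute
    terms of order [r^2], at most [r^(1 + al)], with coefficients as small as desired. Only the
    coefficient of [tau] survives. *)
Lemma height_decay tau al : 0 <= tau -> 0 < al -> al <= 1 ->
  (\forall r \near 0^'+, E (fun y => tilt P y * \1_(eball a r) y) <= tau * r ^+ n * r `^ al) ->
  forall eta, 0 < eta ->
  \forall r \near 0^'+, E (fun y => height a P y * \1_(eball a r) y) <=
    (height_const * tau + eta) * r ^+ n.+1 * r `^ al.
Proof.
move=> tau0 al0 al1 hD eta eta0.
have [L L0 hL] := near_var_ball PS; have M0 := ps_M PS.
pose D : R := 2 ^+ (n + 2) * 4 ^+ n.+1.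
have q2 : 1 <= (2 : R) ^+ (n + 2) by rewrite exprn_ege1// ler1n.
have q4 : 1 <= (4 : R) ^+ n.+1 by rewrite exprn_ege1// ler1n.
have D0 : 0 < D by rewrite mulr_gt0// (lt_le_trans ltr01).
pose eta1 := eta / (6 * D); have e10 : 0 < eta1 by rewrite divr_gt0// mulr_gt0.
(* The bound [L] for the variation enters as [eps * L]; this choice makes its total contribution at
   most [eta / 3]. *)
pose eps := Num.min (1 / 2) (eta / (3 * D * (L + 1))).
have L1 : 0 < L + 1 by rewrite ltr_wpDl.
have e0 : 0 < eps by rewrite lt_min divr_gt0//= divr_gt0// !mulr_gt0.
have e1 : eps <= 1 / 2 by rewrite ge_min lexx.
have e2 : D * (eps * L) <= eta / 3.
  have h : eps <= eta / (3 * D * (L + 1)) by rewrite ge_min lexx orbT.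
  apply: (@le_trans _ _ (D * (eps * (L + 1)))).
    by rewrite ler_wpM2l ?(ltW D0)// ler_wpM2l ?(ltW e0)// lerDl.
  apply: (@le_trans _ _ (D * (eta / (3 * D * (L + 1)) * (L + 1)))).
    by rewrite ler_wpM2l ?(ltW D0)// ler_wpM2r// ltW.
  by rewrite le_eqVlt; apply/orP; left; apply/eqP; field; rewrite !gt_eqF.
have e8 : 0 < eps / 8 by rewrite divr_gt0.
have two0 : 0 < (2 : R) by [].
have /near0P[R1 R10 h1] := near0_scale two0 hD.
have /near0P[R2 R20 h2] := near0_scale two0 hL.
have /near0P[R3 R30 h3] := near0_scale two0 (ps_dom PS).
have /near0P[R4 R40 h4] := near0_scale two0 (ps_mass PS).
have /near0P[R5 R50 h5] := near0_scale two0 (steep_decay VS PS e8 e10).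
have hflat := steep_decay VS PS e0 e10.
pose R0 := Num.min 1 (Num.min R1 (Num.min R2 (Num.min R3 (Num.min R4 R5)))).
have R00 : 0 < R0 by rewrite !lt_min ltr01 R10 R20 R30 R40 R50.
pose g r := r * r `^ al.
have g0 r : 0 <= r -> 0 <= g r by move=> r0; rewrite mulr_ge0// powR_ge0.
have ghalf r : 0 <= r -> g (r / 2) <= g r / 2.
  move=> r0; rewrite /g mulrAC ler_wpM2r ?invr_ge0// ler_wpM2l//.
  by apply: ge0_ler_powR; rewrite ?nnegrE ?(ltW al0) ?divr_ge0//; lra.
pose c1 : R := 5 * n%:R + 9.
have c10 : 0 <= c1 by rewrite addr_ge0// mulr_ge0.
pose A := 4 ^+ n * (2 * c1 * tau + eps * L + 2 * eta1).
have p4 : 0 <= (4 : R) ^+ n by rewrite exprn_ge0.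
have A0 : 0 <= A.
  rewrite mulr_ge0// addr_ge0//; last by rewrite mulr_ge0// ltW.
  by rewrite addr_ge0// mulr_ge0 ?(ltW e0)// mulr_ge0.
have rr r : 0 < r -> r <= 1 -> r <= r `^ al.
  move=> r0 r1; rewrite -{1}[r](@powRr1 _ r) ?(ltW r0)//.
  by apply: ger_powR => //; rewrite r0 r1.
have step kap r : 0 < kap -> 0 < r -> r < R0 -> havg kap eps r <= havg kap eps (r / 2) + A * g r.
  rewrite !lt_min => k0 r0 /and5P[l0 l1 l2 l3 /andP[l4 l5]].
  have rn : 0 < r ^+ n by exact: exprn_gt0.
  apply: le_trans (height_avg_step VS gP k0 e0 e1 r0 (h3 r r0 l3)) _; rewrite lerD2l.
  have t1 : c1 * r * E (fun y => tilt P y * \1_(eball a (2 * r)) y) <= c1 * r * (tau * (2 ^+ n * r ^+ n) * (2 * r `^ al)).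
    rewrite ler_wpM2l ?mulr_ge0// ?(ltW r0)//; apply: le_trans (h1 r r0 l1) _.
    rewrite exprMn; apply: ler_wpM2l.
      by rewrite mulr_ge0// mulr_ge0 ?(ltW rn)// exprn_ge0.
    rewrite powRM ?(ltW r0)// ler_wpM2r ?powR_ge0//.
    rewrite -[leRHS](@powRr1 _ 2)//; apply: ler_powR => //.
    by rewrite ler1n.
  have t2 : eps * r ^+ 2 * v (eball a (2 * r)) <= eps * r ^+ 2 * (L * (2 ^+ n * r ^+ n)).
    rewrite -exprMn ler_wpM2l ?h2//.
    by rewrite mulr_ge0 ?sqr_ge0 ?(ltW e0).
  have t3 : r * m (steep a P (2 * r) (eps / 8 * (2 * r))) <= r * (eta1 * (2 * 2 ^+ n * r * r ^+ n)).
    rewrite ler_wpM2l ?(ltW r0)//; apply: le_trans (h5 r r0 l5) _.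
    by rewrite exprMn !exprS le_eqVlt; apply/orP; left; apply/eqP; ring.
  apply: (@le_trans _ _ (2 ^+ n / r ^+ n * (c1 * r * (tau * (2 ^+ n * r ^+ n) * (2 * r `^ al)) +
     eps * r ^+ 2 * (L * (2 ^+ n * r ^+ n)) + r * (eta1 * (2 * 2 ^+ n * r * r ^+ n))))).
    rewrite ler_wpM2l ?divr_ge0 ?exprn_ge0 ?(ltW r0)//; apply: lerD => //; exact: lerD.
  have -> : 2 ^+ n / r ^+ n * (c1 * r * (tau * (2 ^+ n * r ^+ n) * (2 * r `^ al)) +
     eps * r ^+ 2 * (L * (2 ^+ n * r ^+ n)) + r * (eta1 * (2 * 2 ^+ n * r * r ^+ n))) =
     4 ^+ n * (2 * c1 * tau * g r + (eps * L + 2 * eta1) * (r * r)).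
    have -> : 4 ^+ n = 2 ^+ n * 2 ^+ n :> R by rewrite -exprMn; congr (_ ^+ _); ring.
    by rewrite /g; field; rewrite gt_eqF.
  rewrite /A -[leRHS]mulrA ler_wpM2l// -addrA [leRHS]mulrDl lerD2l ler_wpM2l//; last first.
    by rewrite /g ler_wpM2l ?(ltW r0)// rr// ltW.
  by have := mulr_ge0 (ltW e0) L0; lra.
(* Since [g] at least halves with the radius, [A * g(r_j)] is at most [2 A (g(r_j) - g(r_(j+1)))],
   and the errors telescope. *)
have iter kap r j : 0 < kap -> 0 < r -> r < R0 ->
    havg kap eps r <= havg kap eps (r / 2 ^+ j) + 2 * A * (g r - g (r / 2 ^+ j)).
  move=> k0 r0 rR; elim: j => [|j IH].
    by rewrite expr0 divr1 subrr mulr0 addr0.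
  have rj : 0 < r / 2 ^+ j by rewrite divr_gt0// exprn_gt0.
  have rjR : r / 2 ^+ j < R0.
    by apply: le_lt_trans rR; rewrite ler_pdivrMr ?exprn_gt0// ler_peMr ?(ltW r0)// exprn_ege1// ler1n.
  have e : r / 2 ^+ j.+1 = r / 2 ^+ j / 2 by rewrite exprSr; field; rewrite gt_eqF// exprn_gt0.
  have s1 := step kap _ k0 rj rjR; have s2 := ghalf _ (ltW rj); rewrite -e in s1 s2.
  apply: le_trans IH _; have := ler_wpM2l A0 s2; lra.
(* The average at scale [r / 2^j] tends to 0 because the truncation bounds the smoothed height by
   [eps] times the scale. *)
have limit kap r : 0 < kap -> 0 < r -> r < R0 -> havg kap eps r <= 2 * A * g r.
  move=> k0 r0 rR; apply/ler_addgt0Pr => e ep.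
  pose N := eps * 2 ^+ n * M; have N0 : 0 <= N by rewrite mulr_ge0// mulr_ge0 ?(ltW e0)// exprn_ge0.
  have [j] := pow2_gt (N * r / e); rewrite ltr_pdivrMr// => /ltW hj.
  have rj : 0 < r / 2 ^+ j by rewrite divr_gt0// exprn_gt0.
  have rjR : r / 2 ^+ j < R0.
    by apply: le_lt_trans rR; rewrite ler_pdivrMr ?exprn_gt0// ler_peMr ?(ltW r0)// exprn_ege1// ler1n.
  apply: le_trans (iter kap r j k0 r0 rR) _.
  have l4 : r / 2 ^+ j < R4 by move: rjR; rewrite !lt_min => /and5P[_ _ _ _ /andP[]].
  have := height_avg_small k0 e0 e1 rj (h4 _ rj l4); rewrite -/N => hs.
  have : N * (r / 2 ^+ j) <= e by rewrite mulrA ler_pdivrMr ?exprn_gt0// (mulrC e).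
  have := mulr_ge0 A0 (g0 _ (ltW rj)); lra.
have R02 : 0 < R0 / 2 by rewrite divr_gt0.
near=> r.
have r0 : 0 < r by near: r; exact: nbhs_right_gt.
have rR : 2 * r < R0.
  by rewrite mulrC -ltr_pdivlMr//; near: r; exact: nbhs_right_lt.
have r1 : r <= 1 by move: rR; rewrite lt_min => /andP[? _]; lra.
have hf : m (steep a P r (eps * r)) <= eta1 * r ^+ n.+1 by near: r; exact: hflat.
have r2 : 0 < 2 * r by rewrite mulr_gt0.
have rn : 0 < r ^+ n by exact: exprn_gt0.
have base : E (fun y => height a P y * \1_(eball a r) y) <= 2 * (2 * r) ^+ n * (2 * A * g (2 * r)) + r * (eta1 * r ^+ n.+1).
  (* All earlier bounds are uniform in the smoothing parameter [kap], which can now be sent to 0. *)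
  apply/ler_addgt0Pr => e ep; have mB := mass_ge0 nu (eball a r).
  pose kap := e / (m (eball a r) + 1).
  have k0 : 0 < kap by rewrite divr_gt0// ltr_wpDl.
  apply: le_trans (height_split k0 e0 r0) _; apply: lerD; first apply: lerD.
  - apply: ler_wpM2l (limit _ _ k0 r2 rR).
    by rewrite mulr_ge0// exprn_ge0// ltW.
  - by rewrite ler_wpM2l// ltW.
  - by rewrite /kap mulrAC ler_pdivrMr ?ltr_wpDl// ler_wpM2l ?(ltW ep)// lerDl.
apply: le_trans base _.
have ral := rr r r0 r1; have ral0 := powR_ge0 r al.
have g2 : g (2 * r) <= 4 * (r * r `^ al).
  rewrite /g powRM ?(ltW r0)// (_ : 4 * (r * r `^ al) = 2 * r * (2 * r `^ al)); last by ring.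
  rewrite ler_wpM2l ?(ltW r2)// ler_wpM2r//.
  by rewrite -[leRHS](@powRr1 _ 2)//; apply: ler_powR => //; rewrite ler1n.
apply: (@le_trans _ _ ((2 ^+ (n + 2) * (4 * A) + eta1) * r ^+ n.+1 * r `^ al)).
  rewrite [leRHS](_ : _ = 2 ^+ (n + 2) * (4 * A) * r ^+ n.+1 * r `^ al + eta1 * r ^+ n.+1 * r `^ al); last by ring.
  apply: lerD.
    apply: (@le_trans _ _ (2 * (2 * r) ^+ n * (2 * A * (4 * (r * r `^ al))))).
      apply: ler_wpM2l; first by rewrite mulr_ge0// exprn_ge0// ltW.
      by apply: ler_wpM2l => //; rewrite mulr_ge0.
    by rewrite exprMn exprD [r ^+ n.+1]exprS le_eqVlt; apply/orP; left; apply/eqP; ring.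
  rewrite mulrC; apply: ler_wpM2l => //.
  by rewrite mulr_ge0 ?(ltW e10)// exprn_ge0// ltW.
rewrite -[leLHS]mulrA -[leRHS]mulrA; apply: ler_wpM2r; first by rewrite mulr_ge0// exprn_ge0// ltW.
have -> : 2 ^+ (n + 2) * (4 * A) = height_const * tau + D * (eps * L) + 2 * (D * eta1).
  by rewrite /height_const /A /D /c1 [4 ^+ n.+1]exprS; ring.
have De : D * eta1 = eta / 6 by rewrite /eta1; field; rewrite gt_eqF.
have : eta1 <= D * eta1.
  by rewrite ler_peMl ?(ltW e10)// /D (le_trans q4)// ler_peMl// (le_trans _ q4).
rewrite De; lra.
Unshelve. all: by end_near. Qed.

End HeightDecay.

Lemma invn_bounds (R : realType) (n : nat) : (0 < n)%N -> 0 < (n%:R^-1 : R) <= 1.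
Proof. by move=> n0; rewrite invr_gt0 ltr0n n0 invf_le1 ?ltr0n// ler1n. Qed.

Lemma two_powR_le (R : realType) (x : R) (j : nat) : x <= j%:R -> 2 `^ x <= 2 ^+ j.
Proof. by move=> xj; rewrite -powR_mulrn//; apply: ler_powR => //; rewrite ler1n. Qed.

(** * Supremum bound for the height if p = n *)

Section SupDecay.
Context {R : realType} {k n : nat} {w : R} {V : local_data R k}.
Hypothesis VS : local_spec n w V.
Context {p M : R} {lam : set 'rV[R]_k -> R} {a : 'rV[R]_k} {P : 'M[R]_k}.
Hypothesis PS : point_spec n V p M lam a P.
Local Notation nu := (ld_mu V).
Local Notation T := (ld_plane V).
Local Notation v := (ld_var V).
Local Notation E := (expect nu).
Local Notation m := (mass nu).
Local Notation tilt := (@tilt R k V).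

Local Notation hc := (@height_const R n).

Let n0 : (0 < n)%N := ls_n VS.
Let gP := ps_grass PS.
Let cs := sobolev_const n w.
Let cs0 : 0 < cs := sobolev_const_gt0 n (ls_w VS).

Definition sup_rate : R := sobolev_const n w * (128 + 16 * (1 + 2 ^+ n * M)).
(** The largest initial value that [de_giorgi] admits for [B = 2], exponent [1/n - b] and rate
    [sup_rate]. *)
Definition sup_start (b : R) : R :=
  (2 `^ (- (n%:R^-1 - b)^-1) / 2 / sup_rate) `^ (n%:R^-1 - b)^-1.
(** Chebyshev's inequality at half the final level, applied to the bound of [height_decay] on
    [B(a, 2 r)], yields the initial value [sup_start] for this constant. *)
Definition sup_const (b : R) : R :=
  1 + 2 ^+ (n + 3) * (hc * (1 + M) + 1) / sup_start b.

Lemma sup_rate_gt0 : 0 < sup_rate.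
Proof.
have M0 := ps_M PS; have : 0 <= (2 : R) ^+ n * M by rewrite mulr_ge0// exprn_ge0.
move=> h; apply: mulr_gt0 => //; lra.
Qed.

Lemma sup_start_gt0 b : 0 < sup_start b.
Proof.
have h1 := sup_rate_gt0; have h2 : 0 < (2 : R) `^ (- (n%:R^-1 - b)^-1) by exact: powR_gt0.
by rewrite /sup_start powR_gt0// divr_gt0// divr_gt0.
Qed.

Lemma height_const_ge0 : 0 <= hc.
Proof.
have h1 : 0 <= (2 : R) ^+ (n + 2) by exact: exprn_ge0.
have h2 : 0 <= (4 : R) ^+ n.+1 by exact: exprn_ge0.
apply: mulr_ge0; first exact: mulr_ge0.
by rewrite mulr_ge0// addr_ge0// mulr_ge0.
Qed.

Lemma sup_const_ge1 b : 1 <= sup_const b.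
Proof.
rewrite /sup_const lerDl divr_ge0 ?(ltW (sup_start_gt0 b))//.
have h1 : 0 <= (2 : R) ^+ (n + 3) by exact: exprn_ge0.
have h2 := mulr_ge0 height_const_ge0 (addr_ge0 ler01 (ps_M PS)).
apply: mulr_ge0 => //; lra.
Qed.

Lemma height_chebyshev r t : 0 <= t ->
  t * m (steep a P r t) <= E (fun y => height a P y * \1_(eball a r) y).
Proof.
move=> t0; apply: ge_mass_indic.
- exact: (bborel_height_ball PS).
- exact: measurable_steep.
move=> y; have h0 := height_ge0 a P y; rewrite !indicE.
have [/set_mem[ya yt]|_] := boolP (y \in steep a P r t).
  by rewrite mem_set// !mulr1; exact: ltW.
by rewrite mulr0 mulr_ge0.
Qed.

(** Here [b = 1/q], and the hypothesis on the tilt is Hoelder's inequality, including [q = oo] as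
    [b = 0]. In units of [tau r^(1 + al)] the tilt term gives the power [1 + 1/n - b] of the
    relative mass, which exceeds 1 because [q > n]. *)
Lemma height_sup_decay b tau al : p = n%:R -> 0 <= b -> b < n%:R^-1 -> 0 < tau -> 0 < al -> al <= 1 ->
  (\forall r \near 0^'+, forall A : set (eucl R k), measurable A -> A `<=` eball a r ->
     E (fun y => tilt P y * \1_A y) <= tau * r `^ al * r `^ (n%:R * b) * m A `^ (1 - b)) ->
  \forall r \near 0^'+, m (steep a P r (sup_const b * tau * (r * r `^ al))) = 0.
Proof.
move=> pn b0 bn tau0 al0 al1 hD; have M0 := ps_M PS.
have /andP[nV nV1] := invn_bounds R n0.
have nr0 : 0 < n%:R :> R by rewrite ltr0n.
have nb1 : n%:R * b <= 1 by rewrite mulrC -ler_pdivlMr// mul1r ltW.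
have b1 : b <= 1 by exact: le_trans (ltW bn) nV1.
pose be := n%:R^-1 - b; have be0 : 0 < be by rewrite subr_gt0.
pose K0 := sup_const b; have K1 : 1 <= K0 := sup_const_ge1 b.
have K00 : 0 < K0 := lt_le_trans ltr01 K1.
have D0 : 0 < 1 + M by rewrite ltr_pwDl.
have tM : 0 <= tau * (1 + M) by rewrite mulr_ge0 ?ltW.
have pM : M `^ (1 - b) <= 1 + M.
  have [M1|M1] := leP M 1.
    apply: (@le_trans _ _ (1 `^ (1 - b))); last by rewrite powR1 lerDl.
    by apply: ge0_ler_powR; rewrite ?nnegrE ?subr_ge0.
  apply: (@le_trans _ _ (M `^ 1)); last by rewrite powRr1// lerDr.
  by apply: ler_powR; [exact: ltW|lra].
have hL1 : \forall r \near 0^'+, E (fun y => tilt P y * \1_(eball a r) y) <= tau * (1 + M) * r ^+ n * r `^ al.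
  have hm := ps_mass PS; near=> r.
  have r0 : 0 < r by near: r; exact: nbhs_right_gt.
  have mB : measurable (eball a r : set (eucl R k)) by exact: open_measurable_eucl (@open_eball R k a r).
  have hD' : forall A : set (eucl R k), measurable A -> A `<=` eball a r ->
     E (fun y => tilt P y * \1_A y) <= tau * r `^ al * r `^ (n%:R * b) * m A `^ (1 - b).
    by near: r.
  apply: le_trans (hD' _ mB (@subset_refl _ _)) _.
  have hm' : m (eball a r) <= M * r ^+ n by near: r.
  have h1 : m (eball a r) `^ (1 - b) <= (1 + M) * r `^ (n%:R * (1 - b)).
    apply: (@le_trans _ _ ((M * r ^+ n) `^ (1 - b))).
      by apply: ge0_ler_powR; rewrite ?nnegrE ?subr_ge0 ?mass_ge0// mulr_ge0// exprn_ge0// ltW.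
    rewrite powRM ?exprn_ge0 ?(ltW r0)// -powR_mulrn ?(ltW r0)// -powRrM.
    by rewrite ler_wpM2r ?powR_ge0.
  have rn : r ^+ n = r `^ (n%:R * b) * r `^ (n%:R * (1 - b)).
    by rewrite -powRD ?(gt_eqF r0) ?implybT// -mulrDr subrKC mulr1 powR_mulrn ?(ltW r0).
  apply: (@le_trans _ _ (tau * r `^ al * r `^ (n%:R * b) * ((1 + M) * r `^ (n%:R * (1 - b))))).
    by rewrite ler_wpM2l// mulr_ge0 ?powR_ge0// mulr_ge0 ?powR_ge0 ?ltW.
  by rewrite rn le_eqVlt; apply/orP; left; apply/eqP; ring.
have hH := height_decay VS PS tM al0 al1 hL1 tau0.
have [L L0 hL] := ps_lam PS.
have two0 : 0 < (2 : R) by [].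
have hH2 := near0_scale two0 hH; have hL2 := near0_scale two0 hL.
have hd2 := near0_scale two0 (ps_dom PS); have hm2 := near0_scale two0 (ps_mass PS).
have hD2 := near0_scale two0 hD.
pose rho : R := 2 `^ (- be^-1); have rho0 : 0 < rho by exact: powR_gt0.
pose L' := cs * (2 * L `^ n%:R^-1); have L'0 : 0 <= L'.
  by rewrite mulr_ge0 ?(ltW cs0)// mulr_ge0// powR_ge0.
have small0 : 0 < rho / 2 / (L' + 1) by rewrite !divr_gt0// ltr_wpDl.
near=> r.
have r0 : 0 < r by near: r; exact: nbhs_right_gt.
have rn : 0 < r ^+ n by rewrite exprn_gt0.
have ral : 0 < r `^ al by exact: powR_gt0.
pose sg := r * r `^ al; have sg0 : 0 < sg by rewrite mulr_gt0.
pose K := K0 * tau * sg; have Kp : 0 < K by rewrite mulr_gt0// mulr_gt0.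
have dom2 : eball a (2 * r) `<=` ld_dom V by near: r.
have mass2 : m (eball a (2 * r)) <= M * (2 * r) ^+ n by near: r.
have lam2 : lam (eball a (2 * r)) <= L * (2 * r) ^+ n by near: r.
have hgt2 : E (fun y => height a P y * \1_(eball a (2 * r)) y) <=
   (hc * (tau * (1 + M)) + tau) * (2 * r) ^+ n.+1 * (2 * r) `^ al by near: r.
have til2 : forall A : set (eucl R k), measurable A -> A `<=` eball a (2 * r) ->
     E (fun y => tilt P y * \1_A y) <= tau * (2 * r) `^ al * (2 * r) `^ (n%:R * b) * m A `^ (1 - b).
  by near: r.
have rsmall : L' * r <= rho / 2.
  have : r < rho / 2 / (L' + 1) by near: r; exact: nbhs_right_lt.
  rewrite ltr_pdivlMr ?ltr_wpDl// mulrDr mulr1 mulrC => h; lra.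
have h0 : 0 <= (2^-1 : R) by rewrite invr_ge0.
have h1 : (2^-1 : R) <= 1 by rewrite invf_le1// ler1n.
have hp i : 0 < (2^-1 : R) ^+ i by rewrite exprn_gt0// invr_gt0.
have hp1 i : (2^-1 : R) ^+ i <= 1 by exact: exprn_ile1.
have hpS i : (2^-1 : R) ^+ i.+1 = 2^-1 * 2^-1 ^+ i by rewrite exprS.
pose rk i := r * (1 + 2^-1 ^+ i); pose tk i := K * (1 - 2^-1 ^+ i.+1).
pose A i := steep a P (rk i) (tk i).
have mA i : measurable (A i : set (eucl R k)) by exact: measurable_steep.
have A0 i : A i `<=` eball a (2 * r).
  move=> y [+ _]; rewrite /eball /= => /lt_le_trans; apply.
  by rewrite /rk (mulrC 2) ler_pM2l//; have := hp1 i; lra.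
have Alast i : steep a P r K `<=` A i.
  apply: steep_sub; first by rewrite /rk ler_peMr ?(ltW r0)// lerDl ltW.
  by rewrite /tk ler_piMr ?(ltW Kp)// gerBl ltW.
pose d i := m (A i) / r ^+ n.
have d_ge0 i : 0 <= d i by rewrite divr_ge0 ?mass_ge0 ?ltW.
have mE i : m (A i) = d i * r ^+ n by rewrite /d divfK// gt_eqF.
have dM i : d i <= 2 ^+ n * M.
  rewrite /d ler_pdivrMr//.
  have h : m (A i) <= m (eball a (2 * r)).
    by apply: mass_le; [exact: mA|exact: open_measurable_eucl (@open_eball R k a _)|exact: A0].
  apply: le_trans h (le_trans mass2 _); rewrite exprMn le_eqVlt; apply/orP; left; apply/eqP; ring.
have powm i x : m (A i) `^ x = d i `^ x * r `^ (n%:R * x).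
  by rewrite mE powRM ?(ltW rn)// -powR_mulrn ?(ltW r0)// -powRrM.
have rpow x y : r `^ x * r `^ y = r `^ (x + y) by rewrite -powRD// (gt_eqF r0) implybT.
have p2r x : (2 * r) `^ x = 2 `^ x * r `^ x by rewrite powRM// ltW.
have dpow i x y : 0 <= y -> x + y != 0 -> d i `^ x * d i `^ y = d i `^ (x + y).
  by move=> y0 xy; rewrite -powRD// (negPf xy).
have C0 := sup_rate_gt0.
have step i : d i.+1 <= (sup_rate * 2 ^+ i * d i `^ be + L' * r) * d i.
  have rr : rk i.+1 < rk i by rewrite /rk ltr_pM2l// ltrD2l hpS; have := hp i; lra.
  have tt : tk i < tk i.+1 by rewrite /tk ltr_pM2l// ltrD2l ltrN2 !hpS; have := hp i; lra.
  have rk0 : 0 < rk i.+1 by rewrite mulr_gt0// addr_gt0.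
  have tk0 : 0 <= tk i by rewrite mulr_ge0 ?subr_ge0// ltW.
  have domA : eball a (rk i) `<=` ld_dom V.
    apply: subset_trans dom2; move=> y; rewrite /eball /= => /lt_le_trans; apply.
    by rewrite /rk (mulrC 2) ler_pM2l//; have := hp1 i; lra.
  have := level_estimate VS gP rk0 rr tk0 tt domA.
  rewrite -/(A i) -/(A i.+1) => hlev.
  set ET := E _ in hlev.
  have tiltE : ET <= tau * (2 * r) `^ al * (2 * r) `^ (n%:R * b) * m (A i) `^ (1 - b).
    apply: le_trans (til2 _ (mA i) (A0 i)).
    apply: expect_le.
    - by apply: bborelM; [exact: (bborel_tilt VS gP)|apply: bborel_indic_eucl; exact: measurable_low].
    - by apply: bborelM; [exact: (bborel_tilt VS gP)|exact: bborel_indic_eucl].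
    move=> y; apply: ler_wpM2l; first exact: tilt_ge0.
    rewrite !indicE; have [/set_mem[yA _]|_] := boolP (y \in _ `&` _); first by rewrite (mem_set yA).
    by rewrite ler0n.
  have tE : tk i.+1 - tk i = K * 2^-1 ^+ i / 4 by rewrite /tk !hpS; field.
  have rE : rk i - rk i.+1 = r * 2^-1 ^+ i / 2 by rewrite /rk !hpS; field.
  have i2 : (2 : R) ^+ i = (2^-1 ^+ i)^-1 by rewrite exprVn invrK.
  have i20 : 0 < (2 : R) ^+ i by rewrite exprn_gt0.
  have k1 : 8 / (tk i.+1 - tk i) * ET <= 128 * 2 ^+ i * (d i `^ (1 - b) * (r ^+ n / r)).
    apply: (@le_trans _ _ (8 / (tk i.+1 - tk i) * (tau * (2 * r) `^ al * (2 * r) `^ (n%:R * b) * m (A i) `^ (1 - b)))).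
      by rewrite ler_wpM2l// divr_ge0// subr_ge0 ltW.
    rewrite tE powm !p2r.
    have -> : r ^+ n / r = r `^ (n%:R * b) * r `^ (n%:R * (1 - b)) / r.
      by rewrite rpow -mulrDr subrKC mulr1 powR_mulrn ?(ltW r0).
    have e1 : 2 `^ al <= (2 : R) ^+ 1 by exact: two_powR_le.
    have e2 : 2 `^ (n%:R * b) <= (2 : R) ^+ 1 by exact: two_powR_le.
    have e3 : 2 `^ al * 2 `^ (n%:R * b) <= (4 : R).
      by rewrite (_ : (4 : R) = 2 ^+ 1 * 2 ^+ 1); [apply: ler_pM; rewrite ?powR_ge0|ring].
    set x1 := r `^ (n%:R * b); set x2 := r `^ (n%:R * (1 - b)); set x3 := d i `^ (1 - b).
    have -> : 8 / (K * 2^-1 ^+ i / 4) * (tau * (2 `^ al * r `^ al) * (2 `^ (n%:R * b) * x1) * (x3 * x2)) =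
      32 / K0 * 2 ^+ i * (x3 * (x1 * x2 / r)) * (2 `^ al * 2 `^ (n%:R * b)).
      by rewrite i2 /K /sg; field; rewrite !gt_eqF.
    have y0 : 0 <= x3 * (x1 * x2 / r).
      by apply: mulr_ge0; [exact: powR_ge0|apply: divr_ge0 (ltW r0); apply: mulr_ge0; exact: powR_ge0].
    have -> : 128 * 2 ^+ i * (x3 * (x1 * x2 / r)) = 32 / 1 * 2 ^+ i * (x3 * (x1 * x2 / r)) * 4 by field.
    apply: ler_pM => //.
    - by apply: mulr_ge0 => //; apply: mulr_ge0 (ltW i20); rewrite divr_ge0// ltW.
    - by rewrite ler_wpM2r// ler_wpM2r ?(ltW i20)// ler_wpM2l// lef_pV2 ?posrE.
  have k2 : 8 / (rk i - rk i.+1) * m (A i) = 16 * 2 ^+ i * (d i * (r ^+ n / r)).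
    by rewrite rE mE i2; field; rewrite !gt_eqF.
  (* For [p = n] the factor [lam^(1/n)] is of order [r]. After multiplication by the Sobolev factor,
     the variation is linear in [d i] with coefficient [L' * r], which [de_giorgi] tolerates for
     small [r] whatever [L] is. *)
  have k3 : v (A i) <= 2 * L `^ n%:R^-1 * r * (d i `^ (1 - n%:R^-1) * (r ^+ n / r)).
    have oA : open (A i) by exact: open_steep.
    have oB : open (eball a (2 * r)) by exact: open_eball.
    have dA : A i `<=` ld_dom V by move=> y /A0/dom2.
    have lA : lam (A i) <= L * (2 * r) ^+ n.
      by apply: le_trans lam2; apply: (ps_lam_mono PS oA oB).
    apply: le_trans (var_le PS oA dA lA (lexx _)) _.
    rewrite pn powm powRM ?exprn_ge0 ?mulr_ge0 ?(ltW r0)//.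
    rewrite -(powR_mulrn _ (mulr_ge0 (ltW two0) (ltW r0))) -powRrM divff ?gt_eqF//.
    rewrite powRr1 ?mulr_ge0 ?(ltW r0)//.
    have -> : r `^ (n%:R * (1 - n%:R^-1)) = r ^+ n / r.
      rewrite mulrBr mulr1 divff ?gt_eqF// powRB ?(gt_eqF r0) ?implybT//.
      by rewrite powRr1 ?(ltW r0)// powR_mulrn ?(ltW r0).
    by rewrite le_eqVlt; apply/orP; left; apply/eqP; ring.
  rewrite {1}/d ler_pdivrMr//; apply: le_trans hlev _.
  have csA : 0 <= sobolev_const n w * m (A i) `^ n%:R^-1 by rewrite mulr_ge0 ?powR_ge0// ltW.
  apply: (@le_trans _ _ (sobolev_const n w * m (A i) `^ n%:R^-1 *
     (128 * 2 ^+ i * (d i `^ (1 - b) * (r ^+ n / r)) + 16 * 2 ^+ i * (d i * (r ^+ n / r)) +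
      2 * L `^ n%:R^-1 * r * (d i `^ (1 - n%:R^-1) * (r ^+ n / r))))).
    by rewrite ler_wpM2l// k2; apply: lerD => //; apply: lerD.
  rewrite powm divff ?gt_eqF// powRr1 ?(ltW r0)//.
  have f1 : d i `^ n%:R^-1 * d i `^ (1 - b) = d i `^ be * d i.
    rewrite dpow ?subr_ge0//; last by rewrite gt_eqF//; lra.
    rewrite -[X in _ * X](powRr1 (d_ge0 i)) dpow//; last by rewrite gt_eqF//; lra.
    by congr (_ `^ _); rewrite /be; ring.
  (* The radial cut-off term has a surplus power [d^b], which the upper bound [2^n * M] for the
     relative mass turns into a constant. *)
  have f2 : d i `^ n%:R^-1 <= (1 + 2 ^+ n * M) * d i `^ be.
    have -> : d i `^ n%:R^-1 = d i `^ b * d i `^ be.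
      by rewrite dpow ?(ltW be0)//; [congr (_ `^ _); rewrite /be; ring|rewrite gt_eqF// /be; lra].
    rewrite ler_wpM2r ?powR_ge0//; have [d1|d1] := leP (d i) 1.
      apply: (@le_trans _ _ 1); last by rewrite lerDl; exact: le_trans (d_ge0 i) (dM i).
      have := @ge0_ler_powR R b b0 (d i) 1; rewrite powR1; apply; rewrite ?nnegrE//.
    apply: (@le_trans _ _ (d i `^ 1)); first by apply: ler_powR => //; exact: ltW.
    by rewrite powRr1//; have := dM i; lra.
  have f3 : d i `^ n%:R^-1 * d i `^ (1 - n%:R^-1) = d i.
    by rewrite dpow ?subr_ge0// subrKC ?powRr1 ?oner_neq0.
  have -> : sobolev_const n w * (d i `^ n%:R^-1 * r) *
     (128 * 2 ^+ i * (d i `^ (1 - b) * (r ^+ n / r)) + 16 * 2 ^+ i * (d i * (r ^+ n / r)) +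
      2 * L `^ n%:R^-1 * r * (d i `^ (1 - n%:R^-1) * (r ^+ n / r))) =
    sobolev_const n w * (128 * 2 ^+ i * (d i `^ n%:R^-1 * d i `^ (1 - b)) + 16 * 2 ^+ i * d i * d i `^ n%:R^-1 +
      2 * L `^ n%:R^-1 * r * (d i `^ n%:R^-1 * d i `^ (1 - n%:R^-1))) * r ^+ n.
    by field; rewrite gt_eqF.
  rewrite f1 f3; apply: ler_wpM2r; first exact: ltW.
  have -> : (sup_rate * 2 ^+ i * d i `^ be + L' * r) * d i =
     sobolev_const n w * (128 * 2 ^+ i * (d i `^ be * d i) + 16 * 2 ^+ i * d i * ((1 + 2 ^+ n * M) * d i `^ be) +
      2 * L `^ n%:R^-1 * r * d i) by rewrite /sup_rate /L' /cs; ring.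
  apply: ler_wpM2l; first exact: ltW.
  by rewrite lerD2r lerD2l ler_wpM2l// mulr_ge0// mulr_ge0// ltW.
have d0small : sup_rate * d 0%N `^ be <= 2 `^ (- be^-1) / 2.
  have st0 := sup_start_gt0 b; have hc0 := height_const_ge0.
  have hq : d 0%N <= sup_start b.
    have hK : K / 2 <= tk 0%N by rewrite /tk expr1; lra.
    have hm : K / 2 * m (steep a P (2 * r) (K / 2)) <= (hc * (tau * (1 + M)) + tau) * (2 * r) ^+ n.+1 * (2 * r) `^ al.
      by apply: le_trans hgt2; apply: height_chebyshev; rewrite divr_ge0// ltW.
    have hA : m (A 0%N) <= m (steep a P (2 * r) (K / 2)).
      apply: mass_le; [exact: mA|exact: measurable_steep|].
      by apply: steep_sub => //; rewrite /rk expr0; lra.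
    have e1 : (2 * r) `^ al <= 2 * r `^ al.
      by rewrite powRM ?(ltW r0)// ler_wpM2r ?(ltW ral)// -[leRHS]expr1; exact: two_powR_le.
    have B0 : 0 <= (hc * (tau * (1 + M)) + tau) * (2 * r) ^+ n.+1.
      apply: mulr_ge0; last by rewrite exprn_ge0// mulr_ge0 ?ltW.
      by have := mulr_ge0 hc0 tM; lra.
    have hm' : K / 2 * m (A 0%N) <= (hc * (tau * (1 + M)) + tau) * (2 * r) ^+ n.+1 * (2 * r `^ al).
      apply: (@le_trans _ _ (K / 2 * m (steep a P (2 * r) (K / 2)))).
        by rewrite ler_wpM2l// divr_ge0// ltW.
      by apply: le_trans hm _; rewrite ler_wpM2l.
    have hm2' : K0 * d 0%N <= 2 ^+ (n + 3) * (hc * (1 + M) + 1).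
      have pos_ : 0 < tau * sg * r ^+ n / 2 by rewrite divr_gt0// mulr_gt0// mulr_gt0.
      rewrite -(ler_pM2l pos_); have -> : tau * sg * r ^+ n / 2 * (K0 * d 0%N) = K / 2 * m (A 0%N).
        by rewrite mE /K; field.
      apply: le_trans hm' _; rewrite exprMn exprD [r ^+ n.+1]exprS [2 ^+ n.+1]exprS /sg.
      by rewrite le_eqVlt; apply/orP; left; apply/eqP; field.
    have : 2 ^+ (n + 3) * (hc * (1 + M) + 1) <= K0 * sup_start b.
      rewrite /K0 /sup_const mulrDl divfK ?gt_eqF// lerDr mul1r ltW//.
    by move=> /(le_trans hm2'); rewrite ler_pM2l.
  have hq2 : d 0%N `^ be <= 2 `^ (- be^-1) / 2 / sup_rate.
    apply: (@le_trans _ _ (sup_start b `^ be)).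
      by apply: ge0_ler_powR; rewrite ?nnegrE ?(ltW be0) ?(ltW st0).
    rewrite /sup_start -/be -powRrM mulVf ?gt_eqF// powRr1//.
    by rewrite !divr_ge0 ?(ltW C0)// powR_ge0.
  by rewrite mulrC -ler_pdivlMr.
have B1 : 1 < (2 : R) by rewrite ltr1n.
have kp : 0 <= L' * r by rewrite mulr_ge0// ltW.
apply/eqP; rewrite eq_le mass_ge0 andbT leNgt; apply/negP => h.
have [i hi] := de_giorgi B1 be0 (ltW C0) kp d_ge0 step d0small rsmall (divr_gt0 h rn).
move: hi; rewrite /d ltNge => /negP; apply.
rewrite ler_pM2r ?invr_gt0//; apply: mass_le; [exact: measurable_steep|exact: mA|exact: Alast].
Unshelve. all: by end_near. Qed.

End SupDecay.

(** * Inequalities of Young and Hoelder type, dyadic sums *)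

Section PowerInequalities.
Context {R : realType}.
Implicit Types (u z x y t c q : R).

Lemma powR_mul_add x s t : 0 < x -> x `^ s * x `^ t = x `^ (s + t).
Proof. by move=> x0; rewrite -powRD// (gt_eqF x0) implybT. Qed.

Lemma ge0_powR_mono q x y : 0 <= q -> 0 <= x -> x <= y -> x `^ q <= y `^ q.
Proof. by move=> q0 x0 xy; apply: ge0_ler_powR; rewrite ?nnegrE//; exact: le_trans xy. Qed.

(** Distinguish whether [z <= del * u]. The exponents of [del] have opposite signs, so the term with
    [u] can be made small at the expense of the other. *)
Lemma young_split u z del th : 0 <= u -> 0 <= z -> 0 < del -> 0 < th -> th < 1 ->
  u `^ (1 - th) * z `^ th <= del `^ th * u + del `^ (th - 1) * z.
Proof.
move=> u0 z0 d0 t0 t1; have t1' : 0 <= 1 - th by rewrite subr_ge0 ltW.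
have A0 : 0 <= del `^ th * u by rewrite mulr_ge0// powR_ge0.
have B0 : 0 <= del `^ (th - 1) * z by rewrite mulr_ge0// powR_ge0.
have pw x : 0 <= x -> x `^ (1 - th) * x `^ th = x.
  by move=> x0; rewrite -powRD ?subrK ?powRr1// oner_eq0.
have [zu|uz] := leP z (del * u).
  apply: (@le_trans _ _ (del `^ th * u)); last by rewrite lerDl.
  rewrite -[X in _ <= _ * X]pw// mulrCA ler_wpM2l ?powR_ge0//.
  by rewrite -powRM ?(ltW d0)//; apply: ge0_powR_mono => //; exact: ltW.
apply: (@le_trans _ _ (del `^ (th - 1) * z)); last by rewrite lerDr.
rewrite -[X in _ <= _ * X]pw// mulrA ler_wpM2r ?powR_ge0//.
have -> : del `^ (th - 1) = (del^-1) `^ (1 - th).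
  by rewrite -powR_inv1 ?(ltW d0)// -powRrM; congr (_ `^ _); ring.
rewrite -powRM ?invr_ge0 ?(ltW d0)//; apply: ge0_powR_mono => //.
by rewrite mulrC ler_pdivlMr// mulrC ltW.
Qed.

(** A pointwise substitute for Hoelder's inequality: the first term is the value where [f <= c], the
    second dominates [f] elsewhere. Being linear after integration, it can be applied level by level
    and summed, with [c] chosen for each level. *)
Lemma weak_holder f c q : 0 <= f -> 0 < c -> 1 <= q -> f <= c + c `^ (1 - q) * f `^ q.
Proof.
move=> f0 c0 q1; have B0 : 0 <= c `^ (1 - q) * f `^ q by rewrite mulr_ge0 ?powR_ge0.
have [fc|cf] := leP f c; first by rewrite -[leLHS]addr0 lerD.
have fp : 0 < f := lt_trans c0 cf.
apply: (@le_trans _ _ (c `^ (1 - q) * f `^ q)); last by rewrite lerDr ltW.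
have {1}-> : f = f `^ (1 - q) * f `^ q by rewrite powR_mul_add// subrK powRr1// ltW.
rewrite ler_wpM2r ?powR_ge0// -(opprB q) !powRN lef_pV2 ?posrE ?powR_gt0//.
by apply: ge0_powR_mono; rewrite ?subr_ge0// ltW.
Qed.

Lemma dyadic_sum_le x0 q N : 0 < x0 -> 1 <= q ->
  \sum_(j < N) (x0 * 2 ^+ j) `^ q <= (x0 * 2 ^+ N) `^ q.
Proof.
move=> x00 q1; elim: N => [|N IH]; first by rewrite big_ord0 powR_ge0.
rewrite big_ord_recr /=; apply: le_trans (lerD IH (lexx _)) _.
have p0 : 0 <= x0 * 2 ^+ N by rewrite mulr_ge0 ?exprn_ge0// ltW.
have -> : (x0 * 2 ^+ N.+1) `^ q = 2 `^ q * (x0 * 2 ^+ N) `^ q by rewrite exprS mulrCA (powRM _ _ p0).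
have h2 : 2 <= 2 `^ q :> R.
  by rewrite -[leLHS](@powRr1 _ 2)//; apply: ler_powR => //; rewrite ler1n.
have := powR_ge0 (x0 * 2 ^+ N) q; nra.
Qed.

(** The terms present form an initial part of a sequence growing at least geometrically with ratio
    2, so their sum is at most twice the last one. Together with the next lemma it replaces the
    layer-cake formula. *)
Lemma dyadic_layer_le x0 q N X : 0 < x0 -> 1 <= q -> 0 <= X ->
  \sum_(j < N) (x0 * 2 ^+ j) `^ q * ((x0 * 2 ^+ j < X)%R)%:R <= 2 * X `^ q.
Proof.
move=> x00 q1 X0; elim: N => [|N IH]; first by rewrite big_ord0 mulr_ge0// powR_ge0.
rewrite big_ord_recr /=; have [lt_|ge_] := ltP (x0 * 2 ^+ N) X; last by rewrite mulr0 addr0.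
have p0 : 0 <= x0 * 2 ^+ N by rewrite mulr_ge0 ?exprn_ge0// ltW.
have h1 : (x0 * 2 ^+ N) `^ q <= X `^ q by apply: ge0_powR_mono => //; lra.
rewrite mulr1; apply: (@le_trans _ _ ((x0 * 2 ^+ N) `^ q + (x0 * 2 ^+ N) `^ q)); last by lra.
rewrite lerD2r; apply: le_trans (dyadic_sum_le N x00 q1); apply: ler_sum => j _.
by rewrite ler_piMr ?powR_ge0//; case: (_ < _).
Qed.

Lemma dyadic_layer_ge x0 q N h : 0 < x0 -> 1 <= q -> 0 <= h -> h <= x0 * 2 ^+ N.+1 ->
  h `^ q <= (x0 * 2) `^ q + \sum_(j < N) (x0 * 2 ^+ j.+2) `^ q * ((x0 * 2 ^+ j.+1 < h)%R)%:R.
Proof.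
move=> x00 q1 h0; have q0 : 0 <= q := le_trans ler01 q1.
have s0 i : 0 <= \sum_(j < i) (x0 * 2 ^+ j.+2) `^ q * ((x0 * 2 ^+ j.+1 < h)%R)%:R.
  by apply: sumr_ge0 => j _; rewrite mulr_ge0// powR_ge0.
elim: N => [|N IH] hN; first by rewrite big_ord0 addr0; apply: ge0_powR_mono.
rewrite big_ord_recr /=; have [lt_|ge_] := ltP (x0 * 2 ^+ N.+1) h.
  rewrite mulr1 addrA; apply: (@le_trans _ _ ((x0 * 2 ^+ N.+2) `^ q)); first exact: ge0_powR_mono.
  by rewrite lerDr; apply: addr_ge0; [exact: powR_ge0|exact: s0].
by rewrite mulr0 addr0; exact: IH.
Qed.

End PowerInequalities.

Section ExpectBig.
Context {d : measure_display} {X : measurableType d} {R : realType} {I : Type}.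
Variable nu : {finite_measure set X -> \bar R}.

Lemma bborel_big (f : I -> X -> R) (s : seq I) : (forall j, bborel (f j)) ->
  bborel (fun x => \sum_(j <- s) f j x).
Proof.
move=> bf; elim: s => [|i s IH].
  by under eq_fun do rewrite big_nil; exact: bborel_cst.
by under eq_fun do rewrite big_cons; exact: bborelD.
Qed.

Lemma expect_big (f : I -> X -> R) (s : seq I) : (forall j, bborel (f j)) ->
  expect nu (fun x => \sum_(j <- s) f j x) = \sum_(j <- s) expect nu (f j).
Proof.
move=> bf; elim: s => [|i s IH].
  under eq_fun do rewrite big_nil -(mul0r (0 : R)).
  by rewrite big_nil expectZ ?mul0r//; exact: bborel_cst.
under eq_fun do rewrite big_cons.
by rewrite big_cons -IH expectD//; exact: bborel_big.
Qed.

End ExpectBig.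

Section ExpectSum.
Context {d : measure_display} {X : measurableType d} {R : realType}.
Variable nu : {finite_measure set X -> \bar R}.

Lemma bborel_sum (f : nat -> X -> R) N : (forall j, bborel (f j)) ->
  bborel (fun x => \sum_(j < N) f j x).
Proof. by move=> bf; apply: (bborel_big (f := fun j : 'I_N => f j)). Qed.

Lemma expect_sum (f : nat -> X -> R) N : (forall j, bborel (f j)) ->
  expect nu (fun x => \sum_(j < N) f j x) = \sum_(j < N) expect nu (f j).
Proof. by move=> bf; apply: (expect_big nu (f := fun j : 'I_N => f j)). Qed.

Lemma bborel_powR (f : X -> R) (q : R) : 0 <= q -> (forall x, 0 <= f x) -> bborel f ->
  bborel (fun x => f x `^ q).
Proof.
move=> q0 f0 [mf [M hM]]; split.
  by apply: (@measurableT_comp _ _ _ _ _ _ (fun t : R => t `^ q)) => //; exact: measurable_powR.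
exists (M `^ q) => x; rewrite ger0_norm ?powR_ge0//; apply: ge0_powR_mono => //.
exact: le_trans (ler_norm _) (hM x).
Qed.

End ExpectSum.

Section LevelTerms.
Context {R : realType}.
Implicit Types (x Y be th : R).

(* The weight in the weak Hoelder inequality that balances its two terms. *)
Lemma tilt_term x Y be th q1 q2 (iN : R) : 1 <= x -> 0 < Y -> 0 <= be -> x `^ q2 * be <= Y -> 0 <= th ->
  0 < q1 -> 0 < iN -> q2 * (q1^-1 - iN) <= 1 ->
  x `^ q2 * be `^ iN / x * (x `^ (q2 / q1) * Y `^ (- q1^-1) * be +
     (x `^ (q2 / q1) * Y `^ (- q1^-1)) `^ (1 - q1) * th) <=
  Y `^ (1 - q1^-1 + iN) * (Y^-1 * (x `^ q2 * be) + th).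
Proof.
move=> x1 Y0 be0 xbY th0 q10 iN0 hq; have x0 : 0 < x := lt_le_trans ltr01 x1.
set c := x `^ (q2 / q1) * Y `^ (- q1^-1).
have c0 : 0 < c by rewrite mulr_gt0// powR_gt0.
have hb : be `^ iN <= Y `^ iN * x `^ (- (q2 * iN)).
  have -> : x `^ (- (q2 * iN)) = (x `^ (- q2)) `^ iN by rewrite -powRrM mulNr.
  rewrite -powRM ?powR_ge0 ?(ltW Y0)//; apply: ge0_powR_mono => //; first exact: ltW.
  by rewrite powRN ler_pdivlMr ?powR_gt0// mulrC.
have s0 : 0 <= c * be + c `^ (1 - q1) * th.
  by rewrite addr_ge0 ?mulr_ge0 ?powR_ge0// ltW.
have xl : x `^ (q2 / q1 - q2 * iN - 1) <= 1.
  rewrite -[leRHS](@powRr0 _ x); apply: ler_powR => //.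
  by move: hq; rewrite mulrBr; lra.
apply: (@le_trans _ _ (x `^ q2 * (Y `^ iN * x `^ (- (q2 * iN))) / x * (c * be + c `^ (1 - q1) * th))).
  by apply: ler_wpM2r => //; rewrite ler_wpM2r ?invr_ge0 ?(ltW x0)// ler_wpM2l// powR_ge0.
have xV : x^-1 = x `^ (- 1) by rewrite powR_inv1// ltW.
have YV : Y^-1 = Y `^ (- 1) by rewrite powR_inv1// ltW.
have c1 : c `^ (1 - q1) = x `^ (q2 / q1 - q2) * Y `^ (1 - q1^-1).
  rewrite /c powRM ?powR_ge0// -!powRrM; congr (_ `^ _ * _ `^ _); field; exact: lt0r_neq0.
have e1 : x `^ q2 * (Y `^ iN * x `^ (- (q2 * iN))) / x * (c * be) =
    x `^ (q2 / q1 - q2 * iN - 1) * (Y `^ (1 - q1^-1 + iN) * (Y^-1 * (x `^ q2 * be))).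
  rewrite xV YV /c.
  rewrite (_ : Y `^ (1 - q1^-1 + iN) = Y `^ 1 * Y `^ (- q1^-1) * Y `^ iN); last by rewrite !powR_mul_add.
  rewrite (_ : x `^ (q2 / q1 - q2 * iN - 1) = x `^ (q2 / q1) * x `^ (- (q2 * iN)) * x `^ (- 1)); last by rewrite !powR_mul_add.
  have YY : Y `^ 1 * Y `^ (- 1) = 1 by rewrite powR_mul_add// subrr powRr0.
  rewrite -[LHS]mul1r -{1}YY; ring.
have e2 : x `^ q2 * (Y `^ iN * x `^ (- (q2 * iN))) / x * (c `^ (1 - q1) * th) =
    x `^ (q2 / q1 - q2 * iN - 1) * (Y `^ (1 - q1^-1 + iN) * th).
  rewrite xV c1 (_ : Y `^ (1 - q1^-1 + iN) = Y `^ (1 - q1^-1) * Y `^ iN); last by rewrite !powR_mul_add.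
  rewrite (_ : x `^ (q2 / q1 - q2 * iN - 1) = x `^ q2 * x `^ (- (q2 * iN)) * x `^ (- 1) * x `^ (q2 / q1 - q2)).
    by ring.
  by rewrite !powR_mul_add//; congr (_ `^ _); ring.
rewrite mulrDr e1 e2 -mulrDr -mulrDr ler_piMl//.
rewrite mulr_ge0 ?powR_ge0// addr_ge0// mulr_ge0 ?invr_ge0 ?(ltW Y0)//.
by rewrite mulr_ge0// powR_ge0.
Qed.

(* [th] is the reciprocal of the Sobolev exponent of [p]. *)
Lemma variation_term x r b lam v del p th q2 (n : nat) : (0 < n)%N -> 0 < r -> 1 <= x -> 0 <= b -> 0 <= lam -> 0 < del ->
  1 <= p -> p < n%:R -> v <= lam `^ p^-1 * b `^ (1 - p^-1) -> th = p^-1 - n%:R^-1 ->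
  x `^ q2 * (b / r ^+ n) `^ n%:R^-1 * (r / r ^+ n * v) <=
    del `^ th * (x `^ q2 * (b / r ^+ n)) +
    del `^ (th - 1) * (x `^ q2 * (r * (lam / r ^+ n) `^ p^-1) `^ th^-1).
Proof.
move=> n0 r0 x1 b0 l0 d0 p1 pn hv thE; have x0 : 0 < x := lt_le_trans ltr01 x1.
have rn : 0 < r ^+ n by exact: exprn_gt0.
have p0 : 0 < p := lt_le_trans ltr01 p1.
have nr : 0 < n%:R :> R by rewrite ltr0n.
have th0 : 0 < th by rewrite thE subr_gt0 ltf_pV2.
have ip1 : p^-1 <= 1 by rewrite invf_le1.
have iN : 0 < n%:R^-1 :> R by rewrite invr_gt0.
have th1 : th < 1 by rewrite thE; lra.
set be := b / r ^+ n; set La := lam / r ^+ n.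
have be0 : 0 <= be by rewrite divr_ge0// ltW.
have La0 : 0 <= La by rewrite divr_ge0// ltW.
have u0 : 0 <= x `^ q2 * be by rewrite mulr_ge0// powR_ge0.
have z0 : 0 <= x `^ q2 * (r * La `^ p^-1) `^ th^-1 by rewrite mulr_ge0// powR_ge0.
have hv' : r / r ^+ n * v <= r * La `^ p^-1 * be `^ (1 - p^-1).
  have -> : r * La `^ p^-1 * be `^ (1 - p^-1) = r / r ^+ n * (lam `^ p^-1 * b `^ (1 - p^-1)).
    have -> : lam `^ p^-1 = La `^ p^-1 * (r ^+ n) `^ p^-1.
      by rewrite -(powRM _ La0 (ltW rn)) divfK// gt_eqF.
    have -> : b `^ (1 - p^-1) = be `^ (1 - p^-1) * (r ^+ n) `^ (1 - p^-1).
      by rewrite -(powRM _ be0 (ltW rn)) divfK// gt_eqF.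
    have e : (r ^+ n) `^ p^-1 * (r ^+ n) `^ (1 - p^-1) = r ^+ n.
      by rewrite powR_mul_add// subrKC powRr1// ltW.
    have -> : r / r ^+ n * (La `^ p^-1 * (r ^+ n) `^ p^-1 * (be `^ (1 - p^-1) * (r ^+ n) `^ (1 - p^-1))) =
       r / r ^+ n * (La `^ p^-1 * be `^ (1 - p^-1)) * ((r ^+ n) `^ p^-1 * (r ^+ n) `^ (1 - p^-1)) by ring.
    by rewrite e; field; rewrite gt_eqF.
  by rewrite ler_wpM2l// divr_ge0// ltW.
have [b00|bN] := eqVneq be 0.
  by rewrite b00 powR0 ?gt_eqF// !mulr0 mul0r add0r mulr_ge0// powR_ge0.
have bep : 0 < be by rewrite lt_neqAle eq_sym bN.
apply: le_trans (young_split u0 z0 d0 th0 th1).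
have -> : (x `^ q2 * be) `^ (1 - th) * (x `^ q2 * (r * La `^ p^-1) `^ th^-1) `^ th =
    x `^ q2 * be `^ n%:R^-1 * (r * La `^ p^-1 * be `^ (1 - p^-1)).
  have rL : 0 <= r * La `^ p^-1 by rewrite mulr_ge0 ?powR_ge0// ltW.
  rewrite (powRM _ (powR_ge0 _ _) be0) (powRM _ (powR_ge0 _ _) (powR_ge0 _ _)).
  rewrite -[(_ `^ th^-1) `^ th]powRrM mulVf ?gt_eqF// powRr1//.
  have xE : (x `^ q2) `^ (1 - th) * (x `^ q2) `^ th = x `^ q2.
    by rewrite powR_mul_add ?powR_gt0// subrK powRr1// powR_ge0.
  have bE : be `^ (1 - th) = be `^ n%:R^-1 * be `^ (1 - p^-1).
    by rewrite powR_mul_add//; congr (_ `^ _); rewrite thE; ring.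
  by rewrite bE -[in RHS]xE; ring.
by rewrite ler_wpM2l// mulr_ge0// powR_ge0.
Qed.

End LevelTerms.

Lemma half_of_parts (R : realFieldType) (x y z t : R) :
  x <= 48^-1 * t -> y <= 48^-1 * t -> z <= 6^-1 * t -> 8 * x + 8 * y + z <= t / 2.
Proof. lra. Qed.

Lemma regroup_parts (R : realFieldType) (b c d x y : R) :
  b <= x + y -> b + 8 * c + (d + 1) <= x + 1 + (y + 8 * c + d).
Proof. lra. Qed.

(** * Power means of the height if p < n: one doubling of the radius *)

Section PowerDecay.
Context {R : realType} {k n : nat} {w : R} {V : local_data R k}.
Hypothesis VS : local_spec n w V.
Context {p M : R} {lam : set 'rV[R]_k -> R} {a : 'rV[R]_k} {P : 'M[R]_k}.
Hypothesis PS : point_spec n V p M lam a P.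
Local Notation nu := (ld_mu V).
Local Notation T := (ld_plane V).
Local Notation v := (ld_var V).
Local Notation E := (expect nu).
Local Notation m := (mass nu).
Local Notation tilt := (@tilt R k V).
Local Notation hc := (@height_const R n).

Let n0 : (0 < n)%N := ls_n VS.
Let gP := ps_grass PS.
Local Notation cs := (sobolev_const n w).
Let cs0 : 0 < cs := sobolev_const_gt0 n (ls_w VS).
Variables (q1 q2 : R).
Hypotheses (q11 : 1 <= q1) (q1n : q1 < n%:R) (q21 : 1 <= q2) (q21s : q2 * (q1^-1 - n%:R^-1) <= 1).

Let e := 1 - q1^-1 + n%:R^-1.
(** [4^q2] for shifting the dyadic levels by two, the Sobolev constant, and the factor by which the
    weighted sum of level masses exceeds [pow_avg] at radius [2 r]. *)
Definition pow_factor : R := 4 `^ q2 * cs * (2 * 2 ^+ n * 4 `^ q2).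
Definition pow_cheb : R := (hc * (1 + M) + 1) * 2 ^+ (n + 2).
(** The first level, in units of [tau r^(1 + al)]: by Chebyshev's inequality all masses above it are
    so small that the radial cut-off terms can be absorbed. *)
Definition pow_start : R := 1 + pow_cheb * (48 * pow_factor) ^+ n.
(** The weight in Young's inequality for the power [Y^e], with [e = 1 - 1/q1 + 1/n < 1], that makes
    the part linear in [Y] absorbable. *)
Definition pow_young : R := (48 * (1 + 4 ^+ n) * pow_factor)^-1 `^ (1 - (1 - q1^-1 + n%:R^-1))^-1.
(** What is not absorbed: heights below twice the first level, and the constants left over from
    Young's inequality and the variation. *)
Definition pow_add : R := (2 * pow_start) `^ q2 * M +
  4 `^ q2 * cs * (8 * (1 + 4 ^+ n) * (pow_young `^ (1 - (1 - q1^-1 + n%:R^-1)) +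
    pow_young `^ (- (1 - q1^-1 + n%:R^-1))) + 1).

Lemma pow_factor_gt0 : 0 < pow_factor.
Proof.
have h : 0 < (4 : R) `^ q2 by exact: powR_gt0.
have h2 : 0 < (2 : R) ^+ n by exact: exprn_gt0.
have two0 : 0 < (2 : R) by [].
exact: (mulr_gt0 (mulr_gt0 h cs0) (mulr_gt0 (mulr_gt0 two0 h2) h)).
Qed.

Lemma pow_cheb_ge0 : 0 <= pow_cheb.
Proof.
have h := mulr_ge0 (height_const_ge0 (R := R) (n := n)) (addr_ge0 ler01 (ps_M PS)).
by rewrite mulr_ge0 ?exprn_ge0// addr_ge0.
Qed.

Lemma pow_start_ge1 : 1 <= pow_start.
Proof.
rewrite /pow_start lerDl; apply: mulr_ge0 pow_cheb_ge0 _.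
by apply: exprn_ge0; rewrite mulr_ge0// ltW// pow_factor_gt0.
Qed.

Lemma pow_exponent : 0 < e /\ e < 1.
Proof.
have q10 : 0 < q1 := lt_le_trans ltr01 q11.
have h1 : n%:R^-1 < q1^-1 by rewrite ltf_pV2 ?posrE ?ltr0n.
have h2 : q1^-1 <= 1 by rewrite invf_le1.
have h3 : 0 < n%:R^-1 :> R by rewrite invr_gt0 ltr0n.
by rewrite /e; split; lra.
Qed.

Lemma pow_young_gt0 : 0 < pow_young.
Proof.
have h := pow_factor_gt0; have h4 : 0 < (4 : R) ^+ n by exact: exprn_gt0.
by rewrite powR_gt0// invr_gt0 mulr_gt0// mulr_gt0// addr_gt0.
Qed.

Variables (tau al : R).
Hypotheses (tau0 : 0 < tau) (al0 : 0 < al) (al1 : al <= 1).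
Let sg r := tau * (r * r `^ al).

Definition rel_height r (y : eucl R k) : R := height a P y / (tau * (r * r `^ al)).
Definition pow_avg r : R :=
  (r ^+ n)^-1 * E (fun y => (rel_height r y * \1_(eball a r) y) `^ q2).

Lemma sg_gt0 r : 0 < r -> 0 < sg r.
Proof. by move=> r0; rewrite mulr_gt0// mulr_gt0// powR_gt0. Qed.

Lemma rel_height_ge0 r y : 0 < r -> 0 <= rel_height r y.
Proof. by move=> r0; rewrite divr_ge0 ?height_ge0// ltW// sg_gt0. Qed.

Lemma bborel_rel_height r : 0 < r -> bborel (fun y => (rel_height r y * \1_(eball a r) y) `^ q2).
Proof.
move=> r0; apply: bborel_powR.
- exact: le_trans ler01 q21.
- by move=> y; rewrite mulr_ge0 ?rel_height_ge0// indicE.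
have -> : (fun y => rel_height r y * \1_(eball a r) y) =
    fun y => (sg r)^-1 * (height a P y * \1_(eball a r) y).
  by apply/funext => y; rewrite /rel_height -/(sg r); ring.
by apply: bborelM; [exact: bborel_cst|exact: (bborel_height_ball PS)].
Qed.

Lemma sg_double r : 0 < r -> sg (2 * r) <= 4 * sg r.
Proof.
move=> r0; rewrite /sg powRM ?(ltW r0)//.
have h : 2 `^ al <= (2 : R) ^+ 1 by exact: two_powR_le.
have s0 := sg_gt0 r0; have -> : tau * (2 * r * (2 `^ al * r `^ al)) = 2 * 2 `^ al * sg r by rewrite /sg; ring.
by rewrite ler_wpM2r ?(ltW s0)//; lra.
Qed.

(** Apply [level_estimate] at the levels [x j], multiply by [x j ^ q2] and sum: a dyadic layer-cake
    sum at radius [r] is compared with one at [2 r]. The tilt gives the sublinear power [Y^e], the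
    radial term has a small coefficient by Chebyshev's inequality, and Young's inequality splits the
    variation. Their absorbed parts are [8/48], [8/48] and [1/6], in total [1/2]. *)
Lemma pow_avg_step r del eps eta1 L : 0 < r -> r <= 1 ->
  eball a (2 * r) `<=` ld_dom V ->
  m (eball a (2 * r)) <= M * (2 * r) ^+ n -> m (eball a r) <= M * r ^+ n ->
  E (fun y => height a P y * \1_(eball a (2 * r)) y) <=
    (hc * (tau * (1 + M)) + tau) * (2 * r) ^+ n.+1 * (2 * r) `^ al ->
  E (fun y => tilt P y `^ q1 * \1_(eball a (2 * r)) y) <= (tau * (2 * r) `^ al) `^ q1 * (2 * r) ^+ n ->
  p < n%:R -> al * q2 <= (p^-1 - n%:R^-1)^-1 ->
  0 < eps -> 0 <= eta1 -> 0 <= L -> 0 < del ->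
  lam (eball a (2 * r)) <= L * (2 * r) ^+ n ->
  lam (steep a P (2 * r) (eps * (2 * r))) <= eta1 * (2 * r) ^+ n ->
  let th := p^-1 - n%:R^-1 in
  del `^ th * pow_factor <= 6^-1 ->
  del `^ (th - 1) * (2 * (2 / tau) `^ q2 * ((eta1 * 2 ^+ n) `^ (p^-1 / th) + (L * 2 ^+ n) `^ (p^-1 / th) * eps `^ q2)) <= 1 ->
  pow_avg r <= pow_add + pow_avg (2 * r) / 2.
Proof.
move=> r0 r1 dom2 mass2 mass1 hgt2 til2 pn alp e0 eta10 L0 d0 lam2 lamf /= dfac dz.
set th := p^-1 - n%:R^-1 in alp dfac dz.
have M0 := ps_M PS; have p1 := ps_p PS; have p0 : 0 < p := lt_le_trans ltr01 p1.
have two0 : 0 < (2 : R) by [].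
have rn : 0 < r ^+ n by exact: exprn_gt0.
have s0 := sg_gt0 r0; have cf0 := pow_factor_gt0; have ch0 := pow_cheb_ge0.
have [ee0 ee1] := pow_exponent; have q10 : 0 < q1 := lt_le_trans ltr01 q11.
have q20 : 0 < q2 := lt_le_trans ltr01 q21.
have nr : 0 < n%:R :> R by rewrite ltr0n.
have iN : 0 < n%:R^-1 :> R by rewrite invr_gt0.
have th0 : 0 < th by rewrite subr_gt0 ltf_pV2.
have r2 : 0 < 2 * r by rewrite mulr_gt0.
have ral : 0 < r `^ al by exact: powR_gt0.
pose K0 := pow_start; have K1 : 1 <= K0 := pow_start_ge1.
have K00 : 0 < K0 := lt_le_trans ltr01 K1.
pose x (j : nat) := K0 * 2 ^+ j; pose t j := x j * sg r.
have x1 j : 1 <= x j by rewrite /x mulr_ege1// exprn_ege1// ler1n.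
have x0 j : 0 < x j := lt_le_trans ltr01 (x1 j).
have t0 j : 0 < t j by rewrite mulr_gt0.
have tS j : t j.+1 - t j = t j by rewrite /t /x exprS; ring.
pose B j := steep a P (2 * r) (t j); pose A j := steep a P r (t j).
pose la j : set 'rV[R]_k := B j `&` [set y | height a P y <= t j.+1].
have mB j : measurable (B j : set (eucl R k)) by exact: measurable_steep.
have mA j : measurable (A j : set (eucl R k)) by exact: measurable_steep.
have mla j : measurable (la j : set (eucl R k)) by exact: measurable_low.
have mb2 : measurable (eball a (2 * r) : set (eucl R k)) by exact: open_measurable_eucl (@open_eball R k a _).
have mb1 : measurable (eball a r : set (eucl R k)) by exact: open_measurable_eucl (@open_eball R k a _).
have rr2 : r < 2 * r by lra.
have btilt := bborel_tilt VS gP.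
have btq : bborel (fun y : eucl R k => tilt P y `^ q1).
  by apply: bborel_powR => //; [exact: ltW|move=> y; exact: tilt_ge0].
pose be j := m (B j) / r ^+ n.
have be0 j : 0 <= be j by rewrite divr_ge0 ?mass_ge0// ltW.
have bE j : m (B j) = be j * r ^+ n by rewrite divfK// gt_eqF.
pose ths j := E (fun y => tilt P y `^ q1 * \1_(la j) y) / ((tau * r `^ al) `^ q1 * r ^+ n).
have ta0 : 0 < tau * r `^ al by rewrite mulr_gt0.
have taq : 0 < (tau * r `^ al) `^ q1 by rewrite powR_gt0.
have ths0 j : 0 <= ths j.
  rewrite divr_ge0 ?mulr_ge0 ?(ltW taq) ?(ltW rn)//.
  by apply: expect_ge0 => y; rewrite mulr_ge0 ?powR_ge0// indicE.
pose u j := x j `^ q2 * be j.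
have u0 j : 0 <= u j by rewrite mulr_ge0 ?powR_ge0.
(* Heights in [B(a, r)] are at most [r], hence below the level [2^N] in units of [sg r]. *)
pose N := projT1 (cid (pow2_gt (r / sg r))).
have hN : r / sg r < 2 ^+ N by rewrite /N; case: cid.
pose S := \sum_(j < N) u j; have S0 : 0 <= S by exact: sumr_ge0.
(* The summand 1 keeps [Y] positive; [Y] also dominates every [u j], as [tilt_term] requires. *)
pose Y := 1 + S; have Y0 : 0 < Y by rewrite ltr_pwDl.
have uY (j : 'I_N) : u j <= Y.
  by rewrite /Y /S (bigD1 j)//= addrCA lerDl addr_ge0// sumr_ge0.
have cheb j : x j * be j <= pow_cheb.
  have h := le_trans (height_chebyshev PS (2 * r) (ltW (t0 j))) hgt2.
  have h2 : (2 * r) `^ al <= 2 * r `^ al.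
    by rewrite powRM ?(ltW r0)// ler_wpM2r ?(ltW ral)// -[leRHS]expr1; exact: two_powR_le.
  have pos_ : 0 < sg r * r ^+ n by rewrite mulr_gt0.
  rewrite -(ler_pM2l pos_); have -> : sg r * r ^+ n * (x j * be j) = t j * m (B j) by rewrite bE /t; ring.
  apply: le_trans h _.
  apply: (@le_trans _ _ ((hc * (tau * (1 + M)) + tau) * (2 * r) ^+ n.+1 * (2 * r `^ al))).
    apply: ler_wpM2l => //; apply: mulr_ge0; last by rewrite exprn_ge0// ltW.
    have := mulr_ge0 (height_const_ge0 (R := R) (n := n)) (mulr_ge0 (ltW tau0) (addr_ge0 ler01 M0)).
    by move=> h3; rewrite addr_ge0// ltW.
  rewrite /pow_cheb /sg exprMn exprD [r ^+ n.+1]exprS [2 ^+ n.+1]exprS.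
  by rewrite le_eqVlt; apply/orP; left; apply/eqP; ring.
have be_small j : be j `^ n%:R^-1 * pow_factor <= 48^-1.
  have h1 : be j <= (48 * pow_factor)^-1 ^+ n.
    have F0 : 0 < 48 * pow_factor by rewrite mulr_gt0.
    have Fn : 0 < (48 * pow_factor) ^+ n by exact: exprn_gt0.
    rewrite exprVn -[leRHS]div1r ler_pdivlMr//.
    have h2 : K0 * be j <= pow_cheb.
      apply: le_trans (cheb j); rewrite ler_wpM2r//.
      by rewrite /x ler_peMr ?(ltW K00)// exprn_ege1// ler1n.
    have h3 : pow_cheb * (48 * pow_factor) ^+ n <= K0 by rewrite /K0 /pow_start lerDr.
    have [b1|b1] := eqVneq (be j) 0; first by rewrite b1 mul0r.
    have bp : 0 < be j by rewrite lt_neqAle eq_sym b1 be0.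
    have c0 : 0 < pow_cheb by apply: lt_le_trans h2; rewrite mulr_gt0.
    rewrite -(ler_pM2l c0) mulr1; apply: le_trans h2.
    by rewrite mulrCA mulrC ler_wpM2r.
  have h2 : be j `^ n%:R^-1 <= (48 * pow_factor)^-1.
    apply: (@le_trans _ _ (((48 * pow_factor)^-1 ^+ n) `^ n%:R^-1)).
      by apply: ge0_powR_mono => //; exact: ltW.
    have F0 : 0 <= (48 * pow_factor)^-1 by rewrite invr_ge0 mulr_ge0// ltW.
    by rewrite -powR_mulrn// -powRrM divff ?gt_eqF// powRr1.
  apply: (@le_trans _ _ ((48 * pow_factor)^-1 * pow_factor)); first by rewrite ler_wpM2r// ltW.
  by rewrite le_eqVlt; apply/orP; left; apply/eqP; field; rewrite gt_eqF.
pose La j := lam (B j) / r ^+ n.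
pose z j := x j `^ q2 * (r * La j `^ p^-1) `^ th^-1.
have sub2 j : B j `<=` eball a (2 * r) by exact: steep_eball.
have oB j : open (B j) by exact: open_steep.
have o2 : open (eball a (2 * r)) by exact: open_eball.
have La0 j : 0 <= La j by rewrite divr_ge0 ?(ps_lam_ge0 PS)// ltW.
have b0_far j : 2 * r <= t j -> m (B j) = 0.
  move=> h; have -> : B j = set0.
    apply/seteqP; split => // y [ya yt]; have := grass_perp_enorm (y - a) gP.
    rewrite -/(height a P y) => h'.
    by have := lt_le_trans (lt_le_trans yt (le_trans h' (ltW ya))) h; rewrite ltxx.
  by rewrite /mass measure0.
(* Levels beyond [2 r] carry no mass and can be discarded; this bounds the range of [x j] in the sum
   over the variation. *)
pose zz j := if 2 * r <= t j then 0 else z j.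
have zz0 j : 0 <= zz j by rewrite /zz; case: ifP => // _; rewrite mulr_ge0 ?powR_ge0.
have term (j : 'I_N) : x j `^ q2 * (m (A j.+1) / r ^+ n) <= cs * (8 * (Y `^ e * (Y^-1 * u j + ths j)) +
    8 * (be j `^ n%:R^-1 * u j) + (del `^ th * u j + del `^ (th - 1) * zz j)).
  have tt : t j < t j.+1 by rewrite -subr_gt0 tS.
  have := level_estimate VS gP r0 rr2 (ltW (t0 j)) tt dom2.
  rewrite -/(B j) -/(A j.+1) -/(la j) => hlev.
  set ET := E _ in hlev.
  pose c' := x j `^ (q2 / q1) * Y `^ (- q1^-1).
  have c'0 : 0 < c' by rewrite mulr_gt0// powR_gt0.
  pose c := tau * r `^ al * c'; have c0 : 0 < c by rewrite mulr_gt0.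
  pose G := c' * be j + c' `^ (1 - q1) * ths j.
  have tiltE : ET <= tau * r `^ al * r ^+ n * G.
    have b1 : bborel (fun y : eucl R k => c * \1_(B j) y).
      by apply: bborelM; [exact: bborel_cst|exact: bborel_indic_eucl].
    have b2 : bborel (fun y : eucl R k => tilt P y `^ q1 * \1_(la j) y).
      by apply: bborelM => //; exact: bborel_indic_eucl.
    have b3 : bborel (fun y : eucl R k => c `^ (1 - q1) * (tilt P y `^ q1 * \1_(la j) y)).
      by apply: bborelM => //; exact: bborel_cst.
    have -> : tau * r `^ al * r ^+ n * G = E (fun y => c * \1_(B j) y + c `^ (1 - q1) * (tilt P y `^ q1 * \1_(la j) y)).
      rewrite expectD// !expectZ//; last exact: bborel_indic_eucl.
      rewrite (expect_indic _ (mB j)) bE.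
      have -> : E (fun y => tilt P y `^ q1 * \1_(la j) y) = ths j * ((tau * r `^ al) `^ q1 * r ^+ n).
        by rewrite /ths divfK// gt_eqF// mulr_gt0.
      rewrite /c (powRM _ (ltW ta0) (ltW c'0)) -/c'.
      have eq_ : (tau * r `^ al) `^ (1 - q1) * (tau * r `^ al) `^ q1 = tau * r `^ al.
        by rewrite powR_mul_add// subrK powRr1// ltW.
      rewrite /G mulrDr; congr (_ + _); first by ring.
      have swap (c1 c2 c3 c4 c5 c6 : R) : c1 * c2 = c3 -> c3 * c4 * (c5 * c6) = c1 * c5 * (c6 * (c2 * c4)).
        by move=> <-; ring.
      exact: swap eq_.
    apply: expect_le.
    - by apply: bborelM; [exact: btilt|exact: bborel_indic_eucl].
    - exact: bborelD.
    move=> y; rewrite [\1_(la j) y]indicE; have [/set_mem yl|_] := boolP (y \in la j); last first.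
      by rewrite !mulr0 addr0 mulr_ge0 ?(ltW c0)// indicE.
    have -> : \1_(B j) y = 1 :> R by rewrite indicE mem_set//; case: yl.
    by rewrite !mulr1; apply: weak_holder => //; exact: tilt_ge0.
  have bn : m (B j) `^ n%:R^-1 = be j `^ n%:R^-1 * r.
    by rewrite bE (powRM _ (be0 j) (ltW rn)) -powR_mulrn ?(ltW r0)// -powRrM divff ?gt_eqF// powRr1 ?(ltW r0).
  set b1n := be j `^ n%:R^-1 in bn *.
  have b1n0 : 0 <= b1n by exact: powR_ge0.
  have xq0 : 0 <= x j `^ q2 by exact: powR_ge0.
  have hT := tilt_term (x1 j) Y0 (be0 j) (uY j) (ths0 j) q10 iN q21s.
  have hV : x j `^ q2 * b1n * (r / r ^+ n * v (B j)) <= del `^ th * u j + del `^ (th - 1) * zz j.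
    have [far|near_] := leP (2 * r) (t j).
      have -> : b1n = 0 by rewrite /b1n /be b0_far// mul0r powR0// gt_eqF.
      by rewrite mulr0 mul0r addr_ge0// mulr_ge0 ?powR_ge0.
    have -> : zz j = z j by rewrite /zz leNgt near_.
    have dB : B j `<=` ld_dom V by exact: subset_trans dom2.
    exact: (variation_term q2 n0 r0 (x1 j) (mass_ge0 _ _) (ps_lam_ge0 PS _) d0 p1 pn (ps_var PS (oB j) dB)).
  apply: (@le_trans _ _ (cs * (8 * (x j `^ q2 * b1n / x j * G) + 8 * (b1n * u j) + x j `^ q2 * b1n * (r / r ^+ n * v (B j))))); last first.
    rewrite ler_wpM2l ?(ltW cs0)//; apply: lerD => //; rewrite lerD2r ler_wpM2l//.
  apply: (@le_trans _ _ (x j `^ q2 * (cs * (b1n * r) * (8 / t j * (tau * r `^ al * r ^+ n * G) + 8 / r * m (B j) + v (B j)) / r ^+ n))).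
    rewrite ler_wpM2l// ler_wpM2r ?invr_ge0 ?(ltW rn)//; apply: le_trans hlev _.
    rewrite bn tS (_ : 2 * r - r = r); last by ring.
    apply: ler_wpM2l; first exact: (mulr_ge0 (ltW cs0) (mulr_ge0 b1n0 (ltW r0))).
    by rewrite !lerD2r; apply: ler_wpM2l => //; rewrite divr_ge0// ltW.
  rewrite bE /u le_eqVlt; apply/orP; left; apply/eqP; rewrite /t /sg; field.
  by rewrite !gt_eqF.
(* The layers are disjoint, so these terms add up to one integral of [tilt^q1] over [B(a, 2 r)]. The
   doubling costs [2^n * 2^(al q1) <= 4^n], as [al <= 1] and [q1 < n]. *)
have sum_ths : \sum_(j < N) ths j <= 4 ^+ n.
  have bl j : bborel (fun y : eucl R k => tilt P y `^ q1 * \1_(la j) y).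
    by apply: bborelM => //; exact: bborel_indic_eucl.
  rewrite /ths -mulr_suml ler_pdivrMr ?mulr_gt0// -(expect_sum _ _ bl).
  apply: (@le_trans _ _ (E (fun y => tilt P y `^ q1 * \1_(eball a (2 * r)) y))).
    apply: expect_le; [exact: (bborel_sum N bl)|by apply: bborelM => //; exact: bborel_indic_eucl|].
    move=> y; rewrite -mulr_sumr ler_wpM2l ?powR_ge0//.
    have key i : \sum_(j < i) (\1_(la j) y : R) <= \1_(eball a (2 * r) `&` [set y | height a P y <= t i]) y.
      elim: i => [|i IH]; first by rewrite big_ord0 indicE.
      rewrite big_ord_recr /=; apply: le_trans (lerD IH (lexx _)) _; rewrite !indicE.
      have [/set_mem[ya yi]|_] := boolP (y \in eball a (2 * r) `&` _).
        have -> : y \in la i = false by apply/negP => /set_mem[[_ h] _]; move: (lt_le_trans h yi); rewrite ltxx.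
        rewrite addr0 mem_set//; split=> //=; apply: le_trans yi _.
        by rewrite -subr_ge0 tS ltW.
      rewrite add0r; have [/set_mem[[ya _] yi]|_] := boolP (y \in la i); last by rewrite ler0n.
      by rewrite mem_set.
    apply: le_trans (key N) _; rewrite !indicE.
    by have [/set_mem[ya _]|_] := boolP (y \in _ `&` _); [rewrite mem_set|rewrite ler0n].
  apply: le_trans til2 _.
  rewrite (powRM _ (ltW two0) (ltW r0)) mulrCA (powRM q1 (powR_ge0 _ _) (ltW ta0)) -powRrM exprMn.
  have h1 : 2 `^ (al * q1) <= (2 : R) ^+ n.
    by apply: two_powR_le; have := ler_wpM2r (ltW q10) al1; rewrite mul1r => /le_trans; apply; exact: ltW.
  rewrite (_ : 4 ^+ n = 2 ^+ n * 2 ^+ n); last by rewrite -exprMn; congr (_ ^+ _); ring.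
  have h2 : 0 <= 2 ^+ n * ((tau * r `^ al) `^ q1 * r ^+ n).
    by rewrite mulr_ge0 ?exprn_ge0// mulr_ge0 ?(ltW taq)// ltW.
  have := ler_wpM2r h2 h1; rewrite !mulrA => h3; apply: le_trans h3.
  by rewrite le_eqVlt; apply/orP; left; apply/eqP; ring.
have sum_zz : del `^ (th - 1) * \sum_(j < N) zz j <= 1.
  apply: le_trans dz; rewrite ler_wpM2l ?powR_ge0//.
  set G1 := (eta1 * 2 ^+ n) `^ _; set G2 := (L * 2 ^+ n) `^ _.
  pose X := 2 * r / sg r; have X0 : 0 <= X by rewrite divr_ge0 ?(ltW s0)// ltW.
  have eX0 : 0 <= eps * X by rewrite mulr_ge0// ltW.
  have G10 : 0 <= G1 by exact: powR_ge0.
  have G20 : 0 <= G2 by exact: powR_ge0.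
  have ip0 : 0 <= p^-1 / th by rewrite divr_ge0 ?invr_ge0// ltW.
  have rth : 0 <= r `^ th^-1 by exact: powR_ge0.
  (* Above the height [2 eps r] the value of [lam] is small by the density argument. Below it only
     [L] is available, but there [x j < eps * X], and the dyadic sum gains [eps^q2]. *)
  have zle j : zz j <= r `^ th^-1 * (G1 * (x j `^ q2 * ((x j < X)%R)%:R) + G2 * (x j `^ q2 * ((x j < eps * X)%R)%:R)).
    have i0 (b : bool) : 0 <= x j `^ q2 * b%:R by rewrite mulr_ge0 ?powR_ge0.
    rewrite /zz; case: ifP => [_|/negbT]; first by rewrite mulr_ge0// addr_ge0// mulr_ge0.
    rewrite -ltNge => h; have -> : x j < X by rewrite /X ltr_pdivlMr.
    rewrite mulr1 /z (powRM _ (ltW r0) (powR_ge0 _ _)) -powRrM mulrCA ler_wpM2l//.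
    have [flat|low] := leP (eps * (2 * r)) (t j).
      have LG : La j <= eta1 * 2 ^+ n.
        rewrite /La ler_pdivrMr// -mulrA -exprMn; apply: le_trans lamf.
        apply: (ps_lam_mono PS (oB j)); first exact: open_steep.
          exact: steep_sub.
        by move=> y /steep_eball/dom2.
      rewrite -[leLHS]addr0 mulrC; apply: lerD; last by rewrite mulr_ge0.
      rewrite ler_wpM2r ?powR_ge0//; exact: ge0_powR_mono.
    have LG : La j <= L * 2 ^+ n.
      by rewrite /La ler_pdivrMr// -mulrA -exprMn; apply: le_trans lam2; exact: (ps_lam_mono PS (oB j) o2).
    have -> : x j < eps * X by rewrite /X mulrA ltr_pdivlMr.
    rewrite mulr1 -[leLHS]add0r mulrC; apply: lerD; first by rewrite mulr_ge0 ?powR_ge0.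
    by rewrite ler_wpM2r ?powR_ge0//; exact: ge0_powR_mono.
  apply: (@le_trans _ _ (r `^ th^-1 * (G1 * (2 * X `^ q2) + G2 * (2 * (eps * X) `^ q2)))).
    apply: le_trans (ler_sum _ (fun (j : 'I_N) _ => zle j)) _.
    rewrite -mulr_sumr ler_wpM2l// big_split /= -!mulr_sumr; apply: lerD; apply: ler_wpM2l => //; exact: dyadic_layer_le.
  rewrite (powRM _ (ltW e0) X0).
  (* This is the point where [al * q2] must not exceed the Sobolev exponent [1/th] of [p]: [X] is a
     multiple of [r^(-al)], and the remaining power of [r <= 1] is nonnegative. *)
  have hX : r `^ th^-1 * X `^ q2 <= (2 / tau) `^ q2.
    have -> : X = 2 / tau * r `^ (- al).
      by rewrite /X /sg powRN; field; rewrite !gt_eqF.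
    rewrite powRM ?powR_ge0 ?divr_ge0 ?(ltW tau0)// -powRrM mulrCA (powR_mul_add _ _ r0) ler_piMr ?powR_ge0//.
    have := @ger_powR R r; rewrite r0 r1 => /(_ isT 0 (th^-1 + - al * q2)); rewrite powRr0; apply.
    by rewrite mulNr subr_ge0.
  have := ler_wpM2r (addr_ge0 G10 (mulr_ge0 G20 (powR_ge0 eps q2))) hX.
  move=> h; have : 0 <= (2 : R) by [].
  move=> /ler_wpM2l/(_ _ _ h); rewrite mulrA => h2.
  rewrite -[leRHS]mulrA; apply: le_trans h2; rewrite le_eqVlt; apply/orP; left; apply/eqP; ring.
have S_le : S <= 2 * 2 ^+ n * 4 `^ q2 * pow_avg (2 * r).
  have bB j : bborel (fun y : eucl R k => x j `^ q2 * \1_(B j) y).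
    by apply: bborelM; [exact: bborel_cst|exact: bborel_indic_eucl].
  have SE : S = (r ^+ n)^-1 * E (fun y => \sum_(j < N) x j `^ q2 * \1_(B j) y).
    rewrite (expect_sum _ N bB) mulr_sumr; apply: eq_bigr => j _.
    by rewrite expectZ ?expect_indic//; [rewrite /u /be; ring|exact: bborel_indic_eucl].
  have -> : 2 * 2 ^+ n * 4 `^ q2 * pow_avg (2 * r) =
     (r ^+ n)^-1 * (2 * 4 `^ q2 * E (fun y => (rel_height (2 * r) y * \1_(eball a (2 * r)) y) `^ q2)).
    by rewrite /pow_avg exprMn; field; rewrite !gt_eqF// exprn_gt0.
  have bR := bborel_rel_height r2.
  rewrite SE ler_wpM2l ?invr_ge0 ?(ltW rn)// -expectZ//.
  apply: expect_le; [exact: (bborel_sum N bB)|by apply: bborelM => //; exact: bborel_cst|].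
  move=> y; have [/set_mem ya|ny] := boolP (y \in eball a (2 * r)); last first.
    rewrite big1 ?mulr_ge0 ?powR_ge0// => j _; rewrite indicE.
    have -> : y \in B j = false; last by rewrite mulr0.
    by apply/negP => /set_mem/sub2/mem_set; exact/negP.
  rewrite (_ : \1_(eball a (2 * r)) y = 1) ?mulr1; last by rewrite indicE mem_set.
  have hs : 0 <= height a P y / sg r by rewrite divr_ge0 ?height_ge0// ltW.
  apply: (@le_trans _ _ (\sum_(j < N) x j `^ q2 * ((x j < height a P y / sg r)%R)%:R)).
    apply: ler_sum => j _; rewrite indicE ler_wpM2l ?powR_ge0// ltr_pdivlMr// -/(t j) ler_nat.
    by have [/set_mem[_ /= ->]|_] := boolP (y \in B j).
  apply: le_trans (dyadic_layer_le N K00 q21 hs) _; rewrite -mulrA ler_wpM2l//.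
  have rh0 := rel_height_ge0 y r2.
  rewrite -powRM//; apply: ge0_powR_mono; [exact: ltW|exact: hs|].
  rewrite ler_pdivrMr// /rel_height -/(sg (2 * r)); have s2 := sg_gt0 r2; have sd := sg_double r0.
  have -> : 4 * (height a P y / sg (2 * r)) * sg r = height a P y * (4 * sg r) / sg (2 * r) by ring.
  by rewrite ler_pdivlMr// ler_wpM2l// height_ge0.
have Z_le : pow_avg r <= (2 * K0) `^ q2 * M + 4 `^ q2 * \sum_(j < N) x j `^ q2 * (m (A j.+1) / r ^+ n).
  have bA j : bborel (fun y : eucl R k => x j.+2 `^ q2 * \1_(A j.+1) y).
    by apply: bborelM; [exact: bborel_cst|exact: bborel_indic_eucl].
  have b1 : bborel (fun y : eucl R k => (K0 * 2) `^ q2 * \1_(eball a r) y).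
    by apply: bborelM; [exact: bborel_cst|exact: bborel_indic_eucl].
  apply: (@le_trans _ _ ((r ^+ n)^-1 * E (fun y => (K0 * 2) `^ q2 * \1_(eball a r) y + \sum_(j < N) x j.+2 `^ q2 * \1_(A j.+1) y))).
    rewrite ler_wpM2l ?invr_ge0 ?(ltW rn)//; apply: expect_le.
    - exact: bborel_rel_height.
    - by apply: bborelD => //; exact: (bborel_sum N bA).
    move=> y; have [/set_mem ya|ny] := boolP (y \in eball a r); last first.
      rewrite (_ : \1_(eball a r) y = 0) ?mulr0 ?add0r; last by rewrite indicE (negPf ny).
      rewrite powR0 ?gt_eqF//; apply: sumr_ge0 => j _.
      by rewrite mulr_ge0 ?powR_ge0// indicE.
    rewrite (_ : \1_(eball a r) y = 1) ?mulr1; last by rewrite indicE mem_set.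
    have hr : rel_height r y <= K0 * 2 ^+ N.+1.
      apply: (@le_trans _ _ (r / sg r)).
        rewrite /rel_height -/(sg r) ler_wpM2r ?invr_ge0 ?(ltW s0)//.
        by apply: le_trans (grass_perp_enorm _ gP) (ltW ya).
      by apply: le_trans (ltW hN) _; rewrite exprS mulrA ler_peMl ?exprn_ge0// mulr_ege1// ler1n.
    apply: le_trans (dyadic_layer_ge K00 q21 (rel_height_ge0 y r0) hr) _.
    rewrite lerD2l; apply: ler_sum => j _; rewrite ler_wpM2l ?powR_ge0// indicE ler_nat.
    have [h|_] := ltP (K0 * 2 ^+ j.+1) (rel_height r y) => //.
    rewrite mem_set//; split=> //=; move: h.
    by rewrite /rel_height -/(sg r) ltr_pdivlMr.
  rewrite expectD//; last exact: (bborel_sum N bA).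
  rewrite (expect_sum _ N bA) expectZ ?expect_indic//; last exact: bborel_indic_eucl.
  rewrite mulrDr; apply: lerD.
    rewrite mulrCA (mulrC K0) ler_wpM2l ?powR_ge0// mulrC ler_pdivrMr//.
  rewrite !mulr_sumr; apply: ler_sum => j _.
  rewrite expectZ ?expect_indic//; last exact: bborel_indic_eucl.
  have -> : x j.+2 `^ q2 = 4 `^ q2 * x j `^ q2.
    rewrite -powRM ?(ltW (x0 j))//; congr (_ `^ _); rewrite /x !exprS; ring.
  by rewrite le_eqVlt; apply/orP; left; apply/eqP; ring.
have sum_term : \sum_(j < N) x j `^ q2 * (m (A j.+1) / r ^+ n) <=
    cs * (8 * (Y `^ e * (1 + 4 ^+ n)) + 8 * \sum_(j < N) be j `^ n%:R^-1 * u j + (del `^ th * S + 1)).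
  apply: le_trans (ler_sum _ (fun (j : 'I_N) _ => term j)) _.
  rewrite -mulr_sumr ler_wpM2l ?(ltW cs0)// !big_split /= -!mulr_sumr.
  apply: lerD; last by rewrite lerD2l.
  rewrite lerD2r ler_wpM2l// ler_wpM2l ?powR_ge0// big_split /= -mulr_sumr.
  by apply: lerD => //; rewrite mulrC ler_pdivrMr// mul1r /Y lerDr.
have Yle : Y `^ e <= pow_young `^ (1 - e) * Y + pow_young `^ (- e).
  have e1 : 0 < 1 - e by rewrite subr_gt0.
  have e2 : 1 - e < 1 by rewrite gtrBl.
  have := young_split (ltW Y0) ler01 pow_young_gt0 e1 e2.
  by rewrite powR1 !mulr1 (_ : 1 - (1 - e) = e) 1?(_ : 1 - e - 1 = - e)//; ring.
have yf : pow_young `^ (1 - e) * pow_factor * (1 + 4 ^+ n) <= 48^-1.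
  have h4 : 0 < (4 : R) ^+ n by exact: exprn_gt0.
  have F0 : 0 < 48 * (1 + 4 ^+ n) * pow_factor by rewrite mulr_gt0// mulr_gt0// addr_gt0.
  rewrite /pow_young -/e -powRrM mulVf ?powRr1 ?invr_ge0 ?(ltW F0)//; last by rewrite subr_eq0 gt_eqF.
  by rewrite le_eqVlt; apply/orP; left; apply/eqP; field; rewrite !gt_eqF// addr_gt0.
have fin : 4 `^ q2 * cs * (8 * (pow_young `^ (1 - e) * S * (1 + 4 ^+ n)) + 8 * \sum_(j < N) be j `^ n%:R^-1 * u j + del `^ th * S)
    <= pow_avg (2 * r) / 2.
  have Z0 : 0 <= pow_avg (2 * r).
    by rewrite mulr_ge0 ?invr_ge0 ?exprn_ge0 ?(ltW r2)//; apply: expect_ge0 => y; exact: powR_ge0.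
  pose D := 4 `^ q2 * cs; have D0 : 0 < D by rewrite mulr_gt0// powR_gt0.
  have DS : D * S <= pow_factor * pow_avg (2 * r).
    by rewrite /pow_factor -/D -[leRHS]mulrA ler_wpM2l// ltW.
  have DSb : D * (\sum_(j < N) be j `^ n%:R^-1 * u j) <= 48^-1 * pow_avg (2 * r).
    have h : \sum_(j < N) be j `^ n%:R^-1 * u j <= (48 * pow_factor)^-1 * S.
      rewrite /S mulr_sumr; apply: ler_sum => j _; rewrite ler_wpM2r//.
      have := be_small j; rewrite -ler_pdivlMr// => /le_trans; apply.
      by rewrite le_eqVlt; apply/orP; left; apply/eqP; field; rewrite gt_eqF.
    have F0 : 0 <= (48 * pow_factor)^-1 by rewrite invr_ge0 mulr_ge0// ltW.
    apply: le_trans (ler_wpM2l (ltW D0) h) _; rewrite mulrCA.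
    apply: le_trans (ler_wpM2l F0 DS) _.
    by rewrite le_eqVlt; apply/orP; left; apply/eqP; field; rewrite gt_eqF.
  have T1 : D * (pow_young `^ (1 - e) * S * (1 + 4 ^+ n)) <= 48^-1 * pow_avg (2 * r).
    have c0 : 0 <= pow_young `^ (1 - e) * (1 + 4 ^+ n) by rewrite mulr_ge0 ?powR_ge0// addr_ge0// exprn_ge0.
    have := ler_wpM2l c0 DS; have := ler_wpM2r Z0 yf.
    rewrite (_ : pow_young `^ (1 - e) * pow_factor * (1 + 4 ^+ n) * pow_avg (2 * r) =
      pow_young `^ (1 - e) * (1 + 4 ^+ n) * (pow_factor * pow_avg (2 * r))); last by ring.
    rewrite (_ : D * (pow_young `^ (1 - e) * S * (1 + 4 ^+ n)) = pow_young `^ (1 - e) * (1 + 4 ^+ n) * (D * S)); last by ring.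
    by move=> h1 h2; exact: le_trans h2 h1.
  have T3 : D * (del `^ th * S) <= 6^-1 * pow_avg (2 * r).
    rewrite (mulrCA D (del `^ th) S); apply: le_trans (ler_wpM2l (powR_ge0 del th) DS) _.
    by rewrite (mulrA (del `^ th)); apply: (ler_wpM2r Z0).
  rewrite -/D (_ : D * _ = 8 * (D * (pow_young `^ (1 - e) * S * (1 + 4 ^+ n))) +
     8 * (D * \sum_(j < N) be j `^ n%:R^-1 * u j) + D * (del `^ th * S)); last by ring.
  exact: half_of_parts.
have D0 : 0 < 4 `^ q2 * cs by rewrite mulr_gt0// powR_gt0.
apply: le_trans Z_le _; rewrite /pow_add -/e -addrA; apply: lerD => //.
apply: le_trans (lerD (lexx _) fin); rewrite -[leRHS]mulrDr -[leRHS]mulrA; apply: ler_wpM2l; first exact: powR_ge0.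
apply: le_trans sum_term _; apply: ler_wpM2l; first exact: ltW.
have h4 : 0 <= 8 * (1 + 4 ^+ n) :> R by rewrite mulr_ge0// addr_ge0// exprn_ge0.
have := ler_wpM2l h4 Yle; rewrite /Y.
have -> : 8 * (1 + 4 ^+ n) * (1 + S) `^ e = 8 * ((1 + S) `^ e * (1 + 4 ^+ n)) by ring.
have -> : 8 * (1 + 4 ^+ n) * (pow_young `^ (1 - e) * (1 + S) + pow_young `^ (- e)) =
  8 * (1 + 4 ^+ n) * (pow_young `^ (1 - e) + pow_young `^ (- e)) + 8 * (pow_young `^ (1 - e) * S * (1 + 4 ^+ n)) by ring.
by move=> h; exact: regroup_parts.
Qed.

End PowerDecay.

Lemma powR_root (R : realType) (s X : R) : 0 < s -> 0 < X -> exists2 x, 0 < x & x `^ s = X.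
Proof.
move=> s0 X0; exists (X `^ s^-1); first exact: powR_gt0.
by rewrite -powRrM mulVf ?gt_eqF// powRr1// ltW.
Qed.

(** * Power means of the height: iteration over doubled radii *)

Section PowerIteration.
Context {R : realType} {k n : nat} {w : R} {V : local_data R k}.
Hypothesis VS : local_spec n w V.
Context {p M : R} {lam : set 'rV[R]_k -> R} {a : 'rV[R]_k} {P : 'M[R]_k}.
Hypothesis PS : point_spec n V p M lam a P.
Local Notation nu := (ld_mu V).
Local Notation E := (expect nu).
Local Notation m := (mass nu).
Local Notation tilt := (@tilt R k V).
Local Notation hc := (@height_const R n).
Variables (q1 q2 tau al : R).
Hypotheses (q11 : 1 <= q1) (q1n : q1 < n%:R) (q21 : 1 <= q2) (q21s : q2 * (q1^-1 - n%:R^-1) <= 1).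
Hypotheses (tau0 : 0 < tau) (al0 : 0 < al) (al1 : al <= 1).
Local Notation pavg := (@pow_avg R k n V a P q2 tau al).
Local Notation padd := (@pow_add R n w M q1 q2).
Local Notation pfac := (@pow_factor R n w q2).
Let gP := ps_grass PS.

Lemma pow_avg_bound r0 r : 0 < r0 -> r0 <= r ->
  pavg r <= (r0 ^+ n)^-1 * ((tau * r0 `^ al)^-1 `^ q2 * m setT).
Proof.
move=> r00 rr; have r1 : 0 < r := lt_le_trans r00 rr.
have q20 : 0 <= q2 := le_trans ler01 q21.
have pr0 : 0 < r0 `^ al by exact: powR_gt0.
have pr1 : 0 < r `^ al by exact: powR_gt0.
apply: ler_pM.
- by rewrite invr_ge0 exprn_ge0// ltW.
- by apply: expect_ge0 => y; exact: powR_ge0.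
- by rewrite lef_pV2 ?posrE ?exprn_gt0// lerXn2r ?nnegrE// ltW.
have bR := bborel_rel_height PS q21 al tau0 r1.
apply: expect_indic_le => //.
move=> y; have -> : \1_[set: eucl R k] y = 1 :> R by rewrite indicE mem_set.
rewrite mulr1.
have s0 := sg_gt0 al tau0 r1; rewrite /= in s0.
have i0 : 0 <= (tau * r0 `^ al)^-1 by rewrite invr_ge0 mulr_ge0 ?(ltW tau0)// ltW.
apply: ge0_powR_mono => //; first by rewrite mulr_ge0 ?indicE// rel_height_ge0.
rewrite indicE; have [/set_mem ya|_] := boolP (y \in _); last by rewrite mulr0.
rewrite mulr1 /rel_height ler_pdivrMr//.
have hr : height a P y <= r by apply: le_trans (grass_perp_enorm _ gP) (ltW ya).
apply: le_trans hr _; rewrite mulrC ler_pdivlMr ?mulr_gt0//.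
rewrite (_ : tau * (r * r `^ al) = r * (tau * r `^ al)); last by ring.
rewrite ler_wpM2l ?(ltW r1)// ler_wpM2l ?(ltW tau0)//.
by apply: ge0_powR_mono => //; exact: ltW.
Qed.

(** Iterating [pow_avg_step] from [r] upwards to a fixed scale [R0], the constants sum to at most
    [2 * pow_add], while the value near [R0] is divided by [2^i]. That value depends on the
    varifold, but is finite, so its share falls below 1 for small [r]. *)
Lemma pow_decay : p < n%:R -> al * q2 <= (p^-1 - n%:R^-1)^-1 ->
  (\forall r \near 0^'+, E (fun y => tilt P y `^ q1 * \1_(eball a r) y) <= (tau * r `^ al) `^ q1 * r ^+ n) ->
  \forall r \near 0^'+, pavg r <= 2 * padd + 1.
Proof.
move=> pn alp hD; have M0 := ps_M PS; have p1 := ps_p PS.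
have p0 : 0 < p := lt_le_trans ltr01 p1.
have n0 := ls_n VS; have nr : 0 < n%:R :> R by rewrite ltr0n.
pose th := p^-1 - n%:R^-1; have th0 : 0 < th by rewrite subr_gt0 ltf_pV2.
have q20 : 0 < q2 := lt_le_trans ltr01 q21.
have q10 : 0 < q1 := lt_le_trans ltr01 q11.
have [L L0 hL] := ps_lam PS.
have hm := ps_mass PS.
have hL1 : \forall r \near 0^'+, E (fun y => tilt P y * \1_(eball a r) y) <= tau * (1 + M) * r ^+ n * r `^ al.
  near=> r.
  have r0 : 0 < r by near: r; exact: nbhs_right_gt.
  have rn : 0 < r ^+ n by exact: exprn_gt0.
  have hD' : E (fun y => tilt P y `^ q1 * \1_(eball a r) y) <= (tau * r `^ al) `^ q1 * r ^+ n by near: r.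
  have hm' : m (eball a r) <= M * r ^+ n by near: r.
  have mB : measurable (eball a r : set (eucl R k)) by exact: open_measurable_eucl (@open_eball R k a r).
  pose c := tau * r `^ al; have c0 : 0 < c by rewrite mulr_gt0// powR_gt0.
  have bt := bborel_tilt VS gP.
  have b1 : bborel (fun y : eucl R k => c * \1_(eball a r) y).
    by apply: bborelM; [exact: bborel_cst|exact: bborel_indic_eucl].
  have b2 : bborel (fun y : eucl R k => tilt P y `^ q1 * \1_(eball a r) y).
    apply: bborelM; last exact: bborel_indic_eucl.
    by apply: bborel_powR => //; [exact: ltW|move=> y; exact: tilt_ge0].
  have b3 : bborel (fun y : eucl R k => c `^ (1 - q1) * (tilt P y `^ q1 * \1_(eball a r) y)).
    by apply: bborelM => //; exact: bborel_cst.
  apply: (@le_trans _ _ (c * m (eball a r) + c `^ (1 - q1) * E (fun y => tilt P y `^ q1 * \1_(eball a r) y))).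
    rewrite -(expect_indic _ mB) -!expectZ//; last exact: bborel_indic_eucl.
    rewrite -expectD//; apply: expect_le; [by apply: bborelM => //; exact: bborel_indic_eucl|exact: bborelD|].
    move=> y; rewrite indicE; case: (y \in _); last by rewrite !mulr0 addr0.
    by rewrite !mulr1; apply: weak_holder => //; exact: tilt_ge0.
  have cc : c `^ (1 - q1) * c `^ q1 = c by rewrite powR_mul_add// subrK powRr1// ltW.
  apply: (@le_trans _ _ (c * (M * r ^+ n) + c `^ (1 - q1) * (c `^ q1 * r ^+ n))).
    by apply: lerD; apply: ler_wpM2l => //; [exact: ltW|exact: powR_ge0].
  by rewrite mulrA (mulrA (c `^ _)) cc le_eqVlt; apply/orP; left; apply/eqP; rewrite /c; ring.
have tM : 0 <= tau * (1 + M) by rewrite mulr_ge0 ?addr_ge0// ltW.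
have hH := height_decay VS PS tM al0 al1 hL1 tau0.
have cf0 := pow_factor_gt0 VS q2.
have cf6 : 0 < (6 * pfac)^-1 by rewrite invr_gt0 mulr_gt0.
(* [del], and below [eta1] and [eps], depend on [tau] and on the bound [L] of the varifold. They
   influence only how small [r] has to be, not the resulting bound. *)
have [del d0 delE] := powR_root th0 cf6.
have dfac : del `^ th * pfac <= 6^-1.
  by rewrite delE le_eqVlt; apply/orP; left; apply/eqP; field; rewrite gt_eqF.
have [C3 C30 C3E] : exists2 C3, 0 < C3 & C3 = del `^ (th - 1) * (2 * (2 / tau) `^ q2).
  by eexists; last reflexivity; rewrite mulr_gt0 ?powR_gt0// mulr_gt0// powR_gt0// divr_gt0.
have s0 : 0 < p^-1 / th by rewrite divr_gt0// invr_gt0.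
have p2 : 0 < (2 : R) ^+ n by exact: exprn_gt0.
have C2 : 0 < (2 * C3)^-1 by rewrite invr_gt0 mulr_gt0.
have [e1 e10' e1E] := powR_root s0 C2.
have [eta1 e10 eta1E] : exists2 eta1, 0 < eta1 & eta1 * 2 ^+ n = e1.
  by exists (e1 / 2 ^+ n); rewrite ?divr_gt0// divfK// gt_eqF.
have [G2 G20 G2E] : exists2 G2, 0 <= G2 & G2 = (L * 2 ^+ n) `^ (p^-1 / th).
  by eexists; last reflexivity; exact: powR_ge0.
have G21 : 0 < G2 + 1 by rewrite ltr_wpDl.
have C4 : 0 < (2 * C3 * (G2 + 1))^-1 by rewrite invr_gt0 mulr_gt0// mulr_gt0.
have [eps e0 epsE] := powR_root q20 C4.
have dz : del `^ (th - 1) * (2 * (2 / tau) `^ q2 * ((eta1 * 2 ^+ n) `^ (p^-1 / th) + (L * 2 ^+ n) `^ (p^-1 / th) * eps `^ q2)) <= 1.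
  rewrite eta1E e1E epsE -G2E mulrA -C3E.
  have h : G2 / (G2 + 1) <= 1 by rewrite ler_pdivrMr// mul1r lerDl.
  have -> : C3 * ((2 * C3)^-1 + G2 / (2 * C3 * (G2 + 1))) = 2^-1 + 2^-1 * (G2 / (G2 + 1)).
    by field; rewrite !gt_eqF.
  by move: (G2 / _) h => x h; lra.
have two0 : 0 < (2 : R) by [].
have /near0P[R1 R10 h1] := near0_scale two0 (ps_dom PS).
have /near0P[R2 R20 h2] := near0_scale two0 hm.
have /near0P[R3 R30 h3] := hm.
have /near0P[R4 R40 h4] := near0_scale two0 hH.
have /near0P[R5 R50 h5] := near0_scale two0 hD.
have /near0P[R6 R60 h6] := near0_scale two0 hL.
have /near0P[R7 R70 h7] := near0_scale two0 (ps_lam_flat PS e0 e10).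
pose R0 := Num.min 1 (Num.min R1 (Num.min R2 (Num.min R3 (Num.min R4 (Num.min R5 (Num.min R6 R7)))))).
have R00 : 0 < R0 by rewrite !lt_min ltr01 R10 R20 R30 R40 R50 R60 R70.
have step r : 0 < r -> r < R0 -> pavg r <= padd + pavg (2 * r) / 2.
  rewrite !lt_min => r0 /and5P[l0 l1 l2 l3 /and4P[l4 l5 l6 l7]].
  apply: (pow_avg_step VS PS q11 q1n q21 q21s tau0 al1 r0 (ltW l0) (h1 r r0 l1) (h2 r r0 l2) (h3 r r0 l3)
    (h4 r r0 l4) (h5 r r0 l5) pn alp e0 (ltW e10) L0 d0 (h6 r r0 l6) (h7 r r0 l7) dfac dz).
have A0 : 0 <= padd.
  have h : 0 <= (4 : R) ^+ n by exact: exprn_ge0.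
  have D0 : 0 < 4 `^ q2 * sobolev_const n w by rewrite mulr_gt0 ?powR_gt0// sobolev_const_gt0// (ls_w VS).
  apply: addr_ge0; first by rewrite mulr_ge0 ?powR_ge0.
  apply: mulr_ge0; first exact: ltW.
  by rewrite addr_ge0// mulr_ge0 ?addr_ge0 ?powR_ge0// mulr_ge0// addr_ge0.
have iter i : forall r, 0 < r -> r * 2 ^+ i < 2 * R0 -> pavg r <= 2 * padd + (2 ^+ i)^-1 * pavg (2 ^+ i * r).
  elim: i => [|i IH] r r0 hr; first by rewrite expr0 invr1 !mul1r lerDr mulr_ge0.
  have i1 : 1 <= (2 : R) ^+ i by rewrite exprn_ege1// ler1n.
  have r1 : r < R0.
    move: hr; rewrite exprS mulrCA ltr_pM2l// => /le_lt_trans; apply.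
    by rewrite ler_peMr// ltW.
  have r2 : 0 < 2 * r by rewrite mulr_gt0.
  have hr2 : 2 * r * 2 ^+ i < 2 * R0 by rewrite -mulrA mulrCA -exprS.
  apply: le_trans (step r r0 r1) _; have := IH _ r2 hr2.
  rewrite [2 ^+ i.+1]exprSr invfM (mulrA (2 ^+ i)) => h.
  have -> : 2 * padd + (2 ^+ i)^-1 / 2 * pavg (2 ^+ i * 2 * r) = padd + (2 * padd + (2 ^+ i)^-1 * pavg (2 ^+ i * 2 * r)) / 2 by field.
  by rewrite lerD2l ler_wpM2r.
pose Bd := (R0 ^+ n)^-1 * ((tau * R0 `^ al)^-1 `^ q2 * m setT).
have Bd0 : 0 <= Bd by rewrite mulr_ge0 ?invr_ge0 ?exprn_ge0 ?(ltW R00)// mulr_ge0 ?powR_ge0 ?mass_ge0.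
have Rs0 : 0 < R0 / (Bd + 1) by rewrite divr_gt0// ltr_wpDl.
near=> r.
have r0 : 0 < r by near: r; exact: nbhs_right_gt.
have rR : r < R0 by near: r; exact: nbhs_right_lt.
have rs : r < R0 / (Bd + 1) by near: r; exact: nbhs_right_lt.
(* The least such [i] places [2^i r] between [R0] and [2 R0]: the a priori bound [Bd] holds there,
   and the iteration still reaches it. *)
have ex_i : exists i, R0 <= r * 2 ^+ i.
  have [i hi] := pow2_gt (R0 / r); exists i.
  by rewrite mulrC -ler_pdivrMr// ltW.
have i1 := ex_minnP ex_i; case: i1 => i iR imin.
have i0 : (0 < i)%N.
  by case: i iR {imin} => // ; rewrite expr0 mulr1 leNgt rR.
have iR2 : r * 2 ^+ i < 2 * R0.
  rewrite -(prednK i0) exprS mulrCA ltr_pM2l// ltNge; apply/negP => /imin.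
  by rewrite -ltnS prednK// ltnn.
apply: le_trans (iter i r r0 iR2) _; rewrite lerD2l.
have i2 : 0 < (2 : R) ^+ i by exact: exprn_gt0.
rewrite mulrC ler_pdivrMr// mul1r.
have := pow_avg_bound R00 iR; rewrite -/Bd mulrC => /le_trans; apply.
have hb : Bd + 1 < R0 / r by rewrite ltr_pdivlMr// mulrC -ltr_pdivlMr// ltr_wpDl.
have hb2 : R0 / r <= 2 ^+ i by rewrite ler_pdivrMr// mulrC.
by apply: ltW; apply: lt_le_trans hb2; apply: le_lt_trans hb; rewrite lerDl.
Unshelve. all: by end_near. Qed.

End PowerIteration.

(** * Density of the variation *)

Section Neighborhoods.
Context {R : realType} {k : nat}.
Implicit Types (A E : set 'rV[R]_k) (r : R).

Definition fattening A r : set 'rV[R]_k := [set x | exists2 y, A y & eball y r x].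

Lemma open_fattening A r : open (fattening A r).
Proof.
have -> : fattening A r = \bigcup_(y in A) eball y r.
  by apply/seteqP; split => x [y Ay yx]; exists y.
by apply: bigcup_open => y _; exact: open_eball.
Qed.

End Neighborhoods.

(* [g_outer] stands in for the outer regularity of a Radon measure: [lam] is small on
   open sets that approach the closed set [E] from outside. *)
Record gauge (R : realType) (k : nat) (D : set 'rV[R]_k) (lam : set 'rV[R]_k -> R) : Prop := Gauge {
  g_ge0 : forall O, 0 <= lam O ;
  g_mono : forall O O', open O -> open O' -> O `<=` O' -> O' `<=` D -> lam O <= lam O' ;
  g_super : forall O O', open O -> open O' -> O `&` O' = set0 ->
    O `<=` D -> O' `<=` D -> lam O + lam O' <= lam (O `|` O') ;
  g_outer : forall E, closed E -> forall e : R, 0 < e -> exists2 r : R, 0 < r &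
    forall O, open O -> O `<=` D -> O `<=` fattening E r `\` E -> lam O <= e }.

Section Density.
Context {R : realType} {k n : nat}.
Variables (nu : {finite_measure set (eucl R k) -> \bar R}) (D : set 'rV[R]_k).
Variable lam : set 'rV[R]_k -> R.
Hypotheses (oD : open D) (lamG : gauge D lam).

(** On the balls of a Vitali covering, the fivefold ball has mass at most [5^n M r^n], which is at
    most [5^n M / t] times [lam] of the ball without [F]; disjointness and superadditivity bound the
    sum. [F] is empty for upper densities, and a closed set for densities outside it. *)
Lemma density_cover (F A : set 'rV[R]_k) (M t S r1 rho : R) :
  closed F -> 0 < t -> 0 <= M -> 0 < r1 -> 0 < rho ->
  (forall x, A x -> forall r, 0 < r -> r < r1 -> mass nu (eball x r) <= M * r ^+ n) ->
  (forall x, A x -> forall r0 : R, 0 < r0 -> exists r, [/\ 0 < r, r < r0, eball x r `<=` D &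
     t * r ^+ n <= lam (eball x r `\` F)]) ->
  (forall O, open O -> O `<=` D -> O `<=` fattening A rho `\` F -> lam O <= S) ->
  exists W : set (eucl R k), [/\ measurable W, A `<=` W & (nu W <= (5 ^+ n * M / t * S)%:E)%E].
Proof.
move=> cF t0 M0 r10 rho0 hM hA hS.
pose r0 := Num.min (r1 / 5) rho; have r00 : 0 < r0 by rewrite lt_min divr_gt0.
have /choice[r hr] x : exists r, A x -> [/\ 0 < r, r < r0, eball x r `<=` D & t * r ^+ n <= lam (eball x r `\` F)].
  have [Ax|nA] := pselect (A x); last by exists 0.
  by have [r hr] := hA x Ax r0 r00; exists r.
apply: (@covering_bound R k nu A r (fun x => M * (5 * r x) ^+ n) r0).
- by move=> x /hr[-> h _ _]; rewrite ltW.
- move=> x Ax; have [rp rr _ _] := hr x Ax.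
  apply: (@le_trans _ _ ((mass nu (eball x (5 * r x)))%:E)).
    by rewrite massE; [exact: lexx|exact: measurable_eball].
  rewrite lee_fin; apply: hM => //; first by rewrite mulr_gt0.
  by move: rr; rewrite lt_min => /andP[+ _]; rewrite ltr_pdivlMr// mulrC.
move=> s us sA ds.
pose O := (fattening A rho `&` D) `\` F.
have oO : open O.
  apply: openI; last by rewrite openC.
  by apply: openI => //; exact: open_fattening.
have OD : O `<=` D by move=> x [[]].
have oB x : open (eball x (r x) `\` F) by apply: openI; [exact: open_eball|rewrite openC].
have h1 : \sum_(x <- s) lam (eball x (r x) `\` F) <= lam O.
  apply: (superadditive_sum (g_ge0 lamG) (g_mono lamG) (g_super lamG)
    (F := fun x => eball x (r x) `\` F) oO OD us) => //.
  - move=> x xs y [yx nF]; have [_ rr xD _] := hr x (sA x xs).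
    split=> //; split; last exact: xD.
    exists x; first exact: sA.
    by move: yx; rewrite /eball /= => /lt_trans; apply; move: rr; rewrite lt_min => /andP[].
  move=> x y xs ys xy; apply/seteqP; split => // z [[zx _] [zy _]].
  by rewrite -(ds x y xs ys xy).
have h2 : lam O <= S by apply: hS => // x [[]].
apply: (@le_trans _ _ (\sum_(x <- s) 5 ^+ n * M / t * lam (eball x (r x) `\` F))).
  rewrite big_seq [leRHS]big_seq; apply: ler_sum => x xs.
  have [_ _ _ h] := hr x (sA x xs).
  have -> : M * (5 * r x) ^+ n = 5 ^+ n * M / t * (t * r x ^+ n).
    by rewrite exprMn; field; rewrite gt_eqF.
  by rewrite ler_wpM2l// divr_ge0 ?(ltW t0)// mulr_ge0// exprn_ge0.
rewrite -mulr_sumr ler_wpM2l ?(le_trans h1)//.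
by rewrite divr_ge0 ?(ltW t0)// mulr_ge0// exprn_ge0.
Qed.

Definition bounded_ratio (j : nat) (x : 'rV[R]_k) :=
  forall r : R, 0 < r -> r < j.+1%:R^-1 -> mass nu (eball x r) <= j.+1%:R * r ^+ n.

Lemma not_near0 (Q : R -> Prop) : ~ (\forall r \near 0^'+, Q r) ->
  forall r0, 0 < r0 -> exists r, [/\ 0 < r, r < r0 & ~ Q r].
Proof.
move=> h r0 r00; apply: contrapT => h2; apply: h; apply/near0P; exists r0 => // r rp rr.
by apply: contrapT => nQ; apply: h2; exists r.
Qed.

Lemma near_sub_open x : D x -> \forall r \near 0^'+, eball x r `<=` D.
Proof.
move=> Dx; have /open_eballP/(_ x Dx)[r0 r00 h] := oD.
apply/near0P; exists r0 => // r rp rr y; rewrite /eball /= => yx; apply: h.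
exact: lt_trans rr.
Qed.

Lemma upper_density_negligible j : nu.-negligible [set x | [/\ D x, bounded_ratio j x &
  ~ exists2 L, 0 <= L & \forall r \near 0^'+, lam (eball x r) <= L * r ^+ n]].
Proof.
set A := [set _ | _]; apply: small_cover_negligible => e e0.
pose M : R := j.+1%:R; have M0 : 0 <= M by [].
pose t := 5 ^+ n * M * lam D / e + 1.
have c0 : 0 <= 5 ^+ n * M * lam D / e.
  by rewrite divr_ge0 ?(ltW e0)// mulr_ge0 ?(g_ge0 lamG)// mulr_ge0// exprn_ge0.
have t0 : 0 < t by rewrite ltr_wpDl.
have j0 : 0 < (j.+1%:R^-1 : R) by rewrite invr_gt0.
have hS O : open O -> O `<=` D -> O `<=` fattening A 1 `\` set0 -> lam O <= lam D.
  by move=> oO OD _; exact: (g_mono lamG oO oD OD).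
have hM x : A x -> forall r, 0 < r -> r < j.+1%:R^-1 -> mass nu (eball x r) <= M * r ^+ n.
  by case.
have hA x : A x -> forall r0 : R, 0 < r0 -> exists r, [/\ 0 < r, r < r0, eball x r `<=` D &
     t * r ^+ n <= lam (eball x r `\` set0)].
  move=> [Dx _ hx] r0 r00.
  have nh : ~ \forall r \near 0^'+, eball x r `<=` D -> lam (eball x r) <= t * r ^+ n.
    move=> h; apply: hx; exists t; first exact: ltW.
    have h2 := near_sub_open Dx; near=> r.
    have h1 : eball x r `<=` D -> lam (eball x r) <= t * r ^+ n by near: r.
    by apply: h1; near: r.
  have [r [rp rr]] := not_near0 nh r00; move=> /not_implyP[xD /negP]; rewrite -ltNge => h.
  by exists r; split => //; rewrite setD0; exact: ltW.
have [W [mW AW hW]] := density_cover closed0 t0 M0 j0 ltr01 hM hA hS.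
exists W; split => //; apply: le_trans hW _; rewrite lee_fin.
rewrite mulrAC ler_pdivrMr// mulrDr mulr1 /t.
have -> : e * (5 ^+ n * M * lam D / e) = 5 ^+ n * M * lam D by field; rewrite gt_eqF.
by rewrite lerDl ltW.
Unshelve. all: by end_near. Qed.

(** By [g_outer], [lam] is arbitrarily small on thin neighbourhoods of [E] without [E], and the
    covering takes place inside such a neighbourhood. Hence [lam] outside [E] has density 0 at
    almost all points of [E]. *)
Lemma lower_density_negligible (E : set 'rV[R]_k) j i : closed E ->
  nu.-negligible [set x | [/\ D x, E x, bounded_ratio j x &
    ~ \forall r \near 0^'+, lam (eball x r `\` E) <= i.+1%:R^-1 * r ^+ n]].
Proof.
move=> cE; set A := [set _ | _]; apply: small_cover_negligible => e e0.
pose M : R := j.+1%:R; have M0 : 0 < M by [].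
pose t : R := i.+1%:R^-1; have t0 : 0 < t by rewrite invr_gt0.
have p5 : 0 < (5 : R) ^+ n by exact: exprn_gt0.
pose S := e / (5 ^+ n * M / t); have S0 : 0 < S by rewrite divr_gt0// divr_gt0// mulr_gt0.
have [rho rho0 hrho] := g_outer lamG cE S0.
have j0 : 0 < (j.+1%:R^-1 : R) by rewrite invr_gt0.
have hS O : open O -> O `<=` D -> O `<=` fattening A rho `\` E -> lam O <= S.
  move=> oO OD h; apply: hrho => // x /h[[y Ay yx] nE]; split => //.
  by exists y => //; case: Ay.
have hA x : A x -> forall r0 : R, 0 < r0 -> exists r, [/\ 0 < r, r < r0, eball x r `<=` D &
     t * r ^+ n <= lam (eball x r `\` E)].
  move=> [Dx _ _ hx] r0 r00.
  have nh : ~ \forall r \near 0^'+, eball x r `<=` D -> lam (eball x r `\` E) <= t * r ^+ n.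
    move=> h; apply: hx; have h2 := near_sub_open Dx; near=> r.
    have h1 : eball x r `<=` D -> lam (eball x r `\` E) <= t * r ^+ n by near: r.
    by apply: h1; near: r.
  have [r [rp rr]] := not_near0 nh r00; move=> /not_implyP[xD /negP]; rewrite -ltNge => h.
  by exists r; split => //; exact: ltW.
have hM x : A x -> forall r, 0 < r -> r < j.+1%:R^-1 -> mass nu (eball x r) <= M * r ^+ n.
  by case.
have [W [mW AW hW]] := density_cover cE t0 (ltW M0) j0 rho0 hM hA hS.
exists W; split => //; apply: le_trans hW _; rewrite lee_fin /S mulrC divfK//.
by rewrite gt_eqF// divr_gt0// mulr_gt0.
Unshelve. all: by end_near. Qed.

(** Fixing the range of radii makes the set closed, as [g_outer] requires, and the union over [j]
    contains all regular points. *)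
Definition thick (w : R) (j : nat) : set 'rV[R]_k :=
  [set y | forall s : R, 0 < s -> s < j.+1%:R^-1 -> w * s ^+ n <= mass nu (ecball y s)].

Lemma closed_thick w j : 0 < w -> closed (thick w j).
Proof.
move=> w0; rewrite -openC; apply/open_eballP => y /existsNP[s /not_implyP[s0 /not_implyP[sj /negP]]].
rewrite -ltNge => hs.
have /near0P[e0 e00 he] : \forall e \near 0^'+, mass nu (ecball y s) < w * (s - e) ^+ n.
  have cf : (w * (s - e) ^+ n) @[e --> (0 : R)] --> w * (s - 0) ^+ n.
    apply: cvgM; first exact: cvg_cst.
    apply: (@continuous_comp _ _ _ (fun e : R => s - e) (fun t : R => t ^+ n)); last exact: exprn_continuous.
    by apply: cvgB; [exact: cvg_cst|exact: cvg_id].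
  rewrite subr0 in cf; exact: (cvgr_gt _ (cvg_at_right_filter cf) _ hs).
pose e := Num.min (e0 / 2) (s / 2).
have ep : 0 < e by rewrite lt_min !divr_gt0.
have ee : e < e0 by rewrite gt_min; apply/orP; left; lra.
have es : e <= s / 2 by rewrite ge_min lexx orbT.
exists e => // z zy; apply: contraPnot (he e ep ee) => /(_ (s - e)).
have s1 : 0 < s - e by lra.
have s2 : s - e < j.+1%:R^-1 by apply: lt_trans sj; lra.
move=> /(_ s1 s2) h; apply/negP; rewrite -leNgt; apply: le_trans h _.
apply: mass_le; [exact: measurable_ecball|exact: measurable_ecball|].
move=> u; rewrite /ecball /= => hu; have := enorm_dist u z y.
move: zy; rewrite /eball /=; lra.
Qed.

End Density.

Section PointSpec.
Context {R : realType} {k n : nat} {w : R} {V : local_data R k}.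
Hypothesis VS : local_spec n w V.
Local Notation nu := (ld_mu V).
Local Notation m := (mass nu).
Local Notation thick := (@thick R k n).
Local Notation bounded_ratio := (@bounded_ratio R k n).
Variables (lam : set 'rV[R]_k -> R) (p : R).
Hypotheses (lamG : gauge (ld_dom V) lam) (p1 : 1 <= p).
Hypothesis varP : forall O, open O -> O `<=` ld_dom V ->
    ld_var V O <= lam O `^ p^-1 * m O `^ (1 - p^-1).

Definition flat_at (a : 'rV[R]_k) (P : 'M[R]_k) := forall eps eta : R, 0 < eps -> 0 < eta ->
    \forall r \near 0^'+, m (steep a P r (eps * r)) <= eta * r ^+ n.

Let w0 : 0 < w := ls_w VS.

Lemma height_triangle a P (u y : 'rV[R]_k) : grassmannian n P ->
  height a P y <= height a P u + enorm (u - y).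
Proof.
move=> gP; rewrite /height.
have -> : (y - a) *m (1%:M - P) = (u - a) *m (1%:M - P) + (y - u) *m (1%:M - P).
  by rewrite -mulmxDl [u - a + _]addrC addrA subrK.
apply: le_trans (ler_enormD _ _) _; rewrite lerD2l enormB.
exact: (grass_perp_enorm _ gP).
Qed.

(** A point of the intersection would be the centre of a ball of radius [e' r] and mass at least
    [w (e' r)^n], lying entirely in a slightly larger steep set; flatness makes the mass of the
    latter smaller. *)
Lemma steep_thick a P j eps : grassmannian n P -> flat_at a P -> 0 < eps ->
  \forall r \near 0^'+, steep a P r (eps * r) `&` thick nu w j = set0.
Proof.
move=> gP fl e0; have two0 : 0 < (2 : R) by [].
pose e' := Num.min (eps / 2) 1; have e'0 : 0 < e' by rewrite lt_min ltr01 divr_gt0.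
have e'1 : e' <= 1 by rewrite ge_min lexx orbT.
have e'2 : e' <= eps / 2 by rewrite ge_min lexx.
pose eta := w * (e' / 2) ^+ n / 2.
have e4 : 0 < eps / 4 by rewrite divr_gt0.
have en : 0 < w * (e' / 2) ^+ n by rewrite mulr_gt0// exprn_gt0// divr_gt0.
have eta0 : 0 < eta by rewrite divr_gt0.
have h2 := near0_scale two0 (fl _ _ e4 eta0).
have e2j : 0 < j.+1%:R^-1 / e' by rewrite divr_gt0// invr_gt0.
near=> r.
have r0 : 0 < r by near: r; exact: nbhs_right_gt.
have rj : e' * r < j.+1%:R^-1.
  by rewrite mulrC -ltr_pdivlMr//; near: r; exact: nbhs_right_lt.
have hf : m (steep a P (2 * r) (eps / 4 * (2 * r))) <= eta * (2 * r) ^+ n by near: r.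
apply/seteqP; split => // y [[ya yh] yt].
have er0 : 0 < e' * r by rewrite mulr_gt0.
have hw := yt _ er0 rj.
have sub : ecball y (e' * r) `<=` steep a P (2 * r) (eps / 4 * (2 * r)).
  move=> u; rewrite /ecball /= => uy; have er1 : e' * r <= r by rewrite ler_piMl// ltW.
  have er2 : e' * r <= eps / 2 * r by rewrite ler_wpM2r// ltW.
  split.
    have := enorm_dist u y a; move: ya; rewrite /eball /= => *; lra.
  have := height_triangle a u y gP; move: yh; rewrite /= => *; lra.
have hm : m (ecball y (e' * r)) <= m (steep a P (2 * r) (eps / 4 * (2 * r))).
  by apply: mass_le; [exact: measurable_ecball|exact: measurable_steep|exact: sub].
have e : eta * (2 * r) ^+ n = w * (e' * r) ^+ n / 2.
  have -> : (e' * r) ^+ n = (e' / 2) ^+ n * (2 * r) ^+ n by rewrite -exprMn; congr (_ ^+ _); field.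
  by rewrite /eta; ring.
have wp : 0 < w * (e' * r) ^+ n by rewrite mulr_gt0// exprn_gt0.
rewrite e in hf; have : w * (e' * r) ^+ n <= w * (e' * r) ^+ n / 2.
  exact: le_trans hw (le_trans hm hf).
move=> h; exfalso; move: h wp; lra.
Unshelve. all: by end_near. Qed.

(** The link between flatness and the variation: near a flat point of a thick set the steep set
    avoids the thick set, so its [lam] is at most that of the ball without the thick set, which is
    [o(r^n)] almost everywhere. Countably many indices for radii, ratios and accuracies suffice. *)
Lemma ae_point_spec : {ae nu, forall a, ld_dom V a -> forall P M, grassmannian n P -> 0 <= M ->
  flat_at a P -> (\forall r \near 0^'+, m (eball a r) <= M * r ^+ n) -> point_spec n V p M lam a P}.
Proof.
have n0 := ls_n VS; have oD := ls_open VS.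
pose N1 j := [set x | [/\ ld_dom V x, bounded_ratio nu j x &
  ~ exists2 L, 0 <= L & \forall r \near 0^'+, lam (eball x r) <= L * r ^+ n]].
pose N2 j l i := [set x | [/\ ld_dom V x, thick nu w l x, bounded_ratio nu j x &
    ~ \forall r \near 0^'+, lam (eball x r `\` thick nu w l) <= i.+1%:R^-1 * r ^+ n]].
have neg1 : nu.-negligible (\bigcup_j N1 j).
  by apply: negligible_bigcup => j; exact: upper_density_negligible.
have neg2 : nu.-negligible (\bigcup_j \bigcup_l \bigcup_i N2 j l i).
  apply: negligible_bigcup => j; apply: negligible_bigcup => l; apply: negligible_bigcup => i.
  apply: lower_density_negligible => //; exact: closed_thick (ls_w VS).
have neg3 := ls_regular VS.
have neg := negligibleU neg3 (negligibleU neg1 neg2).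
apply: negligibleS neg => a /= hbad; apply: contrapT => good; apply: hbad => Da P M gP M0 fl hm.
have [nr1 nr2 nr3] : [/\ regular_point n w nu a, ~ (\bigcup_j N1 j) a & ~ (\bigcup_j \bigcup_l \bigcup_i N2 j l i) a].
  split; apply: contrapT => h; apply: good; [by left|right; left|right; right];
    exact: contrapT.
have [C [r0 [r00 hC]]] := nr1.
have [j jC] : exists j : nat, C <= j.+1%:R /\ j.+1%:R^-1 <= r0.
  exists (maxn (Num.truncn C) (Num.truncn r0^-1)); split.
    apply: le_trans (ltW (truncnS_gt _)) _; rewrite ler_nat ltnS leq_maxl//.
  rewrite invf_ple ?posrE//; apply: le_trans (ltW (truncnS_gt _)) _.
  by rewrite ler_nat ltnS leq_maxr.
have [jC1 jC2] := jC.
have br : bounded_ratio nu j a.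
  move=> r rp rj; have /andP[_ h] := hC r rp (lt_le_trans rj jC2).
  have sub : eball a r `<=` ecball a r by move=> y; rewrite /eball /ecball /= => /ltW.
  have h1 : m (eball a r) <= m (ecball a r).
    by apply: mass_le => //; [exact: measurable_eball|exact: measurable_ecball].
  by apply: le_trans h1 (le_trans h _); rewrite ler_wpM2r// exprn_ge0// ltW.
have ta : thick nu w j a.
  by move=> s sp sj; have /andP[] := hC s sp (lt_le_trans sj jC2).
split => //.
- exact: near_sub_open.
- exact: g_ge0 lamG.
- exact: g_mono lamG.
- by apply: contrapT => h; apply: nr2; exists j.
move=> eps eta e0 eta0.
pose i := Num.truncn eta^-1.
have ie : i.+1%:R^-1 <= eta by rewrite invf_ple ?posrE// ltW// truncnS_gt.
have h1 : \forall r \near 0^'+, lam (eball a r `\` thick nu w j) <= i.+1%:R^-1 * r ^+ n.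
  by apply: contrapT => h; apply: nr3; exists j => //; exists j => //; exists i.
have h2 := steep_thick j gP fl e0; have h3 := near_sub_open oD Da.
near=> r.
have r0' : 0 < r by near: r; exact: nbhs_right_gt.
have hd : eball a r `<=` ld_dom V by near: r.
have hl : lam (eball a r `\` thick nu w j) <= i.+1%:R^-1 * r ^+ n by near: r.
have hs : steep a P r (eps * r) `&` thick nu w j = set0 by near: r.
have oB : open (eball a r `\` thick nu w j).
  apply: openI; first exact: open_eball.
  by rewrite openC; exact: closed_thick (ls_w VS).
have hle : lam (steep a P r (eps * r)) <= lam (eball a r `\` thick nu w j).
  apply: (g_mono lamG) => //; first exact: open_steep.
    move=> y ys; split; first exact: steep_eball ys.
    by move=> yt; have : set0 y by rewrite -hs.
  by move=> y [/hd].
by apply: le_trans hle (le_trans hl _); rewrite ler_wpM2r// exprn_ge0// ltW.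
Unshelve. all: by end_near. Qed.

End PointSpec.

(** * Measurability of the tangent planes *)

(* Integrals of arbitrary functions: the library integral is a supremum over
   simple functions, and neither measurability of the integrand nor additivity
   of the set function is needed for the following facts. *)
Section RawIntegral.
Context {d : measure_display} {X : measurableType d} {R : realType}.
Import HBNNSimple.
Implicit Types (f g : X -> \bar R).

(** A simple function below [f], set to 0 on the null set [N], lies below [g] and keeps its
    integral. *)
Lemma ge0_ae_eq_integral_le (mu : {measure set X -> \bar R}) f g (N : set X) :
  measurable N -> mu N = 0%E -> (forall x, (0 <= f x)%E) -> (forall x, (0 <= g x)%E) ->
  (forall x, ~ N x -> f x = g x) -> (\int[mu]_x f x <= \int[mu]_x g x)%E.
Proof.
move=> mN N0 f0 g0 fg; rewrite !ge0_integralTE//; apply: ge_ereal_sup => _ [h hf <-].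
pose h' := proj_nnsfun h (measurableC mN).
have -> : sintegral mu h = sintegral mu h'.
  rewrite -!integralT_nnsfun; apply: ge0_ae_eq_integral => //.
  - by apply/measurable_EFinP; exact: measurable_funPT.
  - by apply/measurable_EFinP; exact: measurable_funPT.
  - by move=> x _; rewrite lee_fin; exact: fun_ge0.
  - by move=> x _; rewrite lee_fin; exact: fun_ge0.
  exists N; split => // x /=; apply: contra_notP => nN _.
  by rewrite /= mindicE mem_set// mulr1.
apply: ereal_sup_ubound; exists h' => // x /=; rewrite mindicE.
have [/set_mem nN|_] := boolP (x \in ~` N); first by rewrite mulr1 -fg.
by rewrite mulr0.
Qed.

Lemma ae_eq_integral_total (mu : {measure set X -> \bar R}) f g :
  {ae mu, forall x, f x = g x} -> (\int[mu]_x f x = \int[mu]_x g x)%E.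
Proof.
move=> [N [mN N0 sub]].
have fg x : ~ N x -> f x = g x by move=> nN; apply: contrapT => h; apply: nN; exact: sub.
have key (f' g' : X -> \bar R) : (forall x, (0 <= f' x)%E) -> (forall x, (0 <= g' x)%E) ->
    (forall x, ~ N x -> f' x = g' x) -> (\int[mu]_x f' x = \int[mu]_x g' x)%E.
  move=> f0 g0 h; apply/eqP; rewrite eq_le; apply/andP; split.
    exact: ge0_ae_eq_integral_le h.
  by apply: (ge0_ae_eq_integral_le mN) => // x /h.
rewrite integralE [RHS]integralE; congr (_ - _)%E; apply: key => // x nN.
  by rewrite !funeposE fg.
by rewrite !funenegE fg.
Qed.

Lemma eq_sintegral_on (m1 m2 : set X -> \bar R) (D : set X) (h : {nnsfun X >-> R}) :
  (forall A, measurable A -> A `<=` D -> m1 A = m2 A) -> (forall x, ~ D x -> h x = 0) ->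
  sintegral m1 h = sintegral m2 h.
Proof.
move=> m12 h0; apply: eq_fsbigr => x _; have [->|x0] := eqVneq x 0; first by rewrite !mul0e.
congr (_ * _)%E; apply: m12; first exact: measurable_funPTI.
by move=> y /= hy; apply: contrapT => nD; move: x0; rewrite -hy h0// eqxx.
Qed.

Lemma eq_integral_on (m1 m2 : set X -> \bar R) (D : set X) f :
  (forall A, measurable A -> A `<=` D -> m1 A = m2 A) -> (forall x, ~ D x -> f x = 0%E) ->
  integral m1 setT f = integral m2 setT f.
Proof.
move=> m12 f0; rewrite /integral !patch_setT.
have key (g : X -> \bar R) : (forall x, ~ D x -> g x = 0%E) ->
    [set sintegral m1 h | h in [set h : {nnsfun X >-> R} | forall x, ((h x)%:E <= g x)%E]] =
    [set sintegral m2 h | h in [set h : {nnsfun X >-> R} | forall x, ((h x)%:E <= g x)%E]].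
  move=> g0; have hz (h : {nnsfun X >-> R}) : (forall x, ((h x)%:E <= g x)%E) -> forall x, ~ D x -> h x = 0.
    move=> hg x nD; have := hg x; rewrite g0// lee_fin => h1.
    by apply/eqP; rewrite eq_le h1 fun_ge0.
  by apply/seteqP; split => _ [h hg <-]; exists h => //; [apply/esym|];
    apply: eq_sintegral_on m12 (hz h hg).
by congr (_ - _)%E; congr ereal_sup; apply: key => x nD; rewrite ?funeposE ?funenegE f0// ?oppe0 maxxx.
Qed.

Lemma integral_invariant (mu : set X -> \bar R) (s : X -> X) (D : set X) f :
  measurable_fun setT s -> involutive s -> (forall A, mu (s @^-1` A) = mu A) ->
  (forall x, D x -> D (s x)) ->
  integral mu D f = integral mu D (f \o s).
Proof.
move=> ms sK smu sD.
have Ds x : D (s x) <-> D x by split; [move=> /sD; rewrite sK|exact: sD].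
have patchs : (f \o s) \_ D = (f \_ D) \o s.
  apply/funext => x /=; rewrite !patchE /=.
  have [/set_mem h|/negP h] := boolP (x \in D); first by rewrite mem_set//; apply/Ds.
  by rewrite memNset// => /Ds /mem_set.
rewrite /integral patchs.
have key (g : X -> \bar R) :
    [set sintegral mu h | h in [set h : {nnsfun X >-> R} | forall x, ((h x)%:E <= g x)%E]] `<=`
    [set sintegral mu h | h in [set h : {nnsfun X >-> R} | forall x, ((h x)%:E <= g (s x))%E]].
  move=> _ [h hg <-].
  have mhs : measurable_fun setT (h \o s) by exact: measurableT_comp.
  have fhs : finite_set (range (h \o s)).
    by apply: sub_finite_set (fimfunP h) => _ [x _ <-]; exists (s x).
  have nhs x : 0 <= (h \o s) x by exact: fun_ge0.
  pose m := isMeasurableFun.Build _ _ _ _ (h \o s) mhs.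
  pose fi := FiniteImage.Build _ _ (h \o s) fhs.
  pose nn := isNonNegFun.Build _ _ (h \o s) nhs.
  pose h' : {nnsfun X >-> R} := HB.pack (h \o s) m fi nn.
  exists h'; first by move=> x; exact: hg.
  by apply: eq_fsbigr => x _; rewrite -[in RHS](smu (h @^-1` [set x])).
have key2 (g : X -> \bar R) :
    [set sintegral mu h | h in [set h : {nnsfun X >-> R} | forall x, ((h x)%:E <= g x)%E]] =
    [set sintegral mu h | h in [set h : {nnsfun X >-> R} | forall x, ((h x)%:E <= g (s x))%E]].
  apply/seteqP; split; first exact: key.
  apply: subset_trans (key (g \o s)) _ => _ [h hg <-]; exists h => // x.
  by have := hg x; rewrite /= sK.
have pE : ((f \_ D) \o s)^\+%E = (f \_ D)^\+%E \o s by apply/funext => x; rewrite /= !funeposE.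
have nE : ((f \_ D) \o s)^\-%E = (f \_ D)^\-%E \o s by apply/funext => x; rewrite /= !funenegE.
by rewrite pE nE (key2 (f \_ D)^\+%E) (key2 (f \_ D)^\-%E).
Qed.

Lemma integral_raw0 (mu : set X -> \bar R) (D : set X) f : (forall x, D x -> f x = 0%E) ->
  fine (integral mu D f) = 0.
Proof.
move=> f0; rewrite /integral; have -> : f \_ D = cst 0%E.
  by apply/funext => x; rewrite patchE; case: ifPn => // /set_mem/f0.
have -> : (cst 0%E : X -> \bar R)^\+%E = (cst 0%E : X -> \bar R)^\-%E.
  by apply/funext => x; rewrite funeposE funenegE oppe0.
(* For a mere set function the supremum need not be 0, but it is subtracted from itself; in the
   infinite cases [fine] returns 0. *)
by case: (ereal_sup _) => //= r; rewrite subrr.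
Qed.

End RawIntegral.

(** * Reflections and Hausdorff measure *)

Section HausdorffInvariance.
Context {R : realType} {k : nat}.
Implicit Types (S : 'M[R]_k).

Lemma ediam_iso S (B : set 'rV[R]_k) : S *m S = 1%:M -> (forall z : 'rV[R]_k, enorm (z *m S) = enorm z) ->
  ediam [set x | B (x *m S)] = ediam B.
Proof.
move=> SS Si; rewrite /ediam; congr (maxe _ (ereal_sup _)); apply/seteqP; split.
  move=> _ [x Bx [y By <-]]; exists (x *m S) => //; exists (y *m S) => //.
  by rewrite -mulmxBl Si.
move=> _ [x Bx [y By <-]]; exists (x *m S); first by rewrite /= -mulmxA SS mulmx1.
exists (y *m S); first by rewrite /= -mulmxA SS mulmx1.
by rewrite -mulmxBl Si.
Qed.

Lemma hausdorff_iso n S (A : set (eucl R k)) : S *m S = 1%:M ->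
  (forall z : 'rV[R]_k, enorm (z *m S) = enorm z) ->
  hausdorff n [set x : eucl R k | A (x *m S)] = hausdorff n A.
Proof.
move=> SS Si.
have key (B : set 'rV[R]_k) d : (hausdorff_size n d [set x | B (x *m S)] <= hausdorff_size n d B)%E.
  apply: le_ereal_inf => _ [C [hC BC ->]].
  exists (fun j => [set x | C j (x *m S)]); split.
  - by move=> j; rewrite ediam_iso.
  - by move=> x /= /BC[j _ Cj]; exists j.
  - by apply: eq_eseriesr => j _; rewrite ediam_iso.
have key2 (B : set 'rV[R]_k) d : (hausdorff_size n d B <= hausdorff_size n d [set x | B (x *m S)])%E.
  have := key [set x | B (x *m S)] d.
  rewrite [X in (hausdorff_size n d X <= _)%E -> _](_ : _ = B)//.
  by apply/seteqP; split => x; rewrite /= -mulmxA SS mulmx1.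
rewrite /hausdorff; congr ereal_sup; apply/seteqP; split.
  by move=> _ [d d0 <-]; exists d => //; apply/eqP; rewrite eq_le key key2.
by move=> _ [d d0 <-]; exists d => //; apply/eqP; rewrite eq_le key key2.
Qed.

Lemma measurable_fun_eucl (f : 'rV[R]_k -> 'rV[R]_k) : continuous f ->
  measurable_fun setT (f : eucl R k -> eucl R k).
Proof.
move=> cf; apply: (@measurability _ _ (eucl R k) (eucl R k) setT f (@open 'rV[R]_k)) => //.
move=> _ [B oB <-]; rewrite setTI; apply: sub_sigma_algebra.
by apply: open_comp => // x _; exact: cf.
Qed.

Definition reflection (v : 'rV[R]_k) : 'M[R]_k := 1%:M - (2 / edot v v) *: (v^T *m v).

Lemma mul_reflection (v z : 'rV[R]_k) : z *m reflection v = z - (2 / edot v v * edot z v) *: v.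
Proof.
rewrite /reflection mulmxBr mulmx1 -scalemxAr mulmxA; congr (_ - _).
have -> : z *m v^T = (edot z v)%:M.
  by apply/matrixP => i j; rewrite !ord1 edotE !mxE eqxx mulr1n; apply: eq_bigr => l _; rewrite !mxE.
by rewrite mul_scalar_mx scalerA.
Qed.

Lemma reflection_inv v : v != 0 -> reflection v *m reflection v = 1%:M.
Proof.
move=> v0; have d0 : edot v v != 0 by apply: contra_neq v0; exact: edotxx_eq0.
apply/row_matrixP => i; rewrite row_mul mul_reflection row1.
set z := row i (reflection v).
have -> : z = delta_mx 0 i - (2 / edot v v * edot (delta_mx 0 i) v) *: v.
  by rewrite -mul_reflection -rowE.
rewrite edotBl edotZl; set c := edot (delta_mx 0 i) v.
rewrite -addrA -opprD -scalerDl.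
have -> : 2 / edot v v * c + 2 / edot v v * (c - 2 / edot v v * c * edot v v) = 0 by field.
by rewrite scale0r subr0.
Qed.

Lemma enorm_reflection v z : v != 0 -> enorm (z *m reflection v) = enorm z.
Proof.
move=> v0; have d0 : edot v v != 0 by apply: contra_neq v0; exact: edotxx_eq0.
rewrite /enorm mul_reflection; congr Num.sqrt.
rewrite edotBl !edotBr !edotZl !edotZr (edotC v z); field.
exact: d0.
Qed.

Lemma reflection_swap (x y : 'rV[R]_k) : edot x x = edot y y -> x != y ->
  x *m reflection (x - y) = y.
Proof.
move=> xy nxy; have v0 : x - y != 0 by rewrite subr_eq0.
have d0 : edot (x - y) (x - y) != 0 by apply: contra_neq v0; exact: edotxx_eq0.
rewrite mul_reflection.
have -> : 2 / edot (x - y) (x - y) * edot x (x - y) = 1.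
  have e : edot (x - y) (x - y) = 2 * edot x (x - y).
    by rewrite edotBl !edotBr (edotC y x) -xy; ring.
  have e0 : edot x (x - y) != 0 by apply: contra_neq d0 => h; rewrite e h mulr0.
  by rewrite e; move: (edot x (x - y)) e0 => t t0; field.
by rewrite scale1r opprB addrC subrK.
Qed.

End HausdorffInvariance.

(** * Second moments of a measure at a point *)

Section TangentMoments.
Context {R : realType} {k n : nat}.
Hypothesis n0 : (0 < n)%N.
Variable nu : {finite_measure set (eucl R k) -> \bar R}.
Implicit Types (x w z : 'rV[R]_k) (T : 'M[R]_k) (r : R).

Definition profile w z : R := bump (edot z z) * edot z w ^+ 2.

Definition moment x w r : R :=
  r ^- n * expect nu (fun y => profile w (r^-1 *: ((y : 'rV[R]_k) - x))).

Definition plane_moment T w : R := fine (integral (@hausdorff R n k) (plane T) (fun z => (profile w z)%:E)).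

Lemma continuous_profile w : continuous (profile w).
Proof.
have c1 : continuous (fun z : 'rV[R]_k => z) by move=> z; exact: cvg_id.
apply: fun_continuousM.
  apply: (fun_continuous_comp (h := bump)); first exact: continuous_bump.
  exact: continuous_edot.
apply: (fun_continuous_comp (h := fun t : R => t ^+ 2)); first exact: exprn_continuous.
by apply: continuous_edot => //; exact: fun_continuous_cst.
Qed.

Lemma profile_far w z : 1 <= enorm z -> profile w z = 0.
Proof.
move=> h; rewrite /profile bump_eq0 ?mul0r// -sqr_enorm.
by rewrite expr_ge1// enorm_ge0.
Qed.

Lemma compact_far_support (phi : 'rV[R]_k -> R) rho : (forall z, rho <= enorm z -> phi z = 0) ->
  compact (closure [set z | phi z != 0]).
Proof.
move=> h; apply: (@compact_sub_ecball R k _ 0 rho); first exact: closed_closure.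
apply: closure_sub; first exact: closed_ecball.
move=> z /= /eqP nz; rewrite /ecball /= subr0 leNgt; apply/negP => /ltW /h; exact: nz.
Qed.

Lemma profile_ge0 w z : 0 <= profile w z.
Proof. by rewrite mulr_ge0 ?bump_ge0 ?sqr_ge0. Qed.

Lemma profile_le w z : profile w z <= enorm w ^+ 2.
Proof.
have [h|h] := leP 1 (enorm z); first by rewrite profile_far// sqr_ge0.
have b1 : bump (edot z z) <= 1 by apply: bump_le1; exact: edotxx_ge0.
have c1 : edot z w ^+ 2 <= enorm w ^+ 2.
  rewrite -real_normK ?num_real// lerXn2r ?nnegrE ?enorm_ge0//.
  by apply: le_trans (edot_le _ _) _; rewrite ler_piMl ?enorm_ge0// ltW.
rewrite /profile; have := bump_ge0 (edot z z); have := sqr_ge0 (edot z w).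
by move: (bump _) b1 (edot z w ^+ 2) c1 => b b1 c c1 c0 b0; nra.
Qed.

Lemma bborel_scaled (phi : 'rV[R]_k -> R) M x r : continuous phi -> (forall z, `|phi z| <= M) ->
  bborel ((fun y => phi (r^-1 *: ((y : 'rV[R]_k) - x))) : eucl R k -> R).
Proof.
move=> cphi hM; apply: (@continuous_bborel _ _ _ M) => //.
have cs : continuous (fun y : 'rV[R]_k => r^-1 *: (y - x)).
  apply: fun_continuousZ; first exact: fun_continuous_cst.
  by apply: fun_continuousB; [move=> y; exact: cvg_id|exact: fun_continuous_cst].
exact: (fun_continuous_comp cphi cs).
Qed.

Lemma bborel_profile w x r : bborel ((fun y => profile w (r^-1 *: ((y : 'rV[R]_k) - x))) : eucl R k -> R).
Proof.
apply: (bborel_scaled (M := enorm w ^+ 2)); first exact: continuous_profile.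
by move=> z; rewrite ger0_norm ?profile_ge0 ?profile_le.
Qed.

Lemma moment_cvg x theta T w : approx_tangent n nu x theta T ->
  moment x w r @[r --> 0^'+] --> theta * plane_moment T w.
Proof.
move=> [gT hT]; apply: hT; first exact: continuous_profile.
by apply: (@compact_far_support _ 1) => z; exact: profile_far.
Qed.

Lemma plane_fixed T z : grassmannian n T -> plane T z <-> z *m T = z.
Proof.
move=> gT; split=> [/submxP[c ->]|<-]; last exact: submxMl.
by rewrite -mulmxA (grass_idem gT).
Qed.

Lemma plane_moment_proj T w : grassmannian n T -> plane_moment T w = plane_moment T (w *m T).
Proof.
move=> gT; rewrite /plane_moment /integral; congr fine.
have -> : (fun z => (profile w z)%:E) \_ (plane T) = (fun z => (profile (w *m T) z)%:E) \_ (plane T) => //.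
apply/funext => z; rewrite !patchE; case: ifPn => // /set_mem/(plane_fixed _ gT) zT.
by congr (_%:E); rewrite /profile -(grass_edot z w gT) zT.
Qed.

(** The reflection along [u - v] exchanges [u] and [v], and maps the plane of [T] to itself because
    [u - v] lies in it. *)
Lemma plane_moment_rot T u v : grassmannian n T -> u *m T = u -> v *m T = v ->
  edot u u = edot v v -> plane_moment T u = plane_moment T v.
Proof.
move=> gT uT vT uv; have [->//|nuv] := eqVneq u v.
set d := u - v; have d0 : d != 0 by rewrite subr_eq0.
pose S := reflection d.
have SS : S *m S = 1%:M by exact: reflection_inv.
have Si (z : 'rV[R]_k) : enorm (z *m S) = enorm z by exact: enorm_reflection.
have uS : u *m S = v by exact: reflection_swap.
have St : S^T = S.
  by rewrite /S /reflection linearB /= trmx1 linearZ /= trmx_mul trmxK.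
have cS : continuous (fun z : 'rV[R]_k => z *m S) by exact: continuous_mulmxr.
rewrite /plane_moment; congr fine.
have inv := @integral_invariant _ (eucl R k) R (@hausdorff R n k) (fun z => z *m S) (plane T)
  (fun z => (profile v z)%:E) (measurable_fun_eucl cS).
rewrite [RHS]inv.
- congr (integral _ _ _); apply/funext => z /=; congr (_%:E).
  rewrite /profile -!sqr_enorm Si; congr (_ * _ ^+ 2).
  by rewrite edot_mulmx St -uS -mulmxA SS mulmx1.
- by move=> z; rewrite -mulmxA SS mulmx1.
- by move=> A; exact: hausdorff_iso.
- move=> z /(plane_fixed _ gT) zT; apply/(plane_fixed _ gT).
  by rewrite mul_reflection mulmxBl zT -scalemxAl /d mulmxBl uT vT.
Qed.

Lemma momentZ x w c r : moment x (c *: w) r = c ^+ 2 * moment x w r.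
Proof.
rewrite /moment mulrCA; congr (_ * _); rewrite -expectZ; last exact: bborel_profile.
by apply: eq_expect => y; rewrite /profile edotZr exprMn; ring.
Qed.

Lemma grass_unit T : grassmannian n T -> exists2 u : 'rV[R]_k, u *m T = u & edot u u = 1.
Proof.
move=> gT; have [_ _ rT] := gT.
have /rowV0Pn[v vT v0] : T != 0 by rewrite -mxrank_eq0 rT -lt0n.
have d0 : 0 < enorm v.
  by rewrite lt_neqAle enorm_ge0 andbT eq_sym; apply: contra_neq v0; exact: enorm_eq0.
exists ((enorm v)^-1 *: v).
  by rewrite -scalemxAl; congr (_ *: _); apply/(plane_fixed _ gT).
rewrite edotZl edotZr -sqr_enorm; field.
by rewrite gt_eqF.
Qed.

(** Reflections show that the limit depends only on the length of [w T], and homogeneity then makes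
    it a multiple of the squared length. The factor is left unevaluated. *)
Lemma moment_limit x theta T : approx_tangent n nu x theta T -> exists c, forall w,
  moment x w r @[r --> 0^'+] --> c * enorm (w *m T) ^+ 2.
Proof.
move=> hT; have gT : grassmannian n T by case: hT.
have [u uT u1] := grass_unit gT.
exists (theta * plane_moment T u) => w.
have -> : theta * plane_moment T u * enorm (w *m T) ^+ 2 = theta * plane_moment T (w *m T).
  have [wT0|wT0] := eqVneq (w *m T) 0.
    have m0 : moment x (w *m T) r @[r --> 0^'+] --> (0 : R).
      have -> : moment x (w *m T) = fun=> 0.
        apply/funext => r; rewrite wT0 -(scale0r (w *m T)) momentZ.
        by rewrite expr0n mul0r.
      exact: cvg_cst.
    by rewrite (cvg_unique (@norm_hausdorff _ R^o) (moment_cvg (w := w *m T) hT) m0) wT0 enorm0 expr0n mulr0.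
  have d0 : 0 < enorm (w *m T).
    by rewrite lt_neqAle enorm_ge0 andbT eq_sym; apply: contra_neq wT0; exact: enorm_eq0.
  pose z := (enorm (w *m T))^-1 *: (w *m T).
  have wz : w *m T = enorm (w *m T) *: z by rewrite scalerA divff ?scale1r// gt_eqF.
  have zT : z *m T = z by rewrite -scalemxAl -mulmxA (grass_idem gT).
  have z1 : edot z z = 1 by rewrite edotZl edotZr -sqr_enorm; field; rewrite gt_eqF.
  (* Homogeneity is obtained on the side of [nu], where the integral is linear, and transferred to
     the plane by uniqueness of limits. *)
  have h1 : moment x (w *m T) r @[r --> 0^'+] --> enorm (w *m T) ^+ 2 * (theta * plane_moment T z).
    have -> : moment x (w *m T) = fun r => enorm (w *m T) ^+ 2 * moment x z r.
      by apply/funext => r; rewrite -momentZ -wz.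
    by apply: cvgM; [exact: cvg_cst|exact: moment_cvg].
  rewrite (cvg_unique (@norm_hausdorff _ R^o) (moment_cvg (w := w *m T) hT) h1).
  by rewrite (plane_moment_rot gT uT zT) ?u1 ?z1//; ring.
by rewrite -plane_moment_proj//; exact: moment_cvg.
Qed.

(** Positivity of [omega n] is deduced from the positive density: for [omega n = 0] the quotient
    defining the density would be identically 0. *)
Lemma density_bounds x theta : has_density n nu x theta -> 0 < theta ->
  0 < omega n :> R /\ \forall r \near 0^'+,
    3 / 4 * theta * omega n * r ^+ n <= mass nu (ecball x r) <= 5 / 4 * theta * omega n * r ^+ n.
Proof.
move=> hd th0.
have hd' : mass nu (ecball x r) / (omega n * r ^+ n) @[r --> 0^'+] --> theta.
  have -> : (fun r => mass nu (ecball x r) / (omega n * r ^+ n)) =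
      (fun r => fine (nu (ecball x r) * ((omega n * r ^+ n)^-1)%:E)%E).
    apply/funext => r; have <- := massE nu (measurable_ecball x r).
    by rewrite -EFinM.
  exact: (fine_cvg hd).
have om0 : 0 <= omega n :> R.
  apply: fine_ge0; apply: le_ereal_inf_tmp => _ [a [b [ab _ ->]]].
  apply: nneseries_ge0 => j _ _; rewrite lee_fin; apply: prodr_ge0 => i _.
  by rewrite subr_ge0.
have omp : 0 < omega n :> R.
  rewrite lt_neqAle om0 andbT eq_sym; apply/eqP => o0.
  have h0 : mass nu (ecball x r) / (omega n * r ^+ n) @[r --> 0^'+] --> (0 : R).
    have -> : (fun r => mass nu (ecball x r) / (omega n * r ^+ n)) = fun=> 0.
      by apply/funext => r; rewrite o0 mul0r invr0 mulr0.
    exact: cvg_cst.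
  by move: th0; rewrite (cvg_unique (@norm_hausdorff _ R^o) hd' h0) ltxx.
split => //; have t4 : 0 < theta / 4 by rewrite divr_gt0.
have /cvgrPdist_le/(_ _ t4) hn := hd'.
near=> r.
have r0 : 0 < r by near: r; exact: nbhs_right_gt.
have h : `|theta - mass nu (ecball x r) / (omega n * r ^+ n)| <= theta / 4 by near: r.
have orn : 0 < omega n * r ^+ n :> R by rewrite mulr_gt0// exprn_gt0.
have mE : mass nu (ecball x r) = mass nu (ecball x r) / (omega n * r ^+ n) * (omega n * r ^+ n).
  by rewrite divfK// gt_eqF.
move: h; rewrite ler_norml => /andP[h1 h2]; rewrite mE.
rewrite -!(mulrA _ (omega n)); apply/andP; split; rewrite ler_pM2r//; lra.
Unshelve. all: by end_near. Qed.

Lemma moment_trace T : grassmannian n T -> \sum_i enorm (delta_mx 0 i *m T : 'rV[R]_k) ^+ 2 = n%:R.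
Proof.
move=> gT; rewrite -(grass_trace gT); apply: eq_bigr => i _.
rewrite sqr_enorm (grass_edot2 _ _ gT) edotC -rowE.
rewrite /edot (bigD1 i)//= !mxE !eqxx mulr1 big1 ?addr0// => j ji.
by rewrite !mxE eqxx (negPf ji) mulr0.
Qed.

Lemma sum_profile z : \sum_i profile (delta_mx 0 i) z = bump (edot z z) * edot z z.
Proof.
rewrite -mulr_sumr; congr (_ * _); apply: eq_bigr => i _.
rewrite /edot (bigD1 i)//= !mxE !eqxx mulr1 big1 ?addr0 ?expr2// => j ji.
by rewrite !mxE eqxx (negPf ji) mulr0.
Qed.

(** Summing over the standard basis turns the limit into [c * n], and the moments into integrals of
    [bump(|z|^2) |z|^2]. These are bounded below by the mass of an annulus, which the density keeps
    positive. *)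
Lemma moment_limit_gt0 x theta T c : has_density n nu x theta -> 0 < theta -> grassmannian n T ->
  (forall w, moment x w r @[r --> 0^'+] --> c * enorm (w *m T) ^+ 2) -> 0 < c.
Proof.
move=> hd th0 gT hc.
have [om0 hb] := density_bounds hd th0.
have sum_cvg : (\sum_i moment x (delta_mx 0 i) r) @[r --> 0^'+] --> c * n%:R.
  rewrite -(moment_trace gT) mulr_sumr -[index_enum _]/(index_enum 'I_k).
  elim: (index_enum _) => [|i s IH].
    rewrite big_nil; under eq_fun do rewrite big_nil; exact: cvg_cst.
  rewrite big_cons; under eq_fun do rewrite big_cons.
  by apply: cvgD => //; exact: hc.
(* For [1/4 < |z| <= 3/4] one has [|z|^2 >= 1/16] and [bump(|z|^2) >= (1 - 9/16)^2]. The remaining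
   factor is a lower bound for the mass ratio of the annulus. *)
pose e := (7 / 16) ^+ 2 / 16 * (theta * omega n * (4^-1 ^+ n) : R).
have p4 : 0 < (4^-1 : R) ^+ n by rewrite exprn_gt0.
have e0 : 0 < e by rewrite mulr_gt0// mulr_gt0// mulr_gt0.
have lower : e <= c * n%:R.
  rewrite -(cvg_lim (@norm_hausdorff _ R^o) sum_cvg); apply: limr_ge.
    exact: cvgP sum_cvg.
  have q34 : (0 : R) < 3 / 4 by rewrite divr_gt0.
  have q14 : (0 : R) < 4^-1 by rewrite invr_gt0.
  have hb3 := near0_scale q34 hb; have hb1 := near0_scale q14 hb.
  near=> r.
  have r0 : 0 < r by near: r; exact: nbhs_right_gt.
  have /andP[m3 _] : 3 / 4 * theta * omega n * (3 / 4 * r) ^+ n <= mass nu (ecball x (3 / 4 * r)) <=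
       5 / 4 * theta * omega n * (3 / 4 * r) ^+ n by near: r.
  have /andP[_ m1] : 3 / 4 * theta * omega n * (4^-1 * r) ^+ n <= mass nu (ecball x (4^-1 * r)) <=
       5 / 4 * theta * omega n * (4^-1 * r) ^+ n by near: r.
  have rn : 0 < r ^+ n by rewrite exprn_gt0.
  pose A := (ecball x (3 / 4 * r) `\` ecball x (4^-1 * r)) : set (eucl R k).
  have mB s : measurable (ecball x s : set (eucl R k)) by exact: measurable_ecball.
  have mA : measurable A by apply: measurableD; exact: mB.
  have mAge : mass nu (ecball x (3 / 4 * r)) <= mass nu A + mass nu (ecball x (4^-1 * r)).
    apply: le_trans (massU _ _ _) => //; apply: mass_le => //; first exact: measurableU.
    by move=> y hy; case: (pselect (ecball x (4^-1 * r) y)) => h; [right|left].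
  have -> : \sum_i moment x (delta_mx 0 i) r =
      r ^- n * expect nu (fun y => \sum_i profile (delta_mx 0 i) (r^-1 *: ((y : 'rV[R]_k) - x))).
    by rewrite -mulr_sumr expect_big// => i; exact: bborel_profile.
  have hA : (7 / 16) ^+ 2 / 16 * mass nu A <=
      expect nu (fun y => \sum_i profile (delta_mx 0 i) (r^-1 *: ((y : 'rV[R]_k) - x))).
    apply: ge_mass_indic => //; first by apply: bborel_big => i; exact: bborel_profile.
    move=> y; rewrite indicE; case: (boolP (y \in A)) => [/set_mem[yA /negP nA]|_]; last first.
      by rewrite mulr0; apply: sumr_ge0 => i _; exact: profile_ge0.
    rewrite mulr1 sum_profile edotZl edotZr -sqr_enorm.
    rewrite /ecball /= -ltNge in nA; rewrite /ecball /= in yA.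
    set t := r^-1 * (r^-1 * _).
    have tE : t = (enorm ((y : 'rV[R]_k) - x) / r) ^+ 2 by rewrite /t expr_div_n; field; rewrite gt_eqF.
    have b3 : enorm ((y : 'rV[R]_k) - x) / r <= 3 / 4 by rewrite ler_pdivrMr.
    have b1 : 4^-1 <= enorm ((y : 'rV[R]_k) - x) / r by rewrite ler_pdivlMr// ltW.
    have t1 : 16^-1 <= t by rewrite tE; move: (_ / r) b1 => z b1; nra.
    have t2 : t <= 9 / 16 by rewrite tE; move: (_ / r) b1 b3 => z b1 b3; nra.
    rewrite /bump pos_id; last lra.
    apply: ler_pM; rewrite ?sqr_ge0//.
    by rewrite lerXn2r ?nnegrE//; lra.
  apply: le_trans (_ : r ^- n * ((7 / 16) ^+ 2 / 16 * mass nu A) <= _); last first.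
    by rewrite ler_pM2l// invr_gt0.
  have n3 : (3 : R) <= 3 ^+ n by rewrite -[leLHS]expr1; apply: ler_weXn2l => //; rewrite ler1n.
  (* In units of [theta * omega n * (r/4)^n], the annulus has mass at least [3^n * 3/4 - 5/4], which
     is at least 1. *)
  have key : theta * omega n * (4^-1 ^+ n) * r ^+ n <= mass nu A.
    rewrite exprMn in m1; rewrite !exprMn in m3.
    have X0 : 0 < theta * omega n * (4^-1 ^+ n) * r ^+ n by rewrite mulr_gt0// mulr_gt0// mulr_gt0.
    have e1 : 5 / 4 * theta * omega n * (4^-1 ^+ n * r ^+ n) = 5 / 4 * (theta * omega n * (4^-1 ^+ n) * r ^+ n).
      by rewrite !mulrA.
    have e3 : 3 / 4 * theta * omega n * (3 ^+ n * 4^-1 ^+ n * r ^+ n) =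
        3 ^+ n * (3 / 4 * (theta * omega n * (4^-1 ^+ n) * r ^+ n)) by ring.
    rewrite e1 in m1; rewrite e3 in m3.
    move: (mass nu A) mAge => a mAge; move: (mass nu (ecball x (3 / 4 * r))) mAge m3 => b mAge m3.
    move: (mass nu (ecball x (4^-1 * r))) mAge m1 => b' mAge m1.
    move: (theta * omega n * 4^-1 ^+ n * r ^+ n) X0 m1 m3 => X X0 m1 m3.
    have : 3 * (3 / 4 * X) <= 3 ^+ n * (3 / 4 * X) by rewrite ler_wpM2r// mulr_ge0// ltW.
    by move: (3 ^+ n * _) m3 => Y m3 h; lra.
  by rewrite mulrCA /e ler_pM2l// [leRHS]mulrC ler_pdivlMr.
have nr : 0 < n%:R :> R by rewrite ltr0n.
by rewrite -(pmulr_lgt0 _ nr); exact: lt_le_trans lower.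
Unshelve. all: by end_near. Qed.

End TangentMoments.

(** * A Borel field of planes *)

Section PlaneField.
Context {R : realType} {k n : nat}.
Hypotheses (n0 : (0 < n)%N) (nk : (n <= k)%N).
Variable nu : {finite_measure set (eucl R k) -> \bar R}.
Implicit Types (x w z : 'rV[R]_k) (T : 'M[R]_k) (r : R).

Lemma measurable_moment w r :
  measurable_fun setT ((fun x => moment (n := n) nu x w r) : eucl R k -> R).
Proof.
pose f (u : eucl R k * eucl R k) : \bar R := (profile w (r^-1 *: ((u.2 : 'rV[R]_k) - u.1)))%:E.
have mc i : measurable_fun setT ((fun x => x 0 i) : eucl R k -> R).
  by apply: continuous_measurable_eucl; exact: coord_continuous.
have mz i : measurable_fun setT (fun u : eucl R k * eucl R k => r^-1 * ((u.2 : 'rV[R]_k) 0 i - (u.1 : 'rV[R]_k) 0 i)).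
  apply: measurable_funM; first exact: measurable_cst.
  apply: measurable_funB.
    by apply: (measurableT_comp (mc i)); exact: measurable_snd.
  by apply: (measurableT_comp (mc i)); exact: measurable_fst.
have mf : measurable_fun setT f.
  apply/measurable_EFinP.
  have -> : (fun u : eucl R k * eucl R k => profile w (r^-1 *: ((u.2 : 'rV[R]_k) - u.1))) = fun u =>
      bump (\sum_i (r^-1 * ((u.2 : 'rV[R]_k) 0 i - (u.1 : 'rV[R]_k) 0 i)) * (r^-1 * ((u.2 : 'rV[R]_k) 0 i - (u.1 : 'rV[R]_k) 0 i))) *
      (\sum_i (r^-1 * ((u.2 : 'rV[R]_k) 0 i - (u.1 : 'rV[R]_k) 0 i)) * w 0 i) ^+ 2.
    apply/funext => u; rewrite /profile /edot; congr (bump _ * _ ^+ 2);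
      by apply: eq_bigr => i _; rewrite !mxE.
  apply: measurable_funM.
    apply: (measurableT_comp (f := bump)).
      by apply: continuous_measurable_fun; exact: continuous_bump.
    by apply: measurable_sum => i; apply: measurable_funM.
  apply: measurable_funX; apply: measurable_sum => i; exact: measurable_funM.
have f0 u : (0 <= f u)%E by rewrite lee_fin profile_ge0.
have mF := @measurable_fun_fubini_tonelli_F _ _ _ _ R nu f mf f0.
have -> : (fun x : eucl R k => moment (n := n) nu x w r) = fun x => r ^- n * fine (fubini_F nu f x).
  by apply/funext => x.
apply: measurable_funM; first exact: measurable_cst.
apply: (measurableT_comp (f := fine)) => //; exact: fine_measurable.
Qed.

(** An upper limit along a sequence of radii is a Borel function of [x] on the whole space; at
    points with a tangent plane it is the limit. *)
Definition upper_moment w x : R :=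
  fine (limn_esup (fun N => (moment (n := n) nu x w N.+1%:R^-1)%:E)).

Lemma measurable_upper_moment w : measurable_fun setT (upper_moment w : eucl R k -> R).
Proof.
apply: (measurableT_comp (f := fine)); first exact: fine_measurable.
apply: (@measurable_fun_limn_esup _ (eucl R k) R setT
  (fun N x => (moment (n := n) nu x w N.+1%:R^-1)%:E)) => N.
by apply/measurable_EFinP; exact: measurable_moment.
Qed.

Lemma upper_moment_lim w x c : moment (n := n) nu x w r @[r --> 0^'+] --> c -> upper_moment w x = c.
Proof.
move=> hc; rewrite /upper_moment.
have h : (moment (n := n) nu x w N.+1%:R^-1)%:E @[N --> \oo] --> c%:E.
  apply: cvg_EFin; first by apply: nearW.
  apply: (cvg_comp _ _ _ hc) => A [e e0 he].
  have [N _ hN] := @cvgr0_norm_lt _ _ _ _ _ _ (@cvg_harmonic R) e e0.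
  exists N => // j Nj; apply: he; last by rewrite invr_gt0.
  by rewrite /ball_ /= sub0r normrN; exact: hN.
by rewrite (cvg_limn_einf_sup h).2.
Qed.

(** Polarization of the quadratic form [c |w T|^2]. The unknown [c] cancels against the sum over the
    basis, which is [c * n]. The power [-1] is a Borel function on the whole line and equals the
    inverse for nonnegative arguments. *)
Definition polar_matrix x : 'M[R]_k := \matrix_(i, j)
  (n%:R * (upper_moment (delta_mx 0 i + delta_mx 0 j) x - upper_moment (delta_mx 0 i) x
     - upper_moment (delta_mx 0 j) x) * (2 * \sum_l upper_moment (delta_mx 0 l) x) `^ (-1)).

Lemma measurable_polar_matrix : measurable_matrix (polar_matrix : eucl R k -> 'M[R]_k).
Proof.
move=> i j; under eq_fun do rewrite mxE.
apply: measurable_funM.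
  apply: measurable_funM; first exact: measurable_cst.
  by apply: measurable_funB; [apply: measurable_funB|]; exact: measurable_upper_moment.
apply: (measurableT_comp (f := fun t : R => t `^ (-1))); first exact: measurable_powR.
apply: measurable_funM; first exact: measurable_cst.
by apply: measurable_sum => l; exact: measurable_upper_moment.
Qed.

Lemma polar_matrix_tangent x theta T : has_density n nu x theta -> 0 < theta ->
  approx_tangent n nu x theta T -> polar_matrix x = T.
Proof.
move=> hd th0 hT; have gT : grassmannian n T by case: hT.
have [c hc] := moment_limit n0 hT.
have c0 := moment_limit_gt0 n0 hd th0 gT hc.
have uE w : upper_moment w x = c * enorm (w *m T) ^+ 2 by exact: upper_moment_lim.
apply/matrixP => i j; rewrite mxE; under eq_bigr do rewrite uE.
rewrite -mulr_sumr (moment_trace gT) !uE powR_inv1; last by rewrite !mulr_ge0// ltW.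
have -> : c * enorm ((delta_mx 0 i + delta_mx 0 j : 'rV[R]_k) *m T) ^+ 2
    - c * enorm (delta_mx 0 i *m T : 'rV[R]_k) ^+ 2 - c * enorm (delta_mx 0 j *m T : 'rV[R]_k) ^+ 2
    = c * 2 * T i j.
  rewrite mulmxDl !sqr_enorm edotDl !edotDr (edotC (delta_mx 0 j *m T)).
  have -> : edot (delta_mx 0 i *m T : 'rV[R]_k) (delta_mx 0 j *m T) = T i j.
    rewrite edotC (grass_edot2 _ _ gT) edotC -!rowE /edot (bigD1 j)//= !mxE !eqxx mulr1 big1 ?addr0// => l lj.
    by rewrite !mxE eqxx (negPf lj) mulr0.
  by ring.
by field; rewrite (gt_eqF c0) pnatr_eq0 -lt0n n0.
Qed.

(** With the trace in place of the rank, membership becomes a finite system of polynomial equations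
    in the entries, hence a Borel condition. *)
Lemma grassmannianP T : grassmannian n T <-> [/\ T^T = T, T *m T = T & \tr T = n%:R].
Proof.
split=> [gT|[sT iT tT]]; first by split; [exact: grass_tr gT|exact: grass_idem gT|exact: grass_trace gT].
by split => //; apply/eqP; rewrite -(eqr_nat R) -mxtrace_proj// tT.
Qed.

(** The coordinate projection fills in at exceptional points, so that every value is a projection of
    rank [n] and the tilt is bounded everywhere. *)
Definition plane_field x : 'M[R]_k :=
  if `[< grassmannian n (polar_matrix x) >] then polar_matrix x else pid_mx n.

Lemma plane_field_grass x : grassmannian n (plane_field x).
Proof.
rewrite /plane_field; case: asboolP => // _; split; first exact: tr_pid_mx.
  by rewrite pid_mx_id.
by rewrite rank_pid_mx.
Qed.

Lemma measurable_plane_field : measurable_matrix (plane_field : eucl R k -> 'M[R]_k).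
Proof.
move=> i j; have mp := measurable_polar_matrix.
pose b1 (x : eucl R k) := [forall i, forall j, polar_matrix x i j == polar_matrix x j i].
pose b2 (x : eucl R k) := [forall i, forall j, (\sum_l polar_matrix x i l * polar_matrix x l j) == polar_matrix x i j].
pose b3 (x : eucl R k) := (\sum_l polar_matrix x l l) == n%:R.
have mall (b : 'I_k -> eucl R k -> bool) : (forall i, measurable_fun setT (b i)) ->
    measurable_fun setT (fun x : eucl R k => [forall i, b i x]).
  move=> mb; apply: (measurable_fun_bool true); rewrite setTI.
  have -> : (fun x : eucl R k => [forall i, b i x]) @^-1` [set true] = \bigcap_(i : 'I_k) (b i @^-1` [set true]).
    apply/seteqP; split => [x /= /forallP h l _ /=|x /= h]; first by rewrite h.
    by apply/forallP => l; rewrite (h l).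
  apply: fin_bigcap_measurable => // l _.
  by rewrite -[X in measurable X]setTI; exact: mb.
have -> : (fun x : eucl R k => plane_field x i j) =
    fun x => if [&& b1 x, b2 x & b3 x] then polar_matrix x i j else (pid_mx n : 'M[R]_k) i j.
  apply/funext => x; rewrite /plane_field; case: asboolP => [/grassmannianP[h1 h2 h3]|h].
    case: ifPn => // /and3P[]; split.
    - by apply/forallP => a; apply/forallP => b; rewrite -{1}h1 mxE.
    - by apply/forallP => a; apply/forallP => b; rewrite -{3}h2 mxE.
    - by apply/eqP.
  case: ifPn => // /and3P[/forallP h1 /forallP h2 /eqP h3].
  exfalso; apply: h; apply/grassmannianP; split => //.
    by apply/matrixP => a b; rewrite mxE; move/forallP: (h1 b) => /(_ a)/eqP.
  by apply/matrixP => a b; rewrite mxE; move/forallP: (h2 a) => /(_ b)/eqP.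
apply: measurable_fun_ifT => //.
apply: measurable_and; first by apply: (mall) => a; apply: (mall) => b; exact: measurable_fun_eqr.
apply: measurable_and.
  apply: (mall) => a; apply: (mall) => b; apply: measurable_fun_eqr => //.
  by apply: measurable_sum => l; exact: measurable_funM.
apply: measurable_fun_eqr; last exact: measurable_cst.
by apply: measurable_sum => l.
Qed.

Lemma plane_field_tangent x theta T : has_density n nu x theta -> 0 < theta ->
  approx_tangent n nu x theta T -> plane_field x = T.
Proof.
move=> hd th0 hT; rewrite /plane_field (polar_matrix_tangent hd th0 hT).
by case: asboolP => // -[]; case: hT.
Qed.

Lemma plane_field_tangent_plane x theta T : has_density n nu x theta -> 0 < theta ->
  approx_tangent n nu x theta T -> tangent_plane n nu x = T.
Proof.
move=> hd th0 hT; rewrite /tangent_plane; case: xgetP => [T' -> [t [t0 ht hT']]|].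
  by rewrite -(plane_field_tangent ht t0 hT') (plane_field_tangent hd th0 hT).
by move=> /(_ T)[]; exists theta.
Qed.

End PlaneField.

(** * Localization and first variation *)

Section Exhaustion.
Context {R : realType} {k : nat}.
Implicit Types (U K O : set 'rV[R]_k) (r : R).

Lemma compact_sub_open K O : compact K -> open O -> K `<=` O ->
  exists2 r : R, 0 < r & forall x, K x -> eball x r `<=` O.
Proof.
move=> cK oO KO.
have /compact_near_coveringP/(_ R 0^'+ (fun r x => eball x r `<=` O)) h := cK.
suff /near0P[r0 r00 hr] : \forall r \near 0^'+, K `<=` (fun x => eball x r `<=` O).
  by exists (r0 / 2); [rewrite divr_gt0|apply: hr; [rewrite divr_gt0|lra]].
apply: h => x Kx; have [s s0 sO] := (open_eballP O).1 oO x (KO _ Kx).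
exists (eball x (s / 2), [set r | r < s / 2]).
  split => /=; first by apply: nbhs_eball; rewrite divr_gt0.
  by apply: nbhs_right_lt; rewrite divr_gt0.
move=> [y r] /= [yx rs] z zy; apply: sO; rewrite /eball /= in yx zy *.
have := enorm_dist z y x; lra.
Qed.

(** A radius strictly above [1/(i+1)] makes the set open; balls of radius exactly [1/(i+1)] define
    the compact subset of [U] that contains it. *)
Definition inner_part U (i : nat) : set 'rV[R]_k :=
  [set x | enorm x < i.+1%:R /\ exists2 r : R, i.+1%:R^-1 < r & eball x r `<=` U].

Lemma open_inner_part U i : open (inner_part U i).
Proof.
apply/open_eballP => x [xi [r ri rU]].
pose s := Num.min (i.+1%:R - enorm x) ((r - i.+1%:R^-1) / 2).
have s0 : 0 < s by rewrite lt_min subr_gt0 xi divr_gt0// subr_gt0.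
have s1 : s <= i.+1%:R - enorm x by rewrite ge_min lexx.
have s2 : s <= (r - i.+1%:R^-1) / 2 by rewrite ge_min lexx orbT.
exists s => // y; rewrite /eball /= => ys; split.
  have := ler_enormD (y - x) x; rewrite subrK; lra.
exists (r - s); first by move: s2 ri; move: (i.+1%:R^-1) => t s2 ri; lra.
move=> z; rewrite /eball /= => zy; apply: rU; rewrite /eball /=.
have := enorm_dist z y x; lra.
Qed.

Lemma inner_part_compact U i : exists K, [/\ compact K, K `<=` U & inner_part U i `<=` K].
Proof.
have i0 : 0 < i.+1%:R^-1 :> R by rewrite invr_gt0.
exists [set x | enorm x <= i.+1%:R /\ eball x i.+1%:R^-1 `<=` U]; split.
- apply: (@compact_sub_ecball R k _ 0 i.+1%:R); last by move=> x [h _]; rewrite /ecball /= subr0.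
  rewrite -openC; apply/open_eballP => x /not_andP[/negP|/existsNP[z /not_implyP[zx nU]]].
    rewrite -ltNge => xi; exists (enorm x - i.+1%:R); first by rewrite subr_gt0.
    move=> y; rewrite /eball /= => yx [yi _].
    have := ler_enormD (x - y) y; rewrite subrK enormB; lra.
  exists (i.+1%:R^-1 - enorm (z - x)); first by rewrite subr_gt0.
  move=> y; rewrite /eball /= => yx [_ yU]; apply: nU; apply: yU; rewrite /eball /= in zx *.
  have := enorm_dist z x y; rewrite (enormB x); move: yx; move: (i.+1%:R^-1) => t yx; lra.
- by move=> x [_]; apply; rewrite /eball /= subrr enorm0.
- move=> x [h [r ri rU]]; split; first exact: ltW.
  by move=> y yx; apply: rU; rewrite /eball /= in yx *; exact: lt_trans ri.
Qed.

Lemma inner_part_sub U i : inner_part U i `<=` U.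
Proof.
move=> x [_ [r ri rU]]; apply: rU; rewrite /eball /= subrr enorm0.
by apply: le_lt_trans ri; rewrite invr_ge0.
Qed.

Lemma inner_part_cover U : open U -> U `<=` \bigcup_i inner_part U i.
Proof.
move=> oU x Ux; have [r r0 rU] := (open_eballP U).1 oU x Ux.
pose N := maxn (Num.truncn (enorm x)) (Num.truncn r^-1).
exists N => //; split.
  apply: lt_le_trans (truncnS_gt (enorm x)) _.
  by rewrite ler_nat ltnS leq_maxl.
exists r => //; rewrite invf_plt ?posrE//.
apply: lt_le_trans (truncnS_gt r^-1) _.
by rewrite ler_nat ltnS leq_maxr.
Qed.

End Exhaustion.

Section Localize.
Context {R : realType} {k n : nat}.
Variable mu : {measure set (eucl R k) -> \bar R}.
Variable D : set 'rV[R]_k.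
Hypotheses (oD : open D) (fD : (mu D < +oo)%E).
Implicit Types (x : 'rV[R]_k) (T : 'M[R]_k).

Definition restrict : {finite_measure set (eucl R k) -> \bar R} :=
  mfrestr (open_measurable_eucl oD) fD.

Lemma restrictE (A : set (eucl R k)) : A `<=` D -> restrict A = mu A.
Proof. by move=> AD; rewrite /restrict /= /mfrestr /mrestr setIidl. Qed.

Lemma restrict_null : restrict (~` D) = 0%E.
Proof. by rewrite /restrict /= /mfrestr /mrestr setIC setICr measure0. Qed.

Lemma integral_restrict (f : eucl R k -> \bar R) : (forall x, ~ D x -> f x = 0%E) ->
  (\int[mu]_x f x = \int[restrict]_x f x)%E.
Proof. by move=> f0; apply: (@eq_integral_on _ (eucl R k) R mu restrict D f _ f0) => A mA AD; rewrite restrictE. Qed.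

Lemma has_density_restrict x theta : D x -> has_density n mu x theta <-> has_density n restrict x theta.
Proof.
move=> Dx; have [s s0 sD] := (open_eballP D).1 oD x Dx.
have E : \forall r \near 0^'+, mu (ecball x r) = restrict (ecball x r).
  apply/near0P; exists s => // r r0 rs; rewrite restrictE// => y; rewrite /ecball /= => yr.
  by apply: sD; exact: le_lt_trans yr rs.
split; apply: cvg_trans; apply: near_eq_cvg; near=> r; congr (_ * _)%E; last apply/esym; by near: r.
Unshelve. all: by end_near. Qed.

Lemma compact_support_far (phi : 'rV[R]_k -> R) : compact (closure [set y | phi y != 0]) ->
  exists2 rho : R, 0 < rho & forall z, rho <= enorm z -> phi z = 0.
Proof.
move=> /compact_bounded[M [_ hM]].
pose M1 := Num.max M 0 + 1.
have M10 : 0 < M1 by rewrite ltr_pwDr// le_max lexx orbT.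
have MM : M < M1 by rewrite ltr_pwDr// le_max lexx.
exists (k%:R * M1 + 1); first by rewrite ltr_pwDr// mulr_ge0// ltW.
move=> z hz; apply/eqP; apply/negP => /negP pz.
have : `|z| <= M1 by apply: hM => //; exact: subset_closure.
have := ler_enorm_norm z; have k0 : 0 <= k%:R :> R by [].
move: hz; move: (k%:R) k0 (enorm z) (`|z|) => K K0 e t; move: (M1) M10 => M2 M20; nra.
Qed.

Lemma approx_tangent_restrict x theta T : D x ->
  approx_tangent n mu x theta T <-> approx_tangent n restrict x theta T.
Proof.
move=> Dx; have [s s0 sD] := (open_eballP D).1 oD x Dx.
have key (phi : 'rV[R]_k -> R) : compact (closure [set y | phi y != 0]) ->
    \forall r \near 0^'+, (\int[mu]_y phi (r^-1 *: ((y : 'rV[R]_k) - x))) =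
      \int[restrict]_y phi (r^-1 *: ((y : 'rV[R]_k) - x)).
  move=> /compact_support_far[rho rho0 hrho].
  apply/near0P; exists (s / rho); first by rewrite divr_gt0.
  move=> r r0; rewrite ltr_pdivlMr// => rs.
  rewrite /Rintegral integral_restrict// => y nDy; rewrite hrho//.
  rewrite enormZ ger0_norm ?invr_ge0 ?(ltW r0)// mulrC ler_pdivlMr// mulrC.
  rewrite leNgt; apply/negP => h; apply: nDy; apply: sD; rewrite /eball /=.
  exact: lt_trans h rs.
split=> -[gT hT]; split=> // phi cphi kphi; apply: cvg_trans (hT phi cphi kphi);
  apply: near_eq_cvg; near=> r; congr (_ * _); last apply/esym; near: r; exact: key.
Unshelve. all: by end_near. Qed.

Lemma tangent_plane_restrict x : D x -> tangent_plane n mu x = tangent_plane n restrict x.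
Proof.
move=> Dx; rewrite /tangent_plane; congr xget; apply/seteqP.
by split=> T [theta [t0 hd hT]]; exists theta; split=> //;
  [exact/has_density_restrict|exact/approx_tangent_restrict|exact/has_density_restrict|exact/approx_tangent_restrict].
Qed.

End Localize.

(** * Test fields with compact support *)

Section Fields.
Context {R : realType} {k : nat}.
Implicit Types (eta : 'rV[R]_k -> 'rV[R]_k) (U V : set 'rV[R]_k).

Definition supp eta : set 'rV[R]_k := closure [set x | eta x != 0].

Lemma supp_eq0 eta x : ~ supp eta x -> eta x = 0.
Proof. by move=> h; apply/eqP; apply/negP => /negP h'; apply: h; exact: subset_closure. Qed.

Lemma jacobian_eq0 eta x : ~ supp eta x -> 'J eta x = 0.
Proof.
move=> nx; have oS : open (~` supp eta) by rewrite openC; exact: closed_closure.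
have [r r0 rS] := (open_eballP _).1 oS x nx.
have h : is_diff x eta (\0 : 'rV[R]_k -> 'rV[R]_k).
  apply: (@is_diff_epsP R _ _ eta \0 x); first exact: cst_continuous.
  move=> e e0; near=> v.
  have vr : eball (0 : 'rV[R]_k) r v by near: v; exact: nbhs_eball.
  rewrite (supp_eq0 nx) (@supp_eq0 eta (v + x)); last first.
    by apply: rS; rewrite /eball /= addrK; rewrite /eball /= subr0 in vr.
  by rewrite !subr0 normr0 mulr_ge0// ltW.
case: h => dx dE; rewrite /jacobian dE; apply/matrixP => i j.
by rewrite mxE [RHS]mxE /= mxE.
Unshelve. all: by end_near. Qed.

Lemma jacobianD eta zeta (x : 'rV[R]_k) : differentiable eta x -> differentiable zeta x ->
  'J (fun y => eta y + zeta y) x = 'J eta x + 'J zeta x.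
Proof.
move=> d1 d2; have d3 : differentiable (eta + zeta) x by exact: differentiableD.
apply/row_matrixP => i; rewrite !rowE.
rewrite mulmxDr.
have h1 := deriveEjacobian (delta_mx 0 i) d1.
have h2 := deriveEjacobian (delta_mx 0 i) d2.
have h3 := deriveEjacobian (delta_mx 0 i) d3.
apply: (etrans (esym h3)).
have h4 : 'D_(delta_mx 0 i) (eta + zeta) x = 'D_(delta_mx 0 i) eta x + 'D_(delta_mx 0 i) zeta x by apply: deriveD; exact: diff_derivable.
apply: (etrans h4). 
congr (_ + _); [exact: h1|exact: h2].
Qed.

Lemma jacobianZ eta c (x : 'rV[R]_k) : differentiable eta x -> 'J (fun y => c *: eta y) x = c *: 'J eta x.
Proof.
move=> d1; have d3 : differentiable (c *: eta) x by exact: differentiableZ.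
apply/row_matrixP => i; rewrite !rowE.
rewrite -scalemxAr.
have h1 := deriveEjacobian (delta_mx 0 i) d1.
have h3 := deriveEjacobian (delta_mx 0 i) d3.
apply: (etrans (esym h3)).
have h4 : 'D_(delta_mx 0 i) (c *: eta) x = c *: 'D_(delta_mx 0 i) eta x by apply: deriveZ; exact: diff_derivable.
apply: (etrans h4). 
congr (_ *: _); exact: h1.
Qed.

Lemma C1c_sub U V eta : U `<=` V -> C1c U eta -> C1c V eta.
Proof. by move=> UV [h1 h2 h3 h4]; split=> //; exact: subset_trans UV. Qed.

Lemma C1cZ U eta c : C1c U eta -> C1c U (fun x => c *: eta x).
Proof.
move=> [h1 h2 h3 h4].
have ss : closure [set x | c *: eta x != 0] `<=` supp eta.
  apply: closureS => x /=; apply: contra_neq => ->; exact: scaler0.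
split.
- by move=> x; exact: differentiableZ.
- have -> : (fun x => 'J (fun y => c *: eta y) x) = fun x => c *: 'J eta x.
    by apply/funext => x; exact: jacobianZ.
  by apply: fun_continuousZ => //; exact: fun_continuous_cst.
- by apply: subclosed_compact ss => //; exact: closed_closure.
- exact: subset_trans h4.
Qed.

Lemma C1cD U V W eta zeta : C1c U eta -> C1c V zeta -> U `<=` W -> V `<=` W ->
  C1c W (fun x => eta x + zeta x).
Proof.
move=> [h1 h2 h3 h4] [g1 g2 g3 g4] UW VW.
have ss : closure [set x | eta x + zeta x != 0] `<=` supp eta `|` supp zeta.
  rewrite /supp -closureU; apply: closureS => x /= nz.
  have [e0|] := eqVneq (eta x) 0; last by left.
  by right; move: nz; rewrite e0 add0r.
split.
- by move=> x; exact: differentiableD.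
- have -> : (fun x => 'J (fun y => eta y + zeta y) x) = fun x => 'J eta x + 'J zeta x.
    by apply/funext => x; exact: jacobianD.
  exact: (fun_continuousD h2 g2).
- by apply: subclosed_compact ss; [exact: closed_closure|exact: compactU].
- move=> x /ss[/h4/UW|/g4/VW] //.
Qed.

Lemma C1c0 U : C1c U (fun=> 0 : 'rV[R]_k).
Proof.
pose z : 'rV[R]_k -> 'rV[R]_k := fun=> 0; rewrite -/z.
have ss : supp z = set0.
  rewrite /supp (_ : [set x | _] = set0) ?closure0//.
  by apply/seteqP; split => x //=; rewrite eqxx.
have j0 x : 'J z x = 0 by apply: jacobian_eq0; rewrite ss.
split; rewrite -/(supp z) ?ss//.
- have -> : jacobian z = fun=> 0 by apply/funext.
  exact: cst_continuous.
- exact: compact0.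
Qed.

End Fields.

Lemma ae_imply {d : measure_display} {X : measurableType d} {R : realType}
    (m : {measure set X -> \bar R}) (P P' : X -> Prop) :
  (forall x, P x -> P' x) -> {ae m, forall x, P x} -> {ae m, forall x, P' x}.
Proof. by move=> h [N [mN N0 sub]]; exists N; split => // x /= nP; apply: sub => /= /h. Qed.

Section FirstVariation.
Context {R : realType} {k n : nat}.
Hypotheses (n0 : (0 < n)%N) (nk : (n <= k)%N).
Variable mu : {measure set (eucl R k) -> \bar R}.
Variable D : set 'rV[R]_k.
Hypotheses (oD : open D) (fD : (mu D < +oo)%E).
Hypothesis varifold : {ae mu, forall x, D x -> exists (T : 'M[R]_k) (N : nat),
    [/\ (0 < N)%N, has_density n mu x N%:R & approx_tangent n mu x N%:R T]}.
Implicit Types (x : 'rV[R]_k) (eta : 'rV[R]_k -> 'rV[R]_k).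
Local Notation nu := (restrict oD fD).
Local Notation T := (plane_field (n := n) nu).

Lemma ae_restrict (P : eucl R k -> Prop) : {ae mu, forall x, D x -> P x} -> {ae nu, forall x, P x}.
Proof.
move=> [N [mN N0 sub]]; have mD := open_measurable_eucl oD.
exists (N `|` ~` D); split; first by apply: measurableU => //; exact: measurableC.
  apply/eqP; rewrite eq_le measure_ge0 andbT.
  rewrite /restrict /= /mfrestr /mrestr setIUl setICl setU0 -N0.
  by apply: le_measure; rewrite ?inE//; exact: measurableI.
move=> x /= nP; have [Dx|] := pselect (D x); last by right.
by left; apply: sub => /= h; apply: nP; exact: h.
Qed.

Lemma ae_of_restrict (P : eucl R k -> Prop) : {ae nu, forall x, P x} -> {ae mu, forall x, D x -> P x}.
Proof.
move=> [N [mN N0 sub]]; have mD := open_measurable_eucl oD.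
exists (N `&` D); split; [exact: measurableI|exact: N0|].
by move=> x /= /not_implyP[Dx nP]; split => //; exact: sub.
Qed.

Lemma ae_plane_field : {ae nu, forall x, tangent_plane n mu x = T x}.
Proof.
apply: ae_restrict; apply: ae_imply varifold => x h Dx.
have [S [N [N0 hd hS]]] := h Dx.
rewrite (tangent_plane_restrict oD fD Dx).
have hd' : has_density n nu x N%:R by exact/(has_density_restrict oD fD).
have hS' : approx_tangent n nu x N%:R S by exact/(approx_tangent_restrict oD fD).
have N0' : 0 < N%:R :> R by rewrite ltr0n.
by rewrite (plane_field_tangent_plane n0 hd' N0' hS') (plane_field_tangent n0 hd' N0' hS').
Qed.

Lemma bborel_div eta : C1c D eta -> bborel (fun x : eucl R k => \tr (T x *m 'J eta x)).
Proof.
move=> [h1 h2 h3 h4].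
have bT i j : bborel (fun x : eucl R k => T x i j).
  split; first exact: measurable_plane_field.
  exists (n%:R : R) => x; have h := grass_hsnorm n0 (plane_field_grass nk nu x); apply: le_trans h.
  rewrite -ler_sqr ?nnegrE ?hsnorm_ge0// sqr_hsnorm real_normK ?num_real//.
  rewrite (bigD1 i)//= (bigD1 j)//= -addrA lerDl addr_ge0//.
    by apply: sumr_ge0 => l _; exact: sqr_ge0.
  by apply: sumr_ge0 => a _; apply: sumr_ge0 => b _; exact: sqr_ge0.
have bJ i j : bborel (fun x : eucl R k => 'J eta x i j).
  have cJ : continuous (fun x : 'rV[R]_k => 'J eta x i j).
    exact: (fun_continuous_comp (h := fun A : 'M[R]_k => A i j) (@coord_continuous _ _ _ i j) h2).
  have [M hM] : exists M, forall y, `|'J eta y i j| <= M.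
    by apply: (compact_supp_bounded cJ h3) => y ny; rewrite (jacobian_eq0 ny) mxE.
  exact: (continuous_bborel cJ hM).
rewrite /mxtrace; under eq_fun do under eq_bigr do rewrite mxE.
by apply: bborel_big => i; apply: bborel_big => j; exact: bborelM.
Qed.

Lemma first_variationE eta : C1c D eta ->
  first_variation n mu eta = expect nu (fun x => \tr (T x *m 'J eta x)).
Proof.
move=> [h1 h2 h3 h4]; rewrite /first_variation /expect /Rintegral; congr fine.
rewrite (integral_restrict oD fD); last first.
  move=> x nDx; rewrite /tangential_div jacobian_eq0 ?mulmx0 ?mxtrace0//.
  by move/h4.
apply: ae_eq_integral_total; apply: ae_imply ae_plane_field => x h.
by rewrite /tangential_div h.
Qed.

Lemma first_variationD eta zeta : C1c D eta -> C1c D zeta ->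
  first_variation n mu (fun x => eta x + zeta x) = first_variation n mu eta + first_variation n mu zeta.
Proof.
move=> c1 c2; have c3 : C1c D (fun x => eta x + zeta x) by exact: (C1cD c1 c2).
rewrite !first_variationE// -expectD; try exact: bborel_div.
apply: eq_expect => x; rewrite jacobianD; first by rewrite mulmxDr mxtraceD.
  by case: c1.
by case: c2.
Qed.

Lemma first_variationZ eta c : C1c D eta ->
  first_variation n mu (fun x => c *: eta x) = c * first_variation n mu eta.
Proof.
move=> c1; have c3 := C1cZ c c1.
rewrite !first_variationE// -expectZ; last exact: bborel_div.
by apply: eq_expect => x; rewrite jacobianZ; [rewrite -scalemxAr mxtraceZ|case: c1].
Qed.

(** The common interface of the two hypotheses on [p]. It is realised by the total variation twice
    if [p = 1], and by the integrals of [|H|] and [|H|^p] if [p > 1]. *)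
Record variation_control (p : R) (v lam : set 'rV[R]_k -> R) : Prop := VariationControl {
  vc_ge0 : forall O, 0 <= v O ;
  vc_mono : forall O O', open O -> open O' -> O `<=` O' -> O' `<=` D -> v O <= v O' ;
  vc_super : forall O O', open O -> open O' -> O `&` O' = set0 ->
    O `<=` D -> O' `<=` D -> v O + v O' <= v (O `|` O') ;
  vc_gauge : gauge D lam ;
  vc_holder : forall O, open O -> O `<=` D ->
    v O <= lam O `^ p^-1 * mass nu O `^ (1 - p^-1) ;
  vc_bound : forall O eta M, open O -> O `<=` D -> C1c O eta -> (forall x, enorm (eta x) <= M) ->
    `|first_variation n mu eta| <= M * v O }.

Section TotalVariation.
Hypothesis finV : (total_first_variation_open n mu D < +oo)%E.
Local Notation tfv := (total_first_variation_open n mu).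
Let v O : R := fine (tfv O).

Lemma first_variation0 : first_variation n mu (fun=> 0) = 0.
Proof.
rewrite -[RHS](mul0r (first_variation n mu (fun=> 0))) -first_variationZ; last exact: C1c0.
by congr (first_variation n mu _); apply/funext => x; rewrite scaler0.
Qed.

Lemma tfv_ge0 O : (0 <= tfv O)%E.
Proof.
apply: ereal_sup_ubound; exists (fun=> 0); last by rewrite first_variation0.
by split; [exact: C1c0|move=> x; rewrite enorm0].
Qed.

Let vE O : O `<=` D -> (v O)%:E = tfv O.
Proof.
move=> OD; rewrite /v fineK// ge0_fin_numE ?tfv_ge0//; apply: le_lt_trans finV.
apply: ge_ereal_sup => _ [eta [c1 e1] <-]; apply: ereal_sup_ubound; exists eta => //.
by split => //; exact: C1c_sub c1.
Qed.

Let v_ub O eta : O `<=` D -> C1c O eta -> (forall x, enorm (eta x) <= 1) -> first_variation n mu eta <= v O.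
Proof.
move=> OD c1 e1; rewrite -lee_fin vE//; apply: ereal_sup_ubound.
by exists eta.
Qed.

Let v_le O c : O `<=` D -> (forall eta, C1c O eta -> (forall x, enorm (eta x) <= 1) ->
  first_variation n mu eta <= c) -> v O <= c.
Proof.
move=> OD h; rewrite -lee_fin vE//; apply: ge_ereal_sup => _ [eta [c1 e1] <-].
by rewrite lee_fin; exact: h.
Qed.

Let v_ge0 O : 0 <= v O. Proof. by apply: fine_ge0; exact: tfv_ge0. Qed.

Let v_mono O O' : open O -> open O' -> O `<=` O' -> O' `<=` D -> v O <= v O'.
Proof.
move=> _ _ OO OD; apply: v_le; first exact: subset_trans OD.
by move=> eta c1 e1; apply: v_ub => //; exact: C1c_sub c1.
Qed.

Lemma enorm_add_disjoint (eta zeta : 'rV[R]_k -> 'rV[R]_k) O O' : O `&` O' = set0 -> C1c O eta -> C1c O' zeta ->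
  (forall x, enorm (eta x) <= 1) -> (forall x, enorm (zeta x) <= 1) ->
  forall x, enorm (eta x + zeta x) <= 1.
Proof.
move=> OO [_ _ _ s1] [_ _ _ s2] e1 e2 x; have [h|h] := pselect (supp eta x).
  rewrite (@supp_eq0 _ _ zeta) ?addr0// => /s2 h2.
  by have : (O `&` O') x; [split => //; exact: s1|rewrite OO].
by rewrite (supp_eq0 h) add0r.
Qed.

Let v_super O O' : open O -> open O' -> O `&` O' = set0 ->
  O `<=` D -> O' `<=` D -> v O + v O' <= v (O `|` O').
Proof.
move=> _ _ OO OD O'D; rewrite -lerBrDr; apply: v_le => // eta c1 e1.
rewrite lerBrDr -lerBrDl; apply: v_le => // zeta c2 e2.
rewrite lerBrDl -first_variationD; [|exact: C1c_sub c1|exact: C1c_sub c2].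
apply: v_ub; first by rewrite subUset.
  by apply: (C1cD c1 c2); [exact: subsetUl|exact: subsetUr].
exact: (enorm_add_disjoint OO c1 c2).
Qed.

(** Take a field supported in [D] without [E] whose first variation nearly attains the supremum. Its
    support is compact, hence at positive distance from [E]. A field living closer to [E] has
    disjoint support and may be added without exceeding norm 1, so it can contribute only the
    missing amount [e]. *)
Let v_outer E : closed E -> forall e : R, 0 < e -> exists2 r : R, 0 < r &
  forall O, open O -> O `<=` D -> O `<=` fattening E r `\` E -> v O <= e.
Proof.
move=> cE e e0; pose O1 := D `&` ~` E.
have oO1 : open O1 by apply: openI => //; rewrite openC.
have O1D : O1 `<=` D by exact: subIsetl.
have [eta [c1 e1 h1]] : exists eta, [/\ C1c O1 eta, (forall x, enorm (eta x) <= 1) &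
    v O1 - e < first_variation n mu eta].
  apply: contrapT => no; suff : v O1 <= v O1 - e by move: e0; lra.
  apply: v_le => // eta c1 e1; rewrite leNgt; apply/negP => h; apply: no; by exists eta.
have [d1 d2 d3 d4] := c1.
have [r r0 hr] := compact_sub_open d3 oO1 d4.
exists r => // O oO OD OE; apply: v_le => // zeta c2 e2.
have dis : supp eta `&` supp zeta = set0.
  apply/seteqP; split => x //= [x1 x2]; have [_ _ _ s2] := c2.
  have [[y Ey yx] _] := OE _ (s2 _ x2).
  have [_] : O1 y by apply: (hr x) => //; rewrite /eball /= enormB.
  by apply.
have c2' : C1c O1 zeta by apply: C1c_sub c2 => x Ox; split; [exact: OD|case: (OE _ Ox)].
have : first_variation n mu (fun x => eta x + zeta x) <= v O1.
  apply: v_ub; [exact: O1D|exact: (C1cD c1 c2' (@subset_refl _ _) (@subset_refl _ _))|].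
  move=> x; have [h|h] := pselect (supp eta x); last by rewrite (supp_eq0 h) add0r.
  rewrite (@supp_eq0 _ _ zeta) ?addr0// => h2.
  by have : (supp eta `&` supp zeta) x by []; rewrite dis.
rewrite first_variationD; [|exact: C1c_sub c1|exact: C1c_sub c2].
rewrite -lerBrDl => /le_trans; apply.
by rewrite lerBlDl -lerBlDr ltW.
Qed.

Let v_bound O eta M : open O -> O `<=` D -> C1c O eta -> (forall x, enorm (eta x) <= M) ->
  `|first_variation n mu eta| <= M * v O.
Proof.
move=> oO OD c1 hM; have M0 : 0 <= M by exact: le_trans (enorm_ge0 _) (hM 0).
have cD : C1c D eta by exact: C1c_sub c1.
(* [M] may be 0, so the field is normalised by [M + e] instead of [M]. *)
have key e : 0 < e -> `|first_variation n mu eta| <= (M + e) * v O.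
  move=> e0; have Me : 0 < M + e by rewrite ltr_wpDl.
  have h (s : R) : `|s| = 1 -> s * first_variation n mu eta <= (M + e) * v O.
    move=> s1; rewrite -[leLHS]mul1r -(divff (lt0r_neq0 Me)) -!mulrA ler_pM2l//.
    rewrite mulrA -first_variationZ//; apply: v_ub => //; first exact: C1cZ.
    move=> x; rewrite enormZ normrM s1 mulr1 ger0_norm ?invr_ge0 ?(ltW Me)//.
    rewrite mulrC ler_pdivrMr// mul1r; apply: le_trans (hM x) _.
    by rewrite lerDl ltW.
  rewrite ler_norml lerNl -mulN1r h ?normrN1//= -[leLHS]mul1r h ?normr1//.
apply/ler_addgt0Pr => e e0.
have := key (e / (v O + 1)); have v1 : 0 < v O + 1 by rewrite ltr_wpDl.
move=> /(_ (divr_gt0 e0 v1))/le_trans; apply; rewrite mulrDl lerD2l.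
rewrite -mulrA ler_piMr ?(ltW e0)// mulrC ler_pdivrMr// mul1r.
by rewrite lerDl.
Qed.

Lemma variation_control1 : variation_control 1 v v.
Proof.
split; [exact: v_ge0|exact: v_mono|exact: v_super| | |exact: v_bound].
  by split; [exact: v_ge0|exact: v_mono|exact: v_super|exact: v_outer].
move=> O oO OD; rewrite invr1 subrr powRr1// powRr0 mulr1//.
Qed.

End TotalVariation.

End FirstVariation.

(** * Hoelder's inequality on sets *)

Section HolderSets.
Context {d : measure_display} {X : measurableType d} {R : realType}.
Variable nu : {finite_measure set X -> \bar R}.
Implicit Types (f : X -> R) (A : set X) (q : R).

Lemma le_1DpowR (t q : R) : 0 <= t -> 1 <= q -> t <= 1 + t `^ q.
Proof.
move=> t0 q1; have [t1|/ltW t1] := leP t 1.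
  by apply: le_trans t1 _; rewrite lerDl powR_ge0.
by apply: (@le_trans _ _ (t `^ q)); [rewrite -{1}(powRr1 t0) ler_powR|rewrite lerDr].
Qed.

Lemma measurable_powR_comp f q : measurable_fun setT f -> measurable_fun setT (fun x => f x `^ q).
Proof. by move=> mf; apply: (measurableT_comp (f := fun t : R => t `^ q)) => //; exact: measurable_powR. Qed.

Lemma integrable_root f q : 1 <= q -> (forall x, 0 <= f x) -> measurable_fun setT f ->
  nu.-integrable setT (EFin \o (fun x => f x `^ q)) -> nu.-integrable setT (EFin \o f).
Proof.
move=> q1 f0 mf fq; have i1 : nu.-integrable setT (EFin \o (fun _ : X => 1 : R)).
  by apply: bborel_integrable; exact: bborel_cst.
have i2 : nu.-integrable setT (EFin \o (fun x => 1 + f x `^ q)).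
  by have := integrableD measurableT i1 fq.
apply: (le_integrable measurableT _ _ i2); first exact/measurable_EFinP.
move=> x _ /=; rewrite lee_fin !ger0_norm ?addr_ge0 ?powR_ge0//.
exact: le_1DpowR.
Qed.

Lemma holder_set f A q : 1 <= q -> (forall x, 0 <= f x) -> measurable_fun setT f ->
  nu.-integrable setT (EFin \o (fun x => f x `^ q)) -> measurable A ->
  \int[nu]_(x in A) f x <= (\int[nu]_(x in A) f x `^ q) `^ q^-1 * mass nu A `^ (1 - q^-1).
Proof.
move=> q1 f0 mf fq mA; have q0 : 0 < q by exact: lt_le_trans q1.
have int := integrable_root q1 f0 mf fq.
(* For [q = 1] the conjugate exponent would be infinite, and the factor [mass nu A ^ 0] is 1. *)
have [q_1|qn1] := eqVneq q 1.
  have -> : (\int[nu]_(x in A) f x `^ q) = \int[nu]_(x in A) f x.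
    by apply: eq_Rintegral => x _; rewrite q_1 powRr1.
  rewrite q_1 invr1 subrr powRr0 mulr1 powRr1//.
  by apply: Rintegral_ge0.
have qq : 1 < q by rewrite lt_neqAle eq_sym qn1.
have qi : q^-1 < 1 by rewrite invf_lt1.
pose q' := (1 - q^-1)^-1; have q'0 : 0 < q' by rewrite invr_gt0 subr_gt0.
have e : q^-1 + q'^-1 = 1 by rewrite /q' invrK addrC subrK.
have m1 : measurable_fun setT (\1_A : X -> R) by exact: measurable_indic.
have mf1 : measurable_fun setT (fun x => f x * \1_A x) by exact: measurable_funM.
have h := hoelder nu mf1 m1 q0 q'0 e.
have ind (g : X -> R) : (forall x, 0 <= g x) -> nu.-integrable setT (EFin \o g) ->
    (\int[nu]_x (g x * \1_A x)%:E)%E = (\int[nu]_(x in A) g x)%:E.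
  move=> g0 ig; rewrite /Rintegral fineK; last first.
    by apply: integrable_fin_num => //; exact: integrableS ig.
  rewrite [RHS]integral_mkcond; apply: eq_integral => x _; rewrite patchE indicE.
  by case: ifPn => _; rewrite ?mulr1 ?mulr0.
have E1 : ('N[nu]_1[EFin \o ((fun x => (f x * \1_A x)%R) \* (\1_A : X -> R))%R] = (\int[nu]_(x in A) f x)%:E)%E.
  rewrite Lnorm1 -ind//; apply: eq_integral => x _ /=; rewrite indicE.
  by case: (x \in A); rewrite !(mulr1, mulr0) ?normr0// ger0_norm.
have E2 : ('N[nu]_q%:E[EFin \o (fun x => (f x * \1_A x)%R)] = ((\int[nu]_(x in A) f x `^ q) `^ q^-1)%:E)%E.
  rewrite unlock -poweR_EFin -ind//; last by move=> x; exact: powR_ge0.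
  congr (_ `^ _)%E; apply: eq_integral => x _ /=; rewrite indicE.
  case: (x \in A); rewrite !(mulr1, mulr0) ?normr0 ?ger0_norm ?poweR_EFin//.
  by rewrite powR0// gt_eqF.
have E3 : ('N[nu]_q'%:E[EFin \o (\1_A : X -> R)] = (mass nu A `^ (1 - q^-1))%:E)%E.
  rewrite unlock -poweR_EFin massE// /q' invrK; congr (_ `^ _)%E.
  rewrite -[X in _ = nu X](setIT A) -integral_indic//; apply: eq_integral => x _ /=; rewrite indicE.
  case: (x \in A); rewrite /= ?normr0 ?normr1 ?poweR_EFin ?powR1//.
  by rewrite powR0// gt_eqF.
by move: h; rewrite E1 E2 E3 -EFinM lee_fin.
Qed.

End HolderSets.

Section IntegralGauge.
Context {R : realType} {k : nat}.
Variables (nu : {finite_measure set (eucl R k) -> \bar R}) (D : set 'rV[R]_k) (f : eucl R k -> R).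
Hypotheses (f0 : forall x, 0 <= f x) (int : nu.-integrable setT (EFin \o f)).
Local Notation g O := (\int[nu]_(x in (O : set (eucl R k))) f x).

Let fS (A : set (eucl R k)) : measurable A -> nu.-integrable A (EFin \o f).
Proof. by move=> mA; exact: integrableS int. Qed.

Lemma integral_gauge_mono (O O' : set (eucl R k)) : measurable O -> measurable O' -> O `<=` O' -> g O <= g O'.
Proof.
move=> mO mO' OO; rewrite /Rintegral fine_le ?integrable_fin_num//; try exact: fS.
apply: ge0_subset_integral => //; last by move=> x _; rewrite lee_fin.
by case/integrableP: (fS mO').
Qed.

Lemma integral_gauge_super (O O' : set (eucl R k)) : measurable O -> measurable O' -> O `&` O' = set0 ->
  g O + g O' <= g (O `|` O').
Proof.
move=> mO mO' OO; rewrite Rintegral_setU//; first by apply: fS; exact: measurableU.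
by apply/disj_setPS; rewrite OO.
Qed.

(** For closed [E] every point eventually leaves the sets obtained from shrinking neighbourhoods of
    [E] by removing [E]; dominated convergence gives [g_outer]. *)
Lemma gauge_integral : gauge D (fun O => g O).
Proof.
split.
- by move=> O; exact: Rintegral_ge0.
- by move=> O O' oO oO' OO _; apply: integral_gauge_mono => //; exact: open_measurable_eucl.
- by move=> O O' oO oO' OO _ _; apply: integral_gauge_super => //; exact: open_measurable_eucl.
move=> E cE e e0.
pose A j := fattening E j.+1%:R^-1 `\` E.
have mA j : measurable (A j : set (eucl R k)).
  apply: open_measurable_eucl; apply: openI; first exact: open_fattening.
  by rewrite openC.
have mf : measurable_fun setT (EFin \o f) by case/integrableP: int.
have mfj j : measurable_fun setT (fun x : eucl R k => (f x * \1_(A j) x)%:E).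
  apply/measurable_EFinP; apply: measurable_funM; first exact/measurable_EFinP.
  exact: measurable_indic.
have hcv : {ae nu, forall x, setT x -> (f x * \1_(A j) x)%:E @[j --> \oo] --> (cst 0%E x : \bar R)}.
  apply/nearW => x _; apply: cvg_near_cst.
  have [Ex|nEx] := pselect (E x).
    by near=> j; rewrite indicE memNset ?mulr0// => -[].
  have oE : open (~` E) by rewrite openC.
  have [r r0 rE] := (open_eballP _).1 oE x nEx.
  have [N _ hN] := @cvgr0_norm_lt _ _ _ _ _ _ (@cvg_harmonic R) r r0.
  exists N => // j Nj /=; rewrite indicE memNset ?mulr0// => -[[y Ey yx] _].
  have yr : eball x r y.
    rewrite /eball /= enormB; apply: lt_trans yx _.
    have := hN j Nj; rewrite /harmonic /= ger0_norm//.
  exact: (rE y yr Ey).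
have hdom : {ae nu, forall x, forall j, setT x -> (`|(f x * \1_(A j) x)%:E| <= (EFin \o f) x)%E}.
  apply/nearW => x j _; rewrite indicE lee_fin.
  by case: (_ \in _); rewrite ?mulr1 ?mulr0 ?normr0// ger0_norm.
have [_ _] := dominated_convergence measurableT mfj (measurable_cst _) hcv int hdom.
rewrite integral0 => hc.
have E1 j : (\int[nu]_x (f x * \1_(A j) x)%:E)%E = (g (A j))%:E.
  rewrite /Rintegral fineK; last by apply: integrable_fin_num => //; exact: fS.
  rewrite [RHS]integral_mkcond; apply: eq_integral => x _; rewrite patchE indicE.
  by case: ifPn => _; rewrite ?mulr1 ?mulr0.
have hg : g (A j) @[j --> \oo] --> (0 : R).
  have -> : (fun j => g (A j)) = fine \o (fun j => (\int[nu]_x (f x * \1_(A j) x)%:E)%E).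
    by apply/funext => j /=; rewrite E1.
  exact: (fine_cvg hc).
have [N _ hN] := @cvgr0_norm_lt _ _ _ _ _ _ hg e e0.
exists N.+1%:R^-1; first by rewrite invr_gt0.
move=> O oO OD OA; apply: le_trans (ltW (hN N (leqnn N))).
rewrite ger0_norm; last exact: Rintegral_ge0.
apply: integral_gauge_mono => //; exact: open_measurable_eucl.
Unshelve. all: by end_near. Qed.

End IntegralGauge.

(** * Variation bounds from the mean curvature *)

Section MeanCurvature.
Context {R : realType} {k n : nat}.
Hypotheses (n0 : (0 < n)%N) (nk : (n <= k)%N).
Variable mu : {measure set (eucl R k) -> \bar R}.
Variables D U : set 'rV[R]_k.
Hypotheses (oD : open D) (fD : (mu D < +oo)%E) (oU : open U).
Variables (K : set 'rV[R]_k) (p : R) (H : 'rV[R]_k -> 'rV[R]_k).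
Hypotheses (cK : compact K) (KU : K `<=` U) (DK : D `<=` K) (p1 : 1 < p).
Hypothesis HL : Lploc U mu p H.
Hypothesis HV : forall eta, C1c U eta ->
  first_variation n mu eta = - \int[mu]_(x in U) edot (H x) (eta x).
Implicit Types (x : 'rV[R]_k) (eta : 'rV[R]_k -> 'rV[R]_k).
Local Notation nu := (restrict oD fD).

Let mD : measurable (D : set (eucl R k)) := open_measurable_eucl oD.
Let DU : D `<=` U := subset_trans DK KU.
Let HD : eucl R k -> 'rV[R]_k := fun x => if x \in D then H x else 0.
Let mU : measurable (U : set (eucl R k)) := open_measurable_eucl oU.
Let h : eucl R k -> R := fun x => enorm (HD x).

Let HDE x : D x -> HD x = H x. Proof. by move=> Dx; rewrite /HD mem_set. Qed.
Let HD0 x : ~ D x -> HD x = 0. Proof. by move=> Dx; rewrite /HD memNset. Qed.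

Let mHD : measurable_row HD.
Proof.
move=> i; have -> : (fun x => HD x 0 i) = ((fun x : eucl R k => H x 0 i) \_ D).
  by apply/funext => x; rewrite /HD patchE; case: ifP => // _; rewrite mxE.
by apply/(measurable_restrictT _ mD); exact: (measurable_funS mU DU (HL.1 i)).
Qed.

Let mh : measurable_fun setT h. Proof. exact: measurable_enorm. Qed.
Let h0 (x : eucl R k) : 0 <= h x. Proof. exact: enorm_ge0. Qed.
Let p0 : 0 < p. Proof. exact: lt_trans p1. Qed.

Let hp_int : nu.-integrable setT (EFin \o (fun x => h x `^ p)).
Proof.
apply/integrableP; split; first by apply/measurable_EFinP; exact: measurable_powR_comp.
have mK : measurable (K : set (eucl R k)).
  by apply: closed_measurable_eucl; exact: compact_closed (@norm_hausdorff _ _) cK.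
apply: le_lt_trans (HL.2 K cK KU).
have -> : (\int[nu]_x `|(EFin \o (fun x => h x `^ p)%R) x| = \int[mu]_(x in D) (enorm (H x) `^ p)%:E)%E.
  rewrite [RHS]integral_mkcond (integral_restrict oD fD); last by move=> x Dx; rewrite patchE memNset.
  apply: eq_integral => x _ /=; rewrite ger0_norm ?powR_ge0// patchE.
  case: ifPn => [/set_mem Dx|/negP nD]; first by rewrite /h HDE.
  rewrite /h HD0 ?enorm0 ?powR0 ?gt_eqF//.
  by move=> Dx; apply: nD; exact: mem_set.
apply: ge0_subset_integral => //.
  apply/measurable_EFinP; apply: (measurableT_comp (f := fun t : R => t `^ p)); first exact: measurable_powR.
  apply: (measurableT_comp (f := @Num.sqrt R)).
    by apply: continuous_measurable_fun; exact: sqrt_continuous.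
  apply: measurable_sum => i; by apply: measurable_funM; exact: (measurable_funS mU KU (HL.1 i)).
by move=> x _; rewrite lee_fin powR_ge0.
Qed.

Let h_int : nu.-integrable setT (EFin \o h).
Proof. exact: (integrable_root (ltW p1) h0 mh hp_int). Qed.

Let bound O eta M : open O -> O `<=` D -> C1c O eta -> (forall x, enorm (eta x) <= M) ->
  `|first_variation n mu eta| <= M * \int[nu]_(x in (O : set (eucl R k))) h x.
Proof.
move=> oO OD c1 hM; have cU : C1c U eta by apply: C1c_sub c1; exact: subset_trans DU.
have mO : measurable (O : set (eucl R k)) := open_measurable_eucl oO.
have M0 : 0 <= M by exact: le_trans (enorm_ge0 _) (hM 0).
have e0 x : ~ O x -> eta x = 0.
  by move=> nO; apply: supp_eq0 => sx; apply: nO; case: c1 => _ _ _; exact.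
have ceta : continuous eta by move=> x; apply: differentiable_continuous; case: c1.
rewrite (HV cU) normrN.
have -> : \int[mu]_(x in U) edot (H x) (eta x) = \int[nu]_x edot (HD x) (eta x).
  rewrite /Rintegral [in LHS]integral_mkcond (integral_restrict oD fD); last first.
    move=> x Dx; rewrite patchE; case: ifP => // _; have -> : eta x = 0 by apply: e0 => /OD.
    by rewrite edotC edot0l.
  congr fine; apply: eq_integral => x _; rewrite patchE.
  have [Dx|Dx] := pselect (D x); first by rewrite mem_set ?HDE//; exact: DU.
  have -> : eta x = 0 by apply: e0 => /OD.
  by rewrite edotC [in RHS]edotC !edot0l; case: ifP.
have me : measurable_fun setT (fun x : eucl R k => edot (HD x) (eta x)).
  apply: measurable_edot => // i.
  by apply: continuous_measurable_eucl; exact: (fun_continuous_comp (h := fun A : 'rV[R]_k => A 0 i) (@coord_continuous _ _ _ 0 i) ceta).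
have le x : `|edot (HD x) (eta x)| <= M * (h x * \1_O x).
  rewrite indicE; have [Ox|Ox] := pselect (O x).
    rewrite mem_set// mulr1 mulrC; apply: le_trans (edot_le _ _) _.
    by rewrite ler_wpM2l ?enorm_ge0.
  by rewrite e0// edotC edot0l normr0 memNset// !mulr0.
have hO : nu.-integrable setT (EFin \o (fun x : eucl R k => h x * \1_O x)).
  apply: (le_integrable measurableT _ _ h_int).
    by apply/measurable_EFinP; apply: measurable_funM => //; exact: measurable_indic.
  move=> x _; rewrite /= lee_fin indicE; case: (_ \in _); rewrite ?mulr1// mulr0 normr0//.
have hMO : nu.-integrable setT (EFin \o (fun x : eucl R k => M * (h x * \1_O x))).
  by have := integrableZl measurableT M hO.
have ie : nu.-integrable setT (EFin \o (fun x : eucl R k => edot (HD x) (eta x))).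
  apply: (le_integrable measurableT _ _ hMO); first exact/measurable_EFinP.
  move=> x _; rewrite /= lee_fin; apply: le_trans (le x) _; exact: ler_norm.
apply: le_trans (le_normr_Rintegral _ ie) _ => //.
have -> : M * \int[nu]_(x in (O : set (eucl R k))) h x = \int[nu]_x (M * (h x * \1_O x)).
  rewrite RintegralZl//; congr (_ * _); rewrite Rintegral_mkcond; apply: eq_Rintegral => x _.
  by rewrite patchE indicE; case: ifP; rewrite ?mulr1 ?mulr0.
apply: le_Rintegral => //.
have := integrable_abse ie; by [].
Qed.

Lemma variation_controlp : exists v lam, variation_control (n := n) oD fD p v lam.
Proof.
have := hp_int; have := h_int => i1 i2.
exists (fun O => \int[nu]_(x in (O : set (eucl R k))) h x).
exists (fun O => \int[nu]_(x in (O : set (eucl R k))) h x `^ p).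
have G := gauge_integral D h0 i1.
split.
- exact: g_ge0 G.
- exact: g_mono G.
- exact: g_super G.
- by apply: gauge_integral => // x; exact: powR_ge0.
- move=> O oO _; apply: (holder_set (ltW p1) h0 _ i2); [exact: measurable_enorm|exact: open_measurable_eucl].
- exact: bound.
Qed.

End MeanCurvature.

(** * Local data of an integral varifold *)

Section LocalVarifold.
Context {R : realType} {k n : nat}.
Hypotheses (n0 : (0 < n)%N) (nk : (n <= k)%N).
Variable mu : {measure set (eucl R k) -> \bar R}.
Variable D : set 'rV[R]_k.
Hypotheses (oD : open D) (fD : (mu D < +oo)%E).
Hypothesis varifold : {ae mu, forall x, D x -> exists (T : 'M[R]_k) (N : nat),
    [/\ (0 < N)%N, has_density n mu x N%:R & approx_tangent n mu x N%:R T]}.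
Implicit Types (x a : 'rV[R]_k).
Local Notation nu := (restrict oD fD).
Local Notation T := (plane_field (n := n) nu).

Lemma has_density_omega_gt0 a theta : D a -> has_density n mu a theta -> 0 < theta -> 0 < omega n :> R.
Proof.
move=> Da hd th0; have hd' : has_density n nu a theta by exact/(has_density_restrict oD fD).
by have [] := density_bounds hd' th0.
Qed.

Section Control.
Hypothesis om0 : 0 < omega n :> R.
Variables (p : R) (v lam : set 'rV[R]_k -> R).
Hypothesis VC : variation_control (n := n) oD fD p v lam.

Definition varifold_data : local_data R k := LocalData nu T D v.

(** An integer multiplicity is at least 1, so the lower ratio [3/4] times the multiplicity exceeds
    [1/2]. *)
Lemma ae_regular_point : {ae nu, forall x, regular_point n (omega n / 2) nu x}.
Proof.
apply: (ae_restrict oD fD); apply: ae_imply varifold => x h Dx.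
have [S [N [N0 hd _]]] := h Dx.
have hd' : has_density n nu x N%:R by exact/(has_density_restrict oD fD).
have N1 : 1 <= N%:R :> R by rewrite ler1n.
have [_ /near0P[r0 r00 hr]] := density_bounds hd' (lt_le_trans ltr01 N1).
exists (5 / 4 * N%:R * omega n), r0; split => // r rp rr.
have /andP[h1 h2] := hr r rp rr; apply/andP; split => //.
apply: le_trans h1; rewrite ler_wpM2r ?exprn_ge0 ?(ltW rp)//.
by move: (omega n) om0 N1 => o o0 N1; nra.
Qed.

Lemma varifold_local_spec : local_spec n (omega n / 2) varifold_data.
Proof.
split => /=.
- by rewrite divr_gt0.
- by [].
- exact: measurable_plane_field.
- exact: plane_field_grass.
- by [].
- exact: restrict_null.
- exact: ae_regular_point.
- exact: vc_ge0 VC.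
- exact: vc_mono VC.
- exact: vc_super VC.
- move=> psi G a L K O M [C1 cK K0] KO oO OD hM.
  have c1 : C1c O (radial_field psi a L) by apply: (C1c_radial a L C1 cK KO) => y /K0[].
  have := vc_bound VC oO OD c1 hM.
  rewrite (first_variationE n0 oD fD varifold); last exact: C1c_sub c1.
  congr (`|_| <= _); apply: eq_expect => x.
  by rewrite (trace_radial a L (T x) x C1).
Qed.

(** The test function [phi] vanishes on the plane of [P], so its rescaled integrals tend to 0, while
    it is at least 1 on the rescaled steep set. *)
Lemma flat_tangent a theta P : approx_tangent n nu a theta P -> @flat_at R k n varifold_data a P.
Proof.
move=> [gP hP] eps eta eps0 eta0.
pose phi (z : 'rV[R]_k) := eps^-1 * enorm (z *m (1%:M - P)) * pos (2 - enorm z).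
have cphi : continuous phi.
  apply: fun_continuousM; last first.
    apply: (fun_continuous_comp (h := pos)); first exact: continuous_pos.
    apply: fun_continuousB; first exact: fun_continuous_cst.
    by move=> z; have := @continuous_enorm R k 0 z; under eq_fun do rewrite subr0.
  apply: fun_continuousM; first exact: fun_continuous_cst.
  apply: (fun_continuous_comp (h := fun z : 'rV[R]_k => enorm z) (g := fun z : 'rV[R]_k => z *m (1%:M - P))).
    by move=> z; have := @continuous_enorm R k 0 z; under eq_fun do rewrite subr0.
  exact: continuous_mulmxr.
have phi_far z : 2 <= enorm z -> phi z = 0 by move=> h; rewrite /phi pos_eq0 ?mulr0// subr_le0.
have phi0 z : 0 <= phi z by rewrite mulr_ge0 ?pos_ge0// mulr_ge0 ?enorm_ge0// invr_ge0 ltW.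
have := hP phi cphi (compact_far_support phi_far).
rewrite integral_raw0 ?mulr0; last first.
  move=> z /(plane_fixed _ gP) zP; rewrite /phi mulmxBr mulmx1 zP subrr enorm0 mulr0 mul0r//.
move=> /(@cvgr0_norm_lt _ _ _ _ _ _)/(_ eta eta0) hn.
near=> r.
have r0 : 0 < r by near: r; exact: nbhs_right_gt.
have rn : 0 < r ^+ n by rewrite exprn_gt0.
have h : `|r ^- n * (\int[nu]_y phi (r^-1 *: ((y : 'rV[R]_k) - a)))| < eta by near: r.
have e0 : 0 <= \int[nu]_y phi (r^-1 *: ((y : 'rV[R]_k) - a)) by exact: Rintegral_ge0.
rewrite ger0_norm in h; last by rewrite mulr_ge0// invr_ge0 ltW.
apply: le_trans (_ : \int[nu]_y phi (r^-1 *: ((y : 'rV[R]_k) - a)) <= _); last first.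
  by rewrite mulrC ltr_pdivrMr// in h; exact: ltW.
have [M hM] : exists M, forall z, `|phi z| <= M.
  by apply: (compact_supp_bounded cphi (@compact_ecball R k 0 2)) => z /negP; rewrite /ecball /= subr0 -ltNge => /ltW/phi_far.
rewrite -[leLHS]mul1r; apply: ge_mass_indic.
- exact: (bborel_scaled a r cphi hM).
- exact: measurable_steep.
- move=> y; rewrite indicE; case: (boolP (y \in _)) => [/set_mem[ya hy]|_]; last by rewrite mulr0.
  rewrite mulr1 /phi -scalemxAl !enormZ ger0_norm ?invr_ge0 ?(ltW r0)//.
  rewrite /eball /= in ya; rewrite /height /= in hy.
  have z1 : r^-1 * enorm ((y : 'rV[R]_k) - a) <= 1 by rewrite mulrC ler_pdivrMr// mul1r ltW.
  have t1 : 1 <= eps^-1 * (r^-1 * enorm (((y : 'rV[R]_k) - a) *m (1%:M - P))).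
    by rewrite mulrA -invfM mulrC ler_pdivlMr ?mul1r ?ltW// mulr_gt0.
  have t2 : 1 <= pos (2 - r^-1 * enorm ((y : 'rV[R]_k) - a)) by rewrite pos_id; lra.
  by rewrite -[leLHS]mulr1 ler_pM.
Unshelve. all: by end_near. Qed.

Hypothesis p1 : 1 <= p.

Lemma ae_varifold_point_spec Q : (0 < Q)%N -> {ae mu, forall a, D a -> has_density n mu a Q%:R ->
  point_spec n varifold_data p (2 * Q%:R * omega n) lam a (tangent_plane n mu a)}.
Proof.
move=> Q0; have Qr : 0 < Q%:R :> R by rewrite ltr0n.
have h := ae_point_spec varifold_local_spec (vc_gauge VC) p1 (vc_holder VC).
have {}h := ae_of_restrict h.
have [N1 [mN1 N10 sub1]] := h; have [N2 [mN2 N20 sub2]] := varifold.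
exists (N1 `|` N2); split; first exact: measurableU.
  by apply: null_set_setU.
move=> a na; apply: contrapT => /not_orP[/(subsetC sub1)/contrapT g1 /(subsetC sub2)/contrapT g2].
apply: na => Da hd; have [S [N [N0 hdN hS]]] := g2 Da.
have Nr : 0 < N%:R :> R by rewrite ltr0n.
have hd' : has_density n nu a Q%:R by exact/(has_density_restrict oD fD).
have hdN' : has_density n nu a N%:R by exact/(has_density_restrict oD fD).
have hS' : approx_tangent n nu a N%:R S by exact/(approx_tangent_restrict oD fD).
rewrite (tangent_plane_restrict oD fD Da) (plane_field_tangent_plane n0 hdN' Nr hS').
apply: (g1 Da Da).
- by case: hS'.
- by rewrite mulr_ge0 ?(ltW om0)// mulr_ge0.
- exact: flat_tangent hS'.
have [_ hb] := density_bounds hd' Qr.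
near=> r.
have r0 : 0 < r by near: r; exact: nbhs_right_gt.
have /andP[_ h2] : 3 / 4 * Q%:R * omega n * r ^+ n <= mass nu (ecball a r) <= 5 / 4 * Q%:R * omega n * r ^+ n by near: r.
apply: le_trans (_ : mass nu (ecball a r) <= _).
  apply: mass_le; [exact: measurable_eball|exact: measurable_ecball|].
  by move=> y; rewrite /eball /ecball /=; exact: ltW.
apply: le_trans h2 _; rewrite ler_wpM2r ?exprn_ge0 ?(ltW r0)//.
by rewrite ler_wpM2r ?(ltW om0)// ler_wpM2r ?(ltW Qr)//; lra.
Unshelve. all: by end_near. Qed.

End Control.

End LocalVarifold.

(** * Comparison of the two limits *)

Section Limsup.
Context {R : realType}.
Implicit Types (f g : R -> \bar R) (c : R).

Lemma limf_esup_le f (c : \bar R) : (\forall r \near 0^'+, (f r <= c)%E) -> (limf_esup f (0 : R)^'+ <= c)%E.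
Proof.
move=> h; apply: ge_ereal_inf; exists (ereal_sup (f @` [set r | (f r <= c)%E])); first by exists [set r | (f r <= c)%E].
by apply: ge_ereal_sup => _ [r hr <-].
Qed.

Lemma near_limf_esup g (c : \bar R) : (limf_esup g (0 : R)^'+ < c)%E -> \forall r \near 0^'+, (g r <= c)%E.
Proof.
move=> /ereal_inf_lt[_ [A FA <-] hA]; apply: filterS FA => r Ar.
by apply: le_trans (ltW hA); apply: ereal_sup_ubound; exists r.
Qed.

(** It suffices to treat each positive number [tau] above the limit superior of [g]. Positivity
    matters because [tau] serves as a unit of height in the estimates. *)
Lemma limf_esup_le_mul f g c : 0 < c -> (forall r, (0 <= g r)%E) ->
  (forall tau : R, 0 < tau -> (\forall r \near 0^'+, (g r <= tau%:E)%E) ->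
     \forall r \near 0^'+, (f r <= (c * tau)%:E)%E) ->
  (limf_esup f (0 : R)^'+ <= c%:E * limf_esup g (0 : R)^'+)%E.
Proof.
move=> c0 g0 h.
have l0 : (0 <= limf_esup g (0 : R)^'+)%E.
  apply: le_ereal_inf_tmp => _ [A FA <-].
  have [r Ar] : exists r, A r by exact: filter_ex FA.
  by apply: le_trans (g0 r) _; apply: ereal_sup_ubound; exists r.
move: l0; case E : (limf_esup g _) => [l| |] // l0; last by rewrite gt0_muley ?lte_fin// leey.
rewrite lee_fin in l0; apply/lee_addgt0Pr => e e0.
have ec : 0 < e / c by rewrite divr_gt0.
have -> : (c%:E * l%:E + e%:E = (c * (l + e / c))%:E)%E.
  by rewrite -EFinM -EFinD mulrDr mulrCA divff ?mulr1// gt_eqF.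
apply: limf_esup_le; apply: h; first by rewrite ltr_wpDl.
by apply: near_limf_esup; rewrite E lte_fin ltrDl.
Qed.

End Limsup.

Section LocalNorms.
Context {R : realType} {k : nat}.
Variable mu : {measure set (eucl R k) -> \bar R}.
Variable D : set 'rV[R]_k.
Hypotheses (oD : open D) (fD : (mu D < +oo)%E).
Implicit Types (a : 'rV[R]_k) (r q c : R) (f g : 'rV[R]_k -> R).
Local Notation nu := (restrict oD fD).
Local Notation E := (expect nu).
Variables (a : 'rV[R]_k) (r : R).
Local Notation B := (eball a r).
Local Notation muB := (mrestr mu (measurable_eball a r)).
Hypothesis BD : B `<=` D.

Let mB : measurable (B : set (eucl R k)) := measurable_eball a r.

Lemma ae_ball (P : eucl R k -> Prop) : {ae nu, forall x, P x} -> {ae muB, forall x, P x}.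
Proof.
move=> [N [mN N0 sub]]; exists (N `|` ~` B); split.
- by apply: measurableU => //; exact: measurableC.
- rewrite /mrestr setIUl setICl setU0; apply/eqP; rewrite eq_le measure_ge0 andbT.
  rewrite -N0 /restrict /= /mfrestr /mrestr.
  by apply: le_measure; rewrite ?inE; [exact: measurableI|apply: measurableI => //; exact: open_measurable_eucl|exact: setIS].
- by move=> x /sub h; left.
Qed.

Lemma integral_ball (F : eucl R k -> \bar R) : (forall x, ~ B x -> F x = 0%E) ->
  (\int[muB]_x F x = \int[nu]_x F x)%E.
Proof.
move=> F0; apply: (@eq_integral_on _ (eucl R k) R muB nu B F _ F0) => A mA AB.
rewrite /mrestr restrictE; last exact: subset_trans BD.
by rewrite setIidl.
Qed.

Lemma lnorm_ball_expect q f g : 1 <= q -> {ae nu, forall x, f x = g x} ->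
  (forall x, 0 <= g x) -> bborel ((fun x => g x * \1_B x) : eucl R k -> R) ->
  Lnorm_ball mu q%:E a r f = ((E (fun x => (g x * \1_B x) `^ q)) `^ q^-1)%:E.
Proof.
move=> q1 fg g0 bg; have q0 : 0 < q := lt_le_trans ltr01 q1.
rewrite /Lnorm_ball unlock -poweR_EFin; congr (_ `^ _)%E.
have b0 (x : eucl R k) : 0 <= g x * \1_B x by rewrite mulr_ge0// indicE.
rewrite -expectE; last exact: (bborel_powR (ltW q0) b0 bg).
rewrite -integral_ball; last first.
  by move=> x nB; rewrite indicE memNset// mulr0 powR0// gt_eqF.
apply: ae_eq_integral_total.
have hB : {ae muB, forall x, B x}.
  exists (~` B); split => //; first exact: measurableC.
  by rewrite /mrestr setICl measure0.
have [N1 [m1 z1 s1]] := ae_ball fg; have [N2 [m2 z2 s2]] := hB.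
exists (N1 `|` N2); split; [exact: measurableU|exact: null_set_setU|].
move=> x nx; apply: contrapT => /not_orP[/(subsetC s1)/contrapT e1 /(subsetC s2)/contrapT e2].
apply: nx => /=; rewrite e1 indicE mem_set// mulr1 ger0_norm// poweR_EFin//.
Qed.

Lemma lnorm_ball_sup_le f c : 0 <= c -> {ae nu, forall x, B x -> `|f x| <= c} ->
  (Lnorm_ball mu +oo a r f <= c%:E)%E.
Proof.
move=> c0 hf; rewrite /Lnorm_ball unlock; case: ifP => // _.
apply/ess_sup_inf.ess_supP.
have [N1 [m1 z1 s1]] := ae_ball hf.
exists (N1 `|` ~` B); split.
- by apply: measurableU => //; exact: measurableC.
- apply: null_set_setU => //; first exact: measurableC.
  by rewrite /= /mrestr setICl measure0.
move=> x nx; apply: contrapT => /not_orP[/(subsetC s1)/contrapT e1 /contrapT e2].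
by apply: nx => /=; rewrite lee_fin; exact: e1.
Qed.

Lemma lnorm_ball_sup f c : (Lnorm_ball mu +oo a r f <= c%:E)%E ->
  {ae nu, forall x, B x -> `|f x| <= c}.
Proof.
rewrite /Lnorm_ball unlock; case: ifPn => [_ /ess_sup_inf.ess_supP[N [mN N0 sub]]|h _].
  exists (N `&` B); split; first exact: measurableI.
    by rewrite restrictE//; move=> x [_]; exact: BD.
  move=> x /= /not_implyP[Bx nx]; split=> //; apply: sub => /= h; apply: nx.
  by rewrite lee_fin in h.
(* Here the ball has measure 0 and the norm takes its default value, so the ball itself is the
   exceptional set. *)
exists B; split => //; last by move=> x /= /not_implyP[].
rewrite restrictE//; move: h; rewrite -leNgt /= /mrestr setTI => h.
by apply/eqP; rewrite eq_le h measure_ge0.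
Qed.

End LocalNorms.

Section Existence.
Context {R : realType} {k n : nat}.
Hypotheses (n0 : (0 < n)%N) (nk : (n <= k)%N).
Variable mu : {measure set (eucl R k) -> \bar R}.
Variables (U : set 'rV[R]_k) (p : R).
Hypotheses (oU : open U) (iv : integral_varifold n U mu) (mc : mean_curvature_condition n U mu p).

Lemma inner_part_finite i : (mu (inner_part U i) < +oo)%E.
Proof.
have [K [cK KU DK]] := inner_part_compact U i; apply: le_lt_trans (iv.1.2 K cK KU).
apply: le_measure => //; rewrite inE; first exact: open_measurable_eucl (@open_inner_part R k U i).
by apply: closed_measurable_eucl; exact: compact_closed (@norm_hausdorff _ _) cK.
Qed.

Lemma inner_part_varifold i : {ae mu, forall x, inner_part U i x -> exists (T : 'M[R]_k) (N : nat),
    [/\ (0 < N)%N, has_density n mu x N%:R & approx_tangent n mu x N%:R T]}.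
Proof. by apply: ae_imply iv.2 => x h /inner_part_sub; exact: h. Qed.

Lemma variation_control_exists i : exists v lam,
  variation_control (n := n) (@open_inner_part R k U i) (inner_part_finite i) p v lam.
Proof.
have [K [cK KU DK]] := inner_part_compact U i.
case: mc => [[p1 [H HL HV]]|[-> lb]].
  by apply: (@variation_controlp R k n mu (inner_part U i) U _ _ oU K p H cK KU DK p1 HL HV).
(* Finiteness on the compact set provides an open neighbourhood of finite variation, which contains
   the inner part. *)
have /ereal_inf_lt[_ [V [oV VU KV] <-] hV] := lb K cK KU.
have h : (total_first_variation_open n mu (inner_part U i) < +oo)%E.
  apply: le_lt_trans hV; apply: ge_ereal_sup => _ [eta [c1 e1] <-].
  apply: ereal_sup_ubound; exists eta => //; split => //.
  by apply: C1c_sub c1; exact: subset_trans KV.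
by eexists; eexists; exact: (variation_control1 n0 nk (@open_inner_part R k U i) (inner_part_finite i) (inner_part_varifold i) h).
Qed.

Lemma ae_inner_parts (P : 'rV[R]_k -> Prop) :
  (forall i, {ae mu, forall x, inner_part U i x -> P x}) -> {ae mu, forall x, U x -> P x}.
Proof.
move=> h; have := negligible_bigcup h.
apply: negligibleS => x /= /not_implyP[Ux nP].
have [i _ Di] := inner_part_cover oU Ux.
by exists i => //= h'; apply: nP; exact: h'.
Qed.

End Existence.

Section RealPowers.
Context {R : realType}.
Implicit Types (X Y r s t al q N M m : R).

Lemma root_le X Y q : 0 <= X -> 0 <= Y -> 0 < q -> X `^ q^-1 <= Y <-> X <= Y `^ q.
Proof.
move=> X0 Y0 q0; have qn : q != 0 by rewrite gt_eqF.
split=> h.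
  by rewrite -[X in X <= _](powRr1 X0) -(mulVf qn) powRrM ge0_ler_powR ?nnegrE ?powR_ge0 ?(ltW q0).
rewrite -[leRHS](powRr1 Y0) -(divff qn) powRrM ge0_ler_powR ?nnegrE ?powR_ge0// invr_ge0 ltW//.
Qed.

Lemma scaled_root_le r X t al q N : 0 < r -> 0 <= X -> 0 <= t -> 0 < q ->
  r `^ (- al - N / q) * X `^ q^-1 <= t <-> X <= (t * r `^ al) `^ q * r `^ N.
Proof.
move=> r0 X0 t0 q0; have qn : q != 0 by rewrite gt_eqF.
have ra : 0 < r `^ al by exact: powR_gt0.
have rN : 0 < r `^ (N / q) by exact: powR_gt0.
have -> : r `^ (- al - N / q) = (r `^ al * r `^ (N / q))^-1.
  by rewrite -opprD powRN powR_mul_add.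
rewrite mulrC ler_pdivrMr ?mulr_gt0//.
have -> : (t * r `^ al) `^ q * r `^ N = (t * (r `^ al * r `^ (N / q))) `^ q.
  rewrite mulrA [in RHS]powRM ?powR_ge0//; last by rewrite mulr_ge0// ltW.
  by rewrite -[in RHS]powRrM divfK.
by apply: root_le => //; rewrite mulr_ge0// mulr_ge0// ltW.
Qed.

(** Hoelder's inequality from [q1] down to [q] on a ball of relative mass at most [M]; in normalised
    form the loss is the factor [1 + M]. *)
Lemma holder_scale X s S M m q q1 : 0 <= X -> 0 <= s -> 0 < S -> 0 <= M -> 0 <= m -> 1 <= q -> q <= q1 ->
  X <= s `^ q1 * S -> m <= M * S ->
  X `^ (q1 / q)^-1 * m `^ (1 - (q1 / q)^-1) <= ((1 + M) * s) `^ q * S.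
Proof.
move=> X0 s0 S0 M0 m0 q1_ qq hX hm.
have q0 : 0 < q := lt_le_trans ltr01 q1_; have q10 : 0 < q1 := lt_le_trans q0 qq.
set th := (q1 / q)^-1; have thE : th = q / q1 by rewrite /th invf_div.
have th0 : 0 <= th by rewrite thE divr_ge0// ltW.
have th1 : th <= 1 by rewrite thE ler_pdivrMr// mul1r.
have D1 : 1 <= 1 + M by rewrite lerDl.
have h1 : X `^ th <= s `^ q * S `^ th.
  apply: (@le_trans _ _ ((s `^ q1 * S) `^ th)).
    by apply: ge0_ler_powR => //; rewrite nnegrE// mulr_ge0 ?powR_ge0// ltW.
  by rewrite powRM ?powR_ge0 ?(ltW S0)// -powRrM thE mulrCA divff ?mulr1// gt_eqF.
have h2 : m `^ (1 - th) <= (1 + M) * S `^ (1 - th).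
  apply: (@le_trans _ _ ((M * S) `^ (1 - th))).
    by apply: ge0_ler_powR; rewrite ?nnegrE ?subr_ge0// mulr_ge0// ltW.
  rewrite powRM ?(ltW S0)// ler_wpM2r ?powR_ge0//.
  have h : M `^ (1 - th) <= (1 + M) `^ (1 - th).
    by apply: ge0_ler_powR; rewrite ?nnegrE ?subr_ge0 ?addr_ge0// lerDr.
  apply: le_trans h _; rewrite -[leRHS](powRr1 (le_trans ler01 D1)).
  by apply: ler_powR => //; rewrite gerBl.
apply: le_trans (ler_pM (powR_ge0 _ _) (powR_ge0 _ _) h1 h2) _.
have -> : s `^ q * S `^ th * ((1 + M) * S `^ (1 - th)) = (1 + M) * (s `^ q * (S `^ th * S `^ (1 - th))) by ring.
have -> : S `^ th * S `^ (1 - th) = S.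
  by rewrite -powRD ?(gt_eqF S0) ?implybT// addrC subrK (powRr1 (ltW S0)).
rewrite powRM ?addr_ge0// -[leRHS]mulrA ler_wpM2r ?mulr_ge0 ?powR_ge0 ?(ltW S0)//.
by rewrite -[leLHS](powRr1 (le_trans ler01 D1)) ler_powR.
Qed.

End RealPowers.

Lemma set_expect {d : measure_display} {X : measurableType d} {R : realType}
    (nu : {finite_measure set X -> \bar R}) (f : X -> R) (A : set X) :
  \int[nu]_(x in A) f x = expect nu (fun x => f x * \1_A x).
Proof.
rewrite Rintegral_mkcond; apply: eq_Rintegral => x _.
by rewrite patchE indicE; case: ifP; rewrite ?mulr1 ?mulr0.
Qed.

(** * The two estimates at a point *)

Section PointEstimates.
Context {R : realType} {k n : nat}.
Hypotheses (n0 : (0 < n)%N) (nk : (n <= k)%N).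
Variable mu : {measure set (eucl R k) -> \bar R}.
Variable D : set 'rV[R]_k.
Hypotheses (oD : open D) (fD : (mu D < +oo)%E).
Hypothesis varifold : {ae mu, forall x, D x -> exists (T : 'M[R]_k) (N : nat),
    [/\ (0 < N)%N, has_density n mu x N%:R & approx_tangent n mu x N%:R T]}.
Hypothesis om0 : 0 < omega n :> R.
Variables (p M : R) (v lam : set 'rV[R]_k -> R).
Hypothesis VC : variation_control (n := n) oD fD p v lam.
Variable a : 'rV[R]_k.
Local Notation nu := (restrict oD fD).
Local Notation E := (expect nu).
Local Notation V := (@varifold_data R k n mu D oD fD v).
Local Notation P := (tangent_plane n mu a).
Hypothesis PS : point_spec n V p M lam a P.
Local Notation w := (omega n / 2).
Local Notation tilt_norm := (fun x : 'rV[R]_k => hsnorm (tangent_plane n mu x - P)).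
Local Notation plane_dist := (fun x : 'rV[R]_k => eucl_dist (x - a) (plane P)).

Let VS := varifold_local_spec n0 nk varifold om0 VC.
Let gP := ps_grass PS.

Let bt : bborel (@tilt R k V P) := bborel_tilt VS gP.

Lemma ae_tilt : {ae nu, forall x, tilt_norm x = @tilt R k V P x}.
Proof. by apply: ae_imply (ae_plane_field n0 oD fD varifold) => x ->. Qed.

Lemma lnorm_tilt q r : 1 <= q -> eball a r `<=` D ->
  Lnorm_ball mu q%:E a r tilt_norm =
    ((E (fun x => @tilt R k V P x `^ q * \1_(eball a r) x)) `^ q^-1)%:E.
Proof.
move=> q1 BD; have q0 : 0 < q := lt_le_trans ltr01 q1.
rewrite (lnorm_ball_expect BD q1 (g := @tilt R k V P) ae_tilt).
- congr (_ `^ _)%:E; apply: eq_expect => x; rewrite indicE; case: (_ \in _); rewrite ?mulr1// mulr0 powR0 ?mulr0// gt_eqF//.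
- by move=> x; exact: tilt_ge0.
- by apply: bborelM => //; apply: bborel_indic_eucl; exact: measurable_eball.
Qed.

Lemma lnorm_height q r : 1 <= q -> eball a r `<=` D ->
  Lnorm_ball mu q%:E a r plane_dist =
    ((E (fun x => (height a P x * \1_(eball a r) x) `^ q)) `^ q^-1)%:E.
Proof.
move=> q1 BD; apply: (lnorm_ball_expect (oD := oD) (fD := fD) BD q1 (g := height a P)).
- by apply/nearW => x; rewrite (eucl_dist_plane _ gP).
- by move=> x; exact: height_ge0.
- exact: bborel_height_ball PS r.
Qed.

Section SubcriticalCase.
Variables (q1 q q2 al tau : R).
Hypotheses (q1n : q1 < n%:R) (q_1 : 1 <= q) (qq1 : q <= q1) (q21 : 1 <= q2).
Hypotheses (q2q : q2 * (q^-1 - n%:R^-1) <= 1) (pn : p < n%:R) (al0 : 0 < al) (al1 : al <= 1).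
Hypotheses (alq2 : al * q2 <= (p^-1 - n%:R^-1)^-1) (tau0 : 0 < tau).

(** [1 + M] is lost in passing from exponent [q1] to [q]; the maximum bounds the [q2]-th root of the
    estimate in [pow_decay], since [G <= G^q2] for [G >= 1]. *)
Definition subcritical_const : R := (1 + M) * Num.max 1 (2 * @pow_add R n w M q q2 + 1).

Lemma subcritical_estimate :
  (\forall r \near 0^'+, ((r `^ (- al - n%:R / q1))%:E * Lnorm_ball mu q1%:E a r tilt_norm <= tau%:E)%E) ->
  \forall r \near 0^'+,
    ((r `^ (- al - 1 - n%:R / q2))%:E * Lnorm_ball mu q2%:E a r plane_dist <= (subcritical_const * tau)%:E)%E.
Proof.
move=> hg; have M0 := ps_M PS.
have q11 : 1 <= q1 := le_trans q_1 qq1.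
have q0 : 0 < q := lt_le_trans ltr01 q_1.
have q10 : 0 < q1 := lt_le_trans ltr01 q11.
have q20 : 0 < q2 := lt_le_trans ltr01 q21.
have D1 : 1 <= 1 + M by rewrite lerDl.
have D0 : 0 < 1 + M := lt_le_trans ltr01 D1.
pose tau' := (1 + M) * tau; have tau'0 : 0 < tau' by rewrite mulr_gt0.
have hD := ps_dom PS; have hm := ps_mass PS.
have nr (r : R) : 0 <= r -> r `^ n%:R = r ^+ n by move=> r0; rewrite powR_mulrn.
have t0 := @tilt_ge0 R k V P.
have hq : \forall r \near 0^'+, E (fun y => @tilt R k V P y `^ q * \1_(eball a r) y) <= (tau' * r `^ al) `^ q * r ^+ n.
  near=> r.
  have r0 : 0 < r by near: r; exact: nbhs_right_gt.
  have BD : eball a r `<=` D by near: r.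
  have mB : measurable (eball a r : set (eucl R k)) := measurable_eball a r.
  have hr : ((r `^ (- al - n%:R / q1))%:E * Lnorm_ball mu q1%:E a r tilt_norm <= tau%:E)%E by near: r.
  have mr : mass nu (eball a r) <= M * r ^+ n by near: r.
  have X0 : 0 <= E (fun x => @tilt R k V P x `^ q1 * \1_(eball a r) x).
    by apply: expect_ge0 => x; rewrite mulr_ge0 ?powR_ge0// indicE.
  rewrite (lnorm_tilt q11 BD) -EFinM lee_fin in hr.
  move/(scaled_root_le al n%:R r0 X0 (ltW tau0) q10) : hr; rewrite nr ?(ltW r0)// => hr.
  have qq : 1 <= q1 / q by rewrite ler_pdivlMr// mul1r.
  have bq : bborel (fun x : eucl R k => @tilt R k V P x `^ q) by apply: bborel_powR => //; exact: ltW.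
  have bq1 : bborel (fun x : eucl R k => (@tilt R k V P x `^ q) `^ (q1 / q)).
    by apply: bborel_powR => //; [exact: le_trans qq|move=> x; exact: powR_ge0].
  have := holder_set (nu := nu) qq (fun x => powR_ge0 (@tilt R k V P x) q) bq.1 (bborel_integrable nu bq1) mB.
  rewrite set_expect => /le_trans; apply.
  have -> : \int[nu]_(x in (eball a r : set (eucl R k))) ((@tilt R k V P x `^ q) `^ (q1 / q)) =
      E (fun x => @tilt R k V P x `^ q1 * \1_(eball a r) x).
    rewrite set_expect; apply: eq_expect => x; rewrite -powRrM; congr (_ `^ _ * _).
    by rewrite mulrC divfK// gt_eqF.
  rewrite /tau' -mulrA; apply: (holder_scale (q1 := q1)) => //.
  - by rewrite mulr_ge0 ?powR_ge0// ltW.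
  - by rewrite exprn_gt0.
  - exact: mass_ge0.
have qn : q < n%:R := le_lt_trans qq1 q1n.
have hdec := pow_decay VS PS q_1 qn q21 q2q tau'0 al0 al1 pn alq2 hq.
near=> r.
have r0 : 0 < r by near: r; exact: nbhs_right_gt.
have BD : eball a r `<=` D by near: r.
have rn : 0 < r ^+ n by rewrite exprn_gt0.
rewrite (lnorm_height q21 BD) -EFinM lee_fin.
have -> : - al - 1 = - (al + 1) by rewrite opprD.
set G := Num.max 1 (2 * @pow_add R n w M q q2 + 1).
have G1 : 1 <= G by rewrite le_max lexx.
have G0 : 0 <= G := le_trans ler01 G1.
have Gp : 2 * @pow_add R n w M q q2 + 1 <= G by rewrite le_max lexx orbT.
have C0 : 0 <= subcritical_const * tau by rewrite !mulr_ge0 ?(ltW D0) ?(ltW tau0).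
apply/(scaled_root_le (al + 1) n%:R r0 _ C0 q20); first by apply: expect_ge0 => x; exact: powR_ge0.
rewrite nr ?(ltW r0)//.
have hd : @pow_avg R k n V a P q2 tau' al r <= 2 * @pow_add R n w M q q2 + 1 by near: r.
set sg := tau' * (r * r `^ al); have sg0 : 0 < sg by rewrite mulr_gt0// mulr_gt0// powR_gt0.
have sgq : 0 < sg `^ q2 by exact: powR_gt0.
set Y := E _.
have YE : @pow_avg R k n V a P q2 tau' al r = (r ^+ n)^-1 * ((sg `^ q2)^-1 * Y).
  rewrite /pow_avg; congr (_ * _); rewrite /Y -expectZ.
    apply: eq_expect => y; rewrite /rel_height -/sg mulrAC.
    have hI : 0 <= height a P y * \1_(eball a r) y by rewrite mulr_ge0 ?height_ge0// indicE.
    have si : 0 <= sg^-1 by rewrite invr_ge0 ltW.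
    by rewrite (powRM q2 hI si) mulrC -(powR_inv1 (ltW sg0)) -powRrM mulN1r powRN.
  apply: bborel_powR; [exact: ltW| |exact: bborel_height_ball PS r].
  by move=> y; rewrite mulr_ge0 ?height_ge0// indicE.
have hY : Y <= G * sg `^ q2 * r ^+ n.
  move: hd; rewrite YE mulrA -invfM mulrC ler_pdivrMr ?mulr_gt0// => /le_trans; apply.
  by rewrite mulrA mulrAC ler_wpM2r ?(ltW rn)// ler_wpM2r// ltW.
apply: le_trans hY _; rewrite ler_wpM2r ?(ltW rn)//.
have -> : subcritical_const * tau * r `^ (al + 1) = G * sg.
  rewrite /subcritical_const -/G /sg /tau' powRD ?(gt_eqF r0) ?implybT// (powRr1 (ltW r0)); ring.
rewrite (powRM q2 G0 (ltW sg0)) ler_wpM2r ?(ltW sgq)//.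
by rewrite -[leLHS](powRr1 G0) ler_powR.
Unshelve. all: by end_near. Qed.

End SubcriticalCase.

Section CriticalCase.
Variables (q : \bar R) (al tau : R).
Hypotheses (nq : (n%:R%:E < q)%E) (pn : p = n%:R) (al0 : 0 < al) (al1 : al <= 1) (tau0 : 0 < tau).
Local Notation b := (fine (q^-1)%E).

Lemma inve_bounds : 0 <= b /\ b < n%:R^-1.
Proof.
have nr : 0 < n%:R :> R by rewrite ltr0n.
move: nq; case: q => [x| |]//.
- rewrite lte_fin => nx; have x0 : 0 < x := lt_trans nr nx.
  rewrite inver (gt_eqF x0) /= invr_ge0 (ltW x0); split=> //.
  by rewrite ltf_pV2.
- by move=> _; rewrite invey /= invr_gt0.
Qed.

Lemma critical_estimate :
  (\forall r \near 0^'+, ((r `^ (- al - n%:R * b))%:E * Lnorm_ball mu q a r tilt_norm <= tau%:E)%E) ->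
  \forall r \near 0^'+,
    ((r `^ (- al - 1))%:E * Lnorm_ball mu +oo a r plane_dist <= (Num.max 1 (@sup_const R n w M b) * tau)%:E)%E.
Proof.
move=> hg; have [b0 bn] := inve_bounds.
have nr : 0 < n%:R :> R by rewrite ltr0n.
have t0 := @tilt_ge0 R k V P.
have hD := ps_dom PS.
have rpow (r c : R) : 0 < r -> r `^ (- al - c) = (r `^ al * r `^ c)^-1.
  by move=> r0; rewrite -opprD powRN powR_mul_add.
have hA : \forall r \near 0^'+, forall A : set (eucl R k), measurable A -> A `<=` eball a r ->
    E (fun y => @tilt R k V P y * \1_A y) <= tau * r `^ al * r `^ (n%:R * b) * mass nu A `^ (1 - b).
  near=> r => A mA AB.
  have r0 : 0 < r by near: r; exact: nbhs_right_gt.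
  have BD : eball a r `<=` D by near: r.
  have mB : measurable (eball a r : set (eucl R k)) := measurable_eball a r.
  have hr : ((r `^ (- al - n%:R * b))%:E * Lnorm_ball mu q a r tilt_norm <= tau%:E)%E by near: r.
  have rr0 : 0 < r `^ al * r `^ (n%:R * b) by rewrite mulr_gt0// powR_gt0.
  rewrite rpow// in hr.
  move: hr nq b0 rr0; case: q => [x| |]//.
    rewrite lte_fin => hr nx _ rr0; have x0 : 0 < x := lt_trans nr nx.
    have x1 : 1 <= x by apply: ltW; apply: le_lt_trans nx; rewrite ler1n.
    move: hr rr0; rewrite inver (gt_eqF x0) /= => hr rr0.
    rewrite (lnorm_tilt x1 BD) -EFinM lee_fin mulrC ler_pdivrMr// in hr.
    have bx : bborel (fun y : eucl R k => @tilt R k V P y `^ x) by apply: bborel_powR => //; exact: ltW.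
    have := holder_set (nu := nu) x1 t0 bt.1 (bborel_integrable nu bx) mA.
    rewrite set_expect => /le_trans; apply; rewrite ler_wpM2r ?powR_ge0//.
    rewrite -[leRHS]mulrA; apply: le_trans hr; rewrite set_expect.
    apply: ge0_ler_powR; rewrite ?invr_ge0 ?(ltW x0)// ?nnegrE.
    - by apply: expect_ge0 => y; rewrite mulr_ge0 ?powR_ge0// indicE.
    - by apply: expect_ge0 => y; rewrite mulr_ge0 ?powR_ge0// indicE.
    apply: expect_le; try by apply: bborelM => //; exact: bborel_indic_eucl.
    move=> y; rewrite ler_wpM2l ?powR_ge0// !indicE ler_nat.
    by case: (boolP (y \in A)) => // /set_mem/AB yB; rewrite mem_set.
  rewrite invey /= mulr0 powRr0 mulr1 subr0 => hr _ _ rr0.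
  rewrite lee_pdivrMl// -EFinM in hr.
  have hB := lnorm_ball_sup oD fD BD hr.
  rewrite !mulr1 (powRr1 (mass_ge0 _ _)) mulrC.
  have [N1 [m1 z1 s1]] := ae_tilt; have [N2 [m2 z2 s2]] := hB.
  (* The tilt of the Borel field obeys the essential bound only off [N]. On [N] it is dominated by
     its global bound [C], which contributes nothing to the integral. *)
  pose N := N1 `|` N2; have mN : measurable N by exact: measurableU.
  have zN : nu N = 0%E by exact: null_set_setU.
  have [C hC] := bt.2.
  have C0 : 0 <= C by apply: le_trans (hC 0); exact: normr_ge0.
  have bN := bborel_indic_eucl mN; have bA := bborel_indic_eucl mA.
  apply: (@le_trans _ _ (E (fun y => r `^ al * tau * \1_A y + C * \1_N y))).
    apply: expect_le.
    - exact: bborelM.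
    - by apply: bborelD; apply: bborelM => //; exact: bborel_cst.
    move=> y; rewrite !indicE; case: (boolP (y \in A)) => [/set_mem Ay|_]; last first.
      by rewrite !mulr0 add0r mulr_ge0.
    rewrite !mulr1; case: (boolP (y \in N)) => [_|/negP nN].
      rewrite mulr1; apply: le_trans (ler_norm _) _; apply: le_trans (hC y) _.
      by rewrite lerDr mulr_ge0 ?powR_ge0// ltW.
    rewrite mulr0 addr0.
    have /not_orP[/(subsetC s1)/contrapT e1 /(subsetC s2)/contrapT e2] : ~ N y by move=> Ny; apply: nN; exact: mem_set.
    have := e2 (AB _ Ay); rewrite e1; exact: (le_trans (ler_norm _)).
  rewrite expectD; try by apply: bborelM => //; exact: bborel_cst.
  rewrite !expectZ// !expect_indic//.
  have -> : mass nu N = 0 by rewrite /mass zN.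
  by rewrite mulr0 addr0 [leRHS]mulrC (mulrC tau).
have := height_sup_decay VS PS pn b0 bn tau0 al0 al1 hA.
set K := @sup_const R n w M b => hK.
near=> r.
have r0 : 0 < r by near: r; exact: nbhs_right_gt.
have BD : eball a r `<=` D by near: r.
have ra : 0 < r `^ al by exact: powR_gt0.
have hz : mass nu (steep a P r (K * tau * (r * r `^ al))) = 0 by near: r.
set G := Num.max 1 K; have G1 : 1 <= G by rewrite le_max lexx.
have KG : K <= G by rewrite le_max lexx orbT.
have c0 : 0 <= G * tau * (r * r `^ al).
  by rewrite !mulr_ge0 ?(ltW r0) ?(ltW tau0) ?(ltW ra)// (le_trans ler01).
have mS := measurable_steep a P r (K * tau * (r * r `^ al)).
have hc : (Lnorm_ball mu +oo a r plane_dist <= (G * tau * (r * r `^ al))%:E)%E.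
  apply: (lnorm_ball_sup_le (oD := oD) (fD := fD) BD c0).
  exists (steep a P r (K * tau * (r * r `^ al))); split => //.
    by rewrite -massE// hz.
  move=> y /= /not_implyP[yB hy]; split => //=.
  rewrite (eucl_dist_plane _ gP) in hy; rewrite ltNge; apply/negP => h; apply: hy.
  rewrite ger0_norm ?enorm_ge0//; apply: le_trans h _.
  by rewrite ler_wpM2r ?mulr_ge0 ?(ltW r0) ?(ltW ra)// ler_wpM2r// ltW.
have -> : - al - 1 = - al - 1 * 1 by rewrite mulr1.
rewrite mulr1 rpow// (powRr1 (ltW r0)).
rewrite lee_pdivrMl ?mulr_gt0// -EFinM; apply: le_trans hc _; rewrite lee_fin.
by rewrite mulrC (mulrC r).
Unshelve. all: by end_near. Qed.

End CriticalCase.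

End PointEstimates.

(** The second entry of the maximum solves [1/q = 1/q2 + 1/N]. The upper bound for [q2] is
    equivalent to that entry being at most [q1]. The exponent [q] depends on [q2] and [N] alone. *)
Lemma reduced_exponent (R : realType) (N q1 q2 : R) : 1 <= q1 -> q1 < N -> 1 <= q2 ->
  q2 <= N * q1 / (N - q1) ->
  let q := Num.max 1 (N * q2 / (N + q2)) in
  [/\ 1 <= q, q <= q1 & q2 * (q^-1 - N^-1) <= 1].
Proof.
move=> q11 q1N q21 hq q; have q10 : 0 < q1 := lt_le_trans ltr01 q11.
have N0 : 0 < N := lt_trans q10 q1N; have q20 : 0 < q2 := lt_le_trans ltr01 q21.
have d0 : 0 < N - q1 by rewrite subr_gt0.
have s0 : 0 < N + q2 by rewrite addr_gt0.
have qq1 : 1 <= q by rewrite le_max lexx.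
have q0 : 0 < q := lt_le_trans ltr01 qq1.
split => //.
  rewrite ge_max q11 /= ler_pdivrMr//; rewrite ler_pdivlMr// in hq; nra.
rewrite mulrBr lerBlDr.
have h : N * q2 / (N + q2) <= q by rewrite le_max lexx orbT.
have z0 : 0 < N * q2 / (N + q2) by rewrite divr_gt0// mulr_gt0.
apply: (@le_trans _ _ (q2 * (N * q2 / (N + q2))^-1)).
  by rewrite ler_pM2l// lef_pV2 ?posrE.
by rewrite le_eqVlt; apply/orP; left; apply/eqP; field; rewrite !gt_eqF.
Qed.

Theorem theorem3p11 (R : realType) (m n Q : nat)
    (m_gt0 : (0 < m)%N) (n_gt0 : (0 < n)%N) (Q_gt0 : (0 < Q)%N) :
  (forall q1 q2 : R, 1 <= q1 -> q1 < n%:R -> 1 <= q2 ->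
    exists2 Gamma : R, 0 < Gamma &
      forall (alpha p : R) (U : set 'rV[R]_(n + m))
          (mu : {measure set (eucl R (n + m)) -> \bar R}),
        0 < alpha -> alpha <= 1 -> 1 <= p -> p < n%:R ->
        q2 <= Num.min (n%:R * q1 / (n%:R - q1))
                      (alpha^-1 * (n%:R * p / (n%:R - p))) ->
        open U -> integral_varifold n U mu ->
        mean_curvature_condition n U mu p ->
        {ae mu, forall a, U a -> has_density n mu a Q%:R ->
          (limf_esup (fun r : R =>
             (r `^ (- alpha - 1 - n%:R / q2))%:E *
             Lnorm_ball mu q2%:E a r
               (fun x => eucl_dist (x - a)%R (plane (tangent_plane n mu a)))) 0%R^'+
           <= Gamma%:E * limf_esup (fun r : R =>
             (r `^ (- alpha - n%:R / q1))%:E *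
             Lnorm_ball mu q1%:E a r
               (fun x => hsnorm (tangent_plane n mu x - tangent_plane n mu a)%R))
             0%R^'+)%E})
  /\
  (forall q : \bar R, (n%:R%:E < q)%E ->
    exists2 Gamma : R, 0 < Gamma &
      forall (alpha p : R) (U : set 'rV[R]_(n + m))
          (mu : {measure set (eucl R (n + m)) -> \bar R}),
        0 < alpha -> alpha <= 1 -> 1 <= p -> p = n%:R ->
        open U -> integral_varifold n U mu ->
        mean_curvature_condition n U mu p ->
        {ae mu, forall a, U a -> has_density n mu a Q%:R ->
          (limf_esup (fun r : R =>
             (r `^ (- alpha - 1))%:E *
             Lnorm_ball mu +oo a r
               (fun x => eucl_dist (x - a)%R (plane (tangent_plane n mu a)))) 0%R^'+
           <= Gamma%:E * limf_esup (fun r : R =>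
             (r `^ (- alpha - n%:R * fine (q^-1)%E))%:E *
             Lnorm_ball mu q a r
               (fun x => hsnorm (tangent_plane n mu x - tangent_plane n mu a)%R))
             0%R^'+)%E}).
Proof.
have nk : (n <= n + m)%N by exact: leq_addr.
(* A point of positive density forces [omega n > 0]. As the constant is chosen before the varifold,
   the alternative [omega n <= 0] is disposed of beforehand, with the constant 1. *)
have vacuous (U : set 'rV[R]_(n + m)) (mu : {measure set (eucl R (n + m)) -> \bar R})
    (S : 'rV[R]_(n + m) -> Prop) : open U -> integral_varifold n U mu -> (omega n : R) <= 0 ->
    {ae mu, forall a, U a -> has_density n mu a Q%:R -> S a}.
  move=> oU iv om; apply: (ae_inner_parts oU) => i.
  apply: aeW => a Da hd; exfalso.
  have Qr : 0 < Q%:R :> R by rewrite ltr0n.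
  have := has_density_omega_gt0 (@open_inner_part R _ U i) (inner_part_finite iv i) Da hd Qr.
  by rewrite ltNge om.
split.
- move=> q1 q2 q11 q1n q21.
  have [om0|om0] := ltP 0 (omega n : R); last by exists 1 => // *; exact: vacuous.
  set M := 2 * Q%:R * omega n : R.
  have M0 : 0 < M by rewrite mulr_gt0// mulr_gt0// ltr0n.
  set q := Num.max 1 (n%:R * q2 / (n%:R + q2)).
  pose G := @subcritical_const R n M q q2.
  have G0 : 0 < G.
    by rewrite mulr_gt0// ?addr_gt0// lt_max ltr01.
  exists G => // alpha p U mu al0 al1 p1 pn; rewrite le_min => /andP[h1 h2] oU iv mc.
  have [q_1 qq1 q2q] := reduced_exponent q11 q1n q21 h1.
  have p0 : 0 < p := lt_le_trans ltr01 p1.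
  have nr : 0 < n%:R :> R by rewrite ltr0n.
  (* The second bound for [q2] in the form used by [pow_decay], since [1/p - 1/n] is the inverse of
     [n p / (n - p)]. *)
  have alq2 : alpha * q2 <= (p^-1 - n%:R^-1)^-1.
    rewrite ler_pdivlMl// in h2; apply: le_trans h2 _.
    rewrite le_eqVlt; apply/orP; left; apply/eqP; field.
    by rewrite (gt_eqF nr) (gt_eqF p0) mulN1r gt_eqF// subr_gt0.
  apply: (ae_inner_parts oU) => i.
  have [v [lam VC]] := variation_control_exists n_gt0 nk oU iv mc i.
  have varifold := inner_part_varifold iv i.
  have := ae_varifold_point_spec n_gt0 nk varifold om0 VC p1 Q_gt0.
  apply: ae_imply => a hps Da hd; have PS := hps Da hd.
  apply: limf_esup_le_mul => //.
    by move=> r; rewrite mule_ge0 ?lee_fin ?powR_ge0// Lnorm_ge0.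
  move=> tau tau0.
  exact: (subcritical_estimate n_gt0 nk varifold om0 VC PS q1n q_1 qq1 q21 q2q pn al0 al1 alq2 tau0).
- move=> q nq.
  have [om0|om0] := ltP 0 (omega n : R); last by exists 1 => // *; exact: vacuous.
  set M := 2 * Q%:R * omega n : R.
  exists (Num.max 1 (@sup_const R n (omega n / 2) M (fine (q^-1)%E))); first by rewrite lt_max ltr01.
  move=> alpha p U mu al0 al1 p1 pn oU iv mc.
  apply: (ae_inner_parts oU) => i.
  have [v [lam VC]] := variation_control_exists n_gt0 nk oU iv mc i.
  have varifold := inner_part_varifold iv i.
  have := ae_varifold_point_spec n_gt0 nk varifold om0 VC p1 Q_gt0.
  apply: ae_imply => a hps Da hd; have PS := hps Da hd.
  apply: limf_esup_le_mul; first by rewrite lt_max ltr01.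
    by move=> r; rewrite mule_ge0 ?lee_fin ?powR_ge0// Lnorm_ge0.
  move=> tau tau0.
  exact: (critical_estimate n_gt0 nk varifold om0 VC PS nq pn al0 al1 tau0).
Qed.
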